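(* Let $f : A \to B$ be a homomorphism between tractable commutative DG rings, such that $\mathrm{H}^0(f) : \bar{A} \to \bar{B}$ is surjective. Let $R_B$ be a dualizing DG $B$-module, and let $M, N \in \mathsf{D}^{\mathrm{b}}_{\mathrm{f}}(B)$. (1) If $M$ is Cohen-Macaulay with respect to $R_B$, and there is an isomorphism $\operatorname{rest}_f(M) \cong \operatorname{rest}_f(N)$ in $\mathsf{D}(A)$, then $N$ is also Cohen-Macaulay with respect to $R_B$. (2) If $M$ and $N$ are both Cohen-Macaulay with respect to $R_B$, then the homomorphism $$\operatorname{rest}_f : \operatorname{Hom}_{\mathsf{D}(B)}(M, N) \to \operatorname{Hom}_{\mathsf{D}(A)}\bigl(\operatorname{rest}_f(M), \operatorname{rest}_f(N)\bigr)$$ is bijective.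
   Context: A commutative DG ring is a graded associative unital ring $A=\bigoplus_{i\le 0}A^i$ with a differential $\mathrm{d}$ of degree $1$ satisfying the graded Leibniz rule, such that $b\cdot a=(-1)^{ij}a\cdot b$ for $a\in A^i$, $b\in A^j$, and $a\cdot a=0$ for $a\in A^i$ with $i$ odd. Write $\bar A:=\mathrm{H}^0(A)$. $\mathsf{D}(A)$ is the derived category of DG $A$-modules (quasi-isomorphisms inverted); $\operatorname{rest}_f:\mathsf{D}(B)\to\mathsf{D}(A)$ is the restriction functor along $f$. $\mathsf{D}^{\mathrm b}_{\mathrm f}(A)$ is the full subcategory of DG modules with bounded cohomology whose cohomology modules are all finitely generated over $\bar A$; $\mathsf{D}^0_{\mathrm f}(A)$ is the full subcategory of those whose cohomology is finitely generated over $\bar A$ and concentrated in degree $0$. $A$ is cohomologically pseudo-noetherian if $\bar A$ is noetherian and every $\mathrm{H}^i(A)$ is a finitely generated $\bar A$-module. $A$ is tractable if it is cohomologically pseudo-noetherian and there exists a DG ring homomorphism $\mathbb{K}\to A$ from some finite dimensional regular noetherian commutative ring $\mathbb{K}$ such that the induced ring homomorphism $\mathbb{K}\to\bar A$ is essentially of finite type (a localization of a finitely generated $\mathbb{K}$-ring). For $A$ cohomologically pseudo-noetherian, a DG $A$-module $R$ is dualizing if: (i) each $\mathrm{H}^i(R)$ is a finitely generated $\bar A$-module; (ii) $R$ has finite injective dimension relative to $\mathsf{D}(A)$, i.e. there are integers $d_0\le d_1$ with $\operatorname{con}(\mathrm{H}(\operatorname{RHom}_A(M,R)))\subseteq-\operatorname{con}(\mathrm{H}(M))+[d_0,d_1]$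 for all $M\in\mathsf{D}(A)$; (iii) the adjunction morphism $A\to\operatorname{RHom}_A(R,R)$ (given by multiplication) is an isomorphism in $\mathsf{D}(A)$. Here, for a graded module $H$, $\operatorname{con}(H)$ is the smallest integer interval (endpoints possibly $\pm\infty$; empty if $H=0$) containing all degrees $i$ with $H^i\ne0$; intervals are added endpoint-wise, $-[i_0,i_1]=[-i_1,-i_0]$, and $\varnothing+[d_0,d_1]=\varnothing$. Given a dualizing DG $A$-module $R$, a DG module $M\in\mathsf{D}^{\mathrm b}_{\mathrm f}(A)$ is Cohen-Macaulay with respect to $R$ if $\operatorname{RHom}_A(M,R)\in\mathsf{D}^0_{\mathrm f}(A)$. *)

(* Defs.v *)
From HB Require Import structures.
From mathcomp Require Import all_boot all_order all_algebra.
From mathcomp Require Import boolp classical_sets.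
From mathcomp Require Import zify.

Set Implicit Arguments.
Unset Strict Implicit.
Unset Printing Implicit Defensive.

Import Order.TTheory GRing.Theory Num.Theory.
Local Open Scope ring_scope.
Local Open Scope quotient_scope.

(* Rings may be zero, as [H0 A] is for an acyclic DG ring [A]; hence
   [comPzRingType] rather than [comNzRingType]. *)

Section CommutativeAlgebra.
Variable R : comPzRingType.

Definition fin_gen (V : lmodType R) : Prop :=
  exists (n : nat) (g : 'I_n -> V),
    forall v, exists c : 'I_n -> R, v = \sum_i c i *: g i.

Definition is_ideal (I : set R) : Prop :=
  [/\ I 0, forall x y, I x -> I y -> I (x + y)
    & forall a x, I x -> I (a * x)].

Definition ideal_span n (g : 'I_n -> R) : set R :=
  fun x => exists c : 'I_n -> R, x = \sum_i c i * g i.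

Definition noetherian : Prop :=
  forall I, is_ideal I -> exists (n : nat) (g : 'I_n -> R), I = ideal_span g.

Definition prime_ideal (p : set R) : Prop :=
  [/\ is_ideal p, ~ p 1 & forall x y, p (x * y) -> p x \/ p y].

Definition maximal_ideal (m : set R) : Prop :=
  [/\ is_ideal m, ~ m 1
    & forall I, is_ideal I -> ~ I 1 -> (m `<=` I)%classic -> I = m].

Definition prime_chain (n : nat) : Prop :=
  exists p : nat -> set R,
    (forall i, (i <= n)%N -> prime_ideal (p i)) /\
    (forall i, (i < n)%N -> (p i `<` p i.+1)%classic).

Definition finite_krull_dim : Prop :=
  exists d : nat, forall n, prime_chain n -> (n <= d)%N.

Definition krull_dim (d : nat) : Prop :=
  prime_chain d /\ forall n, prime_chain n -> (n <= d)%N.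

(* The maximal ideal is generated by [dim R] elements. *)
Definition regular_local : Prop :=
  noetherian /\ exists m : set R,
    [/\ maximal_ideal m, forall m', maximal_ideal m' -> m' = m
      & exists d (g : 'I_d -> R), krull_dim d /\ m = ideal_span g].

(* [C] is generated, as a ring, by the image of [R] and finitely many elements;
   closure under opposites is automatic, since [h (- 1)] is in [P]. *)
Definition fin_type (C : comPzRingType) (h : {rmorphism R -> C}) : Prop :=
  exists gens : seq C, forall P : set C,
    (forall r, P (h r)) -> (forall g, g \in gens -> P g) ->
    (forall x y, P x -> P y -> P (x + y)) ->
    (forall x y, P x -> P y -> P (x * y)) -> forall x, P x.

End CommutativeAlgebra.

(* [l] exhibits [L] as the localization of [R] at the multiplicatively closed
   subset [S]. *)
Definition is_localization (R L : comPzRingType) (S : set R)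
    (l : {rmorphism R -> L}) : Prop :=
  [/\ S 1 /\ forall x y, S x -> S y -> S (x * y),
      forall s, S s -> exists u, u * l s = 1,
      forall x, exists r s, S s /\ x * l s = l r
    & forall r, l r = 0 -> exists s, S s /\ s * r = 0].

Definition ess_fin_type (R L : comPzRingType) (h : {rmorphism R -> L}) : Prop :=
  exists (C : comPzRingType) (c : {rmorphism R -> C}) (l : {rmorphism C -> L}),
    [/\ fin_type c, l \o c =1 h & exists S : set C, is_localization S l].

Definition regular_ring (R : comPzRingType) : Prop :=
  noetherian R /\ forall p : set R, prime_ideal p ->
    exists (L : comPzRingType) (l : {rmorphism R -> L}),
      is_localization (~` p)%classic l /\ regular_local L.

(* A graded abelian group is a family indexed by [int].  Structure maps that
   shift degrees take the target degree and an equation between degrees as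
   arguments, which avoids transport along equalities in [int]. *)

Definition sgnz (V : zmodType) (i : int) (x : V) : V := x *~ (-1) ^+ `|i|%N.

Record complex := Complex {
  cx_obj :> int -> zmodType;
  cx_d : forall i j : int, i + 1 = j -> cx_obj i -> cx_obj j;
  cx_dB : forall i j (e : i + 1 = j), {morph cx_d e : x y / x - y};
  cx_dd : forall i j k (e : i + 1 = j) (e' : j + 1 = k) x,
    cx_d e' (cx_d e x) = 0 }.

Record cxMap (C D : complex) := CxMap {
  cm_fun :> forall i, C i -> D i;
  cm_B : forall i, {morph @cm_fun i : x y / x - y};
  cm_d : forall i j (e : i + 1 = j) x,
    cm_fun (cx_d e x) = cx_d e (cm_fun x) }.

Section Cohomology.
Variables (C : complex) (i : int).

Lemma cx_d0 j k (e : j + 1 = k) : cx_d e (0 : C j) = 0.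
Proof. by rewrite -(subrr (0 : C j)) cx_dB subrr. Qed.

Definition is_cocycle : {pred C i} := fun x => `[< cx_d (erefl (i + 1)) x = 0 >].

Lemma is_cocycle_closed : zmod_closed is_cocycle.
Proof.
split=> [|x y /asboolP dx /asboolP dy]; apply/asboolP; first exact: cx_d0.
by rewrite cx_dB dx dy subrr.
Qed.

HB.instance Definition _ :=
  GRing.isZmodClosed.Build (C i) is_cocycle is_cocycle_closed.

Record cocycle := Cocycle { cval :> C i; cvalP : is_cocycle cval }.

HB.instance Definition _ := [isSub for cval].
HB.instance Definition _ := [Choice of cocycle by <:].
HB.instance Definition _ := [SubChoice_isSubZmodule of cocycle by <:].

Definition is_boundary : {pred cocycle} := fun x =>
  `[< exists j (e : j + 1 = i) (y : C j), cx_d e y = cval x >].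

Lemma is_boundary_closed : zmod_closed is_boundary.
Proof.
split=> [|x y /asboolP[j [e [u du]]] /asboolP[j' [e' [v dv]]]]; apply/asboolP.
  by exists (i - 1), (subrK _ _), 0; rewrite cx_d0.
have jj : j = j' by apply: (addIr 1); rewrite e e'.
move: e' v dv; rewrite -jj => e' v; rewrite (eq_irrelevance e' e) => dv.
by exists j, e, (u - v); rewrite cx_dB du dv.
Qed.

HB.instance Definition _ :=
  GRing.isZmodClosed.Build cocycle is_boundary is_boundary_closed.

Definition boundary : zmodClosed cocycle :=
  GRing.ZmodClosed.clone cocycle is_boundary _.

Definition H : zmodType := {ideal_quot boundary}.

Definition hcls (x : cocycle) : H := \pi_({ideal_quot boundary}) x.

Lemma hclsB : {morph hcls : x y / x - y}.
Proof. by move=> x y; rewrite /hcls raddfB. Qed.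

Lemma hclsD : {morph hcls : x y / x + y}.
Proof. by move=> x y; rewrite /hcls raddfD. Qed.

Lemma hcls_eq x y : hcls x = hcls y <-> is_boundary (x - y).
Proof.
rewrite /hcls; split=> [/eqP|]; first by rewrite -Quotient.idealrBE.
by move=> xy; apply/eqP; rewrite -Quotient.idealrBE.
Qed.

Definition hrep (h : H) : cocycle := repr (h : {ideal_quot boundary}).

Lemma hrepK h : hcls (hrep h) = h.
Proof. exact: reprK. Qed.

End Cohomology.

Arguments hcls {C i} x.
Arguments hrep {C i} h.

Section CohomologyMap.
Variables (C D : complex) (f : cxMap C D) (i : int).

Lemma cm_0 j : f j 0 = 0.
Proof. by rewrite -(subrr (0 : C j)) cm_B subrr. Qed.

Lemma zmap_subproof (x : cocycle C i) : is_cocycle (f i (cval x)).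
Proof.
apply/asboolP; rewrite -cm_d; have /asboolP -> := cvalP x; exact: cm_0.
Qed.

Definition zmap (x : cocycle C i) : cocycle D i := Cocycle (zmap_subproof x).

Definition Hmap (h : H C i) : H D i := hcls (zmap (hrep h)).

Lemma HmapE x : Hmap (hcls x) = hcls (zmap x).
Proof.
apply/hcls_eq; have /hcls_eq/asboolP[j [e [y dy]]] := hrepK (hcls x).
by apply/asboolP; exists j, e, (f j y); rewrite -cm_d dy /= cm_B.
Qed.

Lemma HmapD : {morph Hmap : x y / x + y}.
Proof.
move=> x y; rewrite -[x]hrepK -[y]hrepK -hclsD !HmapE -hclsD; congr hcls.
by apply: val_inj => /=; have := @cm_B _ _ f i (cval (hrep x)) (- cval (hrep y));
  rewrite opprK => ->; have := @cm_B _ _ f i 0 (cval (hrep y)); rewrite cm_0 !sub0r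
  => ->; rewrite opprK.
Qed.

End CohomologyMap.

Definition is_qis (C D : complex) (f : cxMap C D) : Prop :=
  forall i, bijective (@Hmap C D f i).

Definition acyclic (C : complex) : Prop := forall i (h : H C i), h = 0.

Record cdgRing := CdgRing {
  cr_cx :> complex;
  cr_one : cr_cx 0;
  cr_mul : forall i j k : int, i + j = k -> cr_cx i -> cr_cx j -> cr_cx k;
  cr_mulBl : forall i j k (e : i + j = k) a a' b,
    cr_mul e (a - a') b = cr_mul e a b - cr_mul e a' b;
  cr_mulBr : forall i j k (e : i + j = k) a b b',
    cr_mul e a (b - b') = cr_mul e a b - cr_mul e a b';
  cr_mulA : forall i j k ij jk l (e1 : i + j = ij) (e2 : ij + k = l)
      (e3 : j + k = jk) (e4 : i + jk = l) a b c,
    cr_mul e2 (cr_mul e1 a b) c = cr_mul e4 a (cr_mul e3 b c);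
  cr_mul1 : forall i (e : 0 + i = i) a, cr_mul e cr_one a = a;
  cr_mulr1 : forall i (e : i + 0 = i) a, cr_mul e a cr_one = a;
  cr_leibniz : forall i j k i' j' k' (e : i + j = k)
      (ei : i + 1 = i') (ej : j + 1 = j') (ek : k + 1 = k')
      (e1 : i' + j = k') (e2 : i + j' = k') a b,
    cx_d ek (cr_mul e a b) =
      cr_mul e1 (cx_d ei a) b + sgnz i (cr_mul e2 a (cx_d ej b));
  cr_comm : forall i j k (e : i + j = k) (e' : j + i = k) a b,
    cr_mul e' b a = sgnz (i * j) (cr_mul e a b);
  cr_sq : forall i k (e : i + i = k) a, odd `|i|%N -> cr_mul e a a = 0;
  cr_nonpos : forall i (a : cr_cx i), 0 < i -> a = 0 }.

Record cdgHom (A B : cdgRing) := CdgHom {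
  ch_map :> cxMap A B;
  ch_one : ch_map 0 (cr_one A) = cr_one B;
  ch_mul : forall i j k (e : i + j = k) a b,
    ch_map k (cr_mul e a b) = cr_mul e (ch_map i a) (ch_map j b) }.

Record dgModule (A : cdgRing) := DgModule {
  dm_cx :> complex;
  dm_act : forall i j k : int, i + j = k -> A i -> dm_cx j -> dm_cx k;
  dm_actBl : forall i j k (e : i + j = k) a a' m,
    dm_act e (a - a') m = dm_act e a m - dm_act e a' m;
  dm_actBr : forall i j k (e : i + j = k) a m m',
    dm_act e a (m - m') = dm_act e a m - dm_act e a m';
  dm_actA : forall i j k ij jk l (e1 : i + j = ij) (e2 : ij + k = l)
      (e3 : j + k = jk) (e4 : i + jk = l) a b m,
    dm_act e2 (cr_mul e1 a b) m = dm_act e4 a (dm_act e3 b m);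
  dm_act1 : forall i (e : 0 + i = i) m, dm_act e (cr_one A) m = m;
  dm_leibniz : forall i j k i' j' k' (e : i + j = k)
      (ei : i + 1 = i') (ej : j + 1 = j') (ek : k + 1 = k')
      (e1 : i' + j = k') (e2 : i + j' = k') a m,
    cx_d ek (dm_act e a m) =
      dm_act e1 (cx_d ei a) m + sgnz i (dm_act e2 a (cx_d ej m)) }.

Record dgHom (A : cdgRing) (M N : dgModule A) := DgHom {
  dh_map :> cxMap M N;
  dh_act : forall i j k (e : i + j = k) a m,
    dh_map k (dm_act e a m) = dm_act e a (dh_map j m) }.

Definition dg_self (A : cdgRing) : dgModule A :=
  @DgModule A A (@cr_mul A) (@cr_mulBl A) (@cr_mulBr A) (@cr_mulA A)
    (@cr_mul1 A) (@cr_leibniz A).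

Section CohomologyModule.
Variable A : cdgRing.

Section Action.
Variables (M : dgModule A) (i : int).

Lemma dm_act0l p j k (e : p + j = k) (m : M j) : dm_act e (0 : A p) m = 0.
Proof. by rewrite -(subrr (0 : A p)) dm_actBl subrr. Qed.

Lemma dm_act0r p j k (e : p + j = k) (a : A p) : dm_act e a (0 : M j) = 0.
Proof. by rewrite -(subrr (0 : M j)) dm_actBr subrr. Qed.

Lemma dm_actDr p j k (e : p + j = k) (a : A p) (m m' : M j) :
  dm_act e a (m + m') = dm_act e a m + dm_act e a m'.
Proof. by rewrite -{1}[m']opprK dm_actBr -[- m']sub0r dm_actBr dm_act0r sub0r opprK. Qed.

Lemma dm_actDl p j k (e : p + j = k) (a a' : A p) (m : M j) :
  dm_act e (a + a') m = dm_act e a m + dm_act e a' m.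
Proof. by rewrite -{1}[a']opprK dm_actBl -[- a']sub0r dm_actBl dm_act0l sub0r opprK. Qed.

Lemma zact_subproof (a : cocycle A 0) (x : cocycle M i) :
  is_cocycle (dm_act (add0r i) (cval a) (cval x)).
Proof.
apply/asboolP; have /asboolP da := cvalP a; have /asboolP dx := cvalP x.
have e1 : 0 + 1 + i = i + 1 by rewrite add0r addrC.
rewrite (dm_leibniz _ (erefl (0 + 1)) (erefl (i + 1)) _ e1 (add0r (i + 1))).
by rewrite da dx dm_act0l dm_act0r add0r /sgnz mul0rz.
Qed.

Definition zact (a : cocycle A 0) (x : cocycle M i) : cocycle M i :=
  Cocycle (zact_subproof a x).

Definition hact (a : H A 0) (x : H M i) : H M i := hcls (zact (hrep a) (hrep x)).

Lemma hactE a x : hact (hcls a) (hcls x) = hcls (zact a x).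
Proof.
have /hcls_eq/asboolP[j [e [b db]]] := hrepK (hcls a).
have /hcls_eq/asboolP[j' [e' [y dy]]] := hrepK (hcls x).
apply: (@etrans _ _ (hcls (zact a (hrep (hcls x))))); apply/hcls_eq/asboolP.
  have e0 : j + i = j' by apply: (addIr 1); rewrite addrAC e add0r e'.
  exists j', e', (dm_act e0 b (cval (hrep (hcls x)))).
  have e2 : j + (i + 1) = i by lia.
  rewrite (dm_leibniz _ e (erefl (i + 1)) _ (add0r i) e2) db.
  have /asboolP -> := cvalP (hrep (hcls x)).
  by rewrite dm_act0r /sgnz mul0rz addr0 dm_actBl.
exists j', e', (dm_act (add0r j') (cval a) y).
have e1 : 0 + 1 + j' = i by rewrite add0r addrC.
rewrite (dm_leibniz _ (erefl (0 + 1)) e' _ e1 (add0r i)) dy.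
have /asboolP -> := cvalP a.
by rewrite dm_act0l add0r dm_actBr /sgnz mulr1z.
Qed.

Lemma hactDr : right_distributive hact +%R.
Proof.
move=> a x y; rewrite -[a]hrepK -[x]hrepK -[y]hrepK -hclsD !hactE -hclsD.
by congr hcls; apply: val_inj; rewrite /= dm_actDr.
Qed.

Lemma hactDl x : {morph hact^~ x : a b / a + b}.
Proof.
move=> a b; rewrite -[a]hrepK -[x]hrepK -[b]hrepK -hclsD !hactE -hclsD.
by congr hcls; apply: val_inj; rewrite /= dm_actDl.
Qed.

End Action.

Lemma zone_subproof : is_cocycle (cr_one A).
Proof. by apply/asboolP; apply: cr_nonpos. Qed.

Definition zone : cocycle A 0 := Cocycle zone_subproof.

Definition H0 : Type := H A 0.
HB.instance Definition _ := GRing.Zmodule.on H0.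

Definition h0_mul (a b : H0) : H0 := @hact (dg_self A) 0 a b.

Lemma hactA (M : dgModule A) i (a b : H0) (x : H M i) :
  hact a (hact b x) = hact (h0_mul a b) x.
Proof.
rewrite -[a]hrepK -[x]hrepK -[b]hrepK /h0_mul.
rewrite (@hactE M) (@hactE (dg_self A)) !(@hactE M).
by congr hcls; apply: val_inj => /=; rewrite -(dm_actA (add0r 0) (add0r i)).
Qed.

Lemma hact1 (M : dgModule A) i : left_id (hcls zone) (@hact M i).
Proof.
move=> x; rewrite -[x]hrepK hactE; congr hcls; apply: val_inj => /=.
exact: dm_act1.
Qed.

Lemma h0_mulA : associative h0_mul.
Proof. by move=> a b c; exact: (@hactA (dg_self A) 0). Qed.

Lemma h0_mulC : commutative h0_mul.
Proof.
move=> a b; rewrite -[a]hrepK -[b]hrepK /h0_mul !(@hactE (dg_self A)).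
congr hcls; apply: val_inj => /=.
by rewrite (cr_comm (add0r 0)) mulr0 /sgnz mulr1z.
Qed.

Lemma h0_mul1 : left_id (hcls zone) h0_mul.
Proof. exact: (@hact1 (dg_self A) 0). Qed.

Lemma h0_mulDl : left_distributive h0_mul +%R.
Proof. by move=> a b c; exact: (@hactDl (dg_self A) 0). Qed.

HB.instance Definition _ := GRing.Zmodule_isComPzRing.Build H0
  h0_mulA h0_mulC h0_mul1 h0_mulDl.

Definition Hmod (M : dgModule A) (i : int) : Type := H M i.
HB.instance Definition _ M i := GRing.Zmodule.on (Hmod M i).
HB.instance Definition _ M i := GRing.Zmodule_isLmodule.Build H0 (Hmod M i)
  (@hactA M i) (@hact1 M i) (@hactDr M i) (@hactDl M i).

End CohomologyModule.

Section H0Functor.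
Variables (A B : cdgRing) (f : cdgHom A B).

Definition H0map (a : H0 A) : H0 B := @Hmap A B f 0 a.

Lemma H0map_nmod_morphism : nmod_morphism H0map.
Proof.
split; last exact: HmapD.
by apply: (addIr (H0map 0)); rewrite add0r -[LHS](@HmapD A B f 0) addr0.
Qed.

Lemma H0map_monoid_morphism : monoid_morphism H0map.
Proof.
split.
  rewrite /H0map [Hmap _ _]HmapE; congr hcls; apply: val_inj => /=.
  exact: ch_one.
move=> a b; rewrite -[a]hrepK -[b]hrepK /H0map.
rewrite [X in Hmap f X](@hactE A (dg_self A)) !HmapE.
rewrite [RHS](@hactE B (dg_self B)); congr hcls; apply: val_inj => /=.
exact: ch_mul.
Qed.

HB.instance Definition _ :=
  GRing.isNmodMorphism.Build (H0 A) (H0 B) H0map H0map_nmod_morphism.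
HB.instance Definition _ :=
  GRing.isMonoidMorphism.Build (H0 A) (H0 B) H0map H0map_monoid_morphism.

End H0Functor.

Section Concentrated.
Variable K : comPzRingType.

Section Degree.
Variable i : int.

Definition conc_pred : {pred K} := fun x => (i == 0) || (x == 0).

Lemma conc_pred_closed : zmod_closed conc_pred.
Proof.
rewrite /conc_pred; split=> [|x y]; rewrite !unfold_in /= ?eqxx ?orbT //.
by case: (i == 0) => //= /eqP -> /eqP ->; rewrite subr0.
Qed.

HB.instance Definition _ :=
  GRing.isZmodClosed.Build K conc_pred conc_pred_closed.

(* Degree [i] of [conc K]: all of [K] if [i = 0], and the subgroup 0 otherwise. *)
Record conc_obj := ConcObj { conc_val :> K; _ : conc_pred conc_val }.

HB.instance Definition _ := [isSub for conc_val].
HB.instance Definition _ := [Choice of conc_obj by <:].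
HB.instance Definition _ := [SubChoice_isSubZmodule of conc_obj by <:].

Lemma conc_eq0 (x : conc_obj) : i != 0 -> x = 0.
Proof.
move=> /negPf i0; apply: val_inj.
by have /orP[|/eqP //] := valP x; rewrite i0.
Qed.

End Degree.

Definition conc_cx : complex.
Proof.
apply: (@Complex conc_obj (fun _ _ _ _ => 0)) => //.
by move=> i j e x y; rewrite subr0.
Defined.

Lemma conc_mul_subproof i j k (e : i + j = k) (x : conc_obj i) (y : conc_obj j) :
  conc_pred k (conc_val x * conc_val y).
Proof.
rewrite /conc_pred; case: (eqVneq i 0) => [i0|/(conc_eq0 x) ->]; last first.
  by rewrite mul0r eqxx orbT.
case: (eqVneq j 0) => [j0|/(conc_eq0 y) ->]; last by rewrite mulr0 eqxx orbT.
by have -> : k = 0 by lia.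
Qed.

Definition conc_mul i j k (e : i + j = k) (x : conc_obj i) (y : conc_obj j) :
  conc_obj k := ConcObj (conc_mul_subproof e x y).

Definition conc : cdgRing.
Proof.
apply: (@CdgRing conc_cx (@ConcObj 0 1 isT) conc_mul).
- by move=> i j k e a a' b; apply: val_inj; rewrite /= mulrBl.
- by move=> i j k e a b b'; apply: val_inj; rewrite /= mulrBr.
- by move=> *; apply: val_inj; rewrite /= mulrA.
- by move=> i e a; apply: val_inj; rewrite /= mul1r.
- by move=> i e a; apply: val_inj; rewrite /= mulr1.
- move=> i j k i' j' k' e ei ej ek e1 e2 a b; apply: val_inj.
  have -> : conc_mul e2 a 0 = 0 by apply: val_inj; rewrite /= mulr0.
  by rewrite /sgnz mul0rz /= mul0r addr0.
- move=> i j k e e' a b; apply: val_inj => /=.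
  have [i0|/(conc_eq0 a) a0] := eqVneq i 0.
    have -> : i * j = 0 by lia.
    by rewrite /sgnz mulr1z /= mulrC.
  have -> : conc_mul e a b = 0 by apply: val_inj; rewrite /= a0 mul0r.
  by rewrite /sgnz mul0rz a0 /= mulr0.
- move=> i k e a oi; have i0 : i != 0 by apply: contraTneq oi => ->.
  by apply: val_inj; rewrite /= (conc_eq0 a i0) mul0r.
- by move=> i a i0; apply: conc_eq0; rewrite gt_eqF.
Defined.

Lemma conc_cocycle (x : K) : is_cocycle (C := conc) (@ConcObj 0 x isT).
Proof. exact/asboolP. Qed.

Definition conc_H0 (x : K) : H0 conc := hcls (Cocycle (conc_cocycle x)).

Lemma conc_H0_nmod_morphism : nmod_morphism conc_H0.
Proof.
have conc_H0D : {morph conc_H0 : x y / x + y}.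
  move=> x y; rewrite /conc_H0 -hclsD; congr hcls.
  by apply: val_inj; apply: val_inj.
split=> //; apply: (addIr (conc_H0 0)); by rewrite add0r -conc_H0D addr0.
Qed.

Lemma conc_H0_monoid_morphism : monoid_morphism conc_H0.
Proof.
split; first by congr hcls; apply: val_inj; apply: val_inj.
move=> x y; rewrite [RHS](@hactE conc (dg_self conc)).
by congr hcls; apply: val_inj; apply: val_inj.
Qed.

HB.instance Definition _ :=
  GRing.isNmodMorphism.Build K (H0 conc) conc_H0 conc_H0_nmod_morphism.
HB.instance Definition _ :=
  GRing.isMonoidMorphism.Build K (H0 conc) conc_H0 conc_H0_monoid_morphism.

End Concentrated.

Definition cohomologically_pseudo_noetherian (A : cdgRing) : Prop :=
  noetherian (H0 A) /\ forall i, fin_gen (Hmod (dg_self A) i).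

Definition tractable (A : cdgRing) : Prop :=
  cohomologically_pseudo_noetherian A /\
  exists (K : comPzRingType) (u : cdgHom (conc K) A),
    [/\ regular_ring K, finite_krull_dim K
      & ess_fin_type (H0map u \o @conc_H0 K : {rmorphism K -> H0 A})].


Section Signs.

Lemma subrACA (V : zmodType) (a b c d : V) : (a - b) - (c - d) = (a - c) - (b - d).
Proof. by rewrite !opprD !opprK addrACA. Qed.

Lemma morphBD (U V : zmodType) (f : U -> V) :
  {morph f : x y / x - y} -> {morph f : x y / x + y}.
Proof.
move=> fB; have f0 : f 0 = 0 by rewrite -(subrr 0) fB subrr.
have fN y : f (- y) = - f y by rewrite -sub0r fB f0 sub0r.
by move=> x y; rewrite -{1}[y]opprK fB fN opprK.
Qed.

Lemma morphB0 (U V : zmodType) (f : U -> V) : {morph f : x y / x - y} -> f 0 = 0.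
Proof. by move=> fB; rewrite -(subrr 0) fB subrr. Qed.

Lemma signzD (i j : int) : (-1) ^+ `|(i + j)%R|%N = (-1) ^+ `|i|%N * (-1) ^+ `|j|%N :> int.
Proof.
rewrite -exprD -[LHS]signr_odd -[RHS]signr_odd; congr (_ ^+ nat_of_bool _); lia.
Qed.

Lemma sgnzD (V : zmodType) (i j : int) (x : V) : sgnz i (sgnz j x) = sgnz (i + j) x.
Proof. by rewrite /sgnz signzD mulrC mulrzA. Qed.

Lemma sgnzE (V : zmodType) (i : int) (x : V) :
  sgnz i x = if odd `|i|%N then - x else x.
Proof.
by rewrite /sgnz -signr_odd; case: odd; rewrite ?expr0 ?mulr1z// expr1 mulrN1z.
Qed.

Lemma sgnz_odd (V : zmodType) (i j : int) (x : V) :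
  odd `|i|%N = odd `|j|%N -> sgnz i x = sgnz j x.
Proof. by rewrite !sgnzE => ->. Qed.

Lemma sgnz_even (V : zmodType) (i : int) (x : V) : sgnz (i + i) x = x.
Proof. by rewrite (@sgnz_odd V _ 0) ?sgnzE//; lia. Qed.

Lemma sgnz0 (V : zmodType) (i : int) : sgnz i (0 : V) = 0.
Proof. exact: mul0rz. Qed.

Lemma sgnzB (V : zmodType) (i : int) : {morph @sgnz V i : x y / x - y}.
Proof. by move=> x y; rewrite /sgnz mulrzBl. Qed.

Lemma sgnz_morph (U V : zmodType) (f : U -> V) :
  {morph f : x y / x - y} -> forall i x, f (sgnz i x) = sgnz i (f x).
Proof.
move=> fB; have f0 : f 0 = 0 by rewrite -(subrr 0) fB subrr.
by move=> i x; rewrite !sgnzE; case: ifP => // _; rewrite -sub0r fB f0 sub0r.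
Qed.

End Signs.

Section HomDG.
Variables (A : cdgRing) (M N : dgModule A).

Record hom_deg (i : int) := HomDeg {
  hd_fun :> forall j k : int, j + i = k -> M j -> N k;
  hd_B : forall j k (e : j + i = k), {morph @hd_fun j k e : x y / x - y};
  hd_act : forall p j pj k l (e : p + j = pj) (e1 : pj + i = l)
      (e2 : j + i = k) (e3 : p + k = l) (a : A p) (m : M j),
    hd_fun e1 (dm_act e a m) = sgnz (i * p) (dm_act e3 a (hd_fun e2 m)) }.

Arguments hd_fun {i} _ {j k} _ _.

Lemma hom_deg_eq i (f g : hom_deg i) :
  (forall j k (e : j + i = k) m, hd_fun f e m = hd_fun g e m) -> f = g.
Proof.
case: f g => [f fB fa] [g gB ga] /= fg.
have fg' : f = g.
  by do 3![apply: functional_extensionality_dep => ?]; apply: funext => m; exact: fg.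
by subst g; congr HomDeg; exact: Prop_irrelevance.
Qed.

Section Degree.
Variable i : int.

HB.instance Definition _ := gen_eqMixin (hom_deg i).
HB.instance Definition _ := gen_choiceMixin (hom_deg i).

Definition hd0 : hom_deg i.
Proof.
apply: (@HomDeg i (fun _ _ _ _ => 0)) => [j k e x y|p j pj k l e e1 e2 e3 a m].
  by rewrite subr0.
by rewrite dm_act0r sgnz0.
Defined.

Definition hdN (f : hom_deg i) : hom_deg i.
Proof.
apply: (@HomDeg i (fun j k e m => - hd_fun f e m)) => [j k e x y|].
  by rewrite hd_B opprB addrC opprK.
move=> p j pj k l e e1 e2 e3 a m; rewrite (hd_act f e e1 e2 e3).
by rewrite -[- hd_fun f e2 m]sub0r dm_actBr sgnzB dm_act0r sgnz0 sub0r.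
Defined.

Definition hdD (f g : hom_deg i) : hom_deg i.
Proof.
apply: (@HomDeg i (fun j k e m => hd_fun f e m + hd_fun g e m)) => [j k e x y|].
  by rewrite !hd_B opprD addrACA.
move=> p j pj k l e e1 e2 e3 a m; rewrite !(hd_act _ e e1 e2 e3).
by rewrite dm_actDr /sgnz mulrzDl.
Defined.

Lemma hdDA : associative hdD.
Proof. by move=> f g h; apply: hom_deg_eq => * /=; rewrite addrA. Qed.
Lemma hdDC : commutative hdD.
Proof. by move=> f g; apply: hom_deg_eq => * /=; rewrite addrC. Qed.
Lemma hd0D : left_id hd0 hdD.
Proof. by move=> f; apply: hom_deg_eq => * /=; rewrite add0r. Qed.
Lemma hdND : left_inverse hd0 hdN hdD.
Proof. by move=> f; apply: hom_deg_eq => * /=; rewrite addNr. Qed.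

HB.instance Definition _ := GRing.isZmodule.Build (hom_deg i) hdDA hdDC hd0D hdND.

End Degree.

Lemma hd_funB i (f g : hom_deg i) j k (e : j + i = k) (m : M j) :
  hd_fun (f - g) e m = hd_fun f e m - hd_fun g e m.
Proof. by []. Qed.

Lemma hd_fun_sgnz i (f : hom_deg i) p j k (e : j + i = k) (m : M j) :
  hd_fun (sgnz p f) e m = sgnz p (hd_fun f e m).
Proof. by rewrite !sgnzE; case: ifP. Qed.

Lemma hd_d_subproof1 (i i' j k : int) (e : i + 1 = i') (e' : j + i' = k) :
  (j + i) + 1 = k.
Proof. lia. Qed.

Lemma hd_d_subproof2 (i i' j k : int) (e : i + 1 = i') (e' : j + i' = k) :
  (j + 1) + i = k.
Proof. lia. Qed.

Lemma hd_act_subproof (p i q j k : int) (e : p + i = q) (e' : j + q = k) :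
  p + (j + i) = k.
Proof. lia. Qed.

(* d(f) = d o f - (-1)^i f o d *)
Definition hd_d (i i' : int) (e : i + 1 = i') (f : hom_deg i) : hom_deg i'.
Proof.
apply: (@HomDeg i' (fun j k e' m =>
  cx_d (hd_d_subproof1 e e') (hd_fun f (erefl (j + i)) m) -
  sgnz i (hd_fun f (hd_d_subproof2 e e') (cx_d (erefl (j + 1)) m)))).
- by move=> j k e' x y; rewrite hd_B !cx_dB hd_B sgnzB subrACA.
- move=> p j pj k l e1 e2 e3 e4 a m.
  have e5 : p + (j + i) = pj + i by lia.
  rewrite (hd_act f e1 (erefl (pj + i)) (erefl (j + i)) e5).
  rewrite (sgnz_morph (@cx_dB _ _ _ (hd_d_subproof1 e e2))).
  have e6 : p + 1 + (j + i) = l by lia.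
  rewrite (dm_leibniz e5 (erefl (p + 1)) (hd_d_subproof1 e e3) _ e6 e4).
  have e7 : p + 1 + j = pj + 1 by lia.
  have e8 : p + (j + 1) = pj + 1 by lia.
  rewrite (dm_leibniz e1 (erefl (p + 1)) (erefl (j + 1)) (erefl (pj + 1)) e7 e8).
  rewrite (morphBD (hd_B f _)) (sgnz_morph (hd_B f _)).
  have e9 : p + 1 + j + i = l by lia.
  rewrite (hd_act f e7 (hd_d_subproof2 e e2) (erefl (j + i)) e6).
  rewrite (hd_act f e8 (hd_d_subproof2 e e2) (hd_d_subproof2 e e3) e4).
  rewrite dm_actBr (sgnz_morph (dm_actBr e4 a)).
  rewrite !sgnzB !(morphBD (@sgnzB _ _)) !sgnzD.
  have -> : i' * p = i * p + p by rewrite -e mulrDl mul1r.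
  rewrite (@sgnz_odd _ (i + i * (p + 1)) (i * p)); last by rewrite mulrDr mulr1; lia.
  rewrite opprD addrACA subrr add0r; congr (_ - sgnz _ _); lia.
Defined.

Lemma cx_d_hd_fun i (f : hom_deg i) j k k' l (e : j + i = k) (e' : j + i = k')
    (e1 : k + 1 = l) (e1' : k' + 1 = l) (m : M j) :
  cx_d e1 (hd_fun f e m) = cx_d e1' (hd_fun f e' m).
Proof. by subst k k'; rewrite (eq_irrelevance e1 e1'). Qed.

Lemma act_hd_fun i (f : hom_deg i) p j k k' l (e : j + i = k) (e' : j + i = k')
    (e1 : p + k = l) (e1' : p + k' = l) (a : A p) (m : M j) :
  dm_act e1 a (hd_fun f e m) = dm_act e1' a (hd_fun f e' m).
Proof. by subst k k'; rewrite (eq_irrelevance e1 e1'). Qed.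

Lemma hd_dB i i' (e : i + 1 = i') : {morph hd_d e : f g / f - g}.
Proof.
by move=> f g; apply: hom_deg_eq => j k e' m /=; rewrite !cx_dB sgnzB subrACA.
Qed.

Lemma hd_dd i j k (e : i + 1 = j) (e' : j + 1 = k) f : hd_d e' (hd_d e f) = 0.
Proof.
apply: hom_deg_eq => p q ep m /=; rewrite !cx_dB !cx_dd (morphB0 (hd_B f _)).
rewrite (sgnz_morph (@cx_dB _ _ _ (hd_d_subproof1 e' ep))) sgnz0 subr0 sub0r.
rewrite (cx_d_hd_fun f _ erefl _ (hd_d_subproof1 e (hd_d_subproof2 e' ep))).
set x := cx_d _ _; rewrite -e -[sgnz (i + 1) x]sgnzD [sgnz 1 x]sgnzE /=.
by rewrite -[- x]sub0r sgnzB sgnz0 sub0r subrr.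
Qed.

Definition hd_scale (p i q : int) (e : p + i = q) (a : A p) (f : hom_deg i) :
  hom_deg q.
Proof.
apply: (@HomDeg q (fun j k e' m =>
  dm_act (hd_act_subproof e e') a (hd_fun f (erefl (j + i)) m))).
- by move=> j k e' x y; rewrite hd_B dm_actBr.
- move=> r j rj k l e1 e2 e3 e4 b m.
  have e5 : r + (j + i) = rj + i by lia.
  rewrite (hd_act f e1 (erefl (rj + i)) (erefl (j + i)) e5).
  rewrite (sgnz_morph (dm_actBr _ a)).
  have e6 : p + r + (j + i) = l by lia.
  have e7 : r + p + (j + i) = l by lia.
  have e8 : r + p = p + r by rewrite addrC.
  rewrite -(dm_actA (erefl (p + r)) e6) -(dm_actA e8 e6).
  rewrite (cr_comm e8 (erefl (p + r)) b a).
  rewrite (sgnz_morph (fun a a' => dm_actBl e6 a a' _)) sgnzD.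
  by congr sgnz; rewrite -e; lia.
Defined.

Lemma hd_scaleE p i q (e : p + i = q) a f j k l (e' : j + q = k) (e1 : j + i = l)
    (e2 : p + l = k) m :
  hd_fun (hd_scale e a f) e' m = dm_act e2 a (hd_fun f e1 m).
Proof. exact: act_hd_fun. Qed.

Lemma hd_scaleA i j k ij jk l (e1 : i + j = ij) (e2 : ij + k = l)
    (e3 : j + k = jk) (e4 : i + jk = l) a b (f : hom_deg k) :
  hd_scale e2 (cr_mul e1 a b) f = hd_scale e4 a (hd_scale e3 b f).
Proof.
by apply: hom_deg_eq => p q e m /=; apply: dm_actA.
Qed.

Lemma hd_scale1 i (e : 0 + i = i) f : hd_scale e (cr_one A) f = f.
Proof.
apply: hom_deg_eq => p q e' m; have e2 : 0 + q = q by rewrite add0r.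
by rewrite (hd_scaleE e (cr_one A) f e' e' e2) dm_act1.
Qed.

Lemma hd_leibniz i j k i' j' k' (e : i + j = k)
    (ei : i + 1 = i') (ej : j + 1 = j') (ek : k + 1 = k')
    (e1 : i' + j = k') (e2 : i + j' = k') a (f : hom_deg j) :
  hd_d ek (hd_scale e a f) =
    hd_scale e1 (cx_d ei a) f + sgnz i (hd_scale e2 a (hd_d ej f)).
Proof.
apply: hom_deg_eq => p q e' m.
rewrite [RHS]/= hd_fun_sgnz /=.
have e3 : i' + (p + j) = q by lia.
have e4 : p + j + 1 = p + j' by lia.
have e5 : i + (p + j') = q by lia.
rewrite (dm_leibniz _ ei e4 _ e3 e5) dm_actBr sgnzB (sgnz_morph (dm_actBr _ a)) sgnzD.
have -> : @sgnz (N q) k = @sgnz (N q) (i + j) by rewrite e.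
rewrite -addrA (eq_irrelevance e3 (hd_act_subproof e1 e')).
rewrite (eq_irrelevance e5 (hd_act_subproof e2 e')).
rewrite (eq_irrelevance e4 (hd_d_subproof1 ej erefl)).
by rewrite (act_hd_fun f _ (hd_d_subproof2 ej erefl) _ (hd_act_subproof e2 e')).
Qed.

Lemma hd_scaleBl i j k (e : i + j = k) a a' (f : hom_deg j) :
  hd_scale e (a - a') f = hd_scale e a f - hd_scale e a' f.
Proof. by apply: hom_deg_eq => p q e' m /=; rewrite dm_actBl. Qed.

Lemma hd_scaleBr i j k (e : i + j = k) a (f f' : hom_deg j) :
  hd_scale e a (f - f') = hd_scale e a f - hd_scale e a f'.
Proof. by apply: hom_deg_eq => p q e' m /=; rewrite dm_actBr. Qed.

Definition HomDG : dgModule A :=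
  @DgModule A (@Complex hom_deg hd_d hd_dB hd_dd) hd_scale
    hd_scaleBl hd_scaleBr hd_scaleA hd_scale1 hd_leibniz.

End HomDG.

Section Strict.
Variable A : cdgRing.

Lemma dgHom_eq (M N : dgModule A) (f g : dgHom M N) :
  (forall i x, f i x = g i x) -> f = g.
Proof.
case: f g => [[f fB fd] fa] [[g gB gd] ga] /= fg.
have {}fg : f = g.
  by apply: functional_extensionality_dep => i; apply: funext => x; exact: fg.
subst g; rewrite (Prop_irrelevance fB gB) in fa *.
rewrite (Prop_irrelevance fd gd) in fa *.
by rewrite (Prop_irrelevance fa ga).
Qed.

Definition dg_id (M : dgModule A) : dgHom M M.
Proof. by apply: (@DgHom A M M (@CxMap M M (fun _ x => x) _ _)). Defined.

Definition dg_comp (M N P : dgModule A) (g : dgHom N P) (f : dgHom M N) :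
  dgHom M P.
Proof.
unshelve refine (@DgHom A M P (@CxMap M P (fun i x => g i (f i x)) _ _) _) => /=.
- by move=> i x y; rewrite !cm_B.
- by move=> i j e x; rewrite !cm_d.
- by move=> i j k e a m; rewrite !dh_act.
Defined.

End Strict.

(* The localization of the category of DG modules at the quasi-isomorphisms:
   morphisms are composites of DG homomorphisms and formal inverses of
   quasi-isomorphisms, modulo the congruence generated by the axioms of a
   category, functoriality of [dgen] and the inversion relations. *)
Inductive dexpr (A : cdgRing) : dgModule A -> dgModule A -> Type :=
| dgen M N (f : dgHom M N) : dexpr M N
| dinv M N (s : dgHom M N) (qs : is_qis s) : dexpr N M
| dcomp M N P (g : dexpr N P) (f : dexpr M N) : dexpr M P.

Inductive deq (A : cdgRing) :
    forall M N : dgModule A, dexpr M N -> dexpr M N -> Prop :=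
| deq_refl M N (x : dexpr M N) : deq x x
| deq_sym M N (x y : dexpr M N) : deq x y -> deq y x
| deq_trans M N (x y z : dexpr M N) : deq x y -> deq y z -> deq x z
| deq_comp M N P (x x' : dexpr N P) (y y' : dexpr M N) :
    deq x x' -> deq y y' -> deq (dcomp x y) (dcomp x' y')
| deq_assoc M N P Q (x : dexpr P Q) (y : dexpr N P) (z : dexpr M N) :
    deq (dcomp x (dcomp y z)) (dcomp (dcomp x y) z)
| deq_idl M N (x : dexpr M N) : deq (dcomp (dgen (dg_id N)) x) x
| deq_idr M N (x : dexpr M N) : deq (dcomp x (dgen (dg_id M))) x
| deq_gen M N P (g : dgHom N P) (f : dgHom M N) :
    deq (dgen (dg_comp g f)) (dcomp (dgen g) (dgen f))
| deq_invl M N (s : dgHom M N) (qs : is_qis s) :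
    deq (dcomp (dinv qs) (dgen s)) (dgen (dg_id M))
| deq_invr M N (s : dgHom M N) (qs : is_qis s) :
    deq (dcomp (dgen s) (dinv qs)) (dgen (dg_id N)).

Section DerivedCategory.
Variable A : cdgRing.

Definition HomD (M N : dgModule A) : Type :=
  {c : dexpr M N -> Prop | exists x, c = deq x}.

Definition dcls (M N : dgModule A) (x : dexpr M N) : HomD M N :=
  exist _ (deq x) (ex_intro _ x erefl).

Lemma dcls_eq (M N : dgModule A) (x y : dexpr M N) :
  dcls x = dcls y <-> deq x y.
Proof.
split=> [/(congr1 sval) /= xy|xy]; first by rewrite xy; exact: deq_refl.
apply: eq_exist => /=; apply: funext => z; apply: propext.
by split; apply: deq_trans => //; apply: deq_sym.
Qed.

Lemma dclsP (M N : dgModule A) (c : HomD M N) : exists x, c = dcls x.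
Proof. by case: c => c [x cx]; exists x; apply: eq_exist. Qed.

Definition drep (M N : dgModule A) (c : HomD M N) : dexpr M N :=
  projT1 (cid (dclsP c)).

Lemma drepK (M N : dgModule A) (c : HomD M N) : dcls (drep c) = c.
Proof. by rewrite /drep; case: cid. Qed.

Definition Dloc (M N : dgModule A) (f : dgHom M N) : HomD M N := dcls (dgen f).

Definition Did (M : dgModule A) : HomD M M := Dloc (dg_id M).

Definition Dcomp (M N P : dgModule A) (g : HomD N P) (f : HomD M N) : HomD M P :=
  dcls (dcomp (drep g) (drep f)).

Lemma DcompE (M N P : dgModule A) (g : dexpr N P) (f : dexpr M N) :
  Dcomp (dcls g) (dcls f) = dcls (dcomp g f).
Proof. by apply/dcls_eq; apply: deq_comp; apply/dcls_eq; rewrite drepK. Qed.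

Definition is_isoD (M N : dgModule A) (f : HomD M N) : Prop :=
  exists g : HomD N M, Dcomp g f = Did M /\ Dcomp f g = Did N.

Definition isoD (M N : dgModule A) : Prop := exists f : HomD M N, is_isoD f.

End DerivedCategory.

Section Restriction.
Variables (A B : cdgRing) (f : cdgHom A B).

Definition rest (M : dgModule B) : dgModule A.
Proof.
apply: (@DgModule A M (fun i j k e a m => dm_act e (f i a) m)).
- by move=> i j k e a a' m; rewrite cm_B dm_actBl.
- by move=> i j k e a m m'; rewrite dm_actBr.
- by move=> i j k ij jk l e1 e2 e3 e4 a b m; rewrite ch_mul; apply: dm_actA.
- by move=> i e m; rewrite ch_one dm_act1.
- move=> i j k i' j' k' e ei ej ek e1 e2 a m; rewrite cm_d.
  exact: dm_leibniz.
Defined.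

Definition rest_hom (M N : dgModule B) (g : dgHom M N) :
  dgHom (rest M) (rest N).
Proof.
apply: (@DgHom A (rest M) (rest N) (dh_map g)).
by move=> i j k e a m; apply: (dh_act g).
Defined.

Fixpoint rest_expr (M N : dgModule B) (x : dexpr M N) :
    dexpr (rest M) (rest N) :=
  match x with
  | dgen _ _ g => dgen (rest_hom g)
  | dinv _ _ s qs => @dinv A _ _ (rest_hom s) qs
  | dcomp _ _ _ y z => dcomp (rest_expr y) (rest_expr z)
  end.

Lemma rest_expr_deq (M N : dgModule B) (x y : dexpr M N) :
  deq x y -> deq (rest_expr x) (rest_expr y).
Proof.
have rest_id P : rest_hom (dg_id P) = dg_id (rest P) by apply: dgHom_eq.
elim=> /=.
- by move=> *; exact: deq_refl.
- by move=> M0 N0 u v _; exact: deq_sym.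
- by move=> M0 N0 u v w _ uv _; exact: deq_trans.
- by move=> M0 N0 P u u' v v' _ uu' _; exact: deq_comp.
- by move=> M0 N0 P Q u v w; exact: deq_assoc.
- by move=> M0 N0 u; rewrite rest_id; exact: deq_idl.
- by move=> M0 N0 u; rewrite rest_id; exact: deq_idr.
- move=> M0 N0 P g h.
  have -> : rest_hom (dg_comp g h) = dg_comp (rest_hom g) (rest_hom h).
    exact: dgHom_eq.
  exact: deq_gen.
- by move=> M0 N0 s qs; rewrite rest_id; exact: deq_invl.
- by move=> M0 N0 s qs; rewrite rest_id; exact: deq_invr.
Qed.

Definition restD (M N : dgModule B) (c : HomD M N) : HomD (rest M) (rest N) :=
  dcls (rest_expr (drep c)).

Lemma restDE (M N : dgModule B) (x : dexpr M N) :
  restD (dcls x) = dcls (rest_expr x).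
Proof. by apply/dcls_eq; apply: rest_expr_deq; apply/dcls_eq; rewrite drepK. Qed.

End Restriction.

Section RHom.
Variable A : cdgRing.

Definition K_projective (P : dgModule A) : Prop :=
  forall N : dgModule A, acyclic N -> acyclic (HomDG P N).

Record kproj_resolution (M : dgModule A) := KprojResolution {
  kp_obj :> dgModule A;
  kp_map : dgHom kp_obj M;
  kp_proj : K_projective kp_obj;
  kp_qis : is_qis kp_map }.

(* Up to isomorphism in the derived category this does not depend on [P]. *)
Definition RHom (M : dgModule A) (P : kproj_resolution M) (N : dgModule A) :
  dgModule A := HomDG P N.

Section Homothety.
Variables (P N : dgModule A) (q : dgHom P N).

Lemma homothety_subproof (p j k : int) : j + p = k -> p + j = k.
Proof. by rewrite addrC. Qed.

Definition homothety_deg (p : int) (a : A p) : hom_deg P N p.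
Proof.
unshelve refine (@HomDeg A P N p (fun j k e x =>
  dm_act (homothety_subproof e) a (q j x)) _ _) => /=.
- by move=> j k e x y; rewrite cm_B dm_actBr.
- move=> r j rj k l e e1 e2 e3 b x; rewrite dh_act.
  have e4 : p + r + j = l by lia.
  have e5 : r + p = p + r by rewrite addrC.
  rewrite -(dm_actA (erefl (p + r)) e4) -(dm_actA e5 e4).
  rewrite (cr_comm (erefl (p + r)) e5 a b) (sgnz_morph (fun a a' => dm_actBl e4 a a' _)).
  by rewrite sgnzD sgnz_even.
Defined.

(* a |-> (x |-> a q(x)) *)
Definition homothety : dgHom (dg_self A) (HomDG P N).
Proof.
unshelve refine (@DgHom A (dg_self A) (HomDG P N)
  (@CxMap (dg_self A) (HomDG P N) homothety_deg _ _) _) => /=.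
- by move=> p a b; apply: hom_deg_eq => j k e x /=; rewrite dm_actBl.
- move=> p p' e a; apply: hom_deg_eq => j k e' x /=.
  have e1 : p + (j + 1) = k by lia.
  rewrite (dm_leibniz _ e (erefl (j + 1)) _ (homothety_subproof e') e1).
  rewrite cm_d (eq_irrelevance e1 (homothety_subproof (hd_d_subproof2 e e'))).
  by rewrite addrK.
- move=> i j k e a b; apply: hom_deg_eq => r s e' x /=.
  exact: dm_actA.
Defined.

End Homothety.

Definition int_interval (I : set int) : Prop :=
  forall x y z, I x -> I y -> x <= z <= y -> I z.

(* The smallest integer interval (possibly empty or unbounded) containing all
   the degrees in which the cohomology is nonzero, as a set of integers. *)
Definition con (C : complex) : set int :=
  smallest int_interval [set i | exists h : H C i, h <> 0]%classic.

(* - S + [d0, d1] as a set of integers. On intervals, pointwise and endpointwise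
   addition agree, and the result is empty when [S] is. *)
Definition con_bound (S : set int) (d0 d1 : int) : set int :=
  [set - s + d | s in S & d in [set d | d0 <= d <= d1]]%classic.

Definition fin_gen_cohomology (M : dgModule A) : Prop :=
  forall i, fin_gen (Hmod M i).

Definition Dbf (M : dgModule A) : Prop :=
  fin_gen_cohomology M /\
  exists n0 n1 : int, forall i, ~ (n0 <= i <= n1) -> forall h : H M i, h = 0.

Definition D0f (M : dgModule A) : Prop :=
  fin_gen_cohomology M /\ forall i, i <> 0 -> forall h : H M i, h = 0.

Definition finite_inj_dim (R : dgModule A) : Prop :=
  exists d0 d1 : int, d0 <= d1 /\ forall M : dgModule A,
    exists P : kproj_resolution M, (con (RHom P R) `<=` con_bound (con M) d0 d1)%classic.

(* With q : P -> R a K-projective resolution, the adjunction morphism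
   A -> RHom_A(R, R) = Hom_A(P, R) is a |-> a q. *)
Definition dualizing (R : dgModule A) : Prop :=
  [/\ fin_gen_cohomology R, finite_inj_dim R
    & exists P : kproj_resolution R,
        is_isoD (Dloc (homothety (kp_map P)) : HomD (dg_self A) (RHom P R))].

Definition cohen_macaulay (R M : dgModule A) : Prop :=
  exists P : kproj_resolution M, D0f (RHom P R).

End RHom.

(* Main.v *)
(* Let [P] be K-projective over [B], [PA -> P] a K-projective resolution over
   [A], and [K] the fibre of the counit [eps : B (x)_A PA -> P].  As
   [H^0(A) -> H^0(B)] is surjective, [eps] is surjective on top cohomology, and
   [H^j Hom_A(PA, Q) = 0] for [j < g] implies the same for [K] and [j <= g].
   Iterating [P |-> K], which lowers the top degree each time, the groups
   [Ext_A(P, Q)] and [Ext_B(P, Q)] start in the same degree [g], and restriction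
   is bijective in degrees [<= g].

   Write [D = RHom_B(-, R)]; biduality follows from the dualizing property by
   attaching one cell at a time, since [R] has finite injective dimension.
   If [M] and [N] are Cohen-Macaulay, then [Ext_B^j(M, N) = Ext_B^j(D N, D M)]
   vanishes for [j < 0], and restriction is bijective in degree [0].  If only
   [M] is, and [M] and [N] are isomorphic over [A], then the comparison of
   [Ext(-, R)] shows that [D N] lives in degrees [>= 0].  For [s > 0] and
   [V] the truncation of [D N] to degrees [>= s], [Ext_B^j(D V, M) =
   Ext_B^j(D M, V)] vanishes for [j < s], hence so do [Ext_B^j(D V, N) =
   Ext_B^j(D N, V)] by comparison over [A]; for [j = 0] this says that
   [D N -> V] is zero, so that [H^s(D N) = 0]. *)

Require Import Defs.
From HB Require Import structures.
From mathcomp Require Import all_boot all_order all_algebra.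
From mathcomp Require Import boolp classical_sets zify.

Set Implicit Arguments.
Unset Strict Implicit.
Unset Printing Implicit Defensive.

Import Order.TTheory GRing.Theory Num.Theory.
Local Open Scope ring_scope.

(** * Complexes and short exact sequences *)

(** The gain of one degree for K has this origin. Over [A], B (x)_A PA becomes PA (x)_A Bt, with Bt
    a resolution of B over [A], and exchange of variables turns its morphisms to Q into morphisms
    from Bt, in degrees <= 0, to Hom(PA, Q), in degrees >= g. In the critical degree g only the
    effect on H^0(B) counts, and surjectivity of H^0(f) reduces this to the image of 1. Replacing B
    by Bt needs PA to be flat, which follows from K-projectivity by duality with values in Q/Z. The
    bound on the cohomology of K needs no Tor: it is read off by mapping K to its own truncation.
    For biduality, a module may need infinitely many cells; but in a fixed degree j finitely many
    suffice, because both a module in very low degrees and its bidual vanish near j. Morphisms in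
    the derived category are formal words. A path object shows that homotopic maps give equal words,
    and an action of words on homotopy classes of maps out of a K-projective module shows that
    nothing else is identified there. *)

Lemma morphN (U V : zmodType) (f : U -> V) :
  {morph f : x y / x - y} -> {morph f : x / - x}.
Proof. by move=> fB x; rewrite -sub0r fB (morphB0 fB) sub0r. Qed.

Lemma sgnz0l (V : zmodType) (x : V) : sgnz 0 x = x.
Proof. exact: mulr1z. Qed.

Lemma sgnzN (V : zmodType) i (x : V) : sgnz i (- x) = - sgnz i x.
Proof. exact: mulNrz. Qed.

Lemma sgnzDr (V : zmodType) i : {morph @sgnz V i : x y / x + y}.
Proof. exact: morphBD (@sgnzB V i). Qed.

Lemma sgnzK (V : zmodType) i : involutive (@sgnz V i).
Proof. by move=> x; rewrite sgnzD sgnz_even. Qed.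

Lemma sgnzS (V : zmodType) i (x : V) : sgnz (i + 1) x = - sgnz i x.
Proof. by rewrite -sgnzD [sgnz 1 x]sgnzE /= sgnzN. Qed.

Lemma sgnz_inj (V : zmodType) i (x : V) : sgnz i x = 0 -> x = 0.
Proof. by move=> h; rewrite -[x](sgnzK i) h sgnz0. Qed.

Section Complexes.
Variable C : complex.

(* Transport between propositionally equal degrees; every structure map
   absorbs it, because structure maps take their degrees through equations. *)
Definition tr i j (e : i = j) (x : C i) : C j := ecast k (C k) e x.

Lemma trB i j (e : i = j) : {morph @tr i j e : x y / x - y}.
Proof. by case: j / e. Qed.

Lemma tr_sgn i j (e : i = j) n x : tr e (sgnz n x) = sgnz n (tr e x).
Proof. by case: j / e. Qed.

Lemma tr0 i j (e : i = j) : tr e 0 = 0.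
Proof. by case: j / e. Qed.

Lemma tr_id i (e : i = i) x : tr e x = x.
Proof. by rewrite (eq_irrelevance e erefl). Qed.

Lemma tr_tr i j k (e : i = j) (e' : j = k) x : tr e' (tr e x) = tr (etrans e e') x.
Proof. by case: k / e'; case: j / e. Qed.

Lemma tr_d i j k (e : i + 1 = j) (e' : j = k) x :
  tr e' (cx_d e x) = cx_d (etrans e e') x.
Proof. by case: k / e'; rewrite /tr /=; case: j / e. Qed.

Lemma d_tr i j k (e : i = j) (e' : j + 1 = k) x :
  cx_d e' (tr e x) = cx_d (etrans (congr1 (fun z => z + 1) e) e') x.
Proof. by case: j / e e' => e'; rewrite (eq_irrelevance (etrans _ _) e'). Qed.

Lemma cx_dD i j (e : i + 1 = j) : {morph @cx_d C i j e : x y / x + y}.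
Proof. exact: morphBD (cx_dB _). Qed.

Lemma cx_dN i j (e : i + 1 = j) (x : C i) : cx_d e (- x) = - cx_d e x.
Proof. exact: (morphN (cx_dB e)). Qed.

Lemma cx_d_sgn i j (e : i + 1 = j) n (x : C i) : cx_d e (sgnz n x) = sgnz n (cx_d e x).
Proof. exact: (sgnz_morph (cx_dB e)). Qed.

Definition cocyc i (x : C i) : Prop := cx_d (erefl (i + 1)) x = 0.

Definition bdry i (x : C i) : Prop := exists j (e : j + 1 = i) (y : C j), cx_d e y = x.

Lemma closedE i j (e : i + 1 = j) (x : C i) : cocyc x <-> cx_d e x = 0.
Proof. by subst j. Qed.

Lemma bdryE i j (e : j + 1 = i) (x : C i) : bdry x <-> exists y : C j, cx_d e y = x.
Proof.
split=> [[k [e' [y <-]]]|[y <-]]; last by exists j, e, y.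
have ej : k = j by lia.
by subst k; exists y; rewrite (eq_irrelevance e e').
Qed.

Lemma bdry_d i j (e : j + 1 = i) (y : C j) : bdry (cx_d e y).
Proof. by exists j, e, y. Qed.

Lemma bdry0 i : bdry (0 : C i).
Proof. by apply/(bdryE (subrK 1 i)); exists 0; rewrite cx_d0. Qed.

Lemma bdryB i (x y : C i) : bdry x -> bdry y -> bdry (x - y).
Proof.
move=> /(bdryE (subrK 1 i))[u <-] /(bdryE (subrK 1 i))[v <-].
by rewrite -cx_dB; exact: bdry_d.
Qed.

Lemma bdryN i (x : C i) : bdry x -> bdry (- x).
Proof. by rewrite -[- x]sub0r; apply: bdryB; exact: bdry0. Qed.

Lemma bdryD i (x y : C i) : bdry x -> bdry y -> bdry (x + y).
Proof. by move=> bx /bdryN yb; rewrite -[y]opprK; exact: bdryB. Qed.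

Lemma bdry_sgn i n (x : C i) : bdry x <-> bdry (sgnz n x).
Proof.
by split; rewrite sgnzE; case: ifP => // _ /bdryN //; rewrite opprK.
Qed.

Lemma bdry_sub i (x y : C i) : bdry (x - y) -> (bdry x <-> bdry y).
Proof.
move=> xy; split=> [bx|by_]; last by rewrite -(subrK y x); exact: bdryD.
by have := bdryB bx xy; rewrite subKr.
Qed.

Lemma bdry_closed i (x : C i) : bdry x -> cocyc x.
Proof. by move=> [j [e [y <-]]]; rewrite /cocyc cx_dd. Qed.

Lemma closed_d i j (e : j + 1 = i) (y : C j) : cocyc (cx_d e y).
Proof. by apply: bdry_closed; exact: bdry_d. Qed.

Lemma closed0 i : cocyc (0 : C i).
Proof. exact: cx_d0. Qed.

Lemma closedB i (x y : C i) : cocyc x -> cocyc y -> cocyc (x - y).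
Proof. by rewrite /cocyc cx_dB => -> ->; rewrite subrr. Qed.

Lemma closedN i (x : C i) : cocyc x -> cocyc (- x).
Proof. by rewrite /cocyc cx_dN => ->; rewrite oppr0. Qed.

Lemma closedD i (x y : C i) : cocyc x -> cocyc y -> cocyc (x + y).
Proof. by rewrite /cocyc cx_dD => -> ->; rewrite addr0. Qed.

Lemma closed_sgn i n (x : C i) : cocyc x -> cocyc (sgnz n x).
Proof. by rewrite /cocyc cx_d_sgn => ->; rewrite sgnz0. Qed.

Definition van i : Prop := forall x : C i, cocyc x -> bdry x.

Lemma hcls_eq0 i (x : cocycle C i) : hcls x = 0 <-> bdry (cval x).
Proof.
have -> : (0 : H C i) = hcls 0 by rewrite -(subrr (hcls (0 : cocycle C i))) -hclsB subrr.
rewrite hcls_eq subr0 /is_boundary /=.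
by split=> [/asboolP|h]; last exact/asboolP.
Qed.

Lemma vanE i : van i <-> forall h : H C i, h = 0.
Proof.
split=> [v h|v x cx].
  rewrite -[h]hrepK; apply/hcls_eq0; apply: v.
  exact/asboolP/cvalP.
have cx' : is_cocycle x by apply/asboolP.
by have /hcls_eq0 := v (hcls (Cocycle cx')).
Qed.

Lemma acyclicE : acyclic C <-> forall i, van i.
Proof. by split=> h i; apply/vanE/h. Qed.

End Complexes.

Lemma cm_D (C D : complex) (f : cxMap C D) i : {morph f i : x y / x + y}.
Proof. exact: morphBD (@cm_B _ _ f i). Qed.

Lemma cm_N (C D : complex) (f : cxMap C D) i x : f i (- x) = - f i x.
Proof. exact: (morphN (@cm_B _ _ f i)). Qed.

Lemma cm_sgn (C D : complex) (f : cxMap C D) i n x : f i (sgnz n x) = sgnz n (f i x).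
Proof. exact: (sgnz_morph (@cm_B _ _ f i)). Qed.

Lemma cm_closed (C D : complex) (f : cxMap C D) i (x : C i) : cocyc x -> cocyc (f i x).
Proof. by rewrite /cocyc -cm_d => ->; rewrite cm_0. Qed.

Lemma cm_bdry (C D : complex) (f : cxMap C D) i (x : C i) : bdry x -> bdry (f i x).
Proof. by move=> [j [e [y <-]]]; rewrite cm_d; exact: bdry_d. Qed.

Lemma cm_tr (C D : complex) (f : cxMap C D) i j (e : i = j) x : f j (tr e x) = tr e (f i x).
Proof. by case: j / e. Qed.

Lemma is_qisE (C D : complex) (f : cxMap C D) :
  is_qis f <-> forall i,
    (forall x : C i, cocyc x -> bdry (f i x) -> bdry x) /\
    (forall y : D i, cocyc y -> exists2 x : C i, cocyc x & bdry (y - f i x)).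
Proof.
split=> [qf i|qf i].
  have [g fK gK] := qf i; split=> [x cx bx|y cy].
    have cx' : is_cocycle x by apply/asboolP.
    have : Hmap f (hcls (Cocycle cx')) = Hmap f 0.
      rewrite HmapE; transitivity (0 : H D i); first exact/hcls_eq0.
      by apply: (addIr (Hmap f 0)); rewrite -HmapD addr0 add0r.
    by move/(can_inj fK)/hcls_eq0.
  have cy' : is_cocycle y by apply/asboolP.
  have := gK (hcls (Cocycle cy')).
  rewrite -[g _]hrepK HmapE => /esym/hcls_eq; rewrite /is_boundary => /asboolP b.
  exists (cval (hrep (g (hcls (Cocycle cy'))))) => //.
  exact/asboolP/cvalP.
have [inj surj] := qf i.
have fB : {morph @Hmap _ _ f i : x y / x - y}.
  by move=> x y; apply: (addIr (Hmap f y)); rewrite -HmapD !subrK.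
have fi : injective (@Hmap _ _ f i).
  move=> h h' hh; apply/eqP; rewrite -subr_eq0; apply/eqP.
  have : Hmap f (h - h') = 0 by rewrite fB hh subrr.
  rewrite -[h - h']hrepK HmapE => /hcls_eq0 /= b; apply/hcls_eq0; apply: inj => //.
  exact/asboolP/cvalP.
have fs (h : H D i) : exists h', Hmap f h' = h.
  have /asboolP ch := cvalP (hrep h).
  have [x cx b] := surj _ ch.
  have cx' : is_cocycle x by apply/asboolP.
  exists (hcls (Cocycle cx')); rewrite HmapE -[RHS]hrepK; apply/hcls_eq/asboolP.
  by move/bdryN: b; rewrite opprB.
exists (fun h => projT1 (cid (fs h))) => h; case: cid => //= h' /fi //.
Qed.

(* Degreewise short exact sequences, up to a shift of the two outer terms; the
   integers [u] and [v] only record signs. *)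
Record is_ses (Y E X : complex) (sb sa : int -> int) (u v b a : int)
    (si : forall k, Y (sb k) -> E k) (sp : forall k, E k -> X (sa k)) : Prop := Ses {
  ses_b : forall k, sb k = k + b;
  ses_a : forall k, sa k = k + a;
  siB : forall k, {morph si k : x y / x - y};
  spB : forall k, {morph sp k : x y / x - y};
  si_d : forall k l (e : k + 1 = l) (e' : sb k + 1 = sb l) y,
    cx_d e (si k y) = si l (sgnz u (cx_d e' y));
  sp_d : forall k l (e : k + 1 = l) (e' : sa k + 1 = sa l) x,
    cx_d e' (sp k x) = sgnz v (sp l (cx_d e x));
  si_inj : forall k y, si k y = 0 -> y = 0;
  sp_si : forall k y, sp k (si k y) = 0;
  ses_ex : forall k x, sp k x = 0 -> exists y, x = si k y;
  sp_surj : forall k z, exists x, sp k x = z }.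

Arguments siB {Y E X sb sa u v b a si sp} _ k.
Arguments spB {Y E X sb sa u v b a si sp} _ k.

Section ShortExact.
Variables (Y E X : complex) (sb sa : int -> int) (u v b a : int).
Variables (si : forall k, Y (sb k) -> E k) (sp : forall k, E k -> X (sa k)).
Hypothesis s : is_ses u v b a si sp.

Lemma ses_eb k l : k + 1 = l -> sb k + 1 = sb l.
Proof. by rewrite !(ses_b s); lia. Qed.

Lemma ses_ea k l : k + 1 = l -> sa k + 1 = sa l.
Proof. by rewrite !(ses_a s); lia. Qed.

Lemma si_closed k (y : Y (sb k)) : cocyc y <-> cocyc (si y).
Proof.
rewrite (closedE (ses_eb (erefl (k + 1)))) (closedE (erefl (k + 1))).
rewrite (si_d s (erefl _) (ses_eb erefl)).
split=> [->|/(si_inj s)/sgnz_inj //]; by rewrite sgnz0 (morphB0 (siB s _)).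
Qed.

Lemma si_bdry k (y : Y (sb k)) : bdry y -> bdry (si y).
Proof.
have e : k - 1 + 1 = k by rewrite subrK.
move=> /(bdryE (ses_eb e))[z <-].
apply/(bdry_sgn u); rewrite -(sgnz_morph (siB s k)) -(si_d s e (ses_eb e)).
exact: bdry_d.
Qed.

Lemma sp_closed k (x : E k) : cocyc x -> cocyc (sp x).
Proof.
move=> cx; apply/(closedE (ses_ea (erefl (k + 1)))).
by rewrite (sp_d s (erefl (k + 1))) cx (morphB0 (spB s _)) sgnz0.
Qed.

Lemma sp_bdry k (x : E k) : bdry x -> bdry (sp x).
Proof.
have e : k - 1 + 1 = k by rewrite subrK.
move=> /(bdryE e)[z <-].
apply/(bdry_sgn v); rewrite -(sp_d s e (ses_ea e)); exact: bdry_d.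
Qed.

Lemma ses_mid k (x : E k) : cocyc x -> bdry (sp x) ->
  exists2 y : Y (sb k), cocyc y & bdry (x - si y).
Proof.
have e : k - 1 + 1 = k by rewrite subrK.
move=> cx /(bdryE (ses_ea e))[z dz].
have [w wz] := sp_surj s (sgnz v z).
have /(ses_ex s)[y xy] : sp (x - cx_d e w) = 0.
  apply/(@sgnz_inj _ v); rewrite (spB s) sgnzB -(sp_d s e (ses_ea e)) wz cx_d_sgn dz.
  by rewrite subrr.
exists y; first by apply/si_closed; rewrite -xy; apply: closedB (closed_d _ _).
by rewrite -xy subKr; exact: bdry_d.
Qed.

(** The connecting map sends the class of z to that of y. The lift x is returned as well, because
    the five lemma uses it to correct cochains. *)
Lemma ses_conn k l (e : k + 1 = l) (z : X (sa k)) : cocyc z ->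
  exists x y, [/\ sp x = z, cx_d e x = si (y : Y (sb l)) & cocyc y].
Proof.
move=> cz; have [x xz] := sp_surj s z.
have /(ses_ex s)[y xy] : sp (cx_d e x) = 0.
  apply/(@sgnz_inj _ v); rewrite -(sp_d s e (ses_ea e)) xz.
  exact/closedE.
exists x, y; split=> //; apply/si_closed; rewrite -xy; exact: closed_d.
Qed.

Lemma ses_van_mid k : van Y (sb k) -> van X (sa k) -> van E k.
Proof.
move=> vY vX x cx; have [y cy bxy] := ses_mid cx (vX _ (sp_closed cx)).
by apply/(bdry_sub bxy)/si_bdry/vY.
Qed.

Lemma ses_van_sub k : van E (k + 1) -> van X (sa k) -> van Y (sb (k + 1)).
Proof.
move=> vE vX y cy.
have /(bdryE (erefl (k + 1)))[x dx] := vE _ ((si_closed y).1 cy).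
have /vX /(bdryE (ses_ea (subrK 1 k)))[z dz] : cocyc (sp x).
  apply/(closedE (ses_ea (erefl (k + 1)))).
  by rewrite (sp_d s (erefl (k + 1))) dx (sp_si s) sgnz0.
have [w wz] := sp_surj s (sgnz v z).
have /(ses_ex s)[y' xy] : sp (x - cx_d (subrK 1 k) w) = 0.
  apply/(@sgnz_inj _ v); rewrite (spB s) sgnzB -(sp_d s (subrK 1 k) (ses_ea (subrK 1 k))).
  by rewrite wz cx_d_sgn dz subrr.
apply/(bdryE (ses_eb (erefl (k + 1)))); exists (sgnz u y').
have : cx_d (erefl (k + 1)) (si y') = si y by rewrite -xy cx_dB cx_dd subr0.
rewrite (si_d s (erefl _) (ses_eb erefl)) cx_d_sgn => /eqP.
by rewrite -subr_eq0 -(siB s) => /eqP/(si_inj s)/eqP; rewrite subr_eq0 => /eqP.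
Qed.

End ShortExact.

Arguments hd_fun {A M N i} _ {j k} _ _.

(** * The calculus of Hom complexes *)

Section HomCalculus.
Variable A : cdgRing.
Implicit Types M N P T : dgModule A.

Lemma dm_act_sgn M p j k (e : p + j = k) (a : A p) n (x : M j) :
  dm_act e a (sgnz n x) = sgnz n (dm_act e a x).
Proof. exact: (sgnz_morph (dm_actBr e a)). Qed.

Lemma dm_actN M p j k (e : p + j = k) (a : A p) (x : M j) :
  dm_act e a (- x) = - dm_act e a x.
Proof. exact: (morphN (dm_actBr e a)). Qed.

Lemma act_tr M p i j k (e : i = j) (e' : p + j = k) (a : A p) (x : M i) :
  dm_act e' a (tr e x) = dm_act (etrans (congr1 (fun z => p + z) e) e') a x.
Proof. by case: j / e e' => e'; rewrite (eq_irrelevance (etrans _ _) e'). Qed.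

Lemma tr_act M p i j k (e : p + i = j) (e' : j = k) (a : A p) (x : M i) :
  tr e' (dm_act e a x) = dm_act (etrans e e') a x.
Proof. by case: k / e'; rewrite /tr /=; case: j / e. Qed.

Lemma hd_sgn M N i (f : hom_deg M N i) j k (e : j + i = k) n x :
  hd_fun f e (sgnz n x) = sgnz n (hd_fun f e x).
Proof. exact: (sgnz_morph (hd_B f e)). Qed.

Lemma hd_D M N i (f : hom_deg M N i) j k (e : j + i = k) :
  {morph hd_fun f e : x y / x + y}.
Proof. exact: morphBD (hd_B f e). Qed.

Lemma hd_N M N i (f : hom_deg M N i) j k (e : j + i = k) x :
  hd_fun f e (- x) = - hd_fun f e x.
Proof. exact: (morphN (hd_B f e)). Qed.

Lemma hd_0 M N i (f : hom_deg M N i) j k (e : j + i = k) : hd_fun f e 0 = 0.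
Proof. exact: (morphB0 (hd_B f e)). Qed.

Lemma hd_tr M N i (f : hom_deg M N i) j j' k (e : j = j') (e' : j' + i = k) x :
  hd_fun f e' (tr e x) = hd_fun f (etrans (congr1 (fun z => z + i) e) e') x.
Proof. by case: j' / e e' => e'; rewrite (eq_irrelevance (etrans _ _) e'). Qed.

Lemma tr_hd M N i (f : hom_deg M N i) j k l (e : j + i = k) (e' : k = l) x :
  tr e' (hd_fun f e x) = hd_fun f (etrans e e') x.
Proof. by case: l / e'; rewrite /tr /=; case: k / e. Qed.

Lemma hd_funD M N i (f g : hom_deg M N i) j k (e : j + i = k) x :
  hd_fun (f + g) e x = hd_fun f e x + hd_fun g e x.
Proof. by []. Qed.

Lemma hd_funN M N i (f : hom_deg M N i) j k (e : j + i = k) x :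
  hd_fun (- f) e x = - hd_fun f e x.
Proof. by []. Qed.

Lemma hd_hd M N P i i' (g : hom_deg N P i') (f : hom_deg M N i) j k k' l
    (e : j + i = k) (e' : j + i = k') (e1 : k + i' = l) (e1' : k' + i' = l) x :
  hd_fun g e1 (hd_fun f e x) = hd_fun g e1' (hd_fun f e' x).
Proof. by subst k k'; rewrite (eq_irrelevance e1 e1'). Qed.

(** The intermediate degrees are arbitrary here, instead of the sums fixed in [hd_d], so that later
    computations can rewrite without transport. *)
Lemma hd_dE M N i i' (e : i + 1 = i') (f : hom_deg M N i) j k (e' : j + i' = k)
    l (e1 : j + i = l) (e2 : l + 1 = k) j' (e3 : j + 1 = j') (e4 : j' + i = k) x :
  hd_fun (hd_d e f) e' x =
    cx_d e2 (hd_fun f e1 x) - sgnz i (hd_fun f e4 (cx_d e3 x)).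
Proof.
subst l j' => /=.
by rewrite (eq_irrelevance e2 (hd_d_subproof1 e e')) (eq_irrelevance e4 (hd_d_subproof2 e e')).
Qed.

Definition hclosed M N i (f : hom_deg M N i) := @cocyc (HomDG M N) i f.
Definition hbdry M N i (f : hom_deg M N i) := @bdry (HomDG M N) i f.
Definition hvan M N i := van (HomDG M N) i.

Lemma hclosedP M N i (f : hom_deg M N i) : hclosed f <->
  forall j k l j' (e1 : j + i = k) (e2 : k + 1 = l) (e3 : j + 1 = j') (e4 : j' + i = l) x,
    cx_d e2 (hd_fun f e1 x) = sgnz i (hd_fun f e4 (cx_d e3 x)).
Proof.
split=> [cf j k l j' e1 e2 e3 e4 x|cf].
  have e5 : j + (i + 1) = l by lia.
  have : hd_fun (hd_d (erefl (i + 1)) f) e5 x = 0 by rewrite [hd_d _ f]cf.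
  by rewrite (hd_dE _ _ _ e1 e2 e3 e4) => /eqP; rewrite subr_eq0 => /eqP.
apply: hom_deg_eq => j k e x /=; apply/eqP; rewrite subr_eq0; apply/eqP.
exact: cf.
Qed.

Lemma hbdryE M N i j (e : j + 1 = i) (f : hom_deg M N i) :
  hbdry f <-> exists h : hom_deg M N j, hd_d e h = f.
Proof. exact: (@bdryE (HomDG M N)). Qed.

Lemma hcomp_subproof (p i j k q : int) : i + j = k -> p + k = q -> p + i + j = q.
Proof. lia. Qed.

Definition hcomp M N P i j k (e : i + j = k) (g : hom_deg N P j) (f : hom_deg M N i) :
  hom_deg M P k.
Proof.
apply: (@HomDeg A M P k (fun p q e' x =>
  hd_fun g (hcomp_subproof e e') (hd_fun f (erefl (p + i)) x))).
- by move=> p q e' x y; rewrite !hd_B.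
- move=> r p rp q s e1 e2 e3 e4 a x.
  have e5 : r + (p + i) = rp + i by lia.
  rewrite (hd_act f e1 erefl erefl e5) hd_sgn.
  rewrite (hd_act g e5 (hcomp_subproof e e2) (hcomp_subproof e e3) e4) sgnzD.
  by congr sgnz; rewrite -e mulrDl.
Defined.

Lemma hcompE M N P i j k (e : i + j = k) (g : hom_deg N P j) (f : hom_deg M N i)
    p q r (e' : p + k = q) (e1 : p + i = r) (e2 : r + j = q) x :
  hd_fun (hcomp e g f) e' x = hd_fun g e2 (hd_fun f e1 x).
Proof. exact: hd_hd. Qed.

Lemma hcompBl M N P i j k (e : i + j = k) (g g' : hom_deg N P j) (f : hom_deg M N i) :
  hcomp e (g - g') f = hcomp e g f - hcomp e g' f.
Proof. by apply: hom_deg_eq => p q e' x /=. Qed.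

Lemma hcompBr M N P i j k (e : i + j = k) (g : hom_deg N P j) (f f' : hom_deg M N i) :
  hcomp e g (f - f') = hcomp e g f - hcomp e g f'.
Proof. by apply: hom_deg_eq => p q e' x /=; rewrite hd_B. Qed.

Lemma hcomp0l M N P i j k (e : i + j = k) (f : hom_deg M N i) :
  hcomp e (0 : hom_deg N P j) f = 0.
Proof. by apply: hom_deg_eq. Qed.

Lemma hcomp0r M N P i j k (e : i + j = k) (g : hom_deg N P j) :
  hcomp e g (0 : hom_deg M N i) = 0.
Proof. by apply: hom_deg_eq => p q e' x /=; rewrite hd_0. Qed.

Lemma hcompA M N P Q i j k ij jk ijk (e1 : i + j = ij) (e2 : ij + k = ijk)
    (e3 : j + k = jk) (e4 : i + jk = ijk)
    (h : hom_deg P Q k) (g : hom_deg N P j) (f : hom_deg M N i) :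
  hcomp e2 h (hcomp e1 g f) = hcomp e4 (hcomp e3 h g) f.
Proof.
apply: hom_deg_eq => p q e x /=.
by rewrite (hd_hd g f _ erefl _ erefl); apply: hd_hd.
Qed.

Lemma hcomp_d M N P i j k i' j' k' (e : i + j = k) (ei : i + 1 = i') (ej : j + 1 = j')
    (ek : k + 1 = k') (e1 : i + j' = k') (e2 : i' + j = k')
    (g : hom_deg N P j) (f : hom_deg M N i) :
  hd_d ek (hcomp e g f) = hcomp e1 (hd_d ej g) f + sgnz j (hcomp e2 g (hd_d ei f)).
Proof.
apply: hom_deg_eq => p q e' x; rewrite hd_funD hd_fun_sgnz.
have e3 : p + k = p + i + j by lia.
have e4 : p + i + j + 1 = q by lia.
have e5 : p + 1 + k = q by lia.
have e6 : p + i + j' = q by lia.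
have e7 : p + i + 1 + j = q by lia.
have e8 : p + 1 + i = p + i + 1 by lia.
have e9 : p + i' = p + i + 1 by lia.
rewrite (hd_dE ek _ e' e3 e4 (erefl (p + 1)) e5).
rewrite (hcompE _ _ _ _ erefl erefl) (hcompE _ _ _ _ e8 e7).
rewrite (hcompE _ _ _ _ erefl e6) (hcompE _ _ _ _ e9 e7).
rewrite (hd_dE ej g e6 erefl e4 erefl e7) (hd_dE ei f e9 erefl erefl erefl e8).
rewrite hd_B sgnzB addrA subrK; congr (_ - _).
by rewrite hd_sgn sgnzD -e addrC.
Qed.

Lemma hclosed_comp M N P i j k (e : i + j = k) (g : hom_deg N P j) (f : hom_deg M N i) :
  hclosed g -> hclosed f -> hclosed (hcomp e g f).
Proof.
have e1 : i + (j + 1) = k + 1 by lia.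
have e2 : i + 1 + j = k + 1 by lia.
move=> cg cf; rewrite /hclosed /cocyc /= (hcomp_d e erefl erefl erefl e1 e2).
by rewrite [hd_d _ g]cg [hd_d _ f]cf hcomp0l hcomp0r sgnz0 addr0.
Qed.

Lemma hbdry_compl M N P i j k (e : i + j = k) (g : hom_deg N P j) (f : hom_deg M N i) :
  hbdry g -> hclosed f -> hbdry (hcomp e g f).
Proof.
move=> /(hbdryE (subrK 1 j))[h <-] cf; apply/(hbdryE (subrK 1 k)).
have e0 : i + (j - 1) = k - 1 by lia.
have e2 : i + 1 + (j - 1) = k by lia.
exists (hcomp e0 h f); rewrite (hcomp_d e0 erefl (subrK 1 j) (subrK 1 k) e e2).
by rewrite [hd_d _ f]cf hcomp0r sgnz0 addr0.
Qed.

Lemma hbdry_compr M N P i j k (e : i + j = k) (g : hom_deg N P j) (f : hom_deg M N i) :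
  hclosed g -> hbdry f -> hbdry (hcomp e g f).
Proof.
move=> cg /(hbdryE (subrK 1 i))[h <-]; apply/(hbdryE (subrK 1 k)).
have e0 : i - 1 + j = k - 1 by lia.
have e1 : i - 1 + (j + 1) = k by lia.
exists (sgnz j (hcomp e0 g h)).
rewrite (sgnz_morph (@hd_dB _ _ _ _ _ (subrK 1 k))).
rewrite (hcomp_d e0 (subrK 1 i) erefl (subrK 1 k) e1 e).
by rewrite [hd_d _ g]cg hcomp0l add0r sgnzK.
Qed.

Lemma hclosedB M N i (f g : hom_deg M N i) : hclosed f -> hclosed g -> hclosed (f - g).
Proof. exact: (@closedB (HomDG M N)). Qed.

Lemma hd_add0 (j k : int) : j + 0 = k -> j = k. Proof. by rewrite addr0. Qed.

(** DG homomorphisms are the cocycles of degree 0 in the Hom complex, with [dgh] as inverse. The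
    transport absorbs the equation j + 0 = k. *)
Definition hm M N (u : dgHom M N) : hom_deg M N 0.
Proof.
apply: (@HomDeg A M N 0 (fun j k e x => tr (hd_add0 e) (u j x))).
- by move=> j k e x y; rewrite cm_B trB.
- move=> p j pj k l e e1 e2 e3 a x; rewrite mul0r sgnz0l dh_act tr_act act_tr.
  by congr dm_act; apply: eq_irrelevance.
Defined.

Lemma hm_closed M N (u : dgHom M N) : hclosed (hm u).
Proof.
apply/hclosedP => j k l j' e1 e2 e3 e4 x /=; rewrite sgnz0l d_tr cm_d tr_d.
by congr cx_d; apply: eq_irrelevance.
Qed.

Lemma hmE M N (u : dgHom M N) j (e : j + 0 = j) x : hd_fun (hm u) e x = u j x.
Proof. by rewrite /= tr_id. Qed.

Definition dgh M N (f : hom_deg M N 0) (cf : hclosed f) : dgHom M N.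
Proof.
unshelve refine (@DgHom A M N (@CxMap M N (fun j x => hd_fun f (addr0 j) x) _ _) _).
- by move=> j x y; rewrite hd_B.
- move=> j k e x; rewrite ((hclosedP f).1 cf _ _ k k (addr0 j) e e (addr0 k)).
  by rewrite sgnz0l.
- move=> i j k e a x /=; rewrite (hd_act f e (addr0 k) (addr0 j) e).
  by rewrite mul0r sgnz0l.
Defined.

Lemma hm_dgh M N (f : hom_deg M N 0) (cf : hclosed f) : hm (dgh cf) = f.
Proof.
apply: hom_deg_eq => j k e x /=; rewrite tr_hd.
by congr hd_fun; apply: eq_irrelevance.
Qed.

Lemma hm_inj M N (u v : dgHom M N) : hm u = hm v -> u = v.
Proof. by move=> uv; apply: dgHom_eq => j x; rewrite -(hmE u (addr0 j)) uv hmE. Qed.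

Lemma hm_id_l M N i (e : i + 0 = i) (f : hom_deg M N i) : hcomp e (hm (dg_id N)) f = f.
Proof.
apply: hom_deg_eq => p q e' x /=; rewrite tr_hd.
by congr hd_fun; apply: eq_irrelevance.
Qed.

Lemma hm_id_r M N i (e : 0 + i = i) (f : hom_deg M N i) : hcomp e f (hm (dg_id M)) = f.
Proof.
apply: hom_deg_eq => p q e' x /=; rewrite hd_tr.
by congr hd_fun; apply: eq_irrelevance.
Qed.

Lemma hm_comp M N P (g : dgHom N P) (f : dgHom M N) (e : 0 + 0 = 0 :> int) :
  hm (dg_comp g f) = hcomp e (hm g) (hm f).
Proof.
apply: hom_deg_eq => p q e' x /=; rewrite cm_tr tr_tr.
by congr tr; apply: eq_irrelevance.
Qed.

Definition hpost T M N (u : dgHom M N) : dgHom (HomDG T M) (HomDG T N).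
Proof.
unshelve refine (@DgHom A (HomDG T M) (HomDG T N) (@CxMap (HomDG T M) (HomDG T N)
  (fun i (f : hom_deg T M i) => @HomDeg A T N i
     (fun j k e x => u k (hd_fun f e x)) _ _) _ _) _).
- by move=> j k e x y; rewrite hd_B cm_B.
- move=> p j pj k l e e1 e2 e3 a x.
  by rewrite (hd_act f e e1 e2 e3) cm_sgn dh_act.
- by move=> i f g; apply: hom_deg_eq => j k e x /=; rewrite cm_B.
- by move=> i j e f; apply: hom_deg_eq => p q e' x /=; rewrite cm_B cm_sgn cm_d.
- by move=> i j k e a f; apply: hom_deg_eq => p q e' x /=; rewrite dh_act.
Defined.

End HomCalculus.

(** * Twisted extensions *)

Lemma sgnz_pair (U V : zmodType) n (x : U) (y : V) :
  sgnz n ((x, y) : (U * V)%type) = (sgnz n x, sgnz n y).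
Proof. by rewrite !sgnzE; case: ifP. Qed.

Lemma sgnz_fst (U V : zmodType) n (x : (U * V)%type) : (sgnz n x).1 = sgnz n x.1.
Proof. by rewrite !sgnzE; case: ifP. Qed.

Lemma sgnz_snd (U V : zmodType) n (x : (U * V)%type) : (sgnz n x).2 = sgnz n x.2.
Proof. by rewrite !sgnzE; case: ifP. Qed.

Section Twist.
Variable A : cdgRing.
Implicit Types M N P Q T : dgModule A.

(* [Tw t] extends [P], shifted by [a], by [N], shifted by [b], along the closed
   homomorphism [f] of degree [b + 1 - a]: mapping fibres and cones, direct sums
   and the attachment of cells are special cases.  The shifts are given as
   functions so that an unshifted component keeps its index definitionally. *)
Record twist P N := Twist {
  t_i : int;
  t_a : int;
  t_b : int;
  t_sa : int -> int;
  t_sb : int -> int;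
  t_saE : forall k, t_sa k = k + t_a;
  t_sbE : forall k, t_sb k = k + t_b;
  t_iE : t_a + t_i = t_b + 1;
  t_f : hom_deg P N t_i;
  t_cl : hclosed t_f }.

Section Tw.
Variables (P N : dgModule A) (t : twist P N).
Notation i := (t_i t).
Notation a := (t_a t).
Notation b := (t_b t).
Notation sa := (t_sa t).
Notation sb := (t_sb t).
Notation f := (t_f t).

Lemma t_sa_d k l (e : k + 1 = l) : sa k + 1 = sa l.
Proof. by rewrite !t_saE -e addrAC. Qed.

Lemma t_sb_d k l (e : k + 1 = l) : sb k + 1 = sb l.
Proof. by rewrite !t_sbE -e addrAC. Qed.

Lemma t_sf_d k l (e : k + 1 = l) : sa k + i = sb l.
Proof. by rewrite t_saE t_sbE -e -!addrA t_iE [1 + _]addrC. Qed.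

Lemma t_sa_act p k l (e : p + k = l) : p + sa k = sa l.
Proof. by rewrite !t_saE -e addrA. Qed.

Lemma t_sb_act p k l (e : p + k = l) : p + sb k = sb l.
Proof. by rewrite !t_sbE -e addrA. Qed.

Lemma t_par p : a * p + i * p = (b + 1) * p.
Proof. by rewrite -mulrDl t_iE. Qed.

Definition tw_obj (k : int) : zmodType := (P (sa k) * N (sb k))%type.

(** A shift by a multiplies the differential by (-1)^a. The square is zero because f is closed and b
    + i has the parity of a + 1. *)
Definition tw_d k l (e : k + 1 = l) (x : tw_obj k) : tw_obj l :=
  (sgnz a (cx_d (t_sa_d e) x.1),
   sgnz b (cx_d (t_sb_d e) x.2 - hd_fun f (t_sf_d e) x.1)).

Lemma tw_dB k l (e : k + 1 = l) : {morph tw_d e : x y / x - y}.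
Proof.
by move=> x y; congr pair; rewrite /= !cx_dB ?hd_B -?sgnzB // subrACA.
Qed.

Lemma tw_dd j k l (e : j + 1 = k) (e' : k + 1 = l) x : tw_d e' (tw_d e x) = 0.
Proof.
congr pair; rewrite /= cx_d_sgn.
  by rewrite cx_dd !sgnz0.
have c := (hclosedP f).1 (@t_cl _ _ t) _ _ _ _ (t_sf_d e) (t_sb_d e')
  (t_sa_d e) (t_sf_d e') x.1.
rewrite cx_dB cx_dd sub0r c hd_sgn sgnzN -opprD sgnzD.
rewrite -[sgnz a _]opprK -sgnzS (@sgnz_odd _ (a + 1) (b + i)) ?subrr ?oppr0 ?sgnz0 //.
by have := t_iE t; lia.
Qed.

Definition tw_cx : complex := Complex tw_dB tw_dd.

Definition tw_act p k l (e : p + k = l) (c : A p) (x : tw_cx k) : tw_cx l :=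
  (sgnz (a * p) (dm_act (t_sa_act e) c x.1), sgnz (b * p) (dm_act (t_sb_act e) c x.2)).

Definition Tw : dgModule A.
Proof.
apply: (@DgModule A tw_cx tw_act).
- by move=> p j k e c c' x; congr pair; rewrite /= dm_actBl sgnzB.
- by move=> p j k e c x x'; congr pair; rewrite /= dm_actBr sgnzB.
- move=> p j k pj jk l e1 e2 e3 e4 c c' x; congr pair; rewrite /= dm_act_sgn sgnzD.
    rewrite (dm_actA _ _ (t_sa_act e3) (t_sa_act e4)); congr sgnz.
    by rewrite -e1 mulrDr.
  rewrite (dm_actA _ _ (t_sb_act e3) (t_sb_act e4)); congr sgnz.
  by rewrite -e1 mulrDr.
- by move=> j e [x y]; congr pair; rewrite /= mulr0 sgnz0l dm_act1.
- move=> p j k p' j' k' e ep ej ek e1 e2 c x; congr pair.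
    rewrite /= cx_d_sgn (dm_leibniz _ ep (t_sa_d ej) _ (t_sa_act e1) (t_sa_act e2)).
    rewrite sgnz_fst /= dm_act_sgn !sgnzDr !sgnzD.
    by congr (_ + _); apply: sgnz_odd; have := congr1 (GRing.mul (t_a t)) ep; lia.
  rewrite /= cx_d_sgn (dm_leibniz _ ep (t_sb_d ej) _ (t_sb_act e1) (t_sb_act e2)).
  have e3 : p + sb j' = sb k' by apply: t_sb_act.
  rewrite sgnz_snd /= hd_sgn (hd_act f _ _ (t_sf_d ej) (t_sb_act e2)) !dm_act_sgn !dm_actBr.
  rewrite !(sgnzDr, sgnzB, sgnzN, sgnzD) addrA.
  congr (_ + _ - _); apply: sgnz_odd; [by have := congr1 (GRing.mul (t_b t)) ep; lia|by lia|].
  by have := t_par p; lia.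
Defined.

End Tw.

Lemma tw_ses P N (t : twist P N) :
  @is_ses N (Tw t) P (t_sb t) (t_sa t) (t_b t) (t_a t) (t_b t) (t_a t)
    (fun k y => (0, y)) (fun k x => x.1).
Proof.
split.
- exact: t_sbE.
- exact: t_saE.
- by move=> k x y; congr pair; rewrite subr0.
- by [].
- move=> k l e e' y; congr pair; rewrite /= ?cx_d0 ?sgnz0 // hd_0 subr0.
  by rewrite (eq_irrelevance e' (t_sb_d t e)).
- by move=> k l e e' x; rewrite /= sgnzK (eq_irrelevance e' (t_sa_d t e)).
- by move=> k y [].
- by [].
- by move=> k [x y] /= ->; exists y.
- by move=> k z; exists (z, 0).
Qed.

Section Pairing.
Variables (T P N : dgModule A) (t : twist P N) (j ja jb : int).
Hypotheses (ea : ja = j + t_a t) (eb : jb = j + t_b t).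

Lemma tw_pair_a p k : p + j = k -> p + ja = t_sa t k.
Proof. by clear eb; rewrite t_saE ea; lia. Qed.

Lemma tw_pair_b p k : p + j = k -> p + jb = t_sb t k.
Proof. by clear ea; rewrite t_sbE eb; lia. Qed.

Definition tw_pair (F : hom_deg T P ja) (G : hom_deg T N jb) : hom_deg T (Tw t) j.
Proof.
apply: (@HomDeg A T (Tw t) j (fun p k e x =>
  (hd_fun F (tw_pair_a e) x, hd_fun G (tw_pair_b e) x) : Tw t k)).
- by move=> p k e x y; congr pair; rewrite hd_B.
- move=> p q pq k l e e1 e2 e3 c x; rewrite sgnzE.
  rewrite (hd_act F e _ (tw_pair_a e2) (t_sa_act t e3)).
  rewrite (hd_act G e _ (tw_pair_b e2) (t_sb_act t e3)).
  transitivity (sgnz (j * p) (sgnz (t_a t * p) (dm_act (t_sa_act t e3) c (hd_fun F (tw_pair_a e2) x))),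
     sgnz (j * p) (sgnz (t_b t * p) (dm_act (t_sb_act t e3) c (hd_fun G (tw_pair_b e2) x)))).
    congr pair; rewrite sgnzD; congr sgnz.
      by rewrite [in LHS]ea mulrDl.
    by rewrite [in LHS]eb mulrDl.
  by rewrite !(sgnzE (j * p)); case: ifP.
Defined.

Lemma tw_fst_subproof p k : p + ja = k -> t_sa t (p + j) = k.
Proof. by clear eb; rewrite t_saE ea; lia. Qed.

Lemma tw_snd_subproof p k : p + jb = k -> t_sb t (p + j) = k.
Proof. by clear ea; rewrite t_sbE eb; lia. Qed.

Definition tw_fst (F : hom_deg T (Tw t) j) : hom_deg T P ja.
Proof.
apply: (@HomDeg A T P ja (fun p k e x =>
  tr (tw_fst_subproof e) (hd_fun F (erefl (p + j)) x).1)).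
- by move=> p k e x y; rewrite hd_B -trB.
- move=> p q pq k l e e1 e2 e3 c x.
  have e4 : p + (q + j) = pq + j by lia.
  rewrite (hd_act F e erefl erefl e4) sgnz_fst /= tr_sgn tr_sgn sgnzD tr_act act_tr.
  rewrite -mulrDl -ea; congr sgnz; congr dm_act; exact: eq_irrelevance.
Defined.

Definition tw_snd (F : hom_deg T (Tw t) j) : hom_deg T N jb.
Proof.
apply: (@HomDeg A T N jb (fun p k e x =>
  tr (tw_snd_subproof e) (hd_fun F (erefl (p + j)) x).2)).
- by move=> p k e x y; rewrite hd_B -trB.
- move=> p q pq k l e e1 e2 e3 c x.
  have e4 : p + (q + j) = pq + j by lia.
  rewrite (hd_act F e erefl erefl e4) sgnz_snd /= tr_sgn tr_sgn sgnzD tr_act act_tr.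
  rewrite -mulrDl -eb; congr sgnz; congr dm_act; exact: eq_irrelevance.
Defined.

Lemma tw_pair_fst F G : tw_fst (tw_pair F G) = F.
Proof.
apply: hom_deg_eq => p k e x; rewrite /= tr_hd.
by congr hd_fun; apply: eq_irrelevance.
Qed.

Lemma tw_pair_snd F G : tw_snd (tw_pair F G) = G.
Proof.
apply: hom_deg_eq => p k e x; rewrite /= tr_hd.
by congr hd_fun; apply: eq_irrelevance.
Qed.

Lemma tw_pair_eta F : tw_pair (tw_fst F) (tw_snd F) = F.
Proof.
apply: hom_deg_eq => p k e x; rewrite /=; subst k; rewrite !tr_id.
by case: (hd_fun F erefl x).
Qed.

End Pairing.

(** Consequently a pair (F, G) is closed exactly when F is closed and G is a primitive of f F: a map
    to a fibre is a map together with a null homotopy. *)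
Lemma tw_pair_d T P N (t : twist P N) j ja jb (ea : ja = j + t_a t) (eb : jb = j + t_b t)
    j' ja' jb' (ea' : ja' = j' + t_a t) (eb' : jb' = j' + t_b t)
    (e : j + 1 = j') (e1 : ja + 1 = ja') (e2 : jb + 1 = jb') (e3 : ja + t_i t = jb')
    (F : hom_deg T P ja) (G : hom_deg T N jb) :
  hd_d e (tw_pair ea eb F G) = tw_pair ea' eb' (sgnz (t_a t) (hd_d e1 F))
    (sgnz (t_b t) (hd_d e2 G - hcomp e3 (t_f t) F)).
Proof.
apply: hom_deg_eq => p k e' x.
have e4 : p + j + 1 = k by lia.
have e5 : p + 1 + j = k by lia.
rewrite (hd_dE _ _ _ erefl e4 erefl e5) [in LHS]/=.
rewrite [X in _ - X](_ : _ = (sgnz j (hd_fun F (tw_pair_a ea e5) (cx_d erefl x)),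
   sgnz j (hd_fun G (tw_pair_b eb e5) (cx_d erefl x)))); last by rewrite !sgnzE; case: ifP.
rewrite [RHS]/=; congr pair; rewrite hd_fun_sgnz.
  have e6 : p + ja + 1 = t_sa t k by rewrite t_saE; lia.
  rewrite (hd_dE e1 F _ (tw_pair_a ea erefl) (t_sa_d t e4) erefl (tw_pair_a ea e5)).
  rewrite sgnzB sgnzD [in LHS]/= ; congr (_ - _); rewrite /=; apply: sgnz_odd.
  by clear -ea; lia.
rewrite hd_funB (hd_dE e2 G _ (tw_pair_b eb erefl) (t_sb_d t e4) erefl (tw_pair_b eb e5)).
rewrite (hcompE _ _ _ _ (tw_pair_a ea erefl) (t_sf_d t e4)).
rewrite !(sgnzB, sgnzD) /= sgnzB addrAC; congr (_ - _ - _).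
by apply: sgnz_odd; clear -eb; lia.
Qed.

Section Copairing.
Variables (P N Q : dgModule A) (t : twist P N) (j ja jb : int).
Hypotheses (ea : ja + t_a t = j) (eb : jb + t_b t = j).

Lemma tw_copair_a p k : p + j = k -> t_sa t p + ja = k.
Proof. by clear eb; rewrite t_saE; lia. Qed.

Lemma tw_copair_b p k : p + j = k -> t_sb t p + jb = k.
Proof. by clear ea; rewrite t_sbE; lia. Qed.

Definition tw_copair (F : hom_deg P Q ja) (G : hom_deg N Q jb) : hom_deg (Tw t) Q j.
Proof.
apply: (@HomDeg A (Tw t) Q j (fun p k e (x : Tw t p) =>
  hd_fun F (tw_copair_a e) x.1 + hd_fun G (tw_copair_b e) x.2)).
- by move=> p k e x y; rewrite /= !hd_B opprD addrACA.
- move=> p q pq k l e e1 e2 e3 c x; rewrite /= !hd_sgn.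
  rewrite (hd_act F _ _ (tw_copair_a e2) e3) (hd_act G _ _ (tw_copair_b e2) e3).
  rewrite !sgnzD -!mulrDl [t_a t + _]addrC [t_b t + _]addrC ea eb dm_actDr.
  by rewrite sgnzDr.
Defined.

Lemma tw_cofst_subproof p k : p + ja = k -> p - t_a t + j = k.
Proof. by clear eb; lia. Qed.

Lemma tw_cosnd_subproof p k : p + jb = k -> p - t_b t + j = k.
Proof. by clear ea; lia. Qed.

Lemma tw_cofst_tr p : p = t_sa t (p - t_a t).
Proof. by rewrite t_saE subrK. Qed.

Lemma tw_cosnd_tr p : p = t_sb t (p - t_b t).
Proof. by rewrite t_sbE subrK. Qed.

Definition tw_cofst (F : hom_deg (Tw t) Q j) : hom_deg P Q ja.
Proof.
apply: (@HomDeg A P Q ja (fun p k e x =>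
  hd_fun F (tw_cofst_subproof e) ((tr (tw_cofst_tr p) x, 0) : Tw t _))).
- move=> p k e x y; rewrite -hd_B; congr hd_fun; congr pair.
    exact: trB.
  by rewrite subr0.
- move=> p q pq k l e e1 e2 e3 c x.
  have e4 : p + (q - t_a t) = pq - t_a t by lia.
  have := hd_act F e4 (tw_cofst_subproof e1) (tw_cofst_subproof e2) e3 c
     ((tr (tw_cofst_tr q) x, 0) : Tw t _).
  set y := dm_act e4 _ _; have -> : y = sgnz (t_a t * p) ((tr (tw_cofst_tr pq) (dm_act e c x), 0) : Tw t _).
    rewrite /y /= /tw_act sgnz_pair /= dm_act0r !sgnz0 act_tr tr_act.
    by congr ((sgnz _ (dm_act _ _ _)), 0); apply: eq_irrelevance.
  rewrite hd_sgn => h; apply: (can_inj (@sgnzK _ (t_a t * p))).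
  by rewrite h sgnzD -mulrDl [t_a t + ja]addrC [in RHS]ea.
Defined.

Definition tw_cosnd (F : hom_deg (Tw t) Q j) : hom_deg N Q jb.
Proof.
apply: (@HomDeg A N Q jb (fun p k e x =>
  hd_fun F (tw_cosnd_subproof e) ((0, tr (tw_cosnd_tr p) x) : Tw t _))).
- move=> p k e x y; rewrite -hd_B; congr hd_fun; congr pair.
    by rewrite subr0.
  exact: trB.
- move=> p q pq k l e e1 e2 e3 c x.
  have e4 : p + (q - t_b t) = pq - t_b t by lia.
  have := hd_act F e4 (tw_cosnd_subproof e1) (tw_cosnd_subproof e2) e3 c
     ((0, tr (tw_cosnd_tr q) x) : Tw t _).
  set y := dm_act e4 _ _; have -> : y = sgnz (t_b t * p) ((0, tr (tw_cosnd_tr pq) (dm_act e c x)) : Tw t _).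
    rewrite /y /= /tw_act sgnz_pair /= dm_act0r !sgnz0 act_tr tr_act.
    by congr (0, (sgnz _ (dm_act _ _ _))); apply: eq_irrelevance.
  rewrite hd_sgn => h; apply: (can_inj (@sgnzK _ (t_b t * p))).
  by rewrite h sgnzD -mulrDl [t_b t + jb]addrC [in RHS]eb.
Defined.

Lemma tw_copair_fst F G : tw_cofst (tw_copair F G) = F.
Proof.
apply: hom_deg_eq => p k e x; rewrite /= hd_0 addr0 hd_tr.
by congr hd_fun; apply: eq_irrelevance.
Qed.

Lemma tw_copair_snd F G : tw_cosnd (tw_copair F G) = G.
Proof.
apply: hom_deg_eq => p k e x; rewrite /= hd_0 add0r hd_tr.
by congr hd_fun; apply: eq_irrelevance.
Qed.

Lemma tw_copair_eta F : tw_copair (tw_cofst F) (tw_cosnd F) = F.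
Proof.
apply: hom_deg_eq => p k e [x y] /=.
have h q (e1 : q = p) (e' : q + j = k) x' y' : hd_fun F e' ((x', y') : Tw t q) =
   hd_fun F e ((tr (congr1 (t_sa t) e1) x', tr (congr1 (t_sb t) e1) y') : Tw t p).
  by subst q; rewrite (eq_irrelevance e e').
have e1 : t_sa t p - t_a t = p by rewrite t_saE addrK.
have e2 : t_sb t p - t_b t = p by rewrite t_sbE addrK.
rewrite (h _ e1) (h _ e2) !tr_tr !tr0 !tr_id -hd_D; congr hd_fun.
by congr pair; rewrite ?addr0 ?add0r.
Qed.

End Copairing.

(** Dually, a copair (F, G) is closed exactly when G is closed and F is, up to sign, a primitive of
    G f. *)
Lemma tw_copair_d P N Q (t : twist P N) j ja jb (ea : ja + t_a t = j) (eb : jb + t_b t = j)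
    j' ja' jb' (ea' : ja' + t_a t = j') (eb' : jb' + t_b t = j')
    (e : j + 1 = j') (e1 : ja + 1 = ja') (e2 : jb + 1 = jb') (e3 : t_i t + jb = ja')
    (F : hom_deg P Q ja) (G : hom_deg N Q jb) :
  hd_d e (tw_copair ea eb F G) =
    tw_copair ea' eb' (hd_d e1 F + sgnz (j + t_b t) (hcomp e3 G (t_f t))) (hd_d e2 G).
Proof.
apply: hom_deg_eq => p k e' x.
have e4 : p + j + 1 = k by lia.
have e5 : p + 1 + j = k by lia.
rewrite (hd_dE _ _ _ erefl e4 erefl e5).
rewrite -[RHS]/(hd_fun (hd_d e1 F + sgnz (j + t_b t) (hcomp e3 G (t_f t)))
  (tw_copair_a ea' e') x.1 + hd_fun (hd_d e2 G) (tw_copair_b eb' e') x.2).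
rewrite hd_funD hd_fun_sgnz (hd_dE e1 F _ (tw_copair_a ea erefl) e4 (t_sa_d t erefl) (tw_copair_a ea e5)).
rewrite (hd_dE e2 G _ (tw_copair_b eb erefl) e4 (t_sb_d t erefl) (tw_copair_b eb e5)).
rewrite (hcompE _ _ _ _ (t_sf_d t erefl) (tw_copair_b eb e5)).
rewrite /= cx_dD !hd_sgn hd_B !(sgnzDr, sgnzB, sgnzD).
rewrite (@sgnz_odd _ (j + t_a t) ja (hd_fun F _ (cx_d _ _))); last by clear -ea; lia.
rewrite (@sgnz_odd _ (j + t_b t) jb (hd_fun G _ (cx_d _ _))); last by clear -eb; lia.
rewrite sgnzN !opprD opprK; set c := - sgnz ja _; set d := - sgnz jb _; set g := sgnz _ _.
by rewrite [d + g]addrC (addrA c) addrACA (addrA _ c g).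
Qed.

End Twist.

(** * K-projective modules *)

Section KProjective.
Variable A : cdgRing.
Implicit Types M N P Q T : dgModule A.

Definition hqis M N i (f : hom_deg M N i) : Prop := forall j k (e : j + i = k),
  (forall x : M j, cocyc x -> bdry (hd_fun f e x) -> bdry x) /\
  (forall y : N k, cocyc y -> exists2 x : M j, cocyc x & bdry (y - hd_fun f e x)).

Lemma hm_hqis M N (u : dgHom M N) : hqis (hm u) <-> is_qis u.
Proof.
rewrite is_qisE; split=> h.
  move=> i; have [h1 h2] := h i i (addr0 i); split=> [x cx|y cy].
    by move: (h1 x cx); rewrite hmE.
  by have [x cx] := h2 y cy; rewrite hmE; exists x.
move=> j k e; have ej := hd_add0 e; case: k / ej e => e.
have [h1 h2] := h j; split=> [x cx|y cy]; first by rewrite hmE; exact: h1.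
by have [x cx] := h2 y cy; exists x => //; rewrite hmE.
Qed.

Lemma hd_closed M N i (f : hom_deg M N i) j k (e : j + i = k) x :
  hclosed f -> cocyc x -> cocyc (hd_fun f e x).
Proof.
move=> /hclosedP cf cx; have e' : j + 1 + i = k + 1 by lia.
by rewrite /cocyc (cf _ _ _ _ e erefl erefl e') [cx_d _ x]cx hd_0 sgnz0.
Qed.

Lemma hd_bdry M N i (f : hom_deg M N i) j k (e : j + i = k) x :
  hclosed f -> bdry x -> bdry (hd_fun f e x).
Proof.
move=> /hclosedP cf /(bdryE (subrK 1 j))[y <-].
have e1 : j - 1 + i = k - 1 by lia.
apply/(bdry_sgn i); rewrite -(cf _ _ _ _ e1 (subrK 1 k) (subrK 1 j) e).
exact: bdry_d.
Qed.

Lemma hbdry_val M N i (f : hom_deg M N i) j k (e : j + i = k) x :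
  hbdry f -> cocyc x -> bdry (hd_fun f e x).
Proof.
move=> /(hbdryE (subrK 1 i))[h <-] cx.
have e1 : j + (i - 1) = k - 1 by lia.
have e2 : j + 1 + (i - 1) = k by lia.
rewrite (hd_dE _ _ _ e1 (subrK 1 k) (erefl (j + 1)) e2) [cx_d _ x]cx hd_0 sgnz0 subr0.
exact: bdry_d.
Qed.

(** Up to sign f induces the connecting map of [tw_ses]; the proof solves for the two components of
    a primitive directly. *)
Lemma hqis_tw P N (t : twist P N) : hqis (t_f t) <-> acyclic (Tw t).
Proof.
have par := t_iE t; split=> [q|/acyclicE ac].
  apply/acyclicE => k [x y] cxy.
  have := congr1 fst cxy; have := congr1 snd cxy; rewrite /= => /sgnz_inj h2 /sgnz_inj h1.
  have cx : cocyc x by apply/(closedE (t_sa_d t (erefl (k + 1)))).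
  have dy : cx_d (t_sb_d t (erefl (k + 1))) y = hd_fun (t_f t) (t_sf_d t (erefl (k + 1))) x.
    by apply/eqP; rewrite -subr_eq0 h2.
  have ek : k - 1 + 1 = k := subrK 1 k.
  have [qi _] := q _ _ (t_sf_d t (erefl (k + 1))).
  have [_ qs] := q _ _ (t_sf_d t ek).
  have /(bdryE (t_sa_d t ek))[x' dx'] : bdry x by apply: qi => //; rewrite -dy; exact: bdry_d.
  have c : cocyc (y - sgnz (t_i t) (hd_fun (t_f t) (t_sf_d t ek) x')).
    apply/(closedE (t_sb_d t (erefl (k + 1)))); rewrite cx_dB cx_d_sgn dy.
    rewrite ((hclosedP _).1 (@t_cl _ _ _ t) _ _ _ _ (t_sf_d t ek) _ (t_sa_d t ek)
      (t_sf_d t (erefl _))).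
    by rewrite sgnzK dx' subrr.
  have [z cz /(bdryE (t_sb_d t ek))[w dw]] := qs _ c.
  apply/(bdryE ek).
  exists (sgnz (t_a t) x' - sgnz (t_b t) z, sgnz (t_b t) w).
  congr pair.
    by rewrite /= cx_dB !cx_d_sgn dx' ((closedE _ _).1 cz) sgnz0 subr0 sgnzK.
  rewrite /= cx_d_sgn hd_B !hd_sgn dw !(sgnzB, sgnzD) !sgnz_even opprB addrA subrK.
  rewrite addrAC -addrA; set F := hd_fun _ _ _.
  rewrite (@sgnz_odd _ (t_b t + t_a t) (t_i t + 1)); last by lia.
  rewrite (@sgnz_odd _ (t_b t + t_b t + t_i t) (t_i t)); last by lia.
  by rewrite sgnzS opprK subrr addr0.
move=> j k e.
have [l el] : exists l, t_sa t l = j by exists (j - t_a t); rewrite t_saE subrK.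
have el' : t_sb t (l + 1) = k by rewrite t_sbE -e -el t_saE; lia.
case: j / el e => e; case: k / el' e => e.
rewrite {}(eq_irrelevance e (t_sf_d t (erefl (l + 1)))).
split=> [x cx|y cy].
  move=> /(bdryE (t_sb_d t (erefl (l + 1))))[y dy].
  have /ac/(bdryE (subrK 1 l))[[u w]] : cocyc ((x, y) : Tw t l).
    by congr pair; rewrite /= ?((closedE _ _).1 cx) ?sgnz0 // dy subrr sgnz0.
  by move/(congr1 fst) => /= <-; rewrite -cx_d_sgn; exact: bdry_d.
have /ac/(bdryE (erefl (l + 1)))[[u w]] : cocyc ((0, y) : Tw t (l + 1)).
  by congr pair; rewrite /= ?cx_d0 ?sgnz0 // ((closedE _ _).1 cy) hd_0 subrr sgnz0.
move=> h; have := congr1 fst h; have := congr1 snd h => /= <- /sgnz_inj du.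
exists (- sgnz (t_b t) u).
  by apply: closedN; apply: closed_sgn; apply/(closedE (t_sa_d t (erefl (l + 1)))).
by rewrite hd_N hd_sgn sgnzB opprK subrK -cx_d_sgn; exact: bdry_d.
Qed.

Lemma KprojE P : K_projective P <-> forall N, acyclic N -> forall i, hvan P N i.
Proof. by split=> h N aN; [exact/acyclicE/h|apply/acyclicE/h]. Qed.

Lemma hom_tw_ses P N Q (t : twist P N) :
  @is_ses (HomDG P Q) (HomDG (Tw t) Q) (HomDG N Q)
    (fun k => k - t_a t) (fun k => k - t_b t) 0 0 (- t_a t) (- t_b t)
    (fun k F => tw_copair (subrK _ k) (subrK _ k) F 0)
    (fun k F => tw_cosnd (subrK _ k) (subrK _ k) F).
Proof.
split=> //.
- by move=> k F G; apply: hom_deg_eq => p q e x /=; rewrite !addr0.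
- by move=> k F G; apply: hom_deg_eq.
- move=> k l e e' F; rewrite sgnz0l.
  have e2 : k - t_b t + 1 = l - t_b t by lia.
  have e3 : t_i t + (k - t_b t) = l - t_a t by have := t_iE t; lia.
  apply: etrans (tw_copair_d _ _ (subrK _ l) (subrK _ l) e e' e2 e3 _ _) _.
  congr (tw_copair _ _ _ _).
    by apply: hom_deg_eq => p q e4 x; rewrite hd_funD hd_fun_sgnz /= sgnz0 addr0.
  by apply: hom_deg_eq => p q e4 x /=; rewrite cx_d0 sgnz0 subr0.
- move=> k l e e' F; rewrite sgnz0l.
  have e2 : k - t_a t + 1 = l - t_a t by lia.
  have e3 : t_i t + (k - t_b t) = l - t_a t by have := t_iE t; lia.
  rewrite -[in RHS](tw_copair_eta (subrK _ k) (subrK _ k) F).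
  rewrite [cx_d e _](tw_copair_d _ _ (subrK _ l) (subrK _ l) e e2 e' e3).
  by rewrite tw_copair_snd.
- by move=> k F /(congr1 (tw_cofst (subrK _ k) (subrK _ k))); rewrite tw_copair_fst => ->;
    apply: hom_deg_eq.
- by move=> k F; rewrite tw_copair_snd.
- move=> k F F0; exists (tw_cofst (subrK _ k) (subrK _ k) F).
  by rewrite -[LHS](tw_copair_eta (subrK _ k) (subrK _ k)) F0.
- by move=> k G; exists (tw_copair (subrK _ k) (subrK _ k) 0 G); rewrite tw_copair_snd.
Qed.

Lemma Kproj_tw P N (t : twist P N) :
  K_projective P -> K_projective N -> K_projective (Tw t).
Proof.
move=> /KprojE hP /KprojE hN; apply/KprojE => Q aQ k.
by apply: (ses_van_mid (hom_tw_ses Q t)); [exact: hP|exact: hN].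
Qed.

(** The mapping fibre, normalised so that the projection to M involves no shift and is a DG
    homomorphism ([fib_pr]). *)
Definition fib M N i (f : hom_deg M N i) (cf : hclosed f) : twist M N :=
  @Twist A M N i 0 (i - 1) id (fun k => k + (i - 1))
    (fun k => esym (addr0 k)) (fun k => erefl)
    (etrans (add0r i) (esym (subrK 1 i))) f cf.

(** A primitive h of s u makes (u, h) a cocycle with values in the acyclic fibre of s. The first
    component of a primitive of this pair is a primitive of u. *)
Lemma Kproj_inj T N N' i (s : hom_deg N N' i) : K_projective T -> hclosed s -> hqis s ->
  forall j k (e : j + i = k) (u : hom_deg T N j),
  hclosed u -> hbdry (hcomp e s u) -> hbdry u.
Proof.
move=> /KprojE KT cs qs j k e u cu /(hbdryE (subrK 1 k))[h dh].
pose t := fib cs; have /(KT _) {}KT : acyclic (Tw t) by apply/hqis_tw.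
have ea : j = j + t_a t by rewrite addr0.
have eb : k - 1 = j + t_b t by rewrite /=; lia.
have ea' : j + 1 = j + 1 + t_a t by rewrite addr0.
have eb' : k = j + 1 + t_b t by rewrite /=; lia.
have /KT/(hbdryE (subrK 1 j))[G dG] : hclosed (tw_pair ea eb u h).
  rewrite /hclosed /cocyc /= (tw_pair_d ea eb ea' eb' erefl erefl (subrK 1 k) e).
  rewrite dh subrr [hd_d _ u]cu !sgnz0.
  by apply: hom_deg_eq.
have ea2 : j - 1 = j - 1 + t_a t by rewrite addr0.
have eb2 : k - 1 - 1 = j - 1 + t_b t by rewrite /=; lia.
have e3 : j - 1 + t_i t = k - 1 by rewrite /=; lia.
apply/(hbdryE (subrK 1 j)); exists (tw_fst ea2 eb2 G).
have := congr1 (tw_fst ea eb) dG; rewrite tw_pair_fst => <-.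
rewrite -[in RHS](tw_pair_eta ea2 eb2 G).
rewrite (tw_pair_d ea2 eb2 ea eb (subrK 1 j) (subrK 1 j) (subrK 1 (k - 1)) e3).
by rewrite tw_pair_fst sgnz0l.
Qed.

(** The pair (0, v) is a cocycle with values in the acyclic fibre of s. Up to sign, a primitive of
    it consists of a lift of v and the homotopy between v and the image of the lift. *)
Lemma Kproj_lift T N N' i (s : hom_deg N N' i) : K_projective T -> hclosed s -> hqis s ->
  forall j k (e : j + i = k) (v : hom_deg T N' k), hclosed v ->
  exists2 u : hom_deg T N j, hclosed u & hbdry (v - hcomp e s u).
Proof.
move=> /KprojE KT cs qs j k e v cv.
pose t := fib cs; have /(KT _) {}KT : acyclic (Tw t) by apply/hqis_tw.
have ea : j + 1 = j + 1 + t_a t by rewrite addr0.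
have eb : k = j + 1 + t_b t by rewrite /=; lia.
have ea' : j + 1 + 1 = j + 1 + 1 + t_a t by rewrite addr0.
have eb' : k + 1 = j + 1 + 1 + t_b t by rewrite /=; lia.
have e3 : j + 1 + t_i t = k + 1 by rewrite /=; lia.
have /KT/(hbdryE (erefl (j + 1)))[G dG] : hclosed (tw_pair ea eb 0 v).
  rewrite /hclosed /cocyc /= (tw_pair_d ea eb ea' eb' erefl erefl erefl e3).
  rewrite [hd_d _ v]cv hcomp0r subrr [hd_d _ 0](@cx_d0 (HomDG T N)) !sgnz0.
  by apply: hom_deg_eq.
have ea2 : j = j + t_a t by rewrite addr0.
have eb2 : k - 1 = j + t_b t by rewrite /=; lia.
move: dG; rewrite -(tw_pair_eta ea2 eb2 G).
rewrite (tw_pair_d ea2 eb2 ea eb erefl erefl (subrK 1 k) e) => dG.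
have := congr1 (tw_fst ea eb) dG; have := congr1 (tw_snd ea eb) dG.
rewrite !tw_pair_fst !tw_pair_snd => hv /sgnz_inj du.
exists (- sgnz (t_b t) (tw_fst ea2 eb2 G)).
  apply: (@closedN (HomDG T N)); apply: (@closed_sgn (HomDG T N)); exact: du.
have -> : v - hcomp e s (- sgnz (t_b t) (tw_fst ea2 eb2 G)) =
    sgnz (t_b t) (hd_d (subrK 1 k) (tw_snd ea2 eb2 G)).
  rewrite -hv sgnzB.
  have -> : hcomp e s (- sgnz (t_b t) (tw_fst ea2 eb2 G)) =
      - sgnz (t_b t) (hcomp e s (tw_fst ea2 eb2 G)).
    apply: hom_deg_eq => p q e' x.
    by rewrite hd_funN hd_fun_sgnz /= hd_fun_sgnz hd_N hd_sgn.
  by rewrite opprK subrK.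
apply: (@bdry_sgn (HomDG T N') k (t_b t) _).1; exact: (@bdry_d (HomDG T N')).
Qed.

Lemma hbdryD M N i (f g : hom_deg M N i) : hbdry f -> hbdry g -> hbdry (f + g).
Proof. exact: (@bdryD (HomDG M N)). Qed.

Lemma hbdryN M N i (f : hom_deg M N i) : hbdry f -> hbdry (- f).
Proof. exact: (@bdryN (HomDG M N)). Qed.

Lemma hbdry_sub M N i (f g : hom_deg M N i) : hbdry (f - g) -> (hbdry f <-> hbdry g).
Proof. exact: (@bdry_sub (HomDG M N)). Qed.

Lemma hbdry_subC M N i (f g : hom_deg M N i) : hbdry (f - g) -> hbdry (g - f).
Proof. by move/hbdryN; rewrite opprB. Qed.

Lemma hbdry_subT M N i (f g h : hom_deg M N i) :
  hbdry (f - g) -> hbdry (g - h) -> hbdry (f - h).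
Proof. by move=> a b; have := hbdryD a b; rewrite addrA subrK. Qed.

Lemma hvan_post T M N (u : dgHom M N) j : K_projective T -> is_qis u ->
  hvan T M j <-> hvan T N j.
Proof.
move=> KT /hm_hqis qu; have cu := hm_closed u; have e : j + 0 = j := addr0 j.
split=> v f cf.
  have [g cg bg] := Kproj_lift KT cu qu e cf.
  by apply/(hbdry_sub bg); apply: hbdry_compr cu (v g cg).
apply: (Kproj_inj KT cu qu (e := e) cf).
by apply: v; exact: hclosed_comp.
Qed.

Lemma hclosed_sub M N i (f g : hom_deg M N i) : hclosed g -> hbdry (f - g) -> hclosed f.
Proof.
move=> cg /(@bdry_closed (HomDG M N)) c; rewrite -(subrK g f).
exact: (@closedD (HomDG M N)).
Qed.

Lemma dgh_lift T M N (s : dgHom M N) (v : dgHom T N) : K_projective T -> is_qis s ->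
  exists u : dgHom T M, hbdry (hm v - hm (dg_comp s u)).
Proof.
move=> KT /hm_hqis qs.
have [u cu b] := Kproj_lift KT (hm_closed s) qs (addr0 0) (hm_closed v).
by exists (dgh cu); rewrite (hm_comp _ _ (addr0 0)) hm_dgh.
Qed.

(** With comparison maps a : P' -> P and b : P -> P' over M, the composite b a is homotopic to the
    identity, so f is f b a up to a boundary, and f b is a boundary by hypothesis. *)
Lemma Kproj_unique M P P' Q (p : dgHom P M) (p' : dgHom P' M) j :
  K_projective P -> K_projective P' -> is_qis p -> is_qis p' ->
  hvan P Q j -> hvan P' Q j.
Proof.
move=> KP KP' qp qp' v f cf.
have [a ha] := dgh_lift p' KP' qp; have [b hb] := dgh_lift p KP qp'.
have e0 : 0 + 0 = 0 :> int := addr0 0.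
have e : 0 + j = j := add0r j.
have hba : hbdry (hm (dg_id P') - hm (dg_comp b a)).
  apply: (Kproj_inj KP' (hm_closed p') ((hm_hqis p').2 qp') (e := e0)).
    exact: hclosedB (hm_closed _) (hm_closed _).
  rewrite hcompBr -!hm_comp.
  apply: (hbdry_subT (g := hm (dg_comp p a))).
    have -> : dg_comp p' (dg_id P') = p' by apply: dgHom_eq.
    exact: ha.
  have -> : dg_comp p' (dg_comp b a) = dg_comp (dg_comp p' b) a by apply: dgHom_eq.
  rewrite !(hm_comp _ _ e0) -hcompBl.
  by apply: hbdry_compl (hm_closed _); rewrite -hm_comp.
have e' : 0 + j = j := add0r j.
have /v hfb : hclosed (hcomp e f (hm b)) by apply: hclosed_comp (hm_closed _).
have := hbdry_compl e hfb (hm_closed a).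
have := hbdry_compr e cf hba.
rewrite hcompBr hm_id_r (hm_comp _ _ e0) (hcompA e0 e e e).
by move=> h1 h2; apply/(hbdry_sub h1).
Qed.

End KProjective.

(** * Truncation *)

Record subdg (A : cdgRing) (M : dgModule A) := SubDg {
  sd_P :> forall k, M k -> Prop;
  sd_0 : forall k, sd_P (0 : M k);
  sd_B : forall k (x y : M k), sd_P x -> sd_P y -> sd_P (x - y);
  sd_d : forall k l (e : k + 1 = l) (x : M k), sd_P x -> sd_P (cx_d e x);
  sd_act : forall i k l (e : i + k = l) (a : A i) (x : M k), sd_P x -> sd_P (dm_act e a x) }.

Section SubModule.
Variables (A : cdgRing) (M : dgModule A) (S : subdg M).

Section Degree.
Variable k : int.

Definition sub_pred : {pred M k} := fun x => `[< S k x >].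

Lemma sub_pred_closed : zmod_closed sub_pred.
Proof.
split=> [|x y /asboolP Sx /asboolP Sy]; apply/asboolP; first exact: sd_0.
exact: sd_B.
Qed.

HB.instance Definition _ := GRing.isZmodClosed.Build (M k) sub_pred sub_pred_closed.

Record sub_obj := SubObj { sub_val :> M k; sub_valP : sub_pred sub_val }.

HB.instance Definition _ := [isSub for sub_val].
HB.instance Definition _ := [Choice of sub_obj by <:].
HB.instance Definition _ := [SubChoice_isSubZmodule of sub_obj by <:].

End Degree.

Definition mksub k (x : M k) (Sx : S k x) : sub_obj k := SubObj (introT (asboolP _) Sx).

Lemma subP k (x : sub_obj k) : S k (sub_val x).
Proof. exact/asboolP/sub_valP. Qed.

Definition SubDG : dgModule A.
Proof.
unshelve refine (@DgModule A (@Complex sub_obj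
  (fun k l e x => mksub (sd_d e (subP x))) _ _)
  (fun i k l e a x => mksub (sd_act e a (subP x))) _ _ _ _ _).
- by move=> k l e x y; apply: val_inj; rewrite /= cx_dB.
- by move=> j k l e e' x; apply: val_inj; rewrite /= cx_dd.
- by move=> i j k e a a' m; apply: val_inj; rewrite /= dm_actBl.
- by move=> i j k e a m m'; apply: val_inj; rewrite /= dm_actBr.
- by move=> i j k ij jk l e1 e2 e3 e4 a b m; apply: val_inj; rewrite /= (dm_actA _ _ e3 e4).
- by move=> i e m; apply: val_inj; rewrite /= dm_act1.
- move=> i j k i' j' k' e ei ej ek e1 e2 a m; apply: val_inj.
  rewrite raddfD /= (dm_leibniz _ ei ej _ e1 e2); congr (_ + _).
  by rewrite !sgnzE; case: ifP.
Defined.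

Definition sub_inc : dgHom SubDG M.
Proof. by apply: (@DgHom A SubDG M (@CxMap SubDG M (fun k x => sub_val x) _ _)). Defined.

Lemma sub_closed k (x : SubDG k) : cocyc x <-> cocyc (sub_val x).
Proof. by split=> [/(congr1 val) //|h]; apply: val_inj. Qed.

Definition sub_fact T i (f : hom_deg T M i)
  (h : forall j k (e : j + i = k) x, S k (hd_fun f e x)) : hom_deg T SubDG i.
Proof.
apply: (@HomDeg A T SubDG i (fun j k e x => mksub (h j k e x))).
- by move=> j k e x y; apply: val_inj; rewrite /= hd_B.
- move=> p j pj k l e e1 e2 e3 a m; apply: val_inj; rewrite /= (hd_act f e e1 e2 e3).
  by rewrite !sgnzE; case: ifP.
Defined.

Lemma sub_factK T i (f : hom_deg T M i) h (e : i + 0 = i) :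
  hcomp e (hm sub_inc) (@sub_fact T i f h) = f.
Proof.
apply: hom_deg_eq => p q e' x /=; rewrite tr_hd.
by congr hd_fun; apply: eq_irrelevance.
Qed.

Lemma sub_fact_closed T i (f : hom_deg T M i) h : hclosed f -> hclosed (@sub_fact T i f h).
Proof.
move=> /hclosedP cf; apply/hclosedP => j k l j' e1 e2 e3 e4 x; apply: val_inj => /=.
rewrite (cf _ _ _ _ e1 e2 e3 e4).
by rewrite !sgnzE; case: ifP.
Qed.

End SubModule.

Section Truncation.
Variables (A : cdgRing) (M : dgModule A) (n : int).
Implicit Type T : dgModule A.

Lemma A_nonpos i (a : A i) : a = 0 \/ i <= 0.
Proof. by case: (lerP i 0) => h; [right|left; exact: cr_nonpos]. Qed.

(** The condition is stable under [A] because [A] lives in degrees <= 0: elements of negative degree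
    lower the degree, and those of degree 0 are cocycles. *)
Definition trunc_le_P k (x : M k) : Prop := [/\ n < k -> x = 0 & k = n -> cocyc x].

Definition trunc_le : subdg M.
Proof.
apply: (@SubDg A M trunc_le_P).
- by move=> k; split=> // _; exact: closed0.
- move=> k x y [x0 cx] [y0 cy]; split=> [h|h]; first by rewrite x0 // y0 // subr0.
  by apply: closedB; auto.
- move=> k l e x [x0 cx]; split=> [h|h]; last exact: closed_d.
  have [kn|kn] : k = n \/ n < k by lia.
    by apply/(closedE e); auto.
  by rewrite x0 // cx_d0.
- move=> i k l e a x [x0 cx]; case: (A_nonpos a) => [->|i0].
    by rewrite dm_act0l; split=> // _; exact: closed0.
  split=> h; first by rewrite x0 ?dm_act0r //; lia.
  have [i0'|i0'] : i = 0 \/ i < 0 by lia.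
    subst i; have ck : cocyc x by apply: cx; lia.
    have e1 : 0 + 1 + k = l + 1 by lia.
    have e2 : 0 + (k + 1) = l + 1 by lia.
    rewrite /cocyc (dm_leibniz _ (erefl (0 + 1)) (erefl (k + 1)) _ e1 e2).
    by rewrite [cx_d _ x]ck (cr_nonpos (cx_d _ a)) ?dm_act0l ?dm_act0r ?sgnz0 ?addr0.
  by rewrite x0 ?dm_act0r; [exact: closed0|lia].
Defined.

Lemma trunc_le_qis : (forall j, n < j -> van M j) -> is_qis (sub_inc trunc_le).
Proof.
move=> vM; apply/is_qisE => i; split=> [x /sub_closed cx /= /(bdryE (subrK 1 i))[y dy]|y cy].
  have [Sx0 _] := subP x.
  case: (ltrP n i) => h.
    apply/(bdryE (subrK 1 i)); exists 0; apply: val_inj; rewrite /= cx_d0.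
    by rewrite Sx0.
  have Sy : trunc_le (i - 1) y by split=> h'; lia.
  by apply/(bdryE (subrK 1 i)); exists (mksub Sy); apply: val_inj.
case: (ltrP n i) => h.
  exists 0; first exact: closed0.
  by rewrite /= subr0; exact: vM.
have Sy : trunc_le i y by split=> // h'; lia.
exists (mksub Sy); first exact/sub_closed.
by rewrite /= subrr; exact: bdry0.
Qed.

(** The kernel of the projection of M to its truncation in degrees >= n. Factoring through this
    kernel replaces mapping to a quotient module. *)
Definition trunc_bd_P k (x : M k) : Prop := [/\ n < k -> x = 0 & k = n -> bdry x].

Definition trunc_bd : subdg M.
Proof.
apply: (@SubDg A M trunc_bd_P).
- by move=> k; split=> // _; exact: bdry0.
- move=> k x y [x0 cx] [y0 cy]; split=> [h|h]; first by rewrite x0 // y0 // subr0.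
  by apply: bdryB; auto.
- move=> k l e x [x0 cx]; split=> [h|h]; last exact: bdry_d.
  have [kn|kn] : k = n \/ n < k by lia.
    by apply/(closedE e); apply: bdry_closed; auto.
  by rewrite x0 // cx_d0.
- move=> i k l e a x [x0 cx]; case: (A_nonpos a) => [->|i0].
    by rewrite dm_act0l; split=> // _; exact: bdry0.
  split=> h; first by rewrite x0 ?dm_act0r //; lia.
  have [i0'|i0'] : i = 0 \/ i < 0 by lia.
    subst i; have /(bdryE (subrK 1 k))[y <-] : bdry x by apply: cx; lia.
    have e0 : 0 + (k - 1) = l - 1 by lia.
    have e1 : 0 + 1 + (k - 1) = l by lia.
    apply/(bdryE (subrK 1 l)); exists (dm_act e0 a y).
    rewrite (dm_leibniz _ (erefl (0 + 1)) (subrK 1 k) _ e1 e).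
    by rewrite (cr_nonpos (cx_d _ a)) ?dm_act0l ?sgnz0l ?add0r.
  by rewrite x0 ?dm_act0r; [exact: bdry0|lia].
Defined.

Lemma trunc_bd_acyclic : (forall j, j < n -> van M j) -> acyclic (SubDG trunc_bd).
Proof.
move=> vM; apply/acyclicE => i x /sub_closed cx.
have [Sx0 Sb] := subP x.
have [h|h] : n < i \/ i <= n by lia.
  have -> : x = 0 by apply: val_inj; exact: Sx0.
  exact: bdry0.
have /(bdryE (subrK 1 i))[y dy] : bdry (sub_val x).
  have [h'|h'] : i < n \/ i = n by lia.
    exact: vM.
  exact: Sb.
have Sy : trunc_bd (i - 1) y by split=> h'; lia.
by apply/(bdryE (subrK 1 i)); exists (mksub Sy); apply: val_inj.
Qed.

End Truncation.

(** * Morphisms between modules with bounded cohomology *)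

Section Orthogonality.
Variable A : cdgRing.

(** Restricted to the truncation of T to degrees <= m, f lands in [trunc_bd G g], which is acyclic;
    and T, being K-projective, maps to its truncation up to homotopy. The hypothesis on degree m
    matters only if m + i = g. *)
Lemma hbdry_trunc (T G : dgModule A) m g i (f : hom_deg T G i) :
  K_projective T -> (forall j, m < j -> van T j) -> (forall j, j < g -> van G j) ->
  m + i <= g -> hclosed f ->
  (forall k (e : m + i = k) (x : T m), cocyc x -> bdry (hd_fun f e x)) -> hbdry f.
Proof.
move=> KT vT vG mig cf bf.
have qi := trunc_le_qis vT; have aG := trunc_bd_acyclic vG.
have [th hth] := dgh_lift (dg_id T) KT qi.
have e : 0 + i = i := add0r i.
pose f1 := hcomp e f (hm (sub_inc (trunc_le T m))).
have cf1 : hclosed f1 by apply: hclosed_comp (hm_closed _).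
have S1 j k (e1 : j + i = k) x : trunc_bd G g k (hd_fun f1 e1 x).
  have e2 : j + 0 = j := addr0 j.
  rewrite (hcompE _ _ _ _ e2 e1) hmE; have [x0 cx] := subP x; split=> h.
    by rewrite /= x0 ?hd_0 //; lia.
  have [jm|jm] : j = m \/ m < j by lia.
    by subst j; apply: bf; exact: cx.
  by rewrite /= x0 // hd_0; exact: bdry0.
have b1 : hbdry (hcomp e (sub_fact S1) (hm th)).
  apply: (KprojE T).1 => //; apply: hclosed_comp (hm_closed _).
  exact: sub_fact_closed.
have e0 : i + 0 = i := addr0 i.
have b2 : hbdry (hcomp e f1 (hm th)).
  rewrite -(sub_factK S1 e0) -(hcompA e e0 e0 e).
  exact: hbdry_compr (hm_closed _) b1.
have := hbdry_compr e cf hth.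
rewrite hcompBr hm_id_r (hm_comp _ _ (addr0 0)) (hcompA (addr0 0) e e e) => h.
exact/(hbdry_sub h).
Qed.

Lemma hvan_trunc (T G : dgModule A) m g i :
  K_projective T -> (forall j, m < j -> van T j) -> (forall j, j < g -> van G j) ->
  m + i < g -> hvan T G i.
Proof.
move=> KT vT vG mig f cf; apply: (hbdry_trunc KT vT vG _ cf); first exact: ltW.
move=> k e x cx; apply: vG; first by rewrite -e.
exact: hd_closed.
Qed.

End Orthogonality.

(** * Resolutions *)

(** Resolutions and tensor products are quotients of syntax trees by a semantic relation, and Q/Z is
    a quotient of [rat]; this record lets one construction serve all three. *)
Record szmod := SZmod {
  sz_car :> Type;
  sz_rel : sz_car -> sz_car -> Prop;
  sz_refl : forall x, sz_rel x x;
  sz_sym : forall x y, sz_rel x y -> sz_rel y x;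
  sz_trans : forall x y z, sz_rel x y -> sz_rel y z -> sz_rel x z;
  sz_zero : sz_car;
  sz_opp : sz_car -> sz_car;
  sz_add : sz_car -> sz_car -> sz_car;
  sz_oppP : forall x y, sz_rel x y -> sz_rel (sz_opp x) (sz_opp y);
  sz_addP : forall x y x' y', sz_rel x y -> sz_rel x' y' -> sz_rel (sz_add x x') (sz_add y y');
  sz_addA : forall x y z, sz_rel (sz_add x (sz_add y z)) (sz_add (sz_add x y) z);
  sz_addC : forall x y, sz_rel (sz_add x y) (sz_add y x);
  sz_add0 : forall x, sz_rel (sz_add sz_zero x) x;
  sz_addN : forall x, sz_rel (sz_add (sz_opp x) x) sz_zero }.

Section SetoidQuotient.
Variable S : szmod.

Definition sq : Type := {c : S -> Prop | exists x, c = sz_rel x}.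

Definition cls (x : S) : sq := exist _ (sz_rel x) (ex_intro _ x erefl).

Lemma cls_eq x y : cls x = cls y <-> sz_rel x y.
Proof.
split=> [/(congr1 sval) /= xy|xy]; first by rewrite xy; exact: sz_refl.
apply: eq_exist => /=; apply: funext => z; apply: propext.
by split; apply: sz_trans => //; apply: sz_sym.
Qed.

Lemma clsP (c : sq) : exists x, c = cls x.
Proof. by case: c => c [x cx]; exists x; apply: eq_exist. Qed.

Definition rep (c : sq) : S := projT1 (cid (clsP c)).

Lemma repK c : cls (rep c) = c.
Proof. by rewrite /rep; case: cid. Qed.

Lemma rep_cls x : sz_rel (rep (cls x)) x.
Proof. by apply/cls_eq; rewrite repK. Qed.

HB.instance Definition _ := gen_eqMixin sq.
HB.instance Definition _ := gen_choiceMixin sq.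

Definition sq_zero := cls (sz_zero S).
Definition sq_opp (x : sq) := cls (sz_opp (rep x)).
Definition sq_add (x y : sq) := cls (sz_add (rep x) (rep y)).

Lemma sq_oppE x : sq_opp (cls x) = cls (sz_opp x).
Proof. by apply/cls_eq/sz_oppP/rep_cls. Qed.

Lemma sq_addE x y : sq_add (cls x) (cls y) = cls (sz_add x y).
Proof. by apply/cls_eq/sz_addP; apply: rep_cls. Qed.

Lemma sq_addA : associative sq_add.
Proof.
by move=> x y z; rewrite -[x]repK -[y]repK -[z]repK !sq_addE; apply/cls_eq/sz_addA.
Qed.
Lemma sq_addC : commutative sq_add.
Proof. by move=> x y; rewrite -[x]repK -[y]repK !sq_addE; apply/cls_eq/sz_addC. Qed.
Lemma sq_add0 : left_id sq_zero sq_add.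
Proof. by move=> x; rewrite -[x]repK sq_addE; apply/cls_eq/sz_add0. Qed.
Lemma sq_addN : left_inverse sq_zero sq_opp sq_add.
Proof. by move=> x; rewrite -[x]repK sq_oppE sq_addE; apply/cls_eq/sz_addN. Qed.

HB.instance Definition _ := GRing.isZmodule.Build sq sq_addA sq_addC sq_add0 sq_addN.

Lemma clsD x y : cls x + cls y = cls (sz_add x y). Proof. exact: sq_addE. Qed.
Lemma clsN x : - cls x = cls (sz_opp x). Proof. exact: sq_oppE. Qed.
Lemma cls0 : 0 = cls (sz_zero S). Proof. by []. Qed.
Lemma clsB x y : cls x - cls y = cls (sz_add x (sz_opp y)).
Proof. by rewrite clsN clsD. Qed.

End SetoidQuotient.

Definition qmap (S S' : szmod) (F : S -> S') (x : sq S) : sq S' := cls (F (rep x)).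

Lemma qmapE (S S' : szmod) (F : S -> S') : (forall x y, sz_rel x y -> sz_rel (F x) (F y)) ->
  forall x, qmap F (cls x) = cls (F x).
Proof. by move=> h x; apply/cls_eq/h/rep_cls. Qed.

Lemma sgnz_pred (V : zmodType) i (x : V) : sgnz i x + sgnz (i - 1) x = 0.
Proof. by have := sgnzS (i - 1) x; rewrite subrK => ->; rewrite addNr. Qed.

Definition fib_pr (A : cdgRing) (M N : dgModule A) i (f : hom_deg M N i) (cf : hclosed f) :
  dgHom (Tw (fib cf)) M.
Proof.
unshelve refine (@DgHom A (Tw (fib cf)) M (@CxMap (Tw (fib cf)) M (fun k x => x.1) _ _) _).
- by [].
- by move=> k l e x; rewrite /= sgnz0l; congr cx_d; apply: eq_irrelevance.
- move=> j k l e a x; rewrite /= mul0r sgnz0l; congr dm_act; exact: eq_irrelevance.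
Defined.

Section Primitive.
Variables (C : complex) (aC : acyclic C) (i j : int) (e : j + 1 = i).

(** The choice must send 0 to 0, because a [model] requires e(0, 0) = 0. The value 0 at elements
    that are not closed is a default. *)
Lemma prim_ex (x : C i) : exists y : C j, (cocyc x -> cx_d e y = x) /\ (x = 0 -> y = 0).
Proof.
case: (pselect (x = 0)) => [->|x0].
  exists 0; split; [move=> _; exact: cx_d0|by []].
case: (pselect (cocyc x)) => [cx|ncx]; last by exists 0.
have vC := (acyclicE C).1 aC; have /vC/(bdryE e)[y dy] := cx.
by exists y; split.
Qed.

Definition prim (x : C i) : C j := projT1 (cid (prim_ex x)).

Lemma prim_d x : cocyc x -> cx_d e (prim x) = x.
Proof. by rewrite /prim; case: cid => y []. Qed.

Lemma prim0 : prim 0 = 0.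
Proof. by rewrite /prim; case: cid => y [_ h] /=; exact: h. Qed.

End Primitive.

(* A K-projective resolution of [M] by syntax.  For [m] in [M^k] and [p] in
   [P^(k+1)] there is a free generator [e(m, p)] of degree [k] lying over [m],
   with [d e(m, p) = e(dm + pi p, - dp) - p] and [e(0, 0) = 0]: this says exactly
   that [(m, p) |-> (0, e(m, p))] is a (non-additive) contraction of the cone of
   [pi : P -> M].  Two expressions are identified when they agree in all modules
   over [M] having such an operation, so that all axioms hold automatically. *)
Section Resolution.
Variables (A : cdgRing) (M : dgModule A).

Inductive pexpr : int -> Type :=
| pgen k (m : M k) (p : pexpr (k + 1)) : pexpr k
| pzero k : pexpr k
| popp k (p : pexpr k) : pexpr k
| padd k (p q : pexpr k) : pexpr k
| pact i j k (e : i + j = k) (a : A i) (p : pexpr j) : pexpr k.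

Fixpoint pe_pi k (p : pexpr k) : M k :=
  match p with
  | pgen _ m _ => m
  | pzero _ => 0
  | popp _ p => - pe_pi p
  | padd _ p q => pe_pi p + pe_pi q
  | pact _ _ _ e a p => dm_act e a (pe_pi p)
  end.

Lemma pact_d1 (i j k : int) (e : i + j = k) : (i + 1) + j = k + 1. Proof. lia. Qed.
Lemma pact_d2 (i j k : int) (e : i + j = k) : i + (j + 1) = k + 1. Proof. lia. Qed.

Definition psgn (i : int) k (p : pexpr k) := if odd `|i|%N then popp p else p.

Fixpoint pe_d k (p : pexpr k) : pexpr (k + 1) :=
  match p in pexpr k return pexpr (k + 1) with
  | pgen k m p => padd (pgen (cx_d erefl m + pe_pi p) (popp (pe_d p))) (popp p)
  | pzero k => pzero (k + 1)
  | popp _ p => popp (pe_d p)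
  | padd _ p q => padd (pe_d p) (pe_d q)
  | pact i _ _ e a p => padd (pact (pact_d1 e) (cx_d erefl a) p)
                             (psgn i (pact (pact_d2 e) a (pe_d p)))
  end.

Record model := Model {
  m_W :> dgModule A;
  m_pi : dgHom m_W M;
  m_e : forall k, M k -> m_W (k + 1) -> m_W k;
  m_e0 : forall k, m_e (0 : M k) 0 = 0;
  m_epi : forall k (m : M k) x, m_pi k (m_e m x) = m;
  m_ed : forall k (m : M k) x, cx_d (erefl (k + 1)) (m_e m x) =
    m_e (cx_d erefl m + m_pi (k + 1) x) (- cx_d erefl x) - x }.

Fixpoint ev (W : model) k (p : pexpr k) : W k :=
  match p in pexpr k return W k with
  | pgen _ m p => m_e m (ev W p)
  | pzero _ => 0
  | popp _ p => - ev W p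
  | padd _ p q => ev W p + ev W q
  | pact _ _ _ e a p => dm_act e a (ev W p)
  end.

Lemma ev_pi W k (p : pexpr k) : m_pi W k (ev W p) = pe_pi p.
Proof.
elim: p => /= [k' m p _|k'|k' p IH|k' p IHp q IHq|i j k' e a p IH].
- exact: m_epi.
- exact: cm_0.
- by rewrite cm_N IH.
- by rewrite cm_D IHp IHq.
- by rewrite dh_act IH.
Qed.

Lemma ev_sgn W i k (p : pexpr k) : ev W (psgn i p) = sgnz i (ev W p).
Proof. by rewrite sgnzE /psgn; case: ifP. Qed.

Lemma pi_sgn i k (p : pexpr k) : pe_pi (psgn i p) = sgnz i (pe_pi p).
Proof. by rewrite sgnzE /psgn; case: ifP. Qed.

Lemma ev_d W k (p : pexpr k) : ev W (pe_d p) = cx_d erefl (ev W p).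
Proof.
elim: p => /= [k' m p IH|k'|k' p IH|k' p IHp q IHq|i j k' e a p IH].
- by rewrite m_ed ev_pi IH.
- by rewrite cx_d0.
- by rewrite IH cx_dN.
- by rewrite IHp IHq cx_dD.
- rewrite ev_sgn /= IH.
  by rewrite (dm_leibniz _ erefl erefl _ (pact_d1 e) (pact_d2 e)).
Qed.

Lemma pi_d k (p : pexpr k) : pe_pi (pe_d p) = cx_d erefl (pe_pi p).
Proof.
elim: p => /= [k' m p IH|k'|k' p IH|k' p IHp q IHq|i j k' e a p IH].
- by rewrite addrK.
- by rewrite cx_d0.
- by rewrite IH cx_dN.
- by rewrite IHp IHq cx_dD.
- rewrite pi_sgn /= IH.
  by rewrite (dm_leibniz _ erefl erefl _ (pact_d1 e) (pact_d2 e)).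
Qed.

(** Agreement under [pe_pi] is imposed separately, so that the projection to M is well defined
    before any model has been constructed. *)
Definition prel k (p q : pexpr k) : Prop :=
  pe_pi p = pe_pi q /\ forall W, ev W p = ev W q.

Definition pz (k : int) : szmod.
Proof.
apply: (@SZmod (pexpr k) (@prel k) _ _ _ (pzero k) (@popp k) (@padd k)).
- by move=> x; split.
- by move=> x y [h1 h2]; split=> [|W] /=; rewrite ?h1 ?h2.
- by move=> x y z [h1 h2] [h1' h2']; split=> [|W] /=; rewrite ?h1 ?h2 ?h1' ?h2'.
- by move=> x y [h1 h2]; split=> [|W] /=; rewrite ?h1 ?h2.
- by move=> x y x' y' [h1 h2] [h1' h2']; split=> [|W] /=; rewrite ?h1 ?h2 ?h1' ?h2'.
- by move=> x y z; split=> [|W] /=; rewrite addrA.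
- by move=> x y; split=> [|W] /=; rewrite addrC.
- by move=> x; split=> [|W] /=; rewrite add0r.
- by move=> x; split=> [|W] /=; rewrite addNr.
Defined.

Definition res_obj (k : int) : zmodType := sq (pz k).

Definition res_d k l (e : k + 1 = l) (x : res_obj k) : res_obj l :=
  ecast z (res_obj z) e (@qmap (pz k) (pz (k + 1)) (@pe_d k) x).

Lemma res_dE k (p : pexpr k) : res_d erefl (@cls (pz k) p) = @cls (pz (k + 1)) (pe_d p).
Proof.
apply: (@qmapE (pz k) (pz (k + 1))) => x y [h1 h2].
by split=> [|W]; rewrite ?pi_d ?ev_d ?h1 ?h2.
Qed.

Definition res_act i j k (e : i + j = k) (a : A i) (x : res_obj j) : res_obj k :=
  @qmap (pz j) (pz k) (@pact i j k e a) x.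

Lemma res_actE i j k (e : i + j = k) (a : A i) p :
  res_act e a (@cls (pz j) p) = @cls (pz k) (pact e a p).
Proof.
apply: (@qmapE (pz j) (pz k)) => x y [h1 h2].
by split=> [|W] /=; rewrite ?h1 ?h2.
Qed.

Lemma cls_sgn i k (p : pexpr k) : sgnz i (@cls (pz k) p : res_obj k) = @cls (pz k) (psgn i p).
Proof. by rewrite sgnzE /psgn; case: ifP => _ //; rewrite clsN. Qed.

Lemma res_dB k l (e : k + 1 = l) : {morph res_d e : x y / x - y}.
Proof.
case: l / e => x y; rewrite -[x]repK -[y]repK clsB !res_dE clsB.
by apply/cls_eq; split=> [|W] /=; rewrite ?pi_d ?ev_d.
Qed.

Lemma res_dd i j k (e : i + 1 = j) (e' : j + 1 = k) x : res_d e' (res_d e x) = 0.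
Proof.
case: k / e'; case: j / e; rewrite -[x]repK !res_dE cls0.
by apply/cls_eq; split=> [|W] /=; rewrite !(pi_d, ev_d) cx_dd.
Qed.

Definition res_cx : complex := Complex res_dB res_dd.

Definition resol : dgModule A.
Proof.
apply: (@DgModule A res_cx res_act).
- move=> i j k e a a' x; rewrite -[x]repK !res_actE clsB; apply/cls_eq.
  by split=> [|W] /=; rewrite dm_actBl.
- move=> i j k e a x x'; rewrite -[x]repK -[x']repK clsB !res_actE clsB; apply/cls_eq.
  by split=> [|W] /=; rewrite dm_actBr.
- move=> i j k ij jk l e1 e2 e3 e4 a b x; rewrite -[x]repK !res_actE; apply/cls_eq.
  by split=> [|W] /=; rewrite (dm_actA e1 _ e3 e4).
- move=> i e x; rewrite -[x]repK !res_actE; apply/cls_eq.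
  by split=> [|W] /=; rewrite dm_act1.
- move=> i j k i' j' k' e ei ej ek e1 e2 a x; subst i' j' k'; rewrite -[x]repK.
  rewrite [X in sgnz _ (_ X)]res_dE !res_actE [X in X = _]res_dE [X in _ = _ + X]cls_sgn clsD; apply/cls_eq.
  split=> [|W] /=; rewrite ?pi_sgn ?ev_sgn /= ?pi_d ?ev_d.
    by rewrite (eq_irrelevance (pact_d1 e) e1) (eq_irrelevance (pact_d2 e) e2).
  by rewrite (eq_irrelevance (pact_d1 e) e1) (eq_irrelevance (pact_d2 e) e2).
Defined.

Definition pcls k (p : pexpr k) : resol k := @cls (pz k) p.

Lemma pclsP k (x : resol k) : exists p, x = pcls p.
Proof. exact: (@clsP (pz k)). Qed.

Lemma pcls_d k (p : pexpr k) : cx_d erefl (pcls p) = pcls (pe_d p).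
Proof. exact: res_dE. Qed.

Definition rpi k (x : resol k) : M k := pe_pi (@rep (pz k) x).

Lemma rpiE k (p : pexpr k) : rpi (pcls p) = pe_pi p.
Proof. by have [] := @rep_cls (pz k) p. Qed.

Definition resol_map : dgHom resol M.
Proof.
unshelve refine (@DgHom A resol M (@CxMap resol M rpi _ _) _).
- move=> k x y; have [p ->] := pclsP x; have [q ->] := pclsP y.
  by rewrite [pcls p - pcls q]clsB !rpiE.
- move=> i j e x; subst j; have [p ->] := pclsP x.
  by rewrite pcls_d !rpiE pi_d.
- move=> i j k e a x; have [p ->] := pclsP x.
  by rewrite [dm_act _ _ _]res_actE [LHS]rpiE [X in _ = dm_act _ _ X]rpiE.
Defined.

Lemma resol_mapE k (p : pexpr k) : resol_map k (pcls p) = pe_pi p.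
Proof. exact: rpiE. Qed.

Section Universal.
Variable W : model.

Definition revf k (x : resol k) : W k := ev W (@rep (pz k) x).

Lemma revfE k (p : pexpr k) : revf (pcls p) = ev W p.
Proof. have [_ h] := @rep_cls (pz k) p; exact: h. Qed.

Definition resol_ev : dgHom resol W.
Proof.
unshelve refine (@DgHom A resol W (@CxMap resol W revf _ _) _).
- move=> k x y; have [p ->] := pclsP x; have [q ->] := pclsP y.
  by rewrite [pcls p - pcls q]clsB !revfE.
- move=> i j e x; subst j; have [p ->] := pclsP x.
  by rewrite pcls_d !revfE ev_d.
- move=> i j k e a x; have [p ->] := pclsP x.
  by rewrite [dm_act _ _ _]res_actE [LHS]revfE [X in _ = dm_act _ _ X]revfE.
Defined.

End Universal.

Definition res_e k (m : M k) (x : resol (k + 1)) : resol k := pcls (pgen m (@rep (pz (k + 1)) x)).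

Lemma res_eE k (m : M k) p : res_e m (pcls p) = pcls (pgen m p).
Proof.
apply/cls_eq; split=> [|W] //=.
by have [_ h] := @rep_cls (pz (k + 1)) p; rewrite [X in m_e _ X]h.
Qed.

Definition resol_model : model.
Proof.
apply: (@Model resol resol_map res_e).
- move=> k; rewrite [0 : resol (k + 1)]cls0 [LHS]res_eE [RHS]cls0; apply/cls_eq.
  by split=> [|W] //=; rewrite m_e0.
- by move=> k m x; rewrite [LHS]resol_mapE.
- move=> k m x; have [p ->] := pclsP x.
  rewrite res_eE !pcls_d resol_mapE [- pcls _]clsN res_eE [RHS]clsB.
  by apply/cls_eq; split=> [|W].
Defined.

Lemma res_e0 k : res_e (0 : M k) 0 = 0.
Proof. exact: (@m_e0 resol_model). Qed.

Lemma res_e_pi k (m : M k) x : resol_map k (res_e m x) = m.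
Proof. exact: (@m_epi resol_model). Qed.

Lemma res_e_d k (m : M k) x : cx_d (erefl (k + 1)) (res_e m x) =
  res_e (cx_d erefl m + resol_map _ x) (- cx_d erefl x) - x.
Proof. exact: (@m_ed resol_model). Qed.

(** As e(0, 0) = 0, the formula for d e gives d e(m, - x) = x whenever x is closed and pi x = dm,
    and it makes e(m, 0) a closed lift of a closed m. *)
Lemma resol_qis : is_qis resol_map.
Proof.
apply/is_qisE => i; split=> [x cx|m cm].
  have [j e] : exists j, j + 1 = i by exists (i - 1); rewrite subrK.
  case: i / e x cx => x cx /(bdryE (erefl (j + 1)))[m dm].
  apply/(bdryE (erefl (j + 1))); exists (res_e m (- x)).
  rewrite res_e_d cm_N -dm subrr cx_dN [cx_d _ x]cx !oppr0 res_e0 sub0r.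
  exact: opprK.
exists (res_e m 0).
  by rewrite /cocyc res_e_d cm_0 addr0 [cx_d _ m]cm cx_d0 oppr0 res_e0 subr0.
by rewrite res_e_pi subrr; exact: bdry0.
Qed.

Section Lifting.
Variables (N : dgModule A) (aN : acyclic N) (i : int) (f : hom_deg resol N i).
Hypothesis cf : hclosed f.

Let t := fib cf.

(* The value of [f] on a generator, corrected by a given choice [y'] for the
   generator that occurs in its differential. *)
Let defect k (m : M k) (w : Tw t (k + 1)) (y' : N (k + 1 + (i - 1))) :
    N (k + 1 + (i - 1)) :=
  hd_fun f (t_sf_d t (erefl (k + 1))) (res_e m w.1) + sgnz (i - 1) (y' - w.2).

Let pr k := @prim N aN _ _ (t_sb_d t (erefl (k + 1))).

Let m' k (m : M k) (w : Tw t (k + 1)) : M (k + 1) := cx_d erefl m + resol_map _ w.1.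

(** The correction at (m, w) must be a primitive of a defect that involves the correction at (m', -
    dw). The recursion stops there: the successor of (m', - dw) is (0, 0), where the correction has
    to be 0. *)
Let y1 k (m : M k) (w : Tw t (k + 1)) : N (k + (i - 1)) :=
  pr (defect m w (pr (defect (m' m w) (- cx_d erefl w) 0))).

Let defect0 k : defect (0 : M k) 0 0 = 0.
Proof.
rewrite /defect subr0 sgnz0 addr0.
have -> : res_e (0 : M k) (0 : Tw t (k + 1)).1 = 0 by exact: res_e0.
exact: hd_0.
Qed.

Let pr0 k : @pr k 0 = 0. Proof. exact: prim0. Qed.

Let m'0 k : m' (0 : M k) 0 = 0.
Proof. by rewrite /m' cx_d0 add0r; exact: cm_0. Qed.

Let y1_0 k : y1 (0 : M k) 0 = 0.
Proof.
have dw : - @cx_d (Tw t) (k + 1) _ (erefl (k + 1 + 1)) 0 = 0 by rewrite cx_d0 oppr0.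
by rewrite /y1 m'0 dw defect0 pr0 defect0 pr0.
Qed.

Let dw1 k (v : Tw t k) : (- cx_d (erefl (k + 1)) v).1 = - cx_d (erefl (k + 1)) v.1.
Proof.
transitivity (- sgnz 0 (cx_d (t_sa_d t (erefl (k + 1))) v.1)); first by [].
by rewrite sgnz0l (eq_irrelevance (t_sa_d t _) (erefl (k + 1))).
Qed.

Let m'm' k (m : M k) (w : Tw t (k + 1)) : m' (m' m w) (- cx_d erefl w) = 0.
Proof.
by rewrite /m' cx_dD cx_dd add0r dw1 cm_N cm_d subrr.
Qed.

Let y1_next k (m : M k) (w : Tw t (k + 1)) :
  y1 (m' m w) (- cx_d erefl w) = pr (defect (m' m w) (- cx_d erefl w) 0).
Proof.
have dw : - @cx_d (Tw t) _ _ (erefl (k + 1 + 1 + 1)) (- cx_d erefl w) = 0.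
  by rewrite cx_dN cx_dd oppr0 oppr0.
by rewrite /y1 m'm' dw defect0 pr0.
Qed.

Let d_y1 k (m : M k) (w : Tw t (k + 1)) : cx_d (t_sb_d t (erefl (k + 1))) (y1 m w) =
   defect m w (y1 (m' m w) (- cx_d erefl w)).
Proof.
have hf := (hclosedP f).1 cf.
have dw2 j (v : Tw t j) : (- cx_d (erefl (j + 1)) v).2 =
  - sgnz (i - 1) (cx_d (t_sb_d t (erefl (j + 1))) v.2 - hd_fun f (t_sf_d t (erefl (j + 1))) v.1).
  by [].
have cd : cocyc (defect (m' m w) (- cx_d erefl w) 0).
  apply/(closedE (t_sb_d t (erefl (k + 1 + 1 + 1)))).
  rewrite /defect sub0r cx_dD cx_d_sgn cx_dN.
  rewrite (hf _ _ _ _ _ _ (erefl (k + 1 + 1)) (t_sf_d t (erefl (k + 1 + 1 + 1)))).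
  rewrite res_e_d dw1 /m' cx_dD cx_dd add0r cm_N cm_d subrr cx_dN cx_dd !oppr0.
  rewrite res_e0 sub0r opprK dw2 cx_dN opprK cx_d_sgn sgnzK cx_dB cx_dd sub0r.
  rewrite (hf _ _ _ _ _ _ (erefl (k + 1 + 1)) (t_sf_d t (erefl (k + 1 + 1 + 1)))).
  by rewrite subrr.
rewrite y1_next [LHS]prim_d //.
apply/(closedE (t_sb_d t (erefl (k + 1 + 1)))).
rewrite {1}/defect cx_dD cx_d_sgn cx_dB prim_d // /defect sub0r dw2 opprK sgnzK.
rewrite (hf _ _ _ _ _ _ (erefl (k + 1)) (t_sf_d t (erefl (k + 1 + 1)))).
rewrite res_e_d dw1 hd_B.
set F := hd_fun f _ (res_e _ _); set G := hd_fun f _ w.1.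
set D := cx_d _ w.2; rewrite [X in _ + sgnz _ X](_ : _ = F - G) ?sgnz_pred //.
by rewrite addrA (addrAC _ D) addrK.
Qed.

(** The fibre of f, regarded as a module over M, carries the operation e. Initiality of [resol]
    among models then gives a map from [resol] to the fibre, and [pr_ev] shows that it is a section
    of the projection. *)
Let W : model.
Proof.
apply: (@Model (Tw t) (dg_comp resol_map (fib_pr cf))
  (fun k m w => (res_e m w.1, y1 m w) : Tw t k)).
- by move=> k; congr pair; [exact: res_e0|exact: y1_0].
- by move=> k m w; exact: res_e_pi.
- move=> k m w; congr pair.
    rewrite -[RHS]/(res_e (m' m w) (- cx_d (erefl (k + 1 + 1)) w).1 - w.1) dw1 -res_e_d.
    rewrite -[LHS]/(sgnz 0 (cx_d (t_sa_d t (erefl (k + 1))) (res_e m w.1))) sgnz0l.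
    by rewrite (eq_irrelevance (t_sa_d t _) (erefl (k + 1))).
  rewrite -[LHS]/(sgnz (i - 1) (cx_d (t_sb_d t (erefl (k + 1))) (y1 m w) -
    hd_fun f (t_sf_d t (erefl (k + 1))) (res_e m w.1))).
  by rewrite d_y1 /defect addrAC subrr add0r sgnzK.
Defined.

Let pr_ev k (x : resol k) : (resol_ev W k x).1 = x.
Proof.
have [p ->] := pclsP x; rewrite [resol_ev W k _]revfE.
elim: p => {k x} /= [k m p IH|k|k p IH|k p IHp q IHq|j l k e a p IH].
- by rewrite [X in res_e m X]IH res_eE.
- by [].
- by rewrite IH [LHS]clsN.
- by rewrite IHp IHq [LHS]clsD.
- rewrite mul0r sgnz0l IH (eq_irrelevance (t_sa_act t e) e).
  exact: res_actE.
Qed.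

(** The section is a closed pair (id, G), and closedness of this pair says dG = f. *)
Lemma resol_hbdry : hbdry f.
Proof.
have ea : 0 = 0 + t_a t by rewrite addr0.
have eb : i - 1 = 0 + t_b t by rewrite add0r.
have ea' : 1 = 1 + t_a t by rewrite addr0.
have eb' : i = 1 + t_b t by rewrite /=; lia.
have e0 : 0 + t_i t = i by rewrite add0r.
have c := hm_closed (resol_ev W).
have e1 : tw_fst ea eb (hm (resol_ev W)) = hm (dg_id resol).
  apply: hom_deg_eq => p q e x; case: q / e.
  have pe : p = p + 0 by rewrite addr0.
  transitivity (tr pe x); last exact: (congr1 (fun e => tr e x) (eq_irrelevance pe (hd_add0 erefl))).
  rewrite -[LHS]/(tr (tw_fst_subproof ea erefl) (tr (hd_add0 erefl) (resol_ev W p x)).1).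
  have tr1 a b (e : a = b) (w : Tw t a) : (tr e w).1 = tr e w.1 by case: b / e.
  rewrite tr1 pr_ev tr_tr; exact: (congr1 (fun e => tr e x) (eq_irrelevance _ pe)).
move: c; rewrite /hclosed /cocyc /= -(tw_pair_eta ea eb (hm (resol_ev W))).
rewrite (tw_pair_d ea eb ea' eb' erefl erefl (subrK 1 i) e0) e1.
move/(congr1 (tw_snd ea' eb')); rewrite tw_pair_snd => h.
have {}h : sgnz (t_b t) (hd_d (subrK 1 i) (tw_snd ea eb (hm (resol_ev W))) -
    hcomp e0 (t_f t) (hm (dg_id resol))) = 0.
  by rewrite h; apply: hom_deg_eq => p q e x; rewrite /= tr0.
apply/(hbdryE (subrK 1 i)); exists (tw_snd ea eb (hm (resol_ev W))).
move/sgnz_inj/eqP: h; rewrite subr_eq0 => /eqP ->.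
exact: hm_id_r.
Qed.

End Lifting.

Lemma resol_proj : K_projective resol.
Proof. by apply/KprojE => N aN i f cf; exact: resol_hbdry. Qed.

Definition resolution : kproj_resolution M := KprojResolution resol_proj resol_qis.

End Resolution.

(** * Morphisms in the derived category *)

Section Homotopy.
Variable A : cdgRing.
Implicit Types M N P T : dgModule A.

Definition htp M N (u v : dgHom M N) : Prop := hbdry (hm u - hm v).

Lemma htp_refl M N (u : dgHom M N) : htp u u.
Proof. by rewrite /htp subrr; exact: (@bdry0 (HomDG M N)). Qed.

Lemma htp_sym M N (u v : dgHom M N) : htp u v -> htp v u.
Proof. exact: hbdry_subC. Qed.

Lemma htp_trans M N (v u w : dgHom M N) : htp u v -> htp v w -> htp u w.
Proof. exact: hbdry_subT. Qed.

Lemma htp_compl M N P (g : dgHom N P) (u v : dgHom M N) :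
  htp u v -> htp (dg_comp g u) (dg_comp g v).
Proof.
move=> h; rewrite /htp !(hm_comp _ _ (addr0 0)) -hcompBr.
exact: hbdry_compr (hm_closed _) h.
Qed.

Lemma htp_compr M N P (g h : dgHom N P) (u : dgHom M N) :
  htp g h -> htp (dg_comp g u) (dg_comp h u).
Proof.
move=> gh; rewrite /htp !(hm_comp _ _ (addr0 0)) -hcompBl.
exact: hbdry_compl gh (hm_closed _).
Qed.

Lemma dg_compA M N P Q (h : dgHom P Q) (g : dgHom N P) (f : dgHom M N) :
  dg_comp h (dg_comp g f) = dg_comp (dg_comp h g) f.
Proof. exact: dgHom_eq. Qed.

Lemma dg_idl M N (f : dgHom M N) : dg_comp (dg_id N) f = f.
Proof. exact: dgHom_eq. Qed.

Lemma dg_idr M N (f : dgHom M N) : dg_comp f (dg_id M) = f.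
Proof. exact: dgHom_eq. Qed.

Lemma Kproj_htp T M N (s : dgHom M N) (u v : dgHom T M) : K_projective T -> is_qis s ->
  htp (dg_comp s u) (dg_comp s v) -> htp u v.
Proof.
move=> KT /hm_hqis qs; rewrite /htp !(hm_comp _ _ (addr0 0)) -hcompBr.
by apply: (Kproj_inj KT (hm_closed s) qs); apply: hclosedB; exact: hm_closed.
Qed.

Lemma qis_id M : is_qis (dg_id M).
Proof.
apply/is_qisE => i; split=> [x cx //|y cy].
by exists y => //=; rewrite subrr; exact: bdry0.
Qed.

Section Path.
Variable N : dgModule A.

Let tE := fib (hm_closed (dg_id N)).
Let E := Tw tE.

Let zero_closed : hclosed (0 : hom_deg N E 1).
Proof. exact: (@closed0 (HomDG N E)). Qed.

Let tP : twist N E := @Twist A N E 1 0 0 id id (fun k => esym (addr0 k))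
  (fun k => esym (addr0 k)) erefl 0 zero_closed.
(* A path in [N] from [x] to [x + y] is stored as [(x, (y, z))], where
   [(y, z)] lies in the contractible fibre of the identity. *)
Let Path := Tw tP.

Let E_acyclic i : van E i.
Proof.
have [h _] := acyclicE E; apply: h; apply/hqis_tw/hm_hqis; exact: qis_id.
Qed.

Let path_const : dgHom N Path.
Proof.
unshelve refine (@DgHom A N Path (@CxMap N Path (fun k x => (x, 0) : Path k) _ _) _).
- by move=> k x y; congr pair; rewrite subr0.
- move=> k l e x; congr pair; last by rewrite -[RHS]/(sgnz 0 (cx_d _ (0 : E _) - 0)) cx_d0 subr0.
  by rewrite /= sgnz0l; congr cx_d; apply: eq_irrelevance.
- move=> i j k e a x; congr pair.
    by rewrite /= mul0r sgnz0l; congr dm_act; apply: eq_irrelevance.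
  by rewrite -[RHS]/(sgnz (0 * i) (dm_act _ a (0 : E _))) dm_act0r sgnz0.
Defined.

Let path_0 : dgHom Path N.
Proof.
unshelve refine (@DgHom A Path N (@CxMap Path N (fun k x => x.1) _ _) _).
- by [].
- by move=> k l e x; rewrite /= sgnz0l; congr cx_d; apply: eq_irrelevance.
- move=> j k l e a x; rewrite /= mul0r sgnz0l; congr dm_act; exact: eq_irrelevance.
Defined.

Let path_1 : dgHom Path N.
Proof.
unshelve refine (@DgHom A Path N (@CxMap Path N (fun k x => x.1 + x.2.1) _ _) _).
- by move=> k x y; rewrite /= opprD addrACA.
- move=> k l e x; rewrite /= !sgnz0l cx_dD subr0.
  by congr (_ + _); congr cx_d; apply: eq_irrelevance.
- move=> j k l e a x; rewrite /= !mul0r !sgnz0l /tw_act /= mul0r sgnz0l dm_actDr.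
  by congr (_ + _); congr dm_act; exact: eq_irrelevance.
Defined.

Let path_const_qis : is_qis path_const.
Proof.
have sub := tw_ses tP.
apply/is_qisE => k; split=> [x cx|w cw].
  by move=> /(sp_bdry sub).
have c1 : cocyc w.1 := sp_closed sub cw.
exists w.1 => //.
have c2 := closedB cw (cm_closed path_const c1).
have s2 : bdry (w - path_const k w.1).1 by rewrite /= subrr; exact: bdry0.
have [y cy b] := ses_mid sub c2 s2.
by apply/(bdry_sub b)/(si_bdry sub)/E_acyclic.
Qed.

(** A homotopy from v to u is a map w to the path object with end points v and u. Both end point
    maps are left inverse to the quasi-isomorphism of constant paths, so they coincide in the
    derived category. *)
Lemma htp_deq P (u v : dgHom P N) : htp u v -> deq (dgen u) (dgen v).
Proof.
move=> /(hbdryE (subrK 1 0))[h dh].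
have e0 : 0 = 0 + t_a tE by rewrite addr0.
have eb : 0 - 1 = 0 + t_b tE by rewrite add0r.
have e1 : 1 = 1 + t_a tE by rewrite addr0.
have e1b : 0 = 1 + t_b tE by [].
have cE : hclosed (tw_pair e0 eb (hm u - hm v) h).
  rewrite /hclosed /cocyc /=.
  rewrite (tw_pair_d e0 eb e1 e1b (erefl _) (erefl _) (subrK 1 0) (addr0 0)).
  rewrite dh hm_id_l subrr [hd_d _ _](hclosedB (hm_closed u) (hm_closed v)) !sgnz0.
  by apply: hom_deg_eq.
have f0 : 0 = 0 + t_a tP by rewrite addr0.
have f1 : 1 = 1 + t_a tP by rewrite addr0.
have cP : hclosed (tw_pair f0 f0 (hm v) (tw_pair e0 eb (hm u - hm v) h)).
  rewrite /hclosed /cocyc /=.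
  rewrite (tw_pair_d f0 f0 f1 f1 (erefl _) (erefl _) (erefl _) (erefl _)).
  rewrite [hd_d _ (hm v)](hm_closed v) [hd_d _ (tw_pair _ _ _ _)]cE hcomp0l subrr !sgnz0.
  by apply: hom_deg_eq.
pose w := dgh cP.
have w0 : dg_comp path_0 w = v.
  by apply: dgHom_eq => i x; rewrite /= tr_id.
have w1 : dg_comp path_1 w = u.
  by apply: dgHom_eq => i x; rewrite /= !tr_id addrC subrK.
have inv (p : dgHom Path N) : dg_comp p path_const = dg_id N ->
    deq (dgen p) (dinv path_const_qis).
  move=> pc; apply: deq_trans (deq_sym (deq_idr _)) _.
  apply: deq_trans (deq_comp (deq_refl _) (deq_sym (deq_invr path_const_qis))) _.
  apply: deq_trans (deq_assoc _ _ _) _.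
  apply: deq_trans (deq_comp (deq_sym (deq_gen _ _)) (deq_refl _)) _.
  by rewrite pc; exact: deq_idl.
have d01 : deq (dgen path_1) (dgen path_0).
  apply: deq_trans (inv _ _) (deq_sym (inv _ _)); apply: dgHom_eq => i x //=.
  by rewrite addr0.
rewrite -w0 -w1.
apply: deq_trans (deq_gen _ _) (deq_trans _ (deq_sym (deq_gen _ _))).
exact: deq_comp d01 (deq_refl _).
Qed.

End Path.

(** * Formal morphisms acting on homotopy classes *)

Section Interpretation.
Variables (P : dgModule A) (KP : K_projective P).

(* The action of a formal morphism on homotopy classes of maps from [P], as a
   relation. *)
Fixpoint interp M N (x : dexpr M N) : dgHom P M -> dgHom P N -> Prop :=
  match x in dexpr M N return dgHom P M -> dgHom P N -> Prop with
  | dgen _ _ f => fun u v => htp (dg_comp f u) v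
  | dinv _ _ s _ => fun u v => htp (dg_comp s v) u
  | dcomp _ _ _ g f => fun u v => exists w, interp f u w /\ interp g w v
  end.

Lemma interp_htp M N (x : dexpr M N) u u' v v' : htp u u' -> htp v v' ->
  interp x u v -> interp x u' v'.
Proof.
elim: x u u' v v' => {M N} [M N f|M N s qs|M N Q g IHg f IHf] u u' v v' uu' vv' /=.
- by move=> h; apply: htp_trans (htp_compl f (htp_sym uu')) (htp_trans h vv').
- by move=> h; apply: htp_trans (htp_compl s (htp_sym vv')) (htp_trans h uu').
- move=> [w [h1 h2]]; exists w; split.
    exact: IHf uu' (htp_refl w) h1.
  exact: IHg (htp_refl w) vv' h2.
Qed.

(** Each generator of the congruence preserves the action. The two inversion relations hold because
    a quasi-isomorphism acts bijectively on homotopy classes of maps from the K-projective module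
    P. *)
Lemma interp_deq M N (x y : dexpr M N) : deq x y -> forall u v, interp x u v <-> interp y u v.
Proof.
elim=> {M N x y}.
- by [].
- by move=> M N x y _ IH u v; split=> h; apply/IH.
- by move=> M N x y z _ IH1 _ IH2 u v; rewrite IH1 IH2.
- move=> M N Q x x' y y' _ IHx _ IHy u v /=.
  by split=> -[w [h1 h2]]; exists w; split; [apply/IHy|apply/IHx|apply/IHy|apply/IHx].
- move=> M N Q S x y z u v /=; split.
    by move=> [w [[w' [h1 h2]] h3]]; exists w'; split=> //; exists w.
  by move=> [w [h1 [w' [h2 h3]]]]; exists w'; split=> //; exists w.
- move=> M N x u v /=; split=> [[w [h1 h2]]|h].
    by rewrite dg_idl in h2; exact: interp_htp (htp_refl u) h2 h1.
  by exists v; split=> //; rewrite dg_idl; exact: htp_refl.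
- move=> M N x u v /=; split=> [[w [h1 h2]]|h].
    by rewrite dg_idl in h1; exact: interp_htp (htp_sym h1) (htp_refl v) h2.
  by exists u; split=> //; rewrite dg_idl; exact: htp_refl.
- move=> M N Q g f u v /=; split=> [h|[w [h1 h2]]].
    exists (dg_comp f u); split; first exact: htp_refl.
    by rewrite dg_compA.
  by rewrite -dg_compA; apply: htp_trans (htp_compl g h1) h2.
- move=> M N s qs u v /=; rewrite dg_idl; split=> [[w [h1 h2]]|h].
    by apply: (Kproj_htp KP qs); apply: htp_trans h1 (htp_sym h2).
  exists (dg_comp s u); split; first exact: htp_refl.
  exact: htp_compl (htp_sym h).
- move=> M N s qs u v /=; rewrite dg_idl; split=> [[w [h1 h2]]|h].
    exact: htp_trans (htp_sym h1) h2.
  have [w hw] := dgh_lift u KP qs.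
  exists w; split; first exact: htp_sym.
  exact: htp_trans (htp_sym hw) h.
Qed.

Lemma interp_exists M N (x : dexpr M N) (u : dgHom P M) :
  exists2 v, interp x u v & deq (dcomp x (dgen u)) (dgen v).
Proof.
elim: x u => {M N} [M N f|M N s qs|M N Q g IHg f IHf] u /=.
- by exists (dg_comp f u); [exact: htp_refl|exact: deq_sym (deq_gen _ _)].
- have [w hw] := dgh_lift u KP qs; exists w; first exact: htp_sym.
  apply: deq_trans (deq_comp (deq_refl _) (htp_deq hw)) _.
  apply: deq_trans (deq_comp (deq_refl _) (deq_gen _ _)) _.
  apply: deq_trans (deq_assoc _ _ _) _.
  apply: deq_trans (deq_comp (deq_invl qs) (deq_refl _)) _.
  exact: deq_idl.
- have [w h1 d1] := IHf u; have [v h2 d2] := IHg w.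
  exists v; first by exists w.
  apply: deq_trans (deq_sym (deq_assoc _ _ _)) _.
  exact: deq_trans (deq_comp (deq_refl _) d1) d2.
Qed.

(** Letting both words act on the identity of P recovers the homotopy classes of u and v. *)
Lemma deq_htp N (u v : dgHom P N) : deq (dgen u) (dgen v) <-> htp u v.
Proof.
split=> [h|]; last exact: htp_deq.
have [+ _] := interp_deq h (dg_id P) u; rewrite /= !dg_idr => /(_ (htp_refl u)).
exact: htp_sym.
Qed.

End Interpretation.

(** * Formal morphisms acting on cohomology *)

Section CohomologyAction.
Variable i : int.

Fixpoint hinterp M N (x : dexpr M N) : H M i -> H N i -> Prop :=
  match x in dexpr M N return H M i -> H N i -> Prop with
  | dgen _ _ f => fun a b => Hmap f a = b
  | dinv _ _ s _ => fun a b => Hmap s b = a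
  | dcomp _ _ _ g f => fun a b => exists c, hinterp f a c /\ hinterp g c b
  end.

Lemma Hmap_id M (a : H M i) : Hmap (dg_id M) a = a.
Proof. by rewrite -[a]hrepK HmapE; congr hcls; apply: val_inj. Qed.

Lemma Hmap_comp M N Q (g : dgHom N Q) (f : dgHom M N) (a : H M i) :
  Hmap (dg_comp g f) a = Hmap g (Hmap f a).
Proof. by rewrite -[a]hrepK !HmapE; congr hcls; apply: val_inj. Qed.

Lemma hinterp_deq M N (x y : dexpr M N) : deq x y ->
  forall a b, hinterp x a b <-> hinterp y a b.
Proof.
elim=> {M N x y}.
- by [].
- by move=> M N x y _ IH u v; split=> h; apply/IH.
- by move=> M N x y z _ IH1 _ IH2 u v; rewrite IH1 IH2.
- move=> M N Q x x' y y' _ IHx _ IHy u v /=.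
  by split=> -[w [h1 h2]]; exists w; split; [apply/IHy|apply/IHx|apply/IHy|apply/IHx].
- move=> M N Q S x y z u v /=; split.
    by move=> [w [[w' [h1 h2]] h3]]; exists w'; split=> //; exists w.
  by move=> [w [h1 [w' [h2 h3]]]]; exists w'; split=> //; exists w.
- move=> M N x u v /=; split=> [[w [h1]]|h]; first by rewrite Hmap_id => <-.
  by exists v; rewrite Hmap_id.
- move=> M N x u v /=; split=> [[w []]|h]; first by rewrite Hmap_id => ->.
  by exists u; rewrite Hmap_id.
- move=> M N Q g f u v /=; rewrite Hmap_comp.
  by split=> [<-|[w [<- <-]]]; first by exists (Hmap f u).
- move=> M N s qs u v /=; rewrite Hmap_id; split=> [[w [<-]]|<-].
    by move/(bij_inj (qs i)).
  by exists (Hmap s u).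
- move=> M N s qs u v /=; rewrite Hmap_id; split=> [[w [<- <-]] //|<-].
  by have [g gK Kg] := qs i; exists (g u); rewrite Kg.
Qed.

End CohomologyAction.

(** The inverse is only a formal word; its action on cohomology through [hinterp] inverts that of
    f. *)
Lemma iso_qis M N (f : dgHom M N) : is_isoD (Dloc f) -> is_qis f.
Proof.
move=> [g [gf fg]] i; have [y gy] := dclsP g; subst g.
move: gf fg; rewrite /Did /Dloc !DcompE => /dcls_eq gf /dcls_eq fg.
have inj (a b : H M i) : Hmap f a = Hmap f b -> a = b.
  move=> ab; have [_ h] := hinterp_deq (i := i) gf a a.
  have [c [/= h1 h2]] := h (Hmap_id a).
  have [h' _] := hinterp_deq (i := i) gf b a.
  by rewrite -[b]Hmap_id; apply/esym/h'; exists c; rewrite /= -ab.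
have surj (b : H N i) : exists a, Hmap f a = b.
  have [_ h] := hinterp_deq (i := i) fg b b.
  by have [a [_ h2]] := h (Hmap_id b); exists a.
exists (fun b => projT1 (cid (surj b))) => a; last by case: cid.
by case: cid => a' /= /inj.
Qed.

(** The composite of the isomorphism with p is represented by a DG homomorphism u, as P is
    K-projective; u is invertible in the derived category, hence a quasi-isomorphism. *)
Lemma isoD_roof M N (P : dgModule A) (p : dgHom P M) : isoD M N -> K_projective P ->
  is_qis p -> exists u : dgHom P N, is_qis u.
Proof.
move=> [c [c' [c1 c2]]] KP qp.
have [x xc] := dclsP c; have [y yc] := dclsP c'; subst c c'.
have [u _ du] := interp_exists KP x p; exists u; apply: iso_qis.
exists (dcls (dcomp (dinv qp) y)).
move: c1 c2; rewrite /Did /Dloc !DcompE => /dcls_eq c1 /dcls_eq c2.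
split; apply/dcls_eq.
  apply: deq_trans (deq_comp (deq_refl _) (deq_sym du)) _.
  apply: deq_trans (deq_sym (deq_assoc _ _ _)) _.
  apply: deq_trans (deq_comp (deq_refl _) (deq_assoc _ _ _)) _.
  apply: deq_trans (deq_comp (deq_refl _) (deq_comp c1 (deq_refl _))) _.
  apply: deq_trans (deq_comp (deq_refl _) (deq_idl _)) _.
  exact: deq_invl.
apply: deq_trans (deq_comp (deq_sym du) (deq_refl _)) _.
apply: deq_trans (deq_sym (deq_assoc _ _ _)) _.
apply: deq_trans (deq_comp (deq_refl _) (deq_assoc _ _ _)) _.
apply: deq_trans (deq_comp (deq_refl _) (deq_comp (deq_invr qp) (deq_refl _))) _.
apply: deq_trans (deq_comp (deq_refl _) (deq_idl _)) _.
exact: c2.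
Qed.

End Homotopy.

(** * Characters *)

Section Divisible.

Lemma int_subgroup (I : int -> Prop) : I 0 -> (forall m n, I m -> I n -> I (m - n)) ->
  exists o : nat, forall m, I m <-> exists c : int, m = c * o%:Z.
Proof.
move=> I0 IB.
have IN m : I m -> I (- m) by rewrite -sub0r; exact: IB.
have ID m n : I m -> I n -> I (m + n) by move=> Im /IN In; rewrite -[n]opprK; exact: IB.
have IM m (c : nat) : I m -> I (c%:Z * m).
  move=> Im; elim: c => [|c IH]; first by rewrite mul0r.
  have -> : c.+1%:Z * m = m + c%:Z * m by lia.
  exact: ID.
case: (pselect (exists n : nat, (0 < n)%N /\ I n%:Z)) => [ex|nex]; last first.
  exists 0 => m; split=> [Im|[c ->]]; last by rewrite mulr0.
  exists 0; rewrite mul0r; apply: contrapT => m0; apply: nex.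
  case: m m0 Im => [[|n]|n] m0 Im //; first by exists n.+1.
  by exists n.+1; split=> //; have := IN _ Im; rewrite NegzE opprK.
pose p n := `[< (0 < n)%N /\ I n%:Z >].
have exp : exists n, p n by have [n h] := ex; exists n; apply/asboolP.
case: (ex_minnP exp) => o /asboolP[o0 Io] omin.
exists o => m; split=> [Im|[c ->]]; last first.
  have [n [->|->]] : exists n : nat, c = n%:Z \/ c = - n%:Z by exists `|c|%N; lia.
    exact: IM.
  by rewrite mulNr; apply: IN; exact: IM.
have pos n : I n%:Z -> exists c : int, n%:Z = c * o%:Z.
  elim/ltn_ind: n => n IH In.
  have [n0|n0] := posnP n; first by exists 0; lia.
  have on : (o <= n)%N by apply: omin; apply/asboolP.
  have lt : (n - o < n)%N by lia.
  have I' : I (n - o)%N%:Z.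
    have -> : (n - o)%N%:Z = n%:Z - o%:Z :> int by lia.
    exact: IB.
  have [c hc] := IH _ lt I'.
  by exists (c + 1); rewrite mulrDl mul1r -hc; lia.
have [n [mn|mn]] : exists n : nat, m = n%:Z \/ m = - n%:Z by exists `|m|%N; lia.
  by rewrite mn in Im *; exact: pos.
have /IN := Im; rewrite mn opprK => /pos[c hc]; exists (- c); lia.
Qed.

Variable D : zmodType.
Hypothesis divD : forall (n : nat) (y : D), (0 < n)%N -> exists z, z *+ n = y.

(** Injectivity of divisible groups, for a partial homomorphism given by its graph S. A maximal
    extension is total: if x is outside its domain, the m with m x inside form o Z, and divisibility
    provides a compatible value at x. *)
Lemma divisible_ext (G : zmodType) (S : G -> D -> Prop) : S 0 0 ->
  (forall x y x' y', S x y -> S x' y' -> S (x - x') (y - y')) ->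
  (forall y, S 0 y -> y = 0) ->
  exists2 g : G -> D, {morph g : x y / x - y} & forall x y, S x y -> g x = y.
Proof.
move=> S0 SB Sinj.
pose graph (X : set (G * D)) := (forall u v, X u -> X v -> X (u.1 - v.1, u.2 - v.2)) /\
  (forall y, X (0, y) -> y = 0).
pose S' : set (G * D) := fun u => S u.1 u.2.
pose P (X : set (G * D)) := graph X /\ (X = set0 \/ (S' `<=` X)%classic).
have [X [[[XB Xinj] XS] Xmax]] : exists X, P X /\ forall Y, (X `<` Y)%classic -> ~ P Y.
  apply: Zorn_bigcup => F FP tF; split; first split.
  - move=> u v [X FX Xu] [Y FY Yv]; have [XY|YX] := tF _ _ FX FY.
      by exists Y => //; have [[h _] _] := FP _ FY; apply: h => //; exact: XY.
    by exists X => //; have [[h _] _] := FP _ FX; apply: h => //; exact: YX.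
  - by move=> y [X FX Xy]; have [[_ h] _] := FP _ FX; exact: h.
  - case: (pselect (exists X, F X /\ (S' `<=` X)%classic)) => [[X [FX SX]]|nex].
      by right=> u /SX Xu; exists X.
    left; apply/seteqP; split=> // u [X FX Xu].
    have [_ [X0|SX]] := FP _ FX; first by rewrite X0 in Xu.
    by case: nex; exists X.
have {}XS : (S' `<=` X)%classic.
  case: XS => // X0; case: (Xmax S').
    by rewrite X0; split=> [u //|h]; exact: (h (0, 0) S0).
  by split; [split=> [u v|y]; [exact: SB|exact: Sinj]|right].
have X00 : X (0, 0) by exact: XS.
have XN x y : X (x, y) -> X (- x, - y).
  by move=> h; have := XB _ _ X00 h; rewrite /= !sub0r.
have XD x y x' y' : X (x, y) -> X (x', y') -> X (x + x', y + y').
  by move=> h /XN h'; have := XB _ _ h h'; rewrite /= !opprK.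
have Xfun x y y' : X (x, y) -> X (x, y') -> y = y'.
  move=> h h'; have := XB _ _ h h'; rewrite /= subrr => /Xinj/eqP.
  by rewrite subr_eq0 => /eqP.
have XM (c : int) x y : X (x, y) -> X (x *~ c, y *~ c).
  have nat_case (n : nat) : X (x, y) -> X (x *+ n, y *+ n).
    by move=> h; elim: n => [|n IH] //; rewrite !mulrS; exact: XD.
  by case: c => n h; [exact: nat_case|rewrite !NegzE !mulrNz; apply: XN; exact: nat_case].
have tot x : exists y, X (x, y).
  apply: contrapT => nx.
  have [o ho] := @int_subgroup (fun m => exists y, X (x *~ m, y))
    (ex_intro _ 0 X00) (fun m n hm hn => let: ex_intro y h := hm in
       let: ex_intro z h' := hn in ex_intro _ (y - z) (eq_ind_r (fun w => X (w, y - z)) (XB _ _ h h') (mulrzBr x m n))).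
  have [y0 hy0] : exists y, X (x *~ o%:Z, y) by apply/ho; exists 1; rewrite mul1r.
  have [t ht] : exists t, t *~ o%:Z = y0.
    have [o0|o0] := posnP o; last exact: divD.
    exists 0; rewrite mul0rz; rewrite o0 mulr0z in hy0; exact: Xfun X00 hy0.
  pose Y : set (G * D) := fun u => exists g y (m : int), X (g, y) /\ u = (g + x *~ m, y + t *~ m).
  apply: (Xmax Y).
    split=> [[g y] h|h]; first by exists g, y, 0; rewrite !mulr0z !addr0.
    apply: nx; exists t; apply: (h (x, t)); exists 0, 0, 1.
    by rewrite !mulr1z !add0r.
  split; last by right=> [[g y]] /XS h; exists g, y, 0; rewrite !mulr0z !addr0.
  split=> [_ _ [g [y [m [h ->]]]] [g' [y' [m' [h' ->]]]]|z [g [y [m [h [e ->]]]]]].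
    exists (g - g'), (y - y'), (m - m'); split; first exact: XB h h'.
    by rewrite /= !mulrzBr; congr pair; rewrite opprD addrACA.
  have gm : x *~ m = - g by apply/eqP; rewrite -subr_eq0 opprK addrC -e.
  have [c mc] : exists c, m = c * o%:Z.
    by apply/ho; exists (- y); rewrite gm; exact: XN.
  have := XM c _ _ hy0; rewrite -mulrzA mulrC -mc gm => /XN; rewrite opprK => h''.
  by rewrite (Xfun _ _ _ h h'') mc mulrC mulrzA ht addNr.
exists (fun x => projT1 (cid (tot x))).
  move=> x y; case: cid => z hz; case: cid => z' hz'; case: cid => z'' hz'' /=.
  by apply: Xfun hz (XB _ _ hz' hz'').
by move=> x y Sxy; case: cid => z hz /=; apply: Xfun hz _; exact: XS.
Qed.

End Divisible.

(** * Q/Z and the separation of subgroups by characters *)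

Section RationalsModIntegers.

Let relQ (x y : rat) := x - y \is a Num.int.

Lemma relQ_sym x y : relQ x y -> relQ y x.
Proof. by rewrite /relQ => h; rewrite -opprB rpredN. Qed.

Definition QZ_setoid : szmod.
Proof.
apply: (@SZmod rat relQ _ relQ_sym _ 0 -%R +%R).
- by move=> x; rewrite /relQ subrr.
- by move=> x y z h h'; rewrite /relQ -(subrK y x) -addrA rpredD.
- by move=> x y h; rewrite /relQ -opprD rpredN.
- by move=> x y x' y' h h'; rewrite /relQ opprD addrACA rpredD.
- by move=> x y z; rewrite /relQ (addrA x) subrr.
- by move=> x y; rewrite /relQ (addrC x) subrr.
- by move=> x; rewrite /relQ add0r subrr.
- by move=> x; rewrite /relQ addNr subrr.
Defined.

Definition QZ : zmodType := sq QZ_setoid.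
Definition qz (x : rat) : QZ := @cls QZ_setoid x.

Lemma qzMn x n : qz x *+ n = qz (x *+ n).
Proof.
elim: n => [|n IH]; first by [].
by rewrite !mulrS IH; exact: clsD.
Qed.

Lemma qz_eq0 x : qz x = 0 <-> x \is a Num.int.
Proof. by rewrite [0]cls0 cls_eq /= /relQ subr0. Qed.

Lemma QZ_div (n : nat) (y : QZ) : (0 < n)%N -> exists z, z *+ n = y.
Proof.
move=> n0; have [x ->] := @clsP QZ_setoid y.
have nz : n%:R != 0 :> rat by rewrite pnatr_eq0 -lt0n.
exists (qz (x / n%:R)); rewrite qzMn.
by have -> : x / n%:R *+ n = x by rewrite -mulr_natr mulfVK.
Qed.

(** With o the order of x modulo S, or 0 if that is infinite, sending S to 0 and x to a nonzero t
    with o t = 0 is well defined, and it extends by divisibility. *)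
Lemma QZ_separates (G : zmodType) (S : G -> Prop) (x : G) : S 0 ->
  (forall u v, S u -> S v -> S (u - v)) -> ~ S x ->
  exists g : G -> QZ, [/\ {morph g : u v / u - v}, forall u, S u -> g u = 0 & g x <> 0].
Proof.
move=> S0 SB nSx.
have [|m n|o ho] := @int_subgroup (fun m => S (x *~ m)).
- by rewrite mulr0z.
- by rewrite mulrzBr; exact: SB.
have o1 : o != 1%N.
  apply/eqP => o1; apply: nSx; rewrite -[x]mulr1z; apply/ho.
  by exists 1; rewrite o1 mul1r.
(* Any nonzero value works if the order is infinite, and 1/2 is taken; otherwise t is 1/o, nonzero
   as o is not 1. *)
have [t ht t0] : exists2 t : QZ, t *+ o = 0 & t <> 0.
  have [o0|o0] := posnP o.
    exists (qz (2%:R^-1)); first by rewrite o0 mulr0n.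
    by move/qz_eq0; apply/negP.
  exists (qz (o%:R^-1)).
    rewrite qzMn; have -> : o%:R^-1 *+ o = 1 :> rat.
      by rewrite -[LHS]mulr_natr mulVf // pnatr_eq0 -lt0n.
    exact/qz_eq0/rpred1.
  move/qz_eq0 => /intrP[m hm].
  have : (1 : rat) = (m * o%:Z)%:~R.
    by rewrite intrM -hm mulVf // pnatr_eq0 -lt0n.
  move/eqP; rewrite -[1 : rat]/(1%:~R) eqr_int => /eqP h.
  have : absz (m * o%:Z) = 1%N by rewrite -h.
  by rewrite abszM /= => /eqP; rewrite muln_eq1 (negPf o1) andbF.
have [|u y u' y' [m [h ->]] [m' [h' ->]]|y [m [h ->]]|g gB gS] :=
  @divisible_ext QZ QZ_div G (fun u y => exists m : int, S (u - x *~ m) /\ y = t *~ m).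
- by exists 0; rewrite !mulr0z subr0.
- exists (m - m'); rewrite !mulrzBr; split=> //.
  rewrite [u - u' - _](_ : _ = (u - x *~ m) - (u' - x *~ m')); first exact: SB.
  exact: subrACA.
- have /ho[c ->] : S (x *~ m).
    by have := SB _ _ S0 h; rewrite !sub0r opprK.
  by rewrite mulrC mulrzA -pmulrn ht mul0rz.
exists g; split=> //.
  by move=> u Su; apply: gS; exists 0; rewrite !mulr0z subr0.
by rewrite (gS x t) //; exists 1; rewrite !mulr1z subrr.
Qed.

End RationalsModIntegers.

(** * Tensor products and flatness *)

Lemma dm_act_comm (B : cdgRing) (V : dgModule B) q r j rj qj m (e1 : q + rj = m)
    (e2 : r + j = rj) (e3 : r + qj = m) (e4 : q + j = qj) (b : B q) (a : B r) (v : V j) :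
  dm_act e1 b (dm_act e2 a v) = sgnz (q * r) (dm_act e3 a (dm_act e4 b v)).
Proof.
have e5 : r + q + j = m by lia.
rewrite -(dm_actA (addrC q r) e5) -(dm_actA (erefl (r + q)) e5).
rewrite (cr_comm (erefl (r + q)) (addrC q r) a b) [r * q]mulrC.
exact: (sgnz_morph (fun u u' => dm_actBl e5 u u' v)).
Qed.

Section TensorGroup.
Variables (A : cdgRing) (P V : dgModule A).

(** The left module P serves as a right module through p a = (-1)^(|a| |p|) a p, which explains the
    sign in [bl_act]. *)
Record bal (k : int) (Z : zmodType) := Bal {
  bl :> forall i j, i + j = k -> P i -> V j -> Z;
  bl_Bl : forall i j (e : i + j = k) p p' v, bl e (p - p') v = bl e p v - bl e p' v;
  bl_Br : forall i j (e : i + j = k) p v v', bl e p (v - v') = bl e p v - bl e p v';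
  bl_act : forall q i j qi qj (e1 : q + i = qi) (e2 : q + j = qj) (e : qi + j = k)
      (e' : i + qj = k) (a : A q) p v,
    bl e (dm_act e1 a p) v = sgnz (q * i) (bl e' p (dm_act e2 a v)) }.

Section Degree.
Variable k : int.

Inductive texpr : Type :=
| tten i j (e : i + j = k) (p : P i) (v : V j)
| tzero
| topp (t : texpr)
| tadd (t t' : texpr).

Fixpoint tev Z (b : bal k Z) (t : texpr) : Z :=
  match t with
  | tten _ _ e p v => b _ _ e p v
  | tzero => 0
  | topp t => - tev b t
  | tadd t t' => tev b t + tev b t'
  end.

(** Equality is tested against all balanced pairings, so the universal property holds by
    construction. *)
Definition trel (t t' : texpr) : Prop := forall Z (b : bal k Z), tev b t = tev b t'.

Definition tsz : szmod.
Proof.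
apply: (@SZmod texpr trel _ _ _ tzero topp tadd).
- by [].
- by move=> x y h Z b; rewrite h.
- by move=> x y z h h' Z b; rewrite h h'.
- by move=> x y h Z b /=; rewrite h.
- by move=> x y x' y' h h' Z b /=; rewrite h h'.
- by move=> x y z Z b /=; rewrite addrA.
- by move=> x y Z b /=; rewrite addrC.
- by move=> x Z b /=; rewrite add0r.
- by move=> x Z b /=; rewrite addNr.
Defined.

Definition tobj : zmodType := sq tsz.

Definition tens i j (e : i + j = k) (p : P i) (v : V j) : tobj := @cls tsz (tten e p v).

Definition tlift Z (b : bal k Z) (x : tobj) : Z := tev b (@rep tsz x).

Lemma tliftE Z (b : bal k Z) t : tlift b (@cls tsz t) = tev b t.
Proof. exact: (@rep_cls tsz t). Qed.

Lemma tlift_tens Z (b : bal k Z) i j (e : i + j = k) p v : tlift b (tens e p v) = b _ _ e p v.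
Proof. exact: tliftE. Qed.

Lemma tliftB Z (b : bal k Z) : {morph tlift b : x y / x - y}.
Proof.
move=> x y; have [t ->] := @clsP tsz x; have [t' ->] := @clsP tsz y.
by rewrite clsB !tliftE.
Qed.

Lemma tens_ext (Z : zmodType) (g h : tobj -> Z) : {morph g : x y / x - y} -> {morph h : x y / x - y} ->
  (forall i j (e : i + j = k) p v, g (tens e p v) = h (tens e p v)) -> g =1 h.
Proof.
move=> gB hB gh x; have [t ->] := @clsP tsz x.
elim: t => [i j e p v||t IH|t IH t' IH'].
- exact: gh.
- by rewrite -[cls _]/(0 : tobj) (morphB0 gB) (morphB0 hB).
- by rewrite -[cls _]clsN (morphN gB) (morphN hB) IH.
- by rewrite -[cls _]clsD (morphBD gB) (morphBD hB) IH IH'.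
Qed.

Definition tens_bal : bal k tobj.
Proof.
apply: (@Bal k tobj tens).
- by move=> i j e p p' v; rewrite clsB; apply/cls_eq => Z b /=; rewrite bl_Bl.
- by move=> i j e p v v'; rewrite clsB; apply/cls_eq => Z b /=; rewrite bl_Br.
- move=> q i j qi qj e1 e2 e e' a p v.
  rewrite sgnzE; case: ifP => h; rewrite ?clsN; apply/cls_eq => Z b /=;
    by rewrite (bl_act b e1 e2 e e') sgnzE h.
Defined.

End Degree.

Lemma bl0l k Z (b : bal k Z) i j (e : i + j = k) v : b _ _ e 0 v = 0.
Proof. by rewrite -(subrr (0 : P i)) bl_Bl subrr. Qed.

Lemma bl0r k Z (b : bal k Z) i j (e : i + j = k) p : b _ _ e p 0 = 0.
Proof. by rewrite -(subrr (0 : V j)) bl_Br subrr. Qed.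

Lemma bl_Nl k Z (b : bal k Z) i j (e : i + j = k) p v : b _ _ e (- p) v = - b _ _ e p v.
Proof. by rewrite -sub0r bl_Bl bl0l sub0r. Qed.

Lemma bl_Nr k Z (b : bal k Z) i j (e : i + j = k) p v : b _ _ e p (- v) = - b _ _ e p v.
Proof. by rewrite -sub0r bl_Br bl0r sub0r. Qed.

Lemma bl_Dl k Z (b : bal k Z) i j (e : i + j = k) p p' v :
  b _ _ e (p + p') v = b _ _ e p v + b _ _ e p' v.
Proof. by rewrite -{1}[p']opprK bl_Bl bl_Nl opprK. Qed.

Lemma bl_Dr k Z (b : bal k Z) i j (e : i + j = k) p v v' :
  b _ _ e p (v + v') = b _ _ e p v + b _ _ e p v'.
Proof. by rewrite -{1}[v']opprK bl_Br bl_Nr opprK. Qed.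

Lemma bl_sgnl k Z (b : bal k Z) i j (e : i + j = k) n p v :
  b _ _ e (sgnz n p) v = sgnz n (b _ _ e p v).
Proof. by rewrite !sgnzE; case: ifP; rewrite ?bl_Nl. Qed.

Lemma bl_sgnr k Z (b : bal k Z) i j (e : i + j = k) n p v :
  b _ _ e p (sgnz n v) = sgnz n (b _ _ e p v).
Proof. by rewrite !sgnzE; case: ifP; rewrite ?bl_Nr. Qed.

Lemma tens_tenb k i j (e : i + j = k) p v : tens e p v = tens_bal k _ _ e p v.
Proof. by []. Qed.

Section Differential.
Variables (k l : int) (e : k + 1 = l).

Lemma td1 i j : i + j = k -> (i + 1) + j = l. Proof. lia. Qed.
Lemma td2 i j : i + j = k -> i + (j + 1) = l. Proof. lia. Qed.

Definition bal_d Z (b : bal l Z) : bal k Z.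
Proof.
apply: (@Bal k Z (fun i j e p v =>
  b _ _ (td1 e) (cx_d erefl p) v + sgnz i (b _ _ (td2 e) p (cx_d erefl v)))).
- by move=> i j e1 p p' v; rewrite cx_dB !bl_Bl sgnzB opprD addrACA.
- by move=> i j e1 p v v'; rewrite cx_dB !bl_Br sgnzB opprD addrACA.
- move=> q i j qi qj e1 e2 e3 e4 a p v; subst qi qj.
  have e5 : q + 1 + i = q + i + 1 by lia.
  have e6 : q + (i + 1) = q + i + 1 by lia.
  have e7 : q + 1 + j = q + j + 1 by lia.
  have e8 : q + (j + 1) = q + j + 1 by lia.
  rewrite (dm_leibniz _ erefl erefl _ e5 e6) (dm_leibniz _ erefl erefl _ e7 e8).
  rewrite bl_Dl bl_Dr !bl_sgnl !bl_sgnr.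
  rewrite (bl_act b e5 e7 (td1 e3) (td2 e4)) (bl_act b e6 (erefl (q + j)) (td1 e3) (td1 e4)).
  rewrite (bl_act b erefl e8 (td2 e3) (td2 e4)) !sgnzDr !sgnzD.
  rewrite [RHS]addrCA addrA; congr (_ + _ + _); apply: sgnz_odd; lia.
Defined.

Definition td : tobj k -> tobj l := tlift (bal_d (tens_bal l)).

Lemma td_tens i j (e1 : i + j = k) p v : td (tens e1 p v) =
  tens (td1 e1) (cx_d erefl p) v + sgnz i (tens (td2 e1) p (cx_d erefl v)).
Proof. exact: tlift_tens. Qed.

End Differential.

Lemma tdB k l (e : k + 1 = l) : {morph td e : x y / x - y}.
Proof. exact: tliftB. Qed.

Lemma tdd i j k (e : i + 1 = j) (e' : j + 1 = k) x : td e' (td e x) = 0.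
Proof.
have dB := tdB e; have dB' := tdB e'.
pose g x := td e' (td e x).
have gB : {morph g : x y / x - y} by move=> u v; rewrite /g dB dB'.
have oB : {morph (fun _ : tobj i => 0 : tobj k) : x y / x - y} by move=> *; rewrite subrr.
apply: (@tens_ext i (tobj k) g (fun=> 0)) => // {x} a b eab p v.
rewrite /g td_tens (morphBD dB') (sgnz_morph dB') !td_tens.
rewrite tens_tenb cx_dd bl0l add0r [X in sgnz a X]addrC.
rewrite [X in _ + sgnz _ (X + _)](_ : _ = 0) ?add0r.
  rewrite (eq_irrelevance (td2 e' (td1 e eab)) (td1 e' (td2 e eab))) sgnzS.
  by rewrite addNr.
by rewrite tens_tenb cx_dd bl0r sgnz0.
Qed.

End TensorGroup.

Section Tensor.
Variables (A B : cdgRing) (f : cdgHom A B) (P : dgModule A) (V : dgModule B).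

Definition tcx : complex := Complex (@tdB A P (rest f V)) (@tdd A P (rest f V)).

Section Act.
Variables (q k l : int) (e : q + k = l) (b : B q).

Lemma ta1 i j : i + j = k -> i + (q + j) = l. Proof. lia. Qed.

Definition act_bal : bal P (rest f V) k (tcx l).
Proof.
apply: (@Bal A P (rest f V) k (tcx l) (fun i j e1 p v =>
  sgnz (q * i) (tens (V := rest f V) (ta1 e1) p (dm_act (d := V) erefl b v)))).
- by move=> i j e1 p p' v; rewrite tens_tenb bl_Bl sgnzB.
- by move=> i j e1 p v v'; rewrite tens_tenb [dm_act _ _ _]dm_actBr bl_Br sgnzB.
- move=> r i j ri rj e1 e2 e3 e4 a p v.
  have e5 : r + (q + j) = q + rj by lia.
  rewrite tens_tenb (bl_act (tens_bal P (rest f V) l) e1 e5 (ta1 e3) (ta1 e4)).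
  have h := dm_act_comm (erefl (q + rj)) e2 e5 (erefl (q + j)) b (f r a) v.
  rewrite -[dm_act (d := rest f V) e2 a v]/(dm_act (d := V) e2 (f r a) v) h.
  rewrite tens_tenb bl_sgnr !sgnzD -e1; apply: sgnz_odd; lia.
Defined.

Definition tact : tcx k -> tcx l := tlift act_bal.

Lemma tact_tens i j (e1 : i + j = k) p v : tact (tens (V := rest f V) e1 p v) =
  sgnz (q * i) (tens (V := rest f V) (ta1 e1) p (dm_act (d := V) erefl b v)).
Proof. exact: tlift_tens. Qed.

Lemma tactB : {morph tact : x y / x - y}.
Proof. exact: tliftB. Qed.

End Act.

Lemma tens_act k q i j m m' (e : i + m = k) (e' : i + m' = k) (e1 : q + j = m)
    (e1' : q + j = m') (p : P i) (b : B q) (v : V j) :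
  tens (V := rest f V) e p (dm_act (d := V) e1 b v) =
  tens (V := rest f V) e' p (dm_act (d := V) e1' b v).
Proof. by subst m m'; rewrite (eq_irrelevance e e'). Qed.

Definition Tens : dgModule B.
Proof.
apply: (@DgModule B tcx tact).
- move=> q k l e b b' x; move: x; apply: tens_ext => [x y|x y|i j e1 p v]; rewrite ?tactB //.
    by rewrite !opprD addrACA.
  by rewrite !tact_tens dm_actBl tens_tenb bl_Br sgnzB.
- by move=> q k l e b x y; exact: tactB.
- move=> q r k qr rk l e1 e2 e3 e4 b c x; move: x.
  apply: tens_ext => [x y|x y|i j e5 p v]; rewrite ?tactB ?tactB //.
  rewrite !tact_tens (sgnz_morph (@tactB _ _ _ e4 b)) tact_tens sgnzD.
  have e6 : q + (r + j) = qr + j by lia.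
  rewrite (dm_actA e1 erefl erefl e6) (tens_act _ (ta1 e4 (ta1 e3 e5)) e6 erefl).
  by apply: sgnz_odd; rewrite -e1; lia.
- move=> k e x; move: x; apply: tens_ext => [x y|x y|i j e5 p v]; rewrite ?tactB //.
  rewrite tact_tens mul0r sgnz0l (tens_act _ e5 erefl (add0r j)).
  by rewrite dm_act1.
- move=> q k l q' k' l' e eq ek el e1 e2 b x; subst q' k' l'; move: x.
  apply: tens_ext => [x y|x y|i j e5 p v].
  + by rewrite tactB (@cx_dB tcx).
  + by rewrite (@cx_dB tcx) !tactB sgnzB opprD addrACA.
  have dE i' j' k' (e' : i' + j' = k') p' v' : @cx_d tcx k' (k' + 1) erefl
      (tens (V := rest f V) e' p' v') =
      tens (V := rest f V) (td1 erefl e') (cx_d erefl p') v' +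
      sgnz i' (tens (V := rest f V) (td2 erefl e') p' (@cx_d V _ _ erefl v')).
    exact: td_tens.
  have tD e' (b' : B q) : {morph @tact q (k + 1) (l + 1) e' b' : x y / x + y}.
    exact: morphBD (@tactB _ _ _ _ _).
  rewrite tact_tens cx_d_sgn !dE tD (sgnz_morph (@tactB _ _ _ e2 b)) !tact_tens.
  have e6 : q + 1 + j = q + j + 1 by lia.
  have e7 : q + (j + 1) = q + j + 1 by lia.
  rewrite (dm_leibniz erefl erefl erefl erefl e6 e7).
  rewrite [tens (td2 _ _) p _]tens_tenb bl_Dr bl_sgnr -!tens_tenb.
  rewrite (tens_act (td2 erefl (ta1 e e5)) (ta1 e1 e5) e6 erefl).
  rewrite (tens_act (td2 erefl (ta1 e e5)) (ta1 e2 (td2 erefl e5)) e7 erefl).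
  rewrite (eq_irrelevance (td1 erefl (ta1 e e5)) (ta1 e2 (td1 erefl e5))).
  rewrite !(sgnzDr, sgnzD) addrCA; congr (_ + (_ + _)); apply: sgnz_odd; lia.
Defined.

Lemma Tens_act q k l (e : q + k = l) (b : B q) i j (e1 : i + j = k) p v :
  dm_act (d := Tens) e b (tens (V := rest f V) e1 p v) =
  sgnz (q * i) (tens (V := rest f V) (ta1 e e1) p (dm_act (d := V) erefl b v)).
Proof. exact: tact_tens. Qed.

Lemma Tens_d k i j (e1 : i + j = k) p v :
  @cx_d Tens k (k + 1) erefl (tens (V := rest f V) e1 p v) =
  tens (V := rest f V) (td1 erefl e1) (cx_d erefl p) v +
  sgnz i (tens (V := rest f V) (td2 erefl e1) p (@cx_d V _ _ erefl v)).
Proof. exact: td_tens. Qed.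

Section Adjunction.
Variables (Q : dgModule B) (n : int).

Lemma adj_e (i j k l : int) : i + j = k -> k + n = l -> j + (i + n) = l. Proof. lia. Qed.

Definition adj_bal (F : hom_deg P (rest f (HomDG V Q)) n) k l (e : k + n = l) :
  bal P (rest f V) k (Q l).
Proof.
apply: (@Bal A P (rest f V) k (Q l) (fun i j e1 p v =>
  hd_fun (hd_fun F (erefl (i + n)) p : hom_deg V Q (i + n)) (adj_e e1 e) v)).
- by move=> i j e1 p p' v; rewrite hd_B.
- by move=> i j e1 p v v'; rewrite hd_B.
- move=> q i j qi qj e1 e2 e3 e4 a p v; subst qi qj.
  have e5 : q + (i + n) = q + i + n by rewrite addrA.
  rewrite (hd_act F erefl erefl erefl e5) hd_fun_sgnz.
  have e6 : j + (i + n) = j + i + n by rewrite addrA.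
  have e7 : q + (j + i + n) = l by lia.
  rewrite -[X in sgnz (n * q) X]/(hd_fun (hd_scale e5 (f q a) (hd_fun F erefl p : hom_deg V Q _)) (adj_e e3 e) v).
  rewrite (hd_scaleE e5 (f q a) _ _ e6 e7).
  have := hd_act (hd_fun F erefl p : hom_deg V Q _) (erefl (q + j)) (adj_e e4 e) e6 e7 (f q a) v.
  rewrite -[dm_act (d := rest f V) erefl a v]/(dm_act (d := V) erefl (f q a) v) => ->.
  rewrite sgnzD; apply: sgnz_odd; lia.
Defined.

Definition adjL (F : hom_deg P (rest f (HomDG V Q)) n) : hom_deg Tens Q n.
Proof.
apply: (@HomDeg B Tens Q n (fun k l e x => tlift (adj_bal F e) x)).
- by move=> k l e x y; exact: tliftB.
- move=> q k qk l m e e1 e2 e3 b x; move: x.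
  apply: tens_ext => [x y|x y|i j e4 p v].
  + by rewrite dm_actBr tliftB.
  + by rewrite tliftB dm_actBr sgnzB.
  rewrite Tens_act (sgnz_morph (@tliftB _ _ _ _ _ _)) !tlift_tens /=.
  set G : hom_deg V Q (i + n) := hd_fun F _ p.
  have := hd_act G (erefl (q + j)) (adj_e (ta1 e e4) e1) (adj_e e4 e2) e3 b v.
  move=> ->; rewrite sgnzD; apply: sgnz_odd; lia.
Defined.

Lemma adjL_tens F k l (e : k + n = l) i j (e1 : i + j = k) p v :
  hd_fun (adjL F) e (tens (V := rest f V) e1 p v) =
  hd_fun (hd_fun F (erefl (i + n)) p : hom_deg V Q (i + n)) (adj_e e1 e) v.
Proof. exact: tlift_tens. Qed.

Lemma adjR_e (i j m l : int) : i + n = m -> j + m = l -> (i + j) + n = l. Proof. lia. Qed.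

Definition adjR_val (F : hom_deg Tens Q n) i m (e : i + n = m) (p : P i) : hom_deg V Q m.
Proof.
apply: (@HomDeg B V Q m (fun j l e1 v =>
  hd_fun F (adjR_e e e1) (tens (V := rest f V) (erefl (i + j)) p v))).
- by move=> j l e1 x y; rewrite tens_tenb bl_Br hd_B.
- move=> q j qj l s e1 e2 e3 e4 b v.
  have e5 : q + (i + j) = i + qj by lia.
  have := hd_act F e5 (adjR_e e e2) (adjR_e e e3) e4 b (tens (V := rest f V) (erefl (i + j)) p v).
  rewrite Tens_act hd_sgn => h.
  rewrite (tens_act erefl (ta1 e5 erefl) e1 erefl).
  apply: (can_inj (@sgnzK _ (q * i))); rewrite h sgnzD.
  by apply: sgnz_odd; rewrite -e; lia.
Defined.

Definition adjR (F : hom_deg Tens Q n) : hom_deg P (rest f (HomDG V Q)) n.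
Proof.
apply: (@HomDeg A P (rest f (HomDG V Q)) n (adjR_val F)).
- by move=> i m e p p'; apply: hom_deg_eq => j l e1 v /=; rewrite tens_tenb bl_Bl hd_B.
- move=> q i qi m s e1 e2 e3 e4 a p; apply: hom_deg_eq => j l e5 v.
  rewrite hd_fun_sgnz /=.
  have e6 : i + (q + j) = qi + j by lia.
  rewrite tens_tenb (bl_act _ e1 (erefl (q + j)) _ e6) -tens_tenb.
  have e7 : q + (i + j) = qi + j by lia.
  have e8 : q + (i + j + n) = l by lia.
  have := hd_act F e7 (adjR_e e2 e5) (erefl (i + j + n)) e8 (f q a)
    (tens (V := rest f V) (erefl (i + j)) p v).
  rewrite Tens_act hd_sgn.
  rewrite (tens_act (ta1 e7 erefl) e6 erefl erefl) => h.
  rewrite -[dm_act (d := rest f V) erefl a v]/(dm_act (d := V) erefl (f q a) v).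
  rewrite hd_sgn h; congr sgnz.
  exact: act_hd_fun.
Defined.

Lemma adjLK F : adjR (adjL F) = F.
Proof.
apply: hom_deg_eq => i m e p; apply: hom_deg_eq => j l e1 v.
rewrite -[LHS]/(hd_fun (adjL F) (adjR_e e e1) (tens (V := rest f V) (erefl (i + j)) p v)).
rewrite adjL_tens; subst m.
by congr hd_fun; apply: eq_irrelevance.
Qed.

Lemma adjRK F : adjL (adjR F) = F.
Proof.
apply: hom_deg_eq => k l e x; move: x.
apply: tens_ext => [x y|x y|i j e1 p v]; rewrite ?hd_B //.
rewrite adjL_tens /=; subst k.
by congr hd_fun; apply: eq_irrelevance.
Qed.

End Adjunction.

Lemma adj_irr Q n (F : hom_deg P (rest f (HomDG V Q)) n) i m m' (e : i + n = m)
    (e' : i + n = m') j l (g : j + m = l) (g' : j + m' = l) p v :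
  hd_fun (hd_fun F e p : hom_deg V Q m) g v = hd_fun (hd_fun F e' p : hom_deg V Q m') g' v.
Proof. by subst m m'; congr hd_fun; apply: eq_irrelevance. Qed.

Lemma adjL_d Q n n' (e : n + 1 = n') (F : hom_deg P (rest f (HomDG V Q)) n) :
  hd_d e (adjL F) = adjL (hd_d e F).
Proof.
apply: hom_deg_eq => k l e' x; move: x.
apply: tens_ext => [x y|x y|i j e1 p v]; rewrite ?hd_B //.
have e2 : k + n + 1 = l by lia.
have e3 : k + 1 + n = l by lia.
rewrite (hd_dE e (adjL F) e' (erefl (k + n)) e2 (erefl (k + 1)) e3) Tens_d.
rewrite hd_D hd_sgn !adjL_tens.
have e4 : i + n + 1 = i + n' by lia.
have e5 : i + 1 + n = i + n' by lia.
rewrite (hd_dE e F (erefl (i + n')) (erefl (i + n)) e4 (erefl (i + 1)) e5).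
have e6 : j + 1 + (i + n) = l by lia.
have := hd_dE e4 (hd_fun F (erefl (i + n)) p : hom_deg V Q (i + n)) (adj_e e1 e')
  (adj_e e1 erefl) e2 (erefl (j + 1)) e6 v => h.
pose G : hom_deg V Q (i + n') := hd_fun F e5 (cx_d erefl p).
rewrite -[RHS]/(hd_fun (hd_d e4 (hd_fun F (erefl (i + n)) p : hom_deg V Q (i + n))) (adj_e e1 e') v
   - hd_fun (sgnz n G) (adj_e e1 e') v).
rewrite h hd_fun_sgnz /G (adj_irr F e5 erefl _ (adj_e (td1 erefl e1) e3)).
rewrite (eq_irrelevance e6 (adj_e (td2 erefl e1) e3)) sgnzDr sgnzD opprD [n + i]addrC.
by rewrite [RHS]addrAC addrA.
Qed.

Lemma adj_van Q n : hvan Tens Q n <-> van (HomDG P (rest f (HomDG V Q))) n.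
Proof.
have e : n - 1 + 1 = n := subrK 1 n.
split=> h F cF.
  have /h/(hbdryE e)[G dG] : hclosed (adjL F).
    rewrite /hclosed /cocyc /= adjL_d [hd_d _ F]cF; apply: hom_deg_eq => k l e' x.
    by move: x; apply: tens_ext => [x y|x y|i j e1 p v]; rewrite ?hd_B ?subrr ?adjL_tens.
  apply/(hbdryE e); exists (adjR G).
  by rewrite -[hd_d e _]adjLK -adjL_d adjRK dG adjLK.
have cR : hclosed (adjR F).
  rewrite /hclosed /cocyc /= -[hd_d _ _]adjLK -adjL_d adjRK [hd_d _ F]cF.
  by apply: hom_deg_eq => i m e' p; apply: hom_deg_eq.
have /(hbdryE e)[G dG] := h _ cR.
by apply/(hbdryE e); exists (adjL G); rewrite adjL_d dG adjRK.
Qed.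

End Tensor.

(** Adjunction: Hom_B(P (x)_A V, N) = Hom_A(P, Hom_B(V, N)), and the inner complex is acyclic when N
    is. *)
Lemma Tens_proj (A B : cdgRing) (f : cdgHom A B) (P : dgModule A) (V : dgModule B) :
  K_projective P -> K_projective V -> K_projective (Tens f P V).
Proof.
move=> /KprojE KP /KprojE KV; apply/KprojE => N aN i; apply/adj_van/KP.
by apply/acyclicE => j; exact: KV.
Qed.

(** * The character dual Hom_Z(V, Q/Z) *)

Section CharacterDual.
Variables (A : cdgRing) (V : dgModule A).

Record dual_deg (n : int) := DualDeg {
  du :> forall j : int, j + n = 0 -> V j -> QZ;
  du_B : forall j (e : j + n = 0), {morph @du j e : x y / x - y} }.

Lemma dual_eq n (g h : dual_deg n) : (forall j e v, du g (j := j) e v = du h e v) -> g = h.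
Proof.
case: g h => [g gB] [h hB] /= gh.
have gh' : g = h.
  by do 2![apply: functional_extensionality_dep => ?]; apply: funext => v; exact: gh.
by subst h; congr DualDeg; exact: Prop_irrelevance.
Qed.

Section Degree.
Variable n : int.

HB.instance Definition _ := gen_eqMixin (dual_deg n).
HB.instance Definition _ := gen_choiceMixin (dual_deg n).

Definition du0 : dual_deg n.
Proof. by apply: (@DualDeg n (fun _ _ _ => 0)) => j e x y; rewrite subr0. Defined.

Definition duN (g : dual_deg n) : dual_deg n.
Proof.
by apply: (@DualDeg n (fun j e v => - du g e v)) => j e x y; rewrite du_B opprB addrC opprK.
Defined.

Definition duD (g h : dual_deg n) : dual_deg n.
Proof.
by apply: (@DualDeg n (fun j e v => du g e v + du h e v)) => j e x y;
  rewrite !du_B opprD addrACA.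
Defined.

Lemma duDA : associative duD.
Proof. by move=> x y z; apply: dual_eq => * /=; rewrite addrA. Qed.
Lemma duDC : commutative duD.
Proof. by move=> x y; apply: dual_eq => * /=; rewrite addrC. Qed.
Lemma du0D : left_id du0 duD.
Proof. by move=> x; apply: dual_eq => * /=; rewrite add0r. Qed.
Lemma duND : left_inverse du0 duN duD.
Proof. by move=> x; apply: dual_eq => * /=; rewrite addNr. Qed.

HB.instance Definition _ := GRing.isZmodule.Build (dual_deg n) duDA duDC du0D duND.

End Degree.

Lemma du_sgn n m (g : dual_deg n) j (e : j + n = 0) v :
  du (sgnz m g) e v = sgnz m (du g e v).
Proof. by rewrite !sgnzE; case: ifP. Qed.

Lemma du_sgnr n m (g : dual_deg n) j (e : j + n = 0) v :
  du g e (sgnz m v) = sgnz m (du g e v).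
Proof. exact: (sgnz_morph (du_B g e)). Qed.

Lemma du_irr n (g : dual_deg n) j j' (e : j + n = 0) (e' : j' + n = 0) (ej : j = j') v :
  du g e v = du g e' (tr ej v).
Proof. by subst j'; rewrite (eq_irrelevance e e'). Qed.

Lemma du_d_e (n n' j : int) : n + 1 = n' -> j + n' = 0 -> j + 1 + n = 0. Proof. lia. Qed.
Lemma du_act_e (q n m j : int) : q + n = m -> j + m = 0 -> q + j + n = 0. Proof. lia. Qed.

Definition du_d n n' (e : n + 1 = n') (g : dual_deg n) : dual_deg n'.
Proof.
apply: (@DualDeg n' (fun j e' v => - sgnz n (du g (du_d_e e e') (cx_d erefl v)))).
by move=> j e' x y; rewrite cx_dB du_B sgnzB opprD.
Defined.

Definition du_act q n m (e : q + n = m) (a : A q) (g : dual_deg n) : dual_deg m.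
Proof.
apply: (@DualDeg m (fun j e' v => sgnz (q * n) (du g (du_act_e e e') (dm_act erefl a v)))).
by move=> j e' x y; rewrite dm_actBr du_B sgnzB.
Defined.

Definition Dual : dgModule A.
Proof.
unshelve refine (@DgModule A (@Complex dual_deg du_d _ _) du_act _ _ _ _ _).
- by move=> n n' e g h; apply: dual_eq => j e' v /=; rewrite sgnzB opprD.
- move=> n n' n'' e e' g; apply: dual_eq => j e'' v /=.
  by rewrite cx_dd (morphB0 (du_B g _)) sgnz0 oppr0 sgnz0 oppr0.
- by move=> q n m e a a' g; apply: dual_eq => j e' v /=; rewrite dm_actBl du_B sgnzB.
- by move=> q n m e a g h; apply: dual_eq => j e' v /=; rewrite sgnzB.
- move=> q r n qr rn m e1 e2 e3 e4 a b g; apply: dual_eq => j e v /=.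
  have e5 : r + (q + j) = qr + j by lia.
  have e6 : qr + j = r + (q + j) by lia.
  rewrite (dm_actA e1 erefl erefl (etrans (addrA q r j) (congr1 (fun z => z + j) e1))).
  rewrite (dm_act_comm _ erefl e5 erefl) du_sgnr !sgnzD.
  rewrite (du_irr g _ (du_act_e e3 (du_act_e e4 e)) e6) tr_act.
  rewrite (eq_irrelevance (etrans e5 e6) erefl).
  by apply: sgnz_odd; rewrite -e1 -e3; lia.
- move=> n e g; apply: dual_eq => j e' v /=; rewrite mul0r sgnz0l.
  by rewrite (du_irr g _ e' (add0r j)) tr_act dm_act1.
- move=> q n m q' n' m' e eq en em e1 e2 a g; subst q'.
  apply: dual_eq => j e' v; rewrite [RHS]/= du_sgn /=.
  have e3 : q + j + 1 = q + (j + 1) by rewrite addrA.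
  have e4 : q + 1 + j = q + j + 1 by lia.
  have e5 : q + (j + 1) = q + j + 1 by lia.
  rewrite (dm_leibniz (erefl (q + j)) erefl erefl erefl e4 e5).
  rewrite (morphBD (du_B g _)) du_sgnr.
  rewrite (du_irr g _ (du_act_e e1 e') (esym e4)) tr_act.
  rewrite (du_irr g _ (du_act_e e (du_d_e em e')) e3) tr_act.
  rewrite (eq_irrelevance (etrans e4 (esym e4)) erefl) (eq_irrelevance (etrans e5 e3) erefl).
  rewrite !(sgnzDr, sgnzN, sgnzD); set X := du g _ (dm_act _ a _).
  set Y := du g _ (dm_act _ (cx_d _ a) _); rewrite opprD addrA.
  rewrite (@sgnz_odd _ ((q + 1) * n) (q + q * n' + n) Y).
    by rewrite subrr add0r; congr (- _); apply: sgnz_odd; have := congr1 (GRing.mul q) en; lia.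
  by have := congr1 (GRing.mul q) en; lia.
Defined.

(** A cocycle g kills boundaries, which are all the cocycles of V. So dv |-> g v is well defined on
    boundaries, and its extension to a character is, up to sign, a primitive of g. *)
Lemma Dual_acyclic : acyclic V -> acyclic Dual.
Proof.
move=> /acyclicE aV; apply/acyclicE => n g cg.
have e : n - 1 + 1 = n := subrK 1 n.
have en : - n + n = 0 := addNr n.
have e1 : - n + 1 + (n - 1) = 0 by lia.
pose S (w : V (- n + 1)) (y : QZ) := exists v : V (- n), cx_d erefl v = w /\ du g en v = y.
have [||y|h hB hS] := @divisible_ext QZ QZ_div _ S.
- by exists 0; rewrite cx_d0 (morphB0 (du_B g _)).
- move=> x y x' y' [v [<- <-]] [v' [<- <-]]; exists (v - v').
  by rewrite cx_dB du_B.
- move=> [v [cv <-]].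
  have e2 : - n - 1 + 1 = - n := subrK 1 (- n).
  have /aV/(bdryE e2)[w <-] := cv.
  have e3 : - n - 1 + (n + 1) = 0 by lia.
  have := congr1 (fun g' : Dual (n + 1) => du g' e3 w) cg.
  rewrite /= => /eqP; rewrite oppr_eq0 => /eqP/sgnz_inj.
  by rewrite (du_irr g _ en e2) tr_d (eq_irrelevance (etrans _ _) e2).
have j_n j : j + (n - 1) = 0 -> j = - n + 1 by lia.
have hdB j (e' : j + (n - 1) = 0) :
    {morph (fun v : V j => - sgnz (n - 1) (h (tr (j_n j e') v))) : x y / x - y}.
  by move=> x y; rewrite trB hB sgnzB opprD.
apply/(bdryE e); exists (DualDeg hdB); apply: dual_eq => j e' v /=.
rewrite sgnzN opprK sgnzK tr_d.
have ej : j = - n by lia.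
subst j; rewrite (eq_irrelevance (etrans _ _) erefl) (hS _ (du g en v)); last by exists v.
by rewrite (eq_irrelevance e' en).
Qed.

End CharacterDual.

(* A universal balanced pairing on [P x V], with [P] K-projective and [V]
   acyclic, has acyclic target: a character [chi] of the target that vanishes on
   boundaries is a cocycle in [Hom(P, Dual V)], hence a boundary. *)
Lemma Kproj_flat (A : cdgRing) (P V : dgModule A) (E : complex)
    (mu : forall k, bal P V k (E k)) :
  K_projective P -> acyclic V ->
  (forall k l (ek : k + 1 = l) i j (e : i + j = k) p v,
     cx_d ek (mu k _ _ e p v) = bl (bal_d ek (mu l)) e p v) ->
  (forall k (g : E k -> QZ), {morph g : x y / x - y} ->
     (forall i j (e : i + j = k) p v, g (mu k _ _ e p v) = 0) -> forall x, g x = 0) ->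
  (forall k (b : bal P V k QZ), exists2 g : E k -> QZ, {morph g : x y / x - y} &
     forall i j (e : i + j = k) p v, g (mu k _ _ e p v) = b _ _ e p v) ->
  acyclic E.
Proof.
move=> /KprojE KP aV mu_d spn uni; apply/acyclicE => k x cx.
apply: contrapT => nb.
have [g [gB g0 gx]] := QZ_separates (bdry0 E k) (@bdryB E k) nb.
have cdeg (i n j : int) : i - k = n -> j + n = 0 -> i + j = k by lia.
have FB i n (e : i + - k = n) (p : P i) j (e' : j + n = 0) :
    {morph (fun v : V j => g (mu k _ _ (cdeg i n j e e') p v)) : x y / x - y}.
  by move=> u v; rewrite bl_Br gB.
pose F0 i n (e : i + - k = n) (p : P i) : Dual V n := DualDeg (FB i n e p).
have [F FE] : exists F : hom_deg P (Dual V) (- k), forall i n e p, hd_fun F e p = F0 i n e p.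
  unshelve eexists (@HomDeg A P (Dual V) (- k) F0 _ _) => //.
  - by move=> i n e p p'; apply: dual_eq => j e' v /=; rewrite bl_Bl gB.
  - move=> q i qi n m e1 e2 e3 e4 a p; apply: dual_eq => j e5 v; rewrite du_sgn /=.
    have e6 : i + (q + j) = k by lia.
    rewrite (bl_act (mu k) e1 (erefl (q + j)) _ e6) (sgnz_morph gB) sgnzD.
    rewrite (eq_irrelevance e6 (cdeg _ _ _ e3 (du_act_e e4 e5))).
    by apply: sgnz_odd; rewrite -e3; lia.
have cF : hclosed F.
  apply/hclosedP => i n n' i' e1 e2 e3 e4 p; rewrite !FE; apply: dual_eq => j e5 v.
  rewrite du_sgn /=; subst i'.
  have e6 : i + j = k - 1 by lia.
  have := g0 _ (bdry_d (subrK 1 k) (mu _ _ _ e6 p v)); rewrite mu_d /= (morphBD gB).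
  rewrite (sgnz_morph gB) => /eqP; rewrite addr_eq0 => /eqP h.
  rewrite (eq_irrelevance (cdeg _ _ _ e4 e5) (td1 (subrK 1 k) e6)) h.
  rewrite (eq_irrelevance (cdeg _ _ _ e1 (du_d_e e2 e5)) (td2 (subrK 1 k) e6)).
  by rewrite sgnzN sgnzD; congr (- _); apply: sgnz_odd; rewrite -e1; lia.
have /(KP _ (Dual_acyclic aV))/(hbdryE (subrK 1 (- k)))[G dG] := cF.
have bdeg (i j : int) : i + j = k + 1 -> j + (i + (- k - 1)) = 0 by lia.
have [b bE] : exists b : bal P V (k + 1) QZ, forall i j (e : i + j = k + 1) p v,
    b _ _ e p v = du (hd_fun G (erefl (i + (- k - 1))) p : dual_deg V _) (bdeg _ _ e) v.
  unshelve eexists (@Bal A P V (k + 1) QZ (fun i j e p v =>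
    du (hd_fun G (erefl (i + (- k - 1))) p : dual_deg V _) (bdeg _ _ e) v) _ _ _) => //.
  - by move=> i j e p p' v /=; rewrite hd_B.
  - by move=> i j e p v v' /=; rewrite du_B.
  - move=> q i j qi qj e1 e2 e3 e4 a p v /=.
    have e5 : q + (i + (- k - 1)) = qi + (- k - 1) by lia.
    rewrite (hd_act G e1 erefl erefl e5) du_sgn /= sgnzD.
    have e6 : q + j = qj by [].
    rewrite (du_irr _ _ (bdeg _ _ e4) e6) tr_act.
    rewrite (eq_irrelevance (etrans _ e6) e2).
    by apply: sgnz_odd; lia.
(* The primitive G of F is a balanced pairing of degree k + 1, hence a character h. The equation dG
   = F says that g is h d up to sign, so g vanishes at the cocycle x. *)
have [h hB hE] := uni _ b.
apply: gx.
suff key : forall z : E k, g z + sgnz (k + 1) (h (cx_d (erefl (k + 1)) z)) = 0.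
  by have := key x; rewrite [cx_d _ x]cx (morphB0 hB) sgnz0 addr0.
apply: spn.
  by move=> u v; rewrite gB cx_dB hB sgnzB opprD addrACA.
move=> i j e p v; rewrite mu_d /= (morphBD hB) (sgnz_morph hB) !hE !bE.
have e1 : j + (i - k) = 0 by lia.
have := congr1 (fun F' : hom_deg P (Dual V) (- k) => du (hd_fun F' (erefl (i - k)) p : dual_deg V _) e1 v) dG.
rewrite FE.
have e2 : i + (- k - 1) + 1 = i - k by lia.
have e3 : i + 1 + (- k - 1) = i - k by lia.
rewrite (hd_dE (subrK 1 (- k)) G (erefl (i - k)) (erefl (i + (- k - 1))) e2 (erefl (i + 1)) e3).
rewrite -[du (_ - _) _ _]/(du (cx_d (c := Dual V) e2 (hd_fun G (erefl (i + (- k - 1))) p)) e1 v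
  - du (sgnz (- k - 1) (hd_fun G e3 (cx_d (erefl (i + 1)) p) : dual_deg V _)) e1 v).
rewrite du_sgn /= => hd.
rewrite (eq_irrelevance (cdeg _ _ _ erefl e1) e) in hd.
rewrite -hd.
have Girr m m' (g1 : i + 1 + (- k - 1) = m) (g2 : i + 1 + (- k - 1) = m')
    (d1 : j + m = 0) (d2 : j + m' = 0) y :
    du (hd_fun G g1 y : dual_deg V m) d1 v = du (hd_fun G g2 y : dual_deg V m') d2 v.
  by subst m m'; rewrite (eq_irrelevance d1 d2).
rewrite (Girr _ _ e3 erefl e1 (bdeg _ _ (td1 erefl e))).
rewrite (eq_irrelevance (du_d_e e2 e1) (bdeg _ _ (td2 erefl e))).
rewrite sgnzDr sgnzD.
rewrite (@sgnz_odd _ (k + 1 + i) (i + (- k - 1))); last by lia.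
rewrite (@sgnz_odd _ (k + 1) (- k - 1)); last by lia.
by rewrite addrA subrK addNr.
Qed.

(** * The five lemma, exchange of variables and cone truncation *)

Section FiveLemma.

(** The connecting map is well defined: a lift x of a boundary differs from an element of the
    subcomplex by a boundary. *)
Lemma ses_sub_bdry (Y E X : complex) (sb sa : int -> int) (u v b a : int)
    (si : forall k, Y (sb k) -> E k) (sp : forall k, E k -> X (sa k))
    (s : is_ses u v b a si sp) k l (e : k + 1 = l) (x : E k) (y : Y (sb l)) :
  cx_d e x = si l y -> bdry (sp k x) -> bdry y.
Proof.
have e0 : k - 1 + 1 = k := subrK 1 k.
move=> dx /(bdryE (ses_ea s e0))[c dc].
have [w wc] := sp_surj s (sgnz v c).
have /(ses_ex s)[y' xy] : sp k (x - cx_d e0 w) = 0.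
  apply/(@sgnz_inj _ v); rewrite (spB s) sgnzB -(sp_d s e0 (ses_ea s e0)) wc cx_d_sgn dc.
  by rewrite subrr.
have : si l y = si l (sgnz u (cx_d (ses_eb s e) y')).
  by rewrite -(si_d s e) -xy cx_dB cx_dd subr0 dx.
move/eqP; rewrite -subr_eq0 -(siB s) => /eqP/(si_inj s)/eqP; rewrite subr_eq0 => /eqP ->.
by rewrite -cx_d_sgn; exact: bdry_d.
Qed.

Variables (Y E X Y' E' X' : complex) (sb sa : int -> int) (u v b a : int).
Variables (si : forall k, Y (sb k) -> E k) (sp : forall k, E k -> X (sa k)).
Variables (si' : forall k, Y' (sb k) -> E' k) (sp' : forall k, E' k -> X' (sa k)).
Hypotheses (s : is_ses u v b a si sp) (s' : is_ses u v b a si' sp').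
Variables (fy : cxMap Y Y') (fe : cxMap E E') (fx : cxMap X X').
Hypothesis h1 : forall k (y : Y (sb k)), fe k (si y) = si' (fy _ y).
Hypothesis h2 : forall k (x : E k), sp' (fe k x) = fx _ (sp x).

Lemma ses_five : is_qis fy -> is_qis fx -> is_qis fe.
Proof.
move=> /is_qisE qy /is_qisE qx; apply/is_qisE => i.
have e : i - 1 + 1 = i := subrK 1 i.
split=> [x cx bx|y cy].
  have bsx : bdry (sp x).
    apply: (qx _).1; first exact: (sp_closed s).
    by rewrite -h2; exact: (sp_bdry s').
  have [w cw bw] := ses_mid s cx bsx.
  apply/(bdry_sub bw).
  have /(bdryE e)[e' de'] : bdry (si' (fy _ w)).
    have := cm_bdry fe bw; rewrite cm_B h1 => bw'.
    by apply/(bdry_sub bw').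
  have ce' : cocyc (sp' e').
    by apply/(closedE (ses_ea s e)); rewrite (sp_d s' e) de' (sp_si s') sgnz0.
  have [z cz bz] := (qx _).2 _ ce'.
  have [x1 [w0 [sx1 dx1 cw0]]] := ses_conn s e cz.
  have : bdry (fy _ (w - w0)).
    apply: (ses_sub_bdry s' (e := e) (x := e' - fe _ x1)).
      by rewrite cx_dB de' -cm_d dx1 h1 cm_B (siB s').
    by rewrite (spB s') h2 sx1.
  move/((qy _).1 _ (closedB cw cw0))/(si_bdry s); rewrite (siB s) => h.
  by apply/(bdry_sub h); rewrite -dx1; exact: bdry_d.
have [z cz bz] := (qx _).2 _ (sp_closed s' cy).
have [x1 [w0 [sx1 dx1 cw0]]] := ses_conn s (erefl (i + 1)) cz.
have /bdryN : bdry (- fy _ w0).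
  apply: (ses_sub_bdry s' (e := erefl (i + 1)) (x := y - fe _ x1)).
    by rewrite cx_dB [cx_d _ y]cy -cm_d dx1 h1 sub0r (morphN (siB s' _)).
  by rewrite (spB s') h2 sx1.
rewrite opprK => /((qy _).1 _ cw0)/(bdryE (ses_eb s (erefl (i + 1))))[w1 dw1].
pose x2 := x1 - si (sgnz u w1).
have cx2 : cocyc x2.
  rewrite /cocyc cx_dB dx1 (si_d s _ (ses_eb s (erefl (i + 1)))).
  by rewrite cx_d_sgn sgnzK dw1 subrr.
have c3 := closedB cy (cm_closed fe cx2).
have b3 : bdry (sp' (y - fe _ x2)).
  by rewrite (spB s') h2 (spB s) (sp_si s) subr0 sx1.
have [w2 cw2 bw2] := ses_mid s' c3 b3.
have [w3 cw3 bw3] := (qy _).2 _ cw2.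
exists (x2 + si w3).
  by apply: closedD => //; apply/(si_closed s).
have := bdryD bw2 (si_bdry s' bw3).
by rewrite (siB s') addrA subrK cm_D h1 opprD addrA.
Qed.

End FiveLemma.

Section Swap.
Variable A : cdgRing.

Lemma swap_e (i j n m l : int) : j + n = m -> i + m = l -> j + (i + n) = l.
Proof. lia. Qed.

Section SwapDef.
Variables (M N Q : dgModule A) (n : int) (F : hom_deg M (HomDG N Q) n).

Definition swap_val j m (e : j + n = m) (y : N j) : hom_deg M Q m.
Proof.
apply: (@HomDeg A M Q m (fun i l (e1 : i + m = l) x =>
  sgnz (i * j) (hd_fun (hd_fun F (erefl (i + n)) x : hom_deg N Q (i + n)) (swap_e e e1) y))).
- by move=> i l e1 x x'; rewrite hd_B hd_funB sgnzB.
- move=> q i qi k l e1 e2 e3 e4 a x.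
  have e5 : q + (i + n) = qi + n by lia.
  rewrite (hd_act F e1 erefl erefl e5) hd_fun_sgnz.
  have e6 : j + (i + n) = k by lia.
  rewrite [X in sgnz _ (sgnz _ X)](hd_scaleE e5 a _ _ e6 e4).
  rewrite (eq_irrelevance (swap_e e e3) e6) dm_act_sgn !sgnzD.
  by apply: sgnz_odd; rewrite -e1 -e; lia.
Defined.

Definition swap : hom_deg N (HomDG M Q) n.
Proof.
apply: (@HomDeg A N (HomDG M Q) n swap_val).
- by move=> j m e y y'; apply: hom_deg_eq => i l e1 x /=; rewrite hd_B sgnzB.
- move=> q j qj m l e1 e2 e3 e4 a y; apply: hom_deg_eq => i k e5 x.
  have e6 : q + (i + m) = k by lia.
  rewrite hd_fun_sgnz [X in _ = sgnz _ X](hd_scaleE e4 a _ _ (erefl (i + m)) e6) /=.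
  rewrite (hd_act (hd_fun F erefl x : hom_deg N Q _) e1 _ (swap_e e3 (erefl (i + m))) e6).
  rewrite dm_act_sgn !sgnzD; apply: sgnz_odd; rewrite -e1; lia.
Defined.

End SwapDef.

Variables (M N Q : dgModule A).

Lemma hdhd_irr P n (F : hom_deg P (HomDG N Q) n) i m m' (e : i + n = m)
    (e' : i + n = m') j l (g : j + m = l) (g' : j + m' = l) p v :
  hd_fun (hd_fun F e p : hom_deg N Q m) g v = hd_fun (hd_fun F e' p : hom_deg N Q m') g' v.
Proof. by subst m m'; congr hd_fun; apply: eq_irrelevance. Qed.

Lemma swapE n (F : hom_deg M (HomDG N Q) n) j m (e : j + n = m) y i l (e1 : i + m = l) x
    m' (e2 : i + n = m') (e3 : j + m' = l) :
  hd_fun (hd_fun (swap F) e y : hom_deg M Q m) e1 x =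
  sgnz (i * j) (hd_fun (hd_fun F e2 x : hom_deg N Q m') e3 y).
Proof. by rewrite /= (hdhd_irr F erefl e2 _ e3). Qed.

Lemma swap_d n n' (e : n + 1 = n') (F : hom_deg M (HomDG N Q) n) :
  hd_d e (swap F) = swap (hd_d e F).
Proof.
apply: hom_deg_eq => j m ej y; apply: hom_deg_eq => i l ei x.
have e1 : j + n + 1 = m by lia.
have e2 : j + 1 + n = m by lia.
have e3 : i + (j + n) + 1 = l by lia.
have e4 : i + 1 + (j + n) = l by lia.
have e5 : i + n + 1 = i + n' by lia.
have e6 : i + 1 + n = i + n' by lia.
have e7 : j + (i + n') = l by lia.
have e8 : j + (i + n) = i + (j + n) by lia.
have e9 : j + 1 + (i + n) = l by lia.
rewrite (swapE _ _ _ _ _ (erefl (i + n')) e7).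
rewrite (hd_dE e (swap F) ej erefl e1 erefl e2) (hd_dE e F _ erefl e5 erefl e6).
rewrite -[LHS]/(hd_fun (hd_d e1 (hd_fun (swap F) erefl y : hom_deg M Q _)) ei x -
  hd_fun (sgnz n (hd_fun (swap F) e2 (cx_d erefl y) : hom_deg M Q _)) ei x).
rewrite -[hd_fun (_ - _) e7 y]/(hd_fun (hd_d e5 (hd_fun F erefl x : hom_deg N Q _)) e7 y -
  hd_fun (sgnz n (hd_fun F e6 (cx_d erefl x) : hom_deg N Q _)) e7 y).
rewrite (hd_dE e1 _ _ erefl e3 erefl e4) (hd_dE e5 _ _ e8 e3 erefl e9) !hd_fun_sgnz.
rewrite (swapE _ _ _ _ _ erefl e8) (swapE _ _ _ _ _ e6 e7) (swapE _ _ _ _ _ erefl e9).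
rewrite cx_d_sgn !(sgnzB, sgnzD) addrAC; congr (_ - _ - _); apply: sgnz_odd; lia.
Qed.

End Swap.

Lemma swapK (A : cdgRing) (M N Q : dgModule A) n (F : hom_deg M (HomDG N Q) n) :
  swap (swap F) = F.
Proof.
apply: hom_deg_eq => i m e x; apply: hom_deg_eq => j l e1 y.
have e2 : i + (j + n) = l by lia.
rewrite (swapE _ _ _ _ _ (erefl (j + n)) e2) (swapE _ _ _ _ _ e e1).
by rewrite mulrC sgnzK.
Qed.

Lemma swap_closed (A : cdgRing) (M N Q : dgModule A) n (F : hom_deg M (HomDG N Q) n) :
  hclosed F -> hclosed (swap F).
Proof.
move=> cF; rewrite /hclosed /cocyc /= swap_d [hd_d _ F]cF.
apply: hom_deg_eq => i m e x; apply: hom_deg_eq => j l e1 y /=; exact: sgnz0.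
Qed.

Lemma swap_bdry (A : cdgRing) (M N Q : dgModule A) n (F : hom_deg M (HomDG N Q) n) :
  hbdry (swap F) <-> hbdry F.
Proof.
split=> /(hbdryE (subrK 1 n))[G dG]; apply/(hbdryE (subrK 1 n)); exists (swap G).
  by rewrite swap_d dG swapK.
by rewrite swap_d dG.
Qed.

Lemma swap_van (A : cdgRing) (M N Q : dgModule A) n :
  hvan M (HomDG N Q) n -> hvan N (HomDG M Q) n.
Proof.
move=> h F cF; rewrite -[F]swapK; apply/swap_bdry; apply: h; exact: swap_closed.
Qed.

Section FreeRankOne.
Variables (B : cdgRing) (N : dgModule B).

Definition el i (y : N i) : hom_deg (dg_self B) N i.
Proof.
apply: (@HomDeg B (dg_self B) N i (fun p q e b => sgnz (i * p) (dm_act e b y))).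
- by move=> p q e b b'; rewrite dm_actBl sgnzB.
- move=> q p qp k l e e1 e2 e3 a b.
  rewrite (dm_actA e e1 e2 e3) dm_act_sgn sgnzD; congr sgnz.
  by rewrite -e; lia.
Defined.

Lemma el_d i i' (e : i + 1 = i') (y : N i) : hd_d e (el y) = el (cx_d e y).
Proof.
apply: hom_deg_eq => p q e' b; subst i'.
have e1 : p + i + 1 = q by lia.
have e2 : p + 1 + i = q by lia.
rewrite (hd_dE erefl (el y) e' erefl e1 (erefl (p + 1)) e2) /= cx_d_sgn.
rewrite (dm_leibniz _ erefl erefl _ e2 e') sgnzDr !sgnzD addrAC.
rewrite (@sgnz_odd _ (i + i * (p + 1)) (i * p)) ?subrr ?add0r; last by lia.
by apply: sgnz_odd; lia.
Qed.

Lemma el_1 i (y : N i) (e : 0 + i = i) : hd_fun (el y) e (cr_one B) = y.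
Proof. by rewrite /= mulr0 sgnz0l dm_act1. Qed.

Lemma elK i (F : hom_deg (dg_self B) N i) (e : 0 + i = i) :
  el (hd_fun F e (cr_one B)) = F.
Proof.
apply: hom_deg_eq => p q e' b /=.
have := hd_act F (addr0 p) e' e e' b (cr_one B : dg_self B 0).
by rewrite -[dm_act (d := dg_self B) _ _ _]/(cr_mul (addr0 p) b (cr_one B)) cr_mulr1 => ->.
Qed.

Definition elm : dgHom N (HomDG (dg_self B) N).
Proof.
unshelve refine (@DgHom B N (HomDG (dg_self B) N) (@CxMap N (HomDG (dg_self B) N) el _ _) _).
- by move=> i x y; apply: hom_deg_eq => p q e b /=; rewrite dm_actBr sgnzB.
- by move=> i j e x; rewrite -el_d.
- move=> q i k e b y; apply: hom_deg_eq => p l e1 c /=.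
  rewrite dm_act_sgn (dm_act_comm _ e (hd_act_subproof e e1) erefl) sgnzD.
  by apply: sgnz_odd; rewrite -e; lia.
Defined.

Lemma hvan_self i : hvan (dg_self B) N i <-> van N i.
Proof.
have e : i - 1 + 1 = i := subrK 1 i.
split=> h x cx.
  have /h/(hbdryE e)[G dG] : hclosed (el x).
    rewrite /hclosed /cocyc /= el_d [cx_d _ x]cx; exact: (cm_0 elm).
  apply/(bdryE e); exists (hd_fun G (add0r _) (cr_one B)).
  by rewrite -[LHS](el_1 _ (add0r i)) -el_d elK dG el_1.
have /h/(bdryE e)[y dy] : cocyc (hd_fun x (add0r i) (cr_one B)).
  rewrite /cocyc -[LHS](el_1 _ (add0r (i + 1))) -el_d elK [hd_d _ x]cx; exact: erefl.
by apply/(hbdryE e); exists (el y); rewrite el_d dy elK.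
Qed.

End FreeRankOne.

Lemma self_proj (B : cdgRing) : K_projective (dg_self B).
Proof. by apply/KprojE => N aN i; apply/hvan_self/(acyclicE N).1. Qed.

Section ConeTruncation.
Variables (A : cdgRing).

Definition cone (M N : dgModule A) (u : dgHom M N) : twist M N :=
  @Twist A M N 0 1 0 (fun k => k + 1) id (fun k => erefl) (fun k => esym (addr0 k))
    (addrC 1 0) (hm u) (hm_closed u).

Variables (M : dgModule A) (n : int).

(* Up to quasi-isomorphism, the quotient truncation of [M] to degrees [>= n]. *)
Definition ctrunc : dgModule A := Tw (cone (sub_inc (trunc_le M (n - 1)))).

Definition ctrunc_map : dgHom M ctrunc.
Proof.
unshelve refine (@DgHom A M ctrunc (@CxMap M ctrunc (fun k x => (0, x) : ctrunc k) _ _) _).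
- by move=> k x y; congr pair; rewrite subr0.
- move=> k l e x; congr pair.
    by rewrite -[RHS]/(sgnz 1 (cx_d _ (0 : SubDG (trunc_le M (n - 1)) _))) cx_d0 sgnz0.
  rewrite -[RHS]/(sgnz 0 (cx_d (t_sb_d (cone (sub_inc (trunc_le M (n - 1)))) e) x -
    hd_fun (hm (sub_inc (trunc_le M (n - 1)))) _ 0)) hd_0 subr0 sgnz0l.
  by congr cx_d; apply: eq_irrelevance.
- move=> j k l e a x; congr pair.
    by rewrite -[RHS]/(sgnz _ (dm_act _ a (0 : SubDG (trunc_le M (n - 1)) _))) dm_act0r sgnz0.
  by rewrite /= mul0r sgnz0l; congr dm_act; apply: eq_irrelevance.
Defined.

Lemma ctrunc_closed k (w : ctrunc k) : cocyc w -> cocyc w.1 /\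
  cx_d (t_sb_d (cone (sub_inc (trunc_le M (n - 1)))) (erefl (k + 1))) w.2 = sub_val w.1.
Proof.
case: w => t x h; have h1 := congr1 fst h; have h2 := congr1 snd h.
split; first by apply/(closedE (t_sa_d (cone (sub_inc (trunc_le M (n - 1)))) (erefl (k + 1))));
  exact: sgnz_inj h1.
apply/eqP; rewrite -subr_eq0; apply/eqP; apply: (@sgnz_inj _ 0); move: h2.
rewrite /= => h2; rewrite -[RHS]h2; congr (sgnz _ (_ - _)).
by rewrite tr_id.
Qed.

Lemma ctrunc_van k : k < n -> van ctrunc k.
Proof.
move=> kn [t x] /ctrunc_closed[/= ct dx].
have St : trunc_le M (n - 1) k x.
  split=> [h|h]; first by exfalso; lia.
  have [t0 _] := subP t.
  apply/(closedE (t_sb_d (cone (sub_inc (trunc_le M (n - 1)))) (erefl (k + 1)))).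
  by rewrite dx t0 //; change (n - 1 < k + 1); lia.
have e : k - 1 + 1 = k := subrK 1 k.
have e' : k = k - 1 + 1 by rewrite subrK.
apply/(bdryE e); exists (- tr e' (mksub St : SubDG (trunc_le M (n - 1)) k), 0).
congr pair.
  rewrite -[LHS]/(sgnz 1 (cx_d _ (- tr e' (mksub St : SubDG (trunc_le M (n - 1)) k)))).
  rewrite cx_dN d_tr sgnzN [sgnz 1 _]sgnzE opprK; apply: val_inj => /=.
  by rewrite -dx; congr cx_d; apply: eq_irrelevance.
rewrite -[LHS]/(sgnz 0 (cx_d _ 0 - hd_fun (hm (sub_inc (trunc_le M (n - 1)))) _
   (- tr e' (mksub St : SubDG (trunc_le M (n - 1)) k)))).
by rewrite cx_d0 sub0r hd_N opprK sgnz0l hd_tr /= tr_id.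
Qed.

Lemma ctrunc_inj k (x : M k) : n <= k -> cocyc x -> bdry (ctrunc_map k x) -> bdry x.
Proof.
move=> nk cx; have e : k - 1 + 1 = k := subrK 1 k.
move=> /(bdryE e)[[t y]] h.
have [t0 _] := subP t.
have {}t0 : t = 0 by apply: val_inj; apply: t0; change (n - 1 < k - 1 + 1); lia.
have := congr1 snd h; rewrite t0 => h2.
have {}h2 : sgnz 0 (cx_d (t_sb_d (cone (sub_inc (trunc_le M (n - 1)))) e) y -
  hd_fun (hm (sub_inc (trunc_le M (n - 1)))) (t_sf_d (cone (sub_inc (trunc_le M (n - 1)))) e) 0) = x := h2.
by rewrite -h2 hd_0 subr0 sgnz0l; exact: bdry_d.
Qed.

End ConeTruncation.

Section Restriction.
Variables (A B : cdgRing) (f : cdgHom A B).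
Implicit Types M N Q : dgModule B.

Definition rest_hd M N i (F : hom_deg M N i) : hom_deg (rest f M) (rest f N) i.
Proof.
apply: (@HomDeg A (rest f M) (rest f N) i (fun j k e x => hd_fun F e x)).
- by move=> j k e x y; rewrite hd_B.
- by move=> p j pj k l e e1 e2 e3 a x; exact: (hd_act F e e1 e2 e3 (f p a) x).
Defined.

Lemma rest_hd_d M N i j (e : i + 1 = j) (F : hom_deg M N i) :
  hd_d e (rest_hd F) = rest_hd (hd_d e F).
Proof. exact: hom_deg_eq. Qed.

Lemma rest_hd_closed M N i (F : hom_deg M N i) : hclosed F -> hclosed (rest_hd F).
Proof. by move=> cF; rewrite /hclosed /cocyc /= rest_hd_d [hd_d _ F]cF; exact: hom_deg_eq. Qed.

Lemma rest_hd_bdry M N i (F : hom_deg M N i) : hbdry F -> hbdry (rest_hd F).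
Proof.
move=> /(hbdryE (subrK 1 i))[G <-]; apply/(hbdryE (subrK 1 i)).
by exists (rest_hd G); rewrite rest_hd_d.
Qed.

Lemma rest_hdB M N i (F G : hom_deg M N i) : rest_hd (F - G) = rest_hd F - rest_hd G.
Proof. exact: hom_deg_eq. Qed.

Lemma rest_hm M N (u : dgHom M N) : hm (rest_hom f u) = rest_hd (hm u).
Proof. exact: hom_deg_eq. Qed.

End Restriction.

Section AdjunctionClosed.
Variables (A B : cdgRing) (f : cdgHom A B) (P : dgModule A) (V Q : dgModule B) (n : int).

Lemma adjL_closed (F : hom_deg P (rest f (HomDG V Q)) n) : hclosed F -> hclosed (adjL F).
Proof.
move=> cF; rewrite /hclosed /cocyc /= adjL_d [hd_d _ F]cF.
apply: hom_deg_eq => k l e x; move: x.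
by apply: tens_ext => [x y|x y|i j e1 p v]; rewrite ?hd_B ?subrr ?adjL_tens.
Qed.

Lemma adjR_closed (F : hom_deg (Tens f P V) Q n) : hclosed F -> hclosed (adjR F).
Proof.
move=> cF; rewrite /hclosed /cocyc /= -[hd_d _ _]adjLK -adjL_d adjRK [hd_d _ F]cF.
by apply: hom_deg_eq => i m e' p; apply: hom_deg_eq.
Qed.

Lemma adjR_bdry (F : hom_deg (Tens f P V) Q n) : hbdry (adjR F) -> hbdry F.
Proof.
move=> /(hbdryE (subrK 1 n))[G dG]; apply/(hbdryE (subrK 1 n)).
by exists (adjL G); rewrite adjL_d dG adjRK.
Qed.

End AdjunctionClosed.

Lemma tr_hom (A : cdgRing) (M N : dgModule A) i i' (e : i = i') (F : HomDG M N i) j k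
    (g : j + i' = k) (g' : j + i = k) x :
  hd_fun (tr e F : hom_deg M N i') g x = hd_fun (F : hom_deg M N i) g' x.
Proof. by subst i'; congr hd_fun; apply: eq_irrelevance. Qed.

(* The counit [eps] of extension of scalars along [f], computed on the
   K-projective resolution of [rest f P]. *)
Section Counit.
Variables (A B : cdgRing) (f : cdgHom A B) (P : dgModule B).

Definition PA : dgModule A := resol (rest f P).
Definition pA : dgHom PA (rest f P) := resol_map (rest f P).
Definition bot : dgModule B := Tens f PA (dg_self B).

Definition tns k i j (e : i + j = k) (p : PA i) (b : B j) : bot k :=
  tens (V := rest f (dg_self B)) e p b.

Lemma PA_proj : K_projective PA. Proof. exact: resol_proj. Qed.
Lemma pA_qis : is_qis pA. Proof. exact: resol_qis. Qed.

Lemma bot_proj : K_projective bot.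
Proof. by apply: (Tens_proj (f := f)); [exact: PA_proj|exact: self_proj]. Qed.

Lemma eps_subproof : hclosed (adjL (hm (dg_comp (rest_hom f (elm P)) pA))).
Proof. exact/adjL_closed/hm_closed. Qed.

Definition eps : dgHom bot P := dgh eps_subproof.

Lemma eps_tns k i j (e : i + j = k) (p : PA i) (b : B j) (e' : j + i = k) :
  eps k (tns e p b) = sgnz (i * j) (dm_act (d := P) e' b (pA i p)).
Proof.
rewrite -[LHS]/(hd_fun (adjL (hm (dg_comp (rest_hom f (elm P)) pA))) (addr0 k) (tns e p b)).
rewrite adjL_tens.
rewrite -[hd_fun _ _ p]/(tr (C := HomDG (dg_self B) P) (hd_add0 erefl) (el (pA i p : P i))).
by rewrite (tr_hom _ _ _ e').
Qed.

Lemma one_closed : @cx_d B 0 (0 + 1) erefl (cr_one B) = 0.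
Proof. exact: cr_nonpos. Qed.

Definition etaP : dgHom PA (rest f bot).
Proof.
unshelve refine (@DgHom A PA (rest f bot) (@CxMap PA (rest f bot)
  (fun i p => tns (addr0 i) p (cr_one B)) _ _) _).
- by move=> i p p'; rewrite /tns !tens_tenb bl_Bl.
- move=> i j e p; subst j.
  rewrite -[RHS]/(@cx_d bot i (i + 1) erefl (tns (addr0 i) p (cr_one B))) Tens_d.
  rewrite [tens (td2 _ _) _ _]tens_tenb [X in bl _ _ _ X]one_closed bl0r sgnz0 addr0.
  by rewrite (eq_irrelevance (td1 _ _) (addr0 (i + 1))).
- move=> q i k e a p.
  rewrite -[RHS]/(dm_act (d := bot) e (f q a) (tns (addr0 i) p (cr_one B))) Tens_act.
  rewrite [LHS]tens_tenb.
  have e1 : i + (q + 0) = k by rewrite addr0 addrC.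
  rewrite (bl_act _ e (erefl (q + 0)) _ e1) (eq_irrelevance e1 (ta1 e (addr0 i))).
  by [].
Defined.

Lemma eps_etaP i p : eps i (etaP i p) = pA i p.
Proof. by rewrite (eps_tns _ _ _ (add0r i)) mulr0 sgnz0l dm_act1. Qed.

Section Hat.
Variables (Q : dgModule B) (j : int).

(** The adjoint of F under Hom_A(PA, Q) = Hom_B(bot, Q), with Q read as Hom_B(B, Q) through [elm].
    The inverse [unhat] is restriction along the unit [etaP]. *)
Definition hat (F : hom_deg PA (rest f Q) j) : hom_deg bot Q j :=
  adjL (hpost PA (rest_hom f (elm Q)) j F).

Definition unhat (G : hom_deg bot Q j) : hom_deg PA (rest f Q) j :=
  hcomp (add0r j) (rest_hd f G) (hm etaP).

Lemma hat_tns F k l (e : k + j = l) i m (e1 : i + m = k) (p : PA i) (b : B m)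
    n (e2 : i + j = n) (e3 : m + n = l) :
  hd_fun (hat F) e (tns e1 p b) = sgnz (n * m) (dm_act (d := Q) e3 b (hd_fun F e2 p)).
Proof.
rewrite adjL_tens -[LHS]/(sgnz ((i + j) * m) (dm_act (d := Q) (adj_e e1 e) b (hd_fun F erefl p))).
by subst n; congr (sgnz _ (dm_act _ _ _)); apply: eq_irrelevance.
Qed.

Lemma unhatE G i k (e : i + j = k) (p : PA i) : hd_fun (unhat G) e p = hd_fun G e (etaP i p).
Proof.
rewrite (hcompE _ _ _ _ (addr0 i) e) hmE.
by [].
Qed.

Lemma hatK F : unhat (hat F) = F.
Proof.
apply: hom_deg_eq => i k e p; rewrite unhatE (hat_tns F _ _ _ _ e (add0r k)).
by rewrite mulr0 sgnz0l dm_act1.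
Qed.

End Hat.

Lemma hat_d Q j j' (e : j + 1 = j') (F : hom_deg PA (rest f Q) j) :
  hd_d e (hat F) = hat (hd_d e F).
Proof. by rewrite /hat adjL_d; congr adjL; rewrite -[LHS](@cm_d _ _ (hpost PA (rest_hom f (elm Q)))). Qed.

Lemma hat_closed Q j (F : hom_deg PA (rest f Q) j) : hclosed F -> hclosed (hat F).
Proof.
move=> cF; apply: adjL_closed; exact: (cm_closed (hpost PA (rest_hom f (elm Q)))).
Qed.

Lemma hat_bdry Q j (F : hom_deg PA (rest f Q) j) : hbdry F -> hbdry (hat F).
Proof.
move=> /(hbdryE (subrK 1 j))[G <-]; apply/(hbdryE (subrK 1 j)).
by exists (hat G); rewrite hat_d.
Qed.

(** Restriction of scalars followed by adjunction is composition with the counit. This is what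
    reduces the comparison of Ext over [A] and [B] to the fibre of [eps]. *)
Lemma hat_eps Q j (F : hom_deg P Q j) :
  hat (hcomp (add0r j) (rest_hd f F) (hm pA)) = hcomp (add0r j) F (hm eps).
Proof.
apply: hom_deg_eq => k l e x; move: x.
apply: tens_ext => [x y|x y|i m e1 p b]; rewrite ?hd_B //.
have e3 : m + (i + j) = l by lia.
have e4 : m + i = k by rewrite addrC.
rewrite (hat_tns _ _ _ _ _ erefl e3).
rewrite (hcompE _ _ _ _ (addr0 i) erefl) hmE (hcompE _ _ _ _ (addr0 k) e) hmE.
rewrite (eps_tns _ _ _ e4) hd_sgn.
have := hd_act F e4 e erefl e3 b (pA i p : P i) => ->.
by rewrite sgnzD; apply: sgnz_odd; lia.
Qed.

End Counit.

(** * Extension of scalars *)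

Definition cdg_id (A : cdgRing) : cdgHom A A.
Proof. by apply: (@CdgHom A A (@CxMap A A (fun _ x => x) _ _)). Defined.

Section TwistPairs.
Variables (A : cdgRing) (P N : dgModule A) (t : twist P N) (k : int).

Definition tw_inl (x : P (t_sa t k)) : Tw t k := (x, 0).
Definition tw_inr (y : N (t_sb t k)) : Tw t k := (0, y).

Lemma tw_eta (z : Tw t k) : z = tw_inl z.1 + tw_inr z.2.
Proof. by case: z => x y; congr pair; rewrite /= ?addr0 ?add0r. Qed.

Lemma tw_inlB : {morph tw_inl : x y / x - y}.
Proof. by move=> x y; congr pair; rewrite subrr. Qed.

Lemma tw_inrB : {morph tw_inr : x y / x - y}.
Proof. by move=> x y; congr pair; rewrite subrr. Qed.

Lemma tw_B1 (z z' : Tw t k) : (z - z').1 = z.1 - z'.1. Proof. by []. Qed.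
Lemma tw_B2 (z z' : Tw t k) : (z - z').2 = z.2 - z'.2. Proof. by []. Qed.

Lemma tr_tw l (e : k = l) (z : Tw t k) :
  tr e z = ((tr (congr1 (t_sa t) e) z.1, tr (congr1 (t_sb t) e) z.2) : Tw t l).
Proof. by subst l; rewrite !tr_id -surjective_pairing. Qed.

End TwistPairs.

Lemma fib_d1 (A : cdgRing) (M N : dgModule A) (u : dgHom M N) k l (e : k + 1 = l)
    (z : Tw (fib (hm_closed u)) k) : (cx_d e z).1 = cx_d (c := M) e z.1.
Proof. by rewrite /= sgnz0l; congr cx_d; apply: eq_irrelevance. Qed.

Lemma fib_d2 (A : cdgRing) (M N : dgModule A) (u : dgHom M N) k l (e : k + 1 = l)
    (e2 : k + (0 - 1) + 1 = l + (0 - 1)) (e3 : k = l + (0 - 1))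
    (z : Tw (fib (hm_closed u)) k) :
  (cx_d e z).2 = - (cx_d (c := N) e2 z.2 - tr e3 (u k z.1)).
Proof.
rewrite /= [LHS]sgnzE; congr (- (_ - _)); first by congr cx_d; apply: eq_irrelevance.
by congr tr; apply: eq_irrelevance.
Qed.

(** * A K-projective model over [A] of the extension of scalars *)

Section Upsilon.
Variables (A B : cdgRing) (f : cdgHom A B) (P : dgModule B).

Notation PA := (PA f P).
Notation bot := (bot f P).
Notation BA := (rest f (dg_self B)).

Definition Bt : dgModule A := resol BA.
Definition bt : dgHom Bt BA := resol_map BA.

(** The restriction of [bot] to [A] is not K-projective in general, since B is not; resolving B over
    [A] repairs this. *)
Definition U : dgModule A := Tens (cdg_id A) PA Bt.

Definition tnU k i j (e : i + j = k) (p : PA i) (x : Bt j) : U k :=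
  tens (V := rest (cdg_id A) Bt) e p x.

Lemma U_proj : K_projective U.
Proof. by apply: (Tens_proj (f := cdg_id A)); exact: resol_proj. Qed.

Definition ups_bal k : bal PA (rest (cdg_id A) Bt) k (bot k).
Proof.
apply: (@Bal A PA (rest (cdg_id A) Bt) k (bot k) (fun i j e p x => tns e p (bt j x))).
- by move=> i j e p p' x; rewrite /tns !tens_tenb bl_Bl.
- by move=> i j e p x x'; rewrite /tns cm_B !tens_tenb bl_Br.
- move=> q i j qi qj e1 e2 e3 e4 a p x.
  rewrite -[dm_act (d := rest (cdg_id A) Bt) e2 a x]/(dm_act (d := Bt) e2 a x) dh_act.
  by rewrite /tns !tens_tenb (bl_act _ e1 e2 e3 e4).
Defined.

Lemma U_d k i j (e1 : i + j = k) (p : PA i) (x : Bt j) :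
  cx_d (erefl (k + 1)) (tnU e1 p x) =
  tnU (td1 erefl e1) (cx_d erefl p) x + sgnz i (tnU (td2 erefl e1) p (cx_d erefl x)).
Proof. exact: (@Tens_d A A (cdg_id A)). Qed.

Lemma bot_d k i j (e1 : i + j = k) (p : PA i) (b : B j) :
  cx_d (erefl (k + 1)) (tns e1 p b) =
  tns (td1 erefl e1) (cx_d erefl p) b + sgnz i (tns (td2 erefl e1) p (cx_d erefl b)).
Proof. exact: (@Tens_d A B f). Qed.

Lemma bot_dE k l (ek : k + 1 = l) i j (e1 : i + j = k) (p : PA i) (b : B j)
    (f1 : i + 1 + j = l) j' (ej : j + 1 = j') (f2 : i + j' = l) :
  cx_d ek (tns e1 p b) = tns f1 (cx_d erefl p) b + sgnz i (tns f2 p (cx_d ej b)).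
Proof.
by subst l j'; rewrite bot_d (eq_irrelevance (td1 _ _) f1) (eq_irrelevance (td2 _ _) f2).
Qed.

Definition ups_fun k (x : U k) : bot k := tlift (ups_bal k) x.

Lemma ups_tnU k i j (e : i + j = k) (p : PA i) (x : Bt j) :
  ups_fun (tnU e p x) = tns e p (bt j x).
Proof. exact: tlift_tens. Qed.

Lemma ups_funB k : {morph @ups_fun k : x y / x - y}.
Proof. exact: tliftB. Qed.

Lemma ups_d k l (e : k + 1 = l) (x : U k) :
  ups_fun (cx_d e x) = cx_d (c := bot) e (ups_fun x).
Proof.
subst l; move: x; apply: tens_ext => [x y|x y|i j e1 p x].
- by rewrite (@cx_dB U) ups_funB.
- by rewrite ups_funB cx_dB.
rewrite -[tens e1 p x]/(tnU e1 p x) U_d (morphBD (@ups_funB _)) (sgnz_morph (@ups_funB _)).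
rewrite !ups_tnU bot_d.
rewrite -[tns (td2 _ _) _ _]/(tns (td2 erefl e1) p (cx_d (c := rest f (dg_self B)) erefl (bt j x))).
by rewrite -cm_d.
Qed.

Lemma ups_act q k l (e : q + k = l) (a : A q) (x : U k) :
  ups_fun (dm_act e a x) = dm_act (d := rest f bot) e a (ups_fun x).
Proof.
move: x; apply: tens_ext => [x y|x y|i j e1 p x].
- by rewrite (@dm_actBr A U) ups_funB.
- by rewrite ups_funB (@dm_actBr A (rest f bot)).
rewrite [X in ups_fun X](@Tens_act A A (cdg_id A)) (sgnz_morph (@ups_funB _)).
rewrite -![tens _ _ _]/(tnU _ _ _) !ups_tnU.
rewrite [RHS](@Tens_act A B f); congr (sgnz _ (tens _ p _)).
exact: (dh_act bt).
Qed.

Definition ups : dgHom U (rest f bot) :=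
  @DgHom A U (rest f bot) (CxMap ups_funB ups_d) ups_act.

Let tu := fib (hm_closed ups).
Let tb := fib (hm_closed bt).

Lemma mu_e (i j k : int) : i + j = k -> i + (j + (0 - 1)) = k + (0 - 1).
Proof. by move=> <-; rewrite addrA. Qed.

Lemma tnsB k i j (e : i + j = k) (p p' : PA i) (b : B j) :
  tns e (p - p') b = tns e p b - tns e p' b.
Proof. by rewrite /tns !tens_tenb bl_Bl. Qed.

Lemma tnsBr k i j (e : i + j = k) (p : PA i) (b b' : B j) :
  tns e p (b - b') = tns e p b - tns e p b'.
Proof. by rewrite /tns !tens_tenb bl_Br. Qed.

Lemma tns_sgnr k i j (e : i + j = k) (p : PA i) n (b : B j) :
  tns e p (sgnz n b) = sgnz n (tns e p b).
Proof. by rewrite /tns !tens_tenb bl_sgnr. Qed.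

Lemma tns0r k i j (e : i + j = k) (p : PA i) : tns e p (0 : B j) = 0.
Proof. by rewrite /tns !tens_tenb bl0r. Qed.

Lemma tns_tr k i j j' (e : i + j = k) (ej : j = j') (e' : i + j' = k) (p : PA i) (b : BA j) :
  tns e' p (tr ej b) = tns e p b.
Proof. by subst j'; rewrite (eq_irrelevance e e'). Qed.

Lemma tr_tns k l i j (e : i + j = k) (ek : k = l) (e' : i + j = l) (p : PA i) (b : B j) :
  tr (C := bot) ek (tns e p b) = tns e' p b.
Proof. by subst l; rewrite (eq_irrelevance e e'). Qed.

Lemma tnU0r k i j (e : i + j = k) (p : PA i) : tnU e p (0 : Bt j) = 0.
Proof. by rewrite /tnU !tens_tenb bl0r. Qed.

(** The pairing that exhibits the fibre of [ups] as PA tensored with the fibre of [bt]. The sign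
    (-1)^i comes from moving the shift of the second component past p. *)
Definition mu k : bal PA (Tw tb) k (Tw tu k).
Proof.
apply: (@Bal A PA (Tw tb) k (Tw tu k) (fun i j e p w =>
  (tnU e p w.1, sgnz i (tns (mu_e e) p w.2)) : Tw tu k)).
- move=> i j e p p' w; congr pair; last by rewrite tnsB sgnzB.
  by rewrite /tnU !tens_tenb bl_Bl.
- move=> i j e p w w'; congr pair; last by rewrite [(w - w').2]/(w.2 - w'.2) tnsBr sgnzB.
  by rewrite /tnU !tens_tenb bl_Br.
- move=> q i j qi qj e1 e2 e3 e4 a p w; rewrite sgnz_pair; congr pair.
    rewrite /tnU !tens_tenb (bl_act _ e1 e2 e3 e4) /= mul0r sgnz0l.
    by rewrite (eq_irrelevance (t_sa_act tb e2) (e2 : q + t_sa tb j = t_sa tb qj)).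
  rewrite [X in _ = sgnz _ (sgnz _ (tns _ _ X))]/= tns_sgnr !sgnzD.
  have e5 := t_sb_act tb e2.
  have := bl_act (tens_bal PA BA (k + (0 - 1))) e1 e5 (mu_e e3) (mu_e e4) a p w.2.
  rewrite -!tens_tenb -![tens _ _ _]/(tns _ _ _) => ->.
  rewrite sgnzD (eq_irrelevance (t_sb_act tb e2) e5) -[cr_mul _ _ _]/(dm_act (d := BA) e5 a w.2).
  by apply: sgnz_odd; rewrite -e1; lia.
Defined.

Lemma mu_d k l (ek : k + 1 = l) i j (e : i + j = k) p w :
  cx_d ek (bl (mu k) e p w) = bl (bal_d ek (mu l)) e p w.
Proof.
subst l; have e1 : k + (0 - 1) + 1 = k + 1 + (0 - 1) by lia.
have e2 : k = k + 1 + (0 - 1) by lia.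
have e3 : j + (0 - 1) + 1 = j + 1 + (0 - 1) by lia.
have e4 : j = j + 1 + (0 - 1) by lia.
rewrite [LHS]surjective_pairing fib_d1 (fib_d2 _ e1 e2) -[RHS]/(_ + sgnz i _) sgnz_pair.
congr pair; first by rewrite [LHS]U_d (fib_d1 (u := bt)).
rewrite [bl (mu k) _ _ _]/= [(_, _).2]/= [(_, _).1]/=.
have f1 : i + 1 + (j + (0 - 1)) = k + 1 + (0 - 1) by lia.
have f2 : i + (j + 1 + (0 - 1)) = k + 1 + (0 - 1) by lia.
rewrite [cx_d _ (sgnz _ _)](cx_d_sgn (C := bot)) (bot_dE _ _ _ _ f1 e3 f2).
rewrite [ups k _]ups_tnU.
have f3 : i + j = k + 1 + (0 - 1) by rewrite e.
rewrite (tr_tns _ _ f3).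
rewrite -[(mu _ _ _ _ _ _).2]/(sgnz (i + 1) (tns (mu_e (td1 erefl e)) (cx_d erefl p) w.2)).
rewrite -[(_, _).2]/(sgnz i (sgnz i (tns (mu_e (td2 erefl e)) p (cx_d erefl w).2))).
rewrite (fib_d2 _ e3 e4) sgnzK sgnzS (eq_irrelevance (mu_e (td1 erefl e)) f1).
rewrite (eq_irrelevance (mu_e (td2 erefl e)) f2).
rewrite sgnzDr sgnzK (morphN (tnsBr f2 p)) (tnsBr f2) (tns_tr f3 e4 f2).
by rewrite opprB [in RHS]opprB opprD; exact: addrCA.
Qed.

Lemma mu_spn k (g : Tw tu k -> QZ) : {morph g : x y / x - y} ->
  (forall i j (e : i + j = k) p w, g (mu k _ _ e p w) = 0) -> forall z, g z = 0.
Proof.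
move=> gB g0 z; rewrite (tw_eta z) (morphBD gB).
have h1 u : g (tw_inl (t := tu) u) = 0.
  move: u; apply: (tens_ext (g := fun u => g (tw_inl (t := tu) u)) (h := fun=> 0)).
  - by move=> x y; rewrite tw_inlB gB.
  - by move=> x y; rewrite subrr.
  move=> i j e p x; have <- := g0 _ _ e p (tw_inl (t := tb) x).
  by congr g; rewrite /= tns0r sgnz0.
have h2 y : g (tw_inr (t := tu) y) = 0.
  move: y; apply: (tens_ext (g := fun y => g (tw_inr (t := tu) y)) (h := fun=> 0)).
  - by move=> x y; rewrite tw_inrB gB.
  - by move=> x y; rewrite subrr.
  move=> i j e p y.
  have e1 : i + (j + 1) = k by move: (e : i + j = k + (0 - 1)); lia.
  have e2 : j = j + 1 + (0 - 1) by lia.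
  have := g0 _ _ e1 p (sgnz i (tw_inr (t := tb) (k := j + 1) (tr e2 (y : BA j)))).
  rewrite [mu _ _ _ _ _ _]/= sgnz_pair sgnz0 tnU0r tns_sgnr sgnzK (tns_tr e).
  by [].
by rewrite h1 h2 addr0.
Qed.

Lemma mu_uni k (b : bal PA (Tw tb) k QZ) : exists2 g : Tw tu k -> QZ,
  {morph g : x y / x - y} & forall i j (e : i + j = k) p w, g (mu k _ _ e p w) = b _ _ e p w.
Proof.
have b1 : exists b1 : bal PA (rest (cdg_id A) Bt) k QZ, forall i j (e : i + j = k) p x,
    b1 _ _ e p x = b _ _ e p ((x, 0) : Tw tb j).
  unshelve eexists (@Bal A PA (rest (cdg_id A) Bt) k QZ (fun i j e p x => b _ _ e p ((x, 0) : Tw tb j)) _ _ _) => //.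
  - by move=> i j e p p' x /=; rewrite bl_Bl.
  - move=> i j e p x x' /=; rewrite -bl_Br; congr (b _ _ _ _ _); congr pair.
    by rewrite subrr.
  - move=> q i j qi qj e1 e2 e3 e4 a p x /=.
    rewrite (bl_act b e1 e2 e3 e4); congr (sgnz _ (b _ _ _ _ _)); congr pair.
      rewrite mul0r sgnz0l; congr res_act; exact: eq_irrelevance.
    by rewrite -[dm_act _ _ _]/(dm_act (d := BA) _ a 0) dm_act0r sgnz0.
have [{}b1 b1E] := b1.
have d1 (i j : int) : i + j = k + (0 - 1) -> i + (j + 1) = k by lia.
have d2 (j : int) : j = j + 1 + (0 - 1) by lia.
have b2 : exists b2 : bal PA BA (k + (0 - 1)) QZ, forall i j (e : i + j = k + (0 - 1)) p y,
    b2 _ _ e p y = sgnz i (b _ _ (d1 _ _ e) p ((0, tr (d2 j) y) : Tw tb (j + 1))).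
  unshelve eexists (@Bal A PA BA (k + (0 - 1)) QZ (fun i j e p y =>
    sgnz i (b _ _ (d1 _ _ e) p ((0, tr (d2 j) y) : Tw tb (j + 1)))) _ _ _) => //.
  - by move=> i j e p p' x /=; rewrite bl_Bl sgnzB.
  - move=> i j e p x x' /=; rewrite -sgnzB -bl_Br; congr (sgnz _ (b _ _ _ _ _)); congr pair.
      by rewrite subrr.
    by rewrite trB.
  - move=> q i j qi qj e1 e2 e3 e4 a p y.
    have e5 : q + (j + 1) = qj + 1 by move: e2; lia.
    have := bl_act b e1 e5 (d1 _ _ e3) (d1 _ _ e4) a p ((0, tr (d2 j) y) : Tw tb (j + 1)) => ->.
    set w := dm_act e5 a _.
    have -> : w = sgnz q ((0, tr (d2 qj) (dm_act (d := BA) e2 a y)) : Tw tb (qj + 1)).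
      rewrite sgnz_pair sgnz0; congr pair.
        by rewrite /= -[res_act _ _ _]/(dm_act (d := Bt) _ a 0) dm_act0r sgnz0.
      rewrite -[LHS]/(sgnz ((0 - 1) * q) (dm_act (d := BA) (t_sb_act tb e5) a (tr (d2 j) y))).
      rewrite act_tr tr_act (eq_irrelevance (etrans _ _) (etrans e2 (d2 qj))).
      by apply: sgnz_odd; lia.
    by rewrite bl_sgnr !sgnzD; apply: sgnz_odd; move: e1; lia.
have [{}b2 b2E] := b2.
have [h1 h1B h1E] : exists2 h1 : U k -> QZ, {morph h1 : x y / x - y} &
    forall i j (e : i + j = k) p x, h1 (tnU e p x) = b1 _ _ e p x.
  by exists (tlift b1) => [|i j e p x]; [exact: tliftB|exact: tlift_tens].
have [h2 h2B h2E] : exists2 h2 : bot (k + (0 - 1)) -> QZ, {morph h2 : x y / x - y} &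
    forall i j (e : i + j = k + (0 - 1)) p x, h2 (tns e p x) = b2 _ _ e p x.
  by exists (tlift b2) => [|i j e p x]; [exact: tliftB|exact: tlift_tens].
exists (fun z : Tw tu k => h1 z.1 + h2 z.2).
  by move=> x y; rewrite tw_B1 tw_B2 h1B h2B opprD addrACA.
move=> i j e p w; rewrite [LHS]/= (sgnz_morph h2B) h1E h2E b1E b2E sgnzK.
have e1 : j + (0 - 1) + 1 = j by lia.
have -> z : b _ _ (d1 _ _ (mu_e e)) p z = b _ _ e p (tr (C := Tw tb) e1 z).
  move: z (d1 _ _ _) ; move: (j + (0 - 1) + 1) e1 => j' e1; subst j'.
  by move=> z e1; rewrite (eq_irrelevance e1 e).
rewrite -bl_Dr; congr (b _ _ _ _ _).
rewrite [RHS]surjective_pairing.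
rewrite (tr_tw e1); congr pair; first by rewrite /= tr0 addr0.
by rewrite -[RHS]add0r; congr (0 + _); rewrite tr_tr tr_id.
Qed.

(** Flatness of PA: the fibre of [bt] is acyclic, hence so is its tensor product with PA, which is
    the fibre of [ups]. *)
Lemma ups_qis : is_qis ups.
Proof.
apply/hm_hqis; apply/(hqis_tw tu).
apply: (Kproj_flat (V := Tw tb) (mu := mu)).
- exact: resol_proj.
- by apply/hqis_tw/hm_hqis; exact: resol_qis.
- exact: mu_d.
- exact: mu_spn.
- exact: mu_uni.
Qed.
End Upsilon.

Lemma act_bdry (A : cdgRing) (M : dgModule A) i k (e : 0 + i = k) (a : A 0) (x : M i) :
  bdry x -> bdry (dm_act e a x).
Proof.
move=> /(bdryE (subrK 1 i))[y <-].
have e1 : 0 + (i - 1) = k - 1 by lia.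
have e2 : 0 + 1 + (i - 1) = k by lia.
have := dm_leibniz e1 (erefl (0 + 1)) (subrK 1 i) (subrK 1 k) e2 e a y.
rewrite (cr_nonpos (cx_d (erefl (0 + 1)) a)) // dm_act0l add0r sgnz0l => <-.
exact: bdry_d.
Qed.

Lemma act_closed (A : cdgRing) (M : dgModule A) i k (e : 0 + i = k) (a : A 0) (x : M i) :
  cocyc x -> cocyc (dm_act e a x).
Proof.
move=> cx; have e1 : 0 + (i + 1) = k + 1 by lia.
have e2 : 0 + 1 + i = k + 1 by lia.
rewrite /cocyc (dm_leibniz e (erefl (0 + 1)) (erefl (i + 1)) _ e2 e1).
by rewrite (cr_nonpos (cx_d (erefl (0 + 1)) a)) // dm_act0l [cx_d _ x]cx dm_act0r sgnz0 add0r.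
Qed.

(* Restriction along [cdg_id A] is the identity up to the proofs carried by the
   module structure. *)
Definition unid (A : cdgRing) (M N : dgModule A) i
    (F : hom_deg M (rest (cdg_id A) N) i) : hom_deg M N i.
Proof.
apply: (@HomDeg A M N i (fun j k e x => hd_fun F e x)).
- by move=> j k e x y; rewrite hd_B.
- by move=> p j pj k l e e1 e2 e3 a x; exact: (hd_act F e e1 e2 e3 a x).
Defined.

Definition reid (A : cdgRing) (M N : dgModule A) i
    (F : hom_deg M N i) : hom_deg M (rest (cdg_id A) N) i.
Proof.
apply: (@HomDeg A M (rest (cdg_id A) N) i (fun j k e x => hd_fun F e x)).
- by move=> j k e x y; rewrite hd_B.
- by move=> p j pj k l e e1 e2 e3 a x; exact: (hd_act F e e1 e2 e3 a x).
Defined.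

Lemma unid_closed (A : cdgRing) (M N : dgModule A) i (F : hom_deg M (rest (cdg_id A) N) i) :
  hclosed F -> hclosed (unid F).
Proof.
move=> cF; rewrite /hclosed /cocyc.
transitivity (unid (hd_d (erefl (i + 1)) F)); first exact: hom_deg_eq.
by rewrite [hd_d _ F]cF; exact: hom_deg_eq.
Qed.

Lemma unid_bdry (A : cdgRing) (M N : dgModule A) i (F : hom_deg M (rest (cdg_id A) N) i) :
  hbdry (unid F) -> hbdry F.
Proof.
move=> /(hbdryE (subrK 1 i))[G dG]; apply/(hbdryE (subrK 1 i)); exists (reid G).
transitivity (reid (hd_d (subrK 1 i) G)); first exact: hom_deg_eq.
by rewrite dG; exact: hom_deg_eq.
Qed.

Section BaseChangeUnit.
Variables (A B : cdgRing) (f : cdgHom A B) (P : dgModule B).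
Hypothesis surj_f : forall b : H0 B, exists a : H0 A, H0map f a = b.

Notation PA := (PA f P).
Notation Bt := (Bt f).
Notation bt := (bt f).
Notation U := (U f P).

(** A lift of 1, closed because the generator in its differential is e(0, 0) = 0. *)
Definition one_t : Bt 0 := res_e (cr_one B : rest f (dg_self B) 0) 0.

Lemma bt_one : bt 0 one_t = cr_one B.
Proof. exact: res_e_pi. Qed.

Lemma one_t_d : cx_d (erefl (0 + 1)) one_t = 0.
Proof.
rewrite /one_t res_e_d cx_d0 oppr0 subr0.
rewrite -[cx_d erefl _]/(@cx_d B 0 (0 + 1) erefl (cr_one B)) one_closed.
by rewrite (cm_0 (resol_map _)) addr0 res_e0.
Qed.

Definition etaU : dgHom PA U.
Proof.
unshelve refine (@DgHom A PA U (@CxMap PA U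
  (fun i p => tnU (addr0 i) p one_t) _ _) _).
- by move=> i p p'; rewrite /tnU !tens_tenb bl_Bl.
- move=> i j e p; subst j.
  rewrite U_d one_t_d tnU0r sgnz0 addr0.
  by rewrite (eq_irrelevance (td1 _ _) (addr0 (i + 1))).
- move=> q i k e a p.
  rewrite [RHS](@Tens_act A A (cdg_id A)).
  rewrite [LHS]tens_tenb.
  have e1 : i + (q + 0) = k by rewrite addr0 addrC.
  rewrite (bl_act _ e (erefl (q + 0)) _ e1) (eq_irrelevance e1 (ta1 e (addr0 i))).
  by [].
Defined.

Lemma ups_etaU : dg_comp (ups f P) etaU = etaP f P.
Proof.
apply: dgHom_eq => i p; rewrite -[LHS]/(ups f P i (tnU (addr0 i) p one_t)).
by rewrite [LHS]ups_tnU bt_one.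
Qed.

Lemma Bt_van k : 0 < k -> van Bt k.
Proof.
move=> k0 x cx; have [i _] := (is_qisE bt).1 (resol_qis _) k.
apply: i => //.
by rewrite (_ : bt k x = 0); [exact: bdry0|exact: cr_nonpos].
Qed.

(** By adjunction and exchange of variables, r is a homomorphism [Psi] from [Bt], in degrees <= 0,
    to Hom(PA, Q), in degrees >= g. As j <= g, it suffices that [Psi] is zero on H^0(B), and by
    surjectivity of H^0(f) it suffices to know its value at 1, which is r composed with [etaU]. *)
Lemma etaU_bdry (Q : dgModule A) g j (r : hom_deg U Q j) : 
  (forall i, i < g -> hvan PA Q i) -> j <= g -> hclosed r ->
  hbdry (hcomp (add0r j) r (hm etaU)) -> hbdry r.
Proof.
move=> vQ jg cr br.
apply: (adjR_bdry (f := cdg_id A)); apply: unid_bdry; apply/swap_bdry.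
set Psi := swap _.
have cPsi : hclosed Psi by apply: swap_closed; apply: unid_closed; exact: adjR_closed.
have PsiE k l (e : k + j = l) x i m (e1 : i + l = m) p (e2 : i + k + j = m) :
    hd_fun (hd_fun Psi e x : hom_deg PA Q l) e1 p =
    sgnz (i * k) (hd_fun r e2 (tnU erefl p x)).
  have e3 : k + (i + j) = m by lia.
  rewrite (swapE _ _ _ _ _ (erefl (i + j)) e3); congr sgnz.
  rewrite -[LHS]/(hd_fun r (adjR_e erefl e3) (tnU erefl p x)).
  by congr hd_fun; exact: eq_irrelevance.
apply: (hbdry_trunc (m := 0) (g := g)) => //.
- exact: resol_proj.
- exact: Bt_van.
- by rewrite add0r.
move=> l e x cx.
have cbx : is_cocycle (bt 0 x : B 0) by apply/asboolP; exact: cr_nonpos.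
(* Modulo boundaries x is a0 times the lift of 1, and [Psi] is linear over [A]. *)
have [a] := surj_f (hcls (Cocycle cbx)); rewrite -[a]hrepK /H0map HmapE => /hcls_eq.
set a0 := cval (hrep a) => /asboolP[j0 [e0 [y dy]]].
have ca0 : cocyc a0 by exact: cr_nonpos.
have c1 : cocyc one_t := one_t_d.
pose x' := dm_act (d := Bt) (addr0 0) a0 one_t.
have bx : bdry (x - x').
  have [inj _] := (is_qisE bt).1 (resol_qis _) 0; apply: inj.
    by apply: closedB => //; exact: act_closed.
  rewrite cm_B dh_act bt_one -[dm_act _ _ _]/(cr_mul (addr0 0) (f 0 a0) (cr_one B)) cr_mulr1.
  rewrite -opprB; apply: bdryN; rewrite -[_ - _]dy; exact: (@bdry_d (rest f (dg_self B))).
rewrite -[x](subrK x') hd_D; apply: (@bdryD (HomDG PA Q)).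
  by apply: hd_bdry.
have -> : hd_fun Psi e x' = dm_act e a0 (hd_fun Psi (add0r j) one_t).
  by rewrite (hd_act Psi (addr0 0) e (add0r j) e) mulr0 sgnz0l.
apply: act_bdry.
suff -> : hd_fun Psi (add0r j) one_t = hcomp (add0r j) r (hm etaU) :> hom_deg PA Q j by [].
apply: hom_deg_eq => i m e1 p.
have e2 : i + 0 + j = m by rewrite addr0.
rewrite (PsiE _ _ _ _ _ _ e1 _ e2) mulr0 sgnz0l.
rewrite (hcompE _ _ _ _ (addr0 i) e1) hmE.
rewrite -[etaU i p]/(tnU (addr0 i) p one_t).
have key i' (e3 : i + 0 = i') (e4 : i' + j = m) :
    hd_fun r e2 (tnU erefl p one_t) = hd_fun r e4 (tnU e3 p one_t).
  by subst i'; congr hd_fun; exact: eq_irrelevance.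
exact: key.
Qed.
End BaseChangeUnit.

Lemma tw_copairB (A : cdgRing) (P N Q : dgModule A) (t : twist P N) j ja jb
    (ea : ja + t_a t = j) (eb : jb + t_b t = j) (F F' : hom_deg P Q ja) (G G' : hom_deg N Q jb) :
  tw_copair ea eb (F - F') (G - G') = tw_copair ea eb F G - tw_copair ea eb F' G'.
Proof.
apply: hom_deg_eq => p k e x.
by rewrite -[LHS]/(_ - _ + (_ - _)) -[RHS]/(_ + _ - (_ + _)) opprD addrACA.
Qed.

Lemma hd_d0 (A : cdgRing) (M N : dgModule A) i j (e : i + 1 = j) :
  hd_d e (0 : hom_deg M N i) = 0.
Proof. exact: (@cx_d0 (HomDG M N)). Qed.

Lemma hd_d_sgn (A : cdgRing) (M N : dgModule A) i j (e : i + 1 = j) n (F : hom_deg M N i) :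
  hd_d e (sgnz n F) = sgnz n (hd_d e F).
Proof. exact: (@cx_d_sgn (HomDG M N)). Qed.

Lemma hcomp_sgnl (A : cdgRing) (M N P : dgModule A) i j k (e : i + j = k) n
    (g : hom_deg N P j) (f : hom_deg M N i) : hcomp e (sgnz n g) f = sgnz n (hcomp e g f).
Proof. by rewrite (sgnz_morph (fun x y => hcompBl e x y f)). Qed.

Lemma hclosedE (A : cdgRing) (M N : dgModule A) i j (e : i + 1 = j) (F : hom_deg M N i) :
  hclosed F <-> hd_d e F = 0.
Proof. exact: (closedE (C := HomDG M N)). Qed.

(* A homotopy section [et] of [lam] splits [Hom(U, Q)] as [Hom(PA, Q)] and the
   morphisms killed by [et], so
   that only the latter contribute to [Hom(fibre of lam, Q)]. *)
Lemma fib_section_van (A : cdgRing) (U V Q : dgModule A) (lam : dgHom U V) (et : dgHom V U) j :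
  htp (dg_comp lam et) (dg_id V) ->
  (forall r : hom_deg U Q j, hclosed r -> hbdry (hcomp (add0r j) r (hm et)) -> hbdry r) ->
  hvan (Tw (fib (hm_closed lam))) Q j.
Proof.
set t := fib _ => le kr phi cphi.
have lec i (F : hom_deg V Q i) : hclosed F ->
    hbdry (F - hcomp (add0r i) (hcomp (add0r i) F (hm lam)) (hm et)).
  move=> cF; rewrite -(hcompA (add0r 0) (add0r i)).
  rewrite -{1}[F](hm_id_r (add0r i)) -hcompBr -hm_comp.
  by apply: hbdry_compr => //; exact: hbdry_subC.
have ea : j + t_a t = j := addr0 j.
have eb : j + 1 + t_b t = j by rewrite /=; lia.
have ea1 : j + 1 + t_a t = j + 1 := addr0 _.
have eb1 : j + 1 + 1 + t_b t = j + 1 by rewrite /=; lia.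
have ea' : j - 1 + t_a t = j - 1 := addr0 _.
have eb' : j + t_b t = j - 1 by rewrite /=; lia.
have split_d F G : hclosed (tw_copair ea eb F G) ->
    hd_d erefl F + sgnz (j + t_b t) (hcomp (add0r (j + 1)) G (hm lam)) = 0 /\ hclosed G.
  move=> h; have : hd_d erefl (tw_copair ea eb F G) = 0 by [].
  rewrite (tw_copair_d ea eb ea1 eb1 erefl erefl erefl (add0r (j + 1))) => {}h.
  split.
    have := congr1 (tw_cofst ea1 eb1) h; rewrite tw_copair_fst => ->.
    exact: hom_deg_eq.
  apply/(hclosedE erefl); have := congr1 (tw_cosnd ea1 eb1) h; rewrite tw_copair_snd => ->.
  exact: hom_deg_eq.
pose F1 := tw_cofst ea eb phi; pose G := tw_cosnd ea eb phi.
have phiE : phi = tw_copair ea eb F1 G by rewrite tw_copair_eta.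
have [dF1 cG] : hd_d erefl F1 + sgnz (j + t_b t) (hcomp (add0r (j + 1)) G (hm lam)) = 0
    /\ hclosed G by apply: split_d; rewrite -phiE.
have bGl : hbdry (hcomp (add0r (j + 1)) G (hm lam)).
  apply/(@bdry_sgn (HomDG U Q) _ (j + t_b t)).
  rewrite -(addr0_eq dF1).
  exact/hbdryN/(@bdry_d (HomDG U Q)).
(* Closedness of phi makes G lam a boundary, and G is G lam et up to a boundary. *)
have /(hbdryE (erefl (j + 1)))[psi dpsi] : hbdry G.
  apply/(hbdry_sub (lec _ _ cG)); apply: hbdry_compl => //; exact: hm_closed.
pose s := j - 1 + t_b t.
(* Subtracting the differential of (0, psi) from phi leaves (F', 0). *)
pose F' := F1 - sgnz s (hcomp (add0r j) psi (hm lam)).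
have bphi : hbdry (phi - tw_copair ea eb F' 0).
  have -> : phi - tw_copair ea eb F' 0 = hd_d (subrK 1 j) (tw_copair ea' eb' 0 psi).
    rewrite (tw_copair_d ea' eb' ea eb (subrK 1 j) (subrK 1 j) erefl (add0r j)) hd_d0 add0r dpsi.
    by rewrite phiE -tw_copairB subr0 opprB addrCA subrr addr0.
  exact: (@bdry_d (HomDG (Tw t) Q)).
apply/(hbdry_sub bphi).
have [cF' _] : hd_d erefl F' + sgnz (j + t_b t) (hcomp (add0r (j + 1)) 0 (hm lam)) = 0
    /\ hclosed (0 : hom_deg V Q (j + 1)).
  by apply: split_d; apply: (hclosed_sub cphi); exact: hbdry_subC.
rewrite hcomp0l sgnz0 addr0 in cF'.
pose xi := hcomp (add0r j) F' (hm et).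
have cxi : hclosed xi by apply: hclosed_comp => //; exact: hm_closed.
(* F' and xi lam agree up to a boundary after composition with [et], so the hypothesis on r applies
   to their difference. The part xi lam is itself killed in the fibre, by (0, xi). *)
have /(hbdryE (subrK 1 j))[rho drho] : hbdry (F' - hcomp (add0r j) xi (hm lam)).
  apply: kr.
    by apply: hclosedB => //; apply: hclosed_comp => //; exact: hm_closed.
  by rewrite hcompBl; exact: lec.
have -> : tw_copair ea eb F' 0 = hd_d (subrK 1 j) (tw_copair ea' eb' rho (sgnz s xi)).
  rewrite (tw_copair_d ea' eb' ea eb (subrK 1 j) (subrK 1 j) erefl (add0r j)) drho.
  by rewrite hcomp_sgnl sgnzK subrK hd_d_sgn ((hclosedE erefl xi).1 cxi) sgnz0.
exact: (@bdry_d (HomDG (Tw t) Q)).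
Qed.

Lemma qis_van (C D : complex) (u : cxMap C D) i : is_qis u -> van C i <-> van D i.
Proof.
move=> /is_qisE/(_ i)[inj surj]; split=> [vC y cy|vD x cx].
  have [x cx b] := surj y cy; have := bdryD b (cm_bdry u (vC x cx)).
  by rewrite subrK.
by apply: inj => //; apply: vD; exact: cm_closed.
Qed.

(** * The fibre of the counit, over [A] and over [B] *)

Section CounitFibre.
Variables (A B : cdgRing) (f : cdgHom A B) (P : dgModule B).
Hypothesis surj_f : forall b : H0 B, exists a : H0 A, H0map f a = b.

Notation PA := (PA f P).
Notation U := (U f P).

Definition ceps : dgModule B := Tw (fib (hm_closed (eps f P))).

Section Kappa.
Variables (lam : dgHom U PA) (h : hom_deg U (rest f P) (0 - 1)).
Hypothesis dh : hd_d (subrK 1 0) h =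
  hm (dg_comp (rest_hom f (eps f P)) (ups f P)) - hm (dg_comp (pA f P) lam).

Let KA := Tw (fib (hm_closed lam)).

Definition kap1 k (z : KA k) : bot f P k := ups f P k z.1.

Definition kap2 k (z : KA k) : P (k + (0 - 1)) :=
  pA f P (k + (0 - 1)) z.2 + hd_fun h (erefl (k + (0 - 1))) z.1.

Lemma kap2B k : {morph @kap2 k : x y / x - y}.
Proof.
by move=> x y; rewrite /kap2 tw_B1 tw_B2 cm_B hd_B opprD addrACA.
Qed.

Lemma kap2_d k l (e : k + 1 = l) (e1 : k + (0 - 1) + 1 = l + (0 - 1)) (e2 : k = l + (0 - 1))
    (z : KA k) :
  kap2 (cx_d e z) = - (cx_d (c := P) e1 (kap2 z) - tr e2 (eps f P k (kap1 z))).
Proof.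
rewrite /kap2 (fib_d1 (u := lam)) (fib_d2 (u := lam) e e1 e2) cm_N cm_B.
have e3 : k + 0 = l + (0 - 1) by rewrite addr0.
have := congr1 (fun F : hom_deg U (rest f P) 0 => hd_fun F e3 z.1) dh.
rewrite (hd_dE (subrK 1 0) h e3 (erefl (k + (0 - 1))) e1 e (erefl (l + (0 - 1)))).
rewrite -[hd_fun (hm _ - hm _) e3 z.1]/(tr (C := P) (hd_add0 e3) (eps f P k (kap1 z)) -
  tr (C := rest f P) (hd_add0 e3) (pA f P k (lam k z.1))).
rewrite (eq_irrelevance (hd_add0 e3) e2) [sgnz _ (hd_fun _ _ _)]sgnzE opprK => hh.
rewrite cx_dD -[cx_d e1 (pA f P _ z.2)](cm_d (pA f P) e1) [pA f P _ (tr e2 _)](cm_tr (pA f P)).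
move: (cx_d e1 (hd_fun h _ _)) (hd_fun h _ (cx_d e z.1)) (tr e2 (eps _ _ _ _)) hh => a b c.
have arith (V : zmodType) (x y u v w : V) : u + v = w - y -> - (x - y) + v = - (x + u - w).
  move=> huv; have -> : v = w - y - u by rewrite -huv addrAC subrr add0r.
  rewrite !opprB -[w - y - u]addrA [LHS]addrC -addrA; congr (w + _).
  by rewrite [- y - u]addrC addrA subrK opprD addrC.
exact: arith.
Qed.

Lemma kap2_act q k l (e : q + k = l) (e1 : q + (k + (0 - 1)) = l + (0 - 1)) (a : A q) (z : KA k) :
  kap2 (dm_act e a z) = sgnz ((0 - 1) * q) (dm_act (d := rest f P) e1 a (kap2 z)).
Proof.
rewrite /kap2.
rewrite -[(dm_act e a z).1]/(sgnz (0 * q) (dm_act (t_sa_act (fib (hm_closed lam)) e) a z.1)).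
rewrite -[(dm_act e a z).2]/(sgnz ((0 - 1) * q) (dm_act (t_sb_act (fib (hm_closed lam)) e) a z.2)).
rewrite mul0r sgnz0l cm_sgn dh_act dm_actDr sgnzDr; congr (sgnz _ _ + _).
  by congr dm_act; exact: eq_irrelevance.
by rewrite (hd_act h _ _ (erefl (k + (0 - 1))) e1).
Qed.

Lemma kap1_act q k l (e : q + k = l) (a : A q) (z : KA k) :
  kap1 (dm_act e a z) = dm_act (d := rest f (bot f P)) e a (kap1 z).
Proof.
rewrite /kap1.
rewrite -[(dm_act e a z).1]/(sgnz (0 * q) (dm_act (t_sa_act (fib (hm_closed lam)) e) a z.1)).
rewrite mul0r sgnz0l dh_act; congr dm_act; exact: eq_irrelevance.
Qed.

(** The square of [ups], [pA], [eps] and [lam] commutes only up to the homotopy h, which therefore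
    enters the second component of the induced map between fibres. *)
Definition kappa : dgHom KA (rest f ceps).
Proof.
unshelve refine (@DgHom A KA (rest f ceps) (@CxMap KA (rest f ceps)
  (fun k z => (kap1 z, kap2 z) : ceps k) _ _) _).
- move=> k x y; congr pair; last exact: kap2B.
  exact: (@cm_B _ _ (ups f P) k).
- move=> k l e z.
  have e1 : k + (0 - 1) + 1 = l + (0 - 1) by rewrite -e; lia.
  have e2 : k = l + (0 - 1) by rewrite -e; lia.
  rewrite [RHS]surjective_pairing (fib_d1 (u := eps f P)) (fib_d2 (u := eps f P) e e1 e2).
  congr pair; last exact: kap2_d.
  by rewrite /kap1 (fib_d1 (u := lam)) cm_d.
- move=> q k l e a z.
  have e1 : q + (k + (0 - 1)) = l + (0 - 1) by rewrite -e; lia.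
  rewrite [RHS]surjective_pairing; congr pair.
    rewrite kap1_act.
    rewrite -[RHS]/(sgnz (0 * q) (dm_act (d := bot f P) (t_sa_act (fib (hm_closed (eps f P))) e)
      (f q a) (kap1 z))) mul0r sgnz0l.
    by congr dm_act; exact: eq_irrelevance.
  rewrite (kap2_act _ e1); congr (sgnz _ (dm_act _ _ _)); exact: eq_irrelevance.
Defined.

Lemma kappa_qis : is_qis kappa.
Proof.
apply: (ses_five (tw_ses (fib (hm_closed lam))) (tw_ses (fib (hm_closed (eps f P))))
  (fy := pA f P) (fx := ups f P)).
- move=> k y; congr pair; first exact: cm_0.
  by rewrite /kap2 hd_0 addr0.
- by [].
- exact: pA_qis.
- exact: ups_qis.
Qed.

End Kappa.

(** Over [A] the fibre of [eps] is that of [lam] : U -> PA, and [etaU] is a homotopy section of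
    [lam] because [eps] composed with [etaP] is [pA]. So only morphisms U -> Q that vanish on [etaU]
    contribute, and [etaU_bdry] disposes of them up to degree g. *)
Lemma rest_eps_van (Q : dgModule A) g j (T : dgModule A) (q : dgHom T (rest f ceps)) :
  K_projective T -> is_qis q -> (forall i, i < g -> hvan PA Q i) -> j <= g -> hvan T Q j.
Proof.
move=> KT qq vQ jg.
have [lam /hbdryE-/(_ _ (subrK 1 0))[h dh]] :=
  dgh_lift (dg_comp (rest_hom f (eps f P)) (ups f P)) (@U_proj _ _ f P) (@pA_qis _ _ f P).
have KA : K_projective (Tw (fib (hm_closed lam))).
  by apply: Kproj_tw; [exact: U_proj|exact: PA_proj].
apply: (Kproj_unique KA KT (kappa_qis dh) qq).
apply: (fib_section_van (et := etaU f P)).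
  apply: (Kproj_htp (@PA_proj _ _ f P) (@pA_qis _ _ f P)).
  rewrite dg_idr dg_compA; apply: htp_sym.
  have {1}-> : pA f P = dg_comp (dg_comp (rest_hom f (eps f P)) (ups f P)) (etaU f P).
    rewrite -dg_compA ups_etaU; apply: dgHom_eq => i p; apply/esym.
    by rewrite -[LHS]/(eps f P i (etaP f P i p)) eps_etaP.
  apply: htp_compr; rewrite /htp -dh; exact: (@bdry_d (HomDG _ _)).
move=> r cr; exact: (etaU_bdry surj_f vQ).
Qed.

(** Take for Q the truncation Z of the fibre to degrees >= j. Morphisms PA -> Z vanish in degrees <
    j - m for degree reasons; as 0 <= j - m, the map from the fibre to Z is null, although it is
    injective on H^j. *)
Lemma eps_van m : (forall j, m < j -> van P j) -> forall j, m - 1 < j -> van ceps j.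
Proof.
move=> vP j mj x cx.
pose Z := ctrunc (rest f ceps) j.
pose T := resol (rest f ceps).
have vQ i : i < j - m -> hvan PA Z i.
  move=> im; apply: (hvan_trunc (m := m) (g := j)).
  - exact: PA_proj.
  - by move=> k mk; apply/(qis_van k (@pA_qis _ _ f P)); exact: vP.
  - exact: ctrunc_van.
  - by lia.
have h : hvan T Z 0.
  by apply: (rest_eps_van (@resol_proj _ _) (@resol_qis _ _) vQ); lia.
apply: (ctrunc_inj (M := rest f ceps) (lexx j)) => //.
have [_ /(_ x cx)[y cy bxy]] := (is_qisE (resol_map (rest f ceps))).1 (@resol_qis _ _) j.
have := hbdry_val (addr0 j) (h _ (hm_closed (dg_comp (ctrunc_map (rest f ceps) j)
  (resol_map (rest f ceps))))) cy.
rewrite hmE => b1; have := bdryD (cm_bdry (ctrunc_map (rest f ceps) j) bxy) b1.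
by rewrite cm_B subrK.
Qed.

Lemma ceps_proj : K_projective P -> K_projective ceps.
Proof. by move=> KP; apply: Kproj_tw => //; exact: bot_proj. Qed.

End CounitFibre.

(** * Comparison of Ext over [A] and over [B] *)

Section Comparison.
Variables (A B : cdgRing) (f : cdgHom A B).
Hypothesis surj_f : forall b : H0 B, exists a : H0 A, H0map f a = b.
Variables (Q : dgModule B) (q : int).
Hypothesis vQ : forall j, j < q -> van Q j.

Definition resA (P : dgModule B) j (F : hom_deg P Q j) : hom_deg (PA f P) (rest f Q) j :=
  hcomp (add0r j) (rest_hd f F) (hm (pA f P)).

Lemma resA_closed P j (F : hom_deg P Q j) : hclosed F -> hclosed (resA F).
Proof. by move=> cF; apply: hclosed_comp; [exact: rest_hd_closed|exact: hm_closed]. Qed.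

Lemma resA_bdry P j (F : hom_deg P Q j) : hbdry F -> hbdry (resA F).
Proof. by move=> bF; apply: hbdry_compl; [exact: rest_hd_bdry|exact: hm_closed]. Qed.

Lemma unhat_bdry P j (G : hom_deg (bot f P) Q j) : hbdry G -> hbdry (unhat G).
Proof. by move=> bG; apply: hbdry_compl; [exact: rest_hd_bdry|exact: hm_closed]. Qed.

Lemma unhatB P j (G G' : hom_deg (bot f P) Q j) : unhat (G - G') = unhat G - unhat G'.
Proof. by rewrite /unhat rest_hdB hcompBl. Qed.

(* [resA] is, up to adjunction, precomposition with [eps], whose fibre is
   [ceps f P]. *)
Lemma resA_inj P j (F : hom_deg P Q j) : hvan (ceps f P) Q (j - 1) ->
  hclosed F -> hbdry (resA F) -> hbdry F.
Proof.
move=> vK cF /hat_bdry; rewrite hat_eps => /(hbdryE (subrK 1 j))[psi dpsi].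
set t := fib (hm_closed (eps f P)).
have ea : j - 1 + t_a t = j - 1 := addr0 _.
have eb : j + t_b t = j - 1 by rewrite /=; lia.
have ea' : j + t_a t = j := addr0 _.
have eb' : j + 1 + t_b t = j by rewrite /=; lia.
have ea2 : j - 1 - 1 + t_a t = j - 1 - 1 := addr0 _.
have eb2 : j - 1 + t_b t = j - 1 - 1 by rewrite /=; lia.
pose s := j - 1 + t_b t.
have /vK/(hbdryE (subrK 1 (j - 1)))[chi dchi] :
    hclosed (tw_copair ea eb (- sgnz s psi) F).
  apply/(hclosedE (subrK 1 j)).
  rewrite (tw_copair_d ea eb ea' eb' (subrK 1 j) (subrK 1 j) erefl (add0r j)).
  rewrite ((hclosedE erefl F).1 cF) -[hm (eps f P)]/(t_f t) in dpsi *.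
  rewrite -dpsi (morphN (@hd_dB _ _ _ _ _ _)) hd_d_sgn addNr.
  by apply: hom_deg_eq => p k e x; rewrite /= addr0.
apply/(hbdryE (subrK 1 j)); exists (tw_cosnd ea2 eb2 chi).
have := congr1 (tw_cosnd ea eb) dchi; rewrite tw_copair_snd => <-.
rewrite -{2}[chi](tw_copair_eta ea2 eb2).
by rewrite (tw_copair_d ea2 eb2 ea eb _ (subrK 1 (j - 1)) (subrK 1 j) (add0r _)) tw_copair_snd.
Qed.

(** The copair (hat G, 0) is closed on the fibre of [eps]. The second component of a primitive of it
    is, up to sign, an F over [B] with F eps equal to hat G up to a boundary. *)
Lemma resA_surj P j (G : hom_deg (PA f P) (rest f Q) j) : hvan (ceps f P) Q j ->
  hclosed G -> exists2 F : hom_deg P Q j, hclosed F & hbdry (G - resA F).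
Proof.
move=> vK cG.
set t := fib (hm_closed (eps f P)).
have ea : j - 1 + t_a t = j - 1 := addr0 _.
have eb : j + t_b t = j - 1 by rewrite /=; lia.
have ea' : j + t_a t = j := addr0 _.
have eb' : j + 1 + t_b t = j by rewrite /=; lia.
have ea1 : j + 1 + t_a t = j + 1 := addr0 _.
have eb1 : j + 1 + 1 + t_b t = j + 1 by rewrite /=; lia.
pose s := j - 1 + t_b t.
have /vK/(hbdryE (subrK 1 j))[chi] : hclosed (tw_copair ea' eb' (hat G) 0).
  apply/(hclosedE erefl).
  rewrite (tw_copair_d ea' eb' ea1 eb1 erefl erefl erefl (add0r _)) hcomp0l sgnz0 addr0 hd_d0.
  rewrite ((hclosedE erefl _).1 (hat_closed cG)).
  by apply: hom_deg_eq => p k e x; rewrite /= addr0.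
rewrite -[chi](tw_copair_eta ea eb); set c1 := tw_cofst _ _ _; set c2 := tw_cosnd _ _ _.
rewrite (tw_copair_d ea eb ea' eb' (subrK 1 j) (subrK 1 j) erefl (add0r j)) => h.
have h1 := congr1 (tw_cofst ea' eb') h; rewrite !tw_copair_fst in h1.
have h2 := congr1 (tw_cosnd ea' eb') h; rewrite !tw_copair_snd in h2.
exists (sgnz s c2); first by apply/(hclosedE erefl); rewrite hd_d_sgn h2 sgnz0.
rewrite -[G]hatK -[resA _]hatK -unhatB; apply: unhat_bdry.
rewrite hat_eps hcomp_sgnl -h1 addrK.
exact: (@bdry_d (HomDG (bot f P) Q)).
Qed.

(** By [resA_inj] it suffices to treat the fibre of the counit in degree j - 1; it satisfies the
    same hypothesis over [A], with m - 1 for m. *)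
Lemma hvan_of_rest P m g : K_projective P -> (forall j, m < j -> van P j) ->
  (forall j, j < g -> hvan (PA f P) (rest f Q) j) -> forall j, j < g -> hvan P Q j.
Proof.
move=> KP vP vA j jg.
(* k bounds the number of steps: Ext vanishes for degree reasons below q - m, and each step lowers
   both j and m. *)
have [k jk] : exists k : nat, j < q - m + k%:Z by exists (`|j| + `|q| + `|m| + 1)%N; lia.
elim: k => [|k IH] in P m j KP vP vA jg jk *.
  by apply: (hvan_trunc KP vP vQ); lia.
move=> F cF; apply: resA_inj => //; last by apply: vA => //; exact: resA_closed.
apply: (IH _ (m - 1)).
- exact: ceps_proj.
- exact: eps_van.
- move=> i ig; apply: (rest_eps_van surj_f (@resol_proj _ _) (@resol_qis _ _) vA).
  exact: ltW.
- by lia.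
- by lia.
Qed.

Section Bounds.
Variables (P : dgModule B) (m : int).
Hypotheses (KP : K_projective P) (vP : forall j, m < j -> van P j).

Lemma ceps_hvan g : (forall j, j < g -> hvan (PA f P) (rest f Q) j) ->
  forall j, j <= g -> hvan (ceps f P) Q j.
Proof.
move=> vA j jg; apply: (hvan_of_rest (g := g + 1) (m := m - 1)); last by lia.
- exact: ceps_proj.
- exact: eps_van.
- move=> i ig; apply: (rest_eps_van surj_f (@resol_proj _ _) (@resol_qis _ _) vA).
  by lia.
Qed.

(** Induction on the degree: vanishing over [A] below j gives vanishing on the fibre of the counit
    up to j, so that restriction is surjective in degree j. *)
Lemma rest_of_hvan n : (forall j, j < n -> hvan P Q j) ->
  forall j, j < n -> hvan (PA f P) (rest f Q) j.
Proof.
move=> vB j jn.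
have [k jk] : exists k : nat, j < q - m + k%:Z by exists (`|j| + `|q| + `|m| + 1)%N; lia.
elim: k => [|k IH] in j jn jk *.
  apply: (hvan_trunc (m := m) (g := q)); [exact: PA_proj| |exact: vQ|lia].
  by move=> i mi; apply/(qis_van i (@pA_qis _ _ f P)); exact: vP.
move=> G cG; have [|F cF bGF] := @resA_surj P j G _ cG.
  apply: (ceps_hvan (g := j)) => // i ij; apply: IH; lia.
by apply/(hbdry_sub bGF)/resA_bdry; exact: vB.
Qed.

End Bounds.

End Comparison.

(** * Finitely generated cohomology *)

Section DegreeZero.
Variable B : cdgRing.

Lemma is_cocycle0 (a : B 0) : is_cocycle (C := dg_self B) a.
Proof. by apply/asboolP; exact: cr_nonpos. Qed.

Definition h0c (a : B 0) : H0 B := hcls (Cocycle (is_cocycle0 a)).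

Lemma h0cP (h : H0 B) : exists a, h0c a = h.
Proof.
exists (cval (hrep h)); rewrite -[RHS]hrepK; congr hcls; exact: val_inj.
Qed.

Lemma h0c_eq a b : h0c a = h0c b <-> bdry (a - b : B 0).
Proof.
rewrite /h0c hcls_eq; split=> [/asboolP[j [e [y dy]]]|/(bdryE (subrK 1 0))[y dy]].
  by rewrite -[a - b]dy; exact: bdry_d.
by apply/asboolP; exists (0 - 1), (subrK 1 0), y.
Qed.

Lemma h0cD a b : h0c (a + b) = h0c a + h0c b.
Proof. by rewrite -[RHS]hclsD; congr hcls; exact: val_inj. Qed.

Lemma h0cM a b : h0c (cr_mul (add0r 0) a b) = h0c a * h0c b.
Proof.
rewrite -[RHS]/(@hact B (dg_self B) 0 (h0c a) (h0c b)) /h0c hactE; congr hcls; exact: val_inj.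
Qed.

Lemma h0c0 : h0c 0 = 0.
Proof. by apply: (addIr (h0c 0)); rewrite -h0cD !add0r. Qed.

Section Span.
Variables (M : dgModule B) (i : int).

Definition act0 (a : B 0) (x : M i) : M i := dm_act (add0r i) a x.

Lemma act0Br a : {morph act0 a : x y / x - y}.
Proof. by move=> x y; rewrite /act0 dm_actBr. Qed.

Lemma act0Bl x : {morph act0^~ x : a b / a - b}.
Proof. by move=> a b; rewrite /act0 dm_actBl. Qed.

Lemma act0M a b x : act0 (cr_mul (add0r 0) a b) x = act0 a (act0 b x).
Proof. exact: dm_actA. Qed.

Lemma act0_bdryl a x : bdry (a : B 0) -> cocyc x -> bdry (act0 a x).
Proof.
move=> /(bdryE (subrK 1 0))[y <-] cx.
have e1 : 0 - 1 + i = i - 1 by lia.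
have e2 : 0 - 1 + (i + 1) = i by lia.
have := dm_leibniz e1 (subrK 1 0) (erefl (i + 1)) (subrK 1 i) (add0r i) e2 y x.
by rewrite [cx_d _ x]cx dm_act0r sgnz0 addr0 /act0 => <-; exact: bdry_d.
Qed.

(** Spans in cohomology, with coefficients in B^0 and equality modulo boundaries. Recursion on the
    list lets submodules be treated one generator at a time. *)
Fixpoint spanc (l : seq (M i)) (x : M i) : Prop :=
  if l is y :: l' then exists a, spanc l' (x - act0 a y) else bdry x.

Lemma spanc_bdry l x : bdry x -> spanc l x.
Proof.
elim: l x => //= y l IH x bx; exists 0; apply: IH.
by rewrite /act0 dm_act0l subr0.
Qed.

Lemma spancB l x y : spanc l x -> spanc l y -> spanc l (x - y).
Proof.
elim: l x y => [|z l IH] x y /=; first exact: bdryB.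
move=> [a ha] [b hb]; exists (a - b); rewrite act0Bl subrACA.
exact: IH.
Qed.

Lemma spancD l x y : spanc l x -> spanc l y -> spanc l (x + y).
Proof.
move=> hx hy; rewrite -[y]opprK; apply: spancB => //; rewrite -sub0r.
by apply: spancB => //; apply: spanc_bdry; exact: bdry0.
Qed.

Lemma spanc_act c l x : spanc l x -> spanc l (act0 c x).
Proof.
elim: l x => [|z l IH] x /=; first exact: act_bdry.
by move=> [a ha]; exists (cr_mul (add0r 0) c a); rewrite act0M -act0Br; exact: IH.
Qed.

Lemma spanc_cat l l' x x' : spanc l (x - x') -> spanc l' x' -> spanc (l ++ l') x.
Proof.
elim: l x => [|z l IH] x /=.
  by move=> b h; rewrite -(subrK x' x); apply: spancD => //; exact: spanc_bdry.
by move=> [a ha] h; exists a; apply: IH => //; rewrite addrAC.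
Qed.

Definition fgc : Prop :=
  exists2 l : seq (M i), (forall y, y \in l -> cocyc y) & forall x, cocyc x -> spanc l x.

Lemma spanc_sum n (e : 'I_n -> B 0) (g : 'I_n -> M i) (r : seq 'I_n) x :
  bdry (x - \sum_(k <- r) act0 (e k) (g k)) -> spanc [seq g k | k <- r] x.
Proof.
elim: r x => [|k r IH] x /=; first by rewrite big_nil subr0.
by rewrite big_cons opprD addrA => h; exists (e k); apply: IH.
Qed.

(** Induction on the generators. The coefficients of y in elements of S form an ideal I, which is
    finitely generated; elements of S realising its generators reduce any other to one spanned by
    the remaining list. *)
Lemma noeth_sub (S : M i -> Prop) (l : seq (M i)) : noetherian (H0 B) ->
  (forall x, bdry x -> S x) -> (forall x y, S x -> S y -> S (x - y)) ->
  (forall a x, S x -> S (act0 a x)) -> (forall y, y \in l -> cocyc y) ->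
  (forall x, S x -> spanc l x) ->
  exists2 l', (forall y, y \in l' -> S y) & forall x, S x -> spanc l' x.
Proof.
move=> nB; elim: l S => [|y l IH] S Sb SB Sa cl Sl.
  by exists [::] => // x /Sl.
have S0 : S 0 by apply: Sb; exact: bdry0.
have SD u v : S u -> S v -> S (u + v).
  by move=> Su Sv; rewrite -[v]opprK; apply: (SB) => //; rewrite -sub0r; exact: SB.
have cy : cocyc y by apply: cl; rewrite mem_head.
pose I (h : H0 B) := exists a x, [/\ h0c a = h, S x & spanc l (x - act0 a y)].
have idI : is_ideal I.
  split.
  - exists 0, 0; split => //; first exact: h0c0.
    by rewrite /act0 dm_act0l subrr; apply: spanc_bdry; exact: bdry0.
  - move=> _ _ [a [x [<- Sx lx]]] [b [z [<- Sz lz]]]; exists (a + b), (x + z).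
    split; [exact: h0cD|exact: SD|].
    by rewrite (morphBD (@act0Bl y)) opprD addrACA; exact: spancD.
  - move=> h _ [a [x [<- Sx lx]]]; have [c <-] := h0cP h.
    exists (cr_mul (add0r 0) c a), (act0 c x); split; [exact: h0cM|exact: Sa|].
    by rewrite act0M -act0Br; exact: spanc_act.
have [n [g Ig]] := nB _ idI.
have gI k : I (g k).
  rewrite Ig; exists (fun k' => if k' == k then 1 else 0).
  by rewrite (bigD1 k) //= eqxx mul1r big1 ?addr0 // => k' /negPf ->; rewrite mul0r.
pose w k := projT1 (cid (gI k)); pose v k := projT1 (cid (projT2 (cid (gI k)))).
have wv k : [/\ h0c (w k) = g k, S (v k) & spanc l (v k - act0 (w k) y)].
  exact: projT2 (cid (projT2 (cid (gI k)))).
have [l1 Sl1 spl1] : exists2 l', (forall z, z \in l' -> S z /\ spanc l z) &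
    forall x, S x /\ spanc l x -> spanc l' x.
  apply: (IH (fun x => S x /\ spanc l x)).
  - by move=> x bx; split; [exact: Sb|exact: spanc_bdry].
  - by move=> x z [? ?] [? ?]; split; [exact: SB|exact: spancB].
  - by move=> a x [? ?]; split; [exact: Sa|exact: spanc_act].
  - by move=> z zl; apply: cl; rewrite in_cons zl orbT.
  - by move=> x [].
exists (l1 ++ [seq v k | k <- enum 'I_n]).
  move=> z; rewrite mem_cat => /orP[/Sl1[] //|/mapP[k _ ->]].
  by have [] := wv k.
move=> x Sx; have [a lx] := Sl _ Sx.
have : I (h0c a) by exists a, x.
rewrite Ig => -[c ca]; pose e k := projT1 (cid (h0cP (c k))).
have ec k : h0c (e k) = c k by exact: projT2 (cid (h0cP (c k))).
pose s (r : seq 'I_n) := \sum_(k <- r) act0 (e k) (v k).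
pose b (r : seq 'I_n) : B 0 := \sum_(k <- r) cr_mul (add0r 0) (e k) (w k).
have Ss r : S (s r) /\ spanc l (s r - act0 (b r) y).
  rewrite /s /b; elim: r => [|k r [IH1 IH2]].
    rewrite !big_nil; split => //.
    by rewrite /act0 dm_act0l subrr; apply: spanc_bdry; exact: bdry0.
  have [_ Sv lv] := wv k; rewrite !big_cons; split; first by apply: SD => //; exact: Sa.
  rewrite (morphBD (@act0Bl y)) opprD addrACA; apply: spancD => //.
  by rewrite act0M -act0Br; exact: spanc_act.
have hb : h0c (b (enum 'I_n)) = h0c a.
  rewrite ca -big_enum /= /b; elim: (enum _) => [|k r IHr].
    by rewrite !big_nil h0c0.
  by rewrite !big_cons h0cD IHr h0cM ec; have [-> _ _] := wv k.
have [Ss1 Ss2] := Ss (enum 'I_n).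
(* In H^0(B) this combination has the same coefficient of y as x, so their difference is spanned by
   l. *)
apply: (@spanc_cat _ _ _ (s (enum 'I_n))); last first.
  by apply: (spanc_sum (e := e)); rewrite subrr; exact: bdry0.
apply: spl1; split; first exact: SB.
have -> : x - s (enum 'I_n) = (x - act0 a y) - (s (enum 'I_n) - act0 (b (enum 'I_n)) y)
    + act0 (a - b (enum 'I_n)) y.
  rewrite act0Bl; move: (s _) (act0 a y) (act0 _ y) => s1 A1 A2.
  by rewrite (subrACA x) subrK.
apply: spancD; first exact: spancB.
by apply: spanc_bdry; apply: act0_bdryl => //; apply/h0c_eq.
Qed.

End Span.
End DegreeZero.

Section FinGen.
Variables (B : cdgRing).

(** Coefficients in H^0(B) lift to B^0, all of whose elements are cocycles, because B has no
    elements of positive degree. *)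
Lemma fin_gen_fgc (M : dgModule B) i : fin_gen (Hmod M i) <-> fgc M i.
Proof.
have hclsc x (cx : is_cocycle x) (a : B 0) :
    hcls (Cocycle cx) = 0 :> H M i <-> bdry x by exact: hcls_eq0.
have hact0 (a : B 0) (y : cocycle M i) : h0c a *: (hcls y : Hmod M i) = hcls (zact (Cocycle (is_cocycle0 a)) y).
  exact: hactE.
have hZ (a : B 0) x (cx : is_cocycle x) (cax : is_cocycle (act0 a x)) :
    h0c a *: (hcls (Cocycle cx) : Hmod M i) = hcls (Cocycle cax).
  by rewrite hact0; congr hcls; exact: val_inj.
have closedP x : is_cocycle (C := M) (i := i) x <-> cocyc x.
  by split=> [/asboolP|cx] //; exact/asboolP.
have c_act (a : B 0) x : cocyc x -> is_cocycle (@act0 B M i a x).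
  by move=> cx; apply/closedP; exact: act_closed.
split=> [[n [g gen]]|[l cl gen]].
  exists [seq cval (hrep (g k)) | k <- enum 'I_n].
    by move=> y /mapP[k _ ->]; apply/closedP; exact: cvalP.
  move=> x cx; have [c hc] := gen (hcls (Cocycle ((closedP x).2 cx))).
  pose e k := projT1 (cid (h0cP (c k))).
  have ec k : h0c (e k) = c k by exact: projT2 (cid (h0cP (c k))).
  apply: (spanc_sum (e := e)).
  have cs r : cocyc (\sum_(k <- r) act0 (e k) (cval (hrep (g k)))).
    elim: r => [|k r IHr]; first by rewrite big_nil; exact: closed0.
    rewrite big_cons; apply: closedD => //; apply: act_closed; apply/closedP; exact: cvalP.
  have hs r : hcls (Cocycle ((closedP _).2 (cs r))) = \sum_(k <- r) c k *: g k :> Hmod M i.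
    elim: r => [|k r IHr].
      by rewrite [RHS]big_nil; apply/hcls_eq0 => /=; rewrite big_nil; exact: bdry0.
    rewrite [in RHS]big_cons -IHr -ec -[g k in RHS]hrepK hact0 -[RHS]hclsD.
    by congr hcls; apply: val_inj; rewrite /= big_cons.
  move: hc; rewrite -big_enum /= -hs => /hcls_eq/asboolP[j [e' [y dy]]].
  by rewrite -[X in bdry X]dy; exact: bdry_d.
pose cl0 (x : M i) : Hmod M i :=
  if pselect (is_cocycle x) is left cx then hcls (Cocycle cx) else 0.
have cl0E x (cx : is_cocycle x) : cl0 x = hcls (Cocycle cx).
  by rewrite /cl0; case: pselect => // cx'; congr hcls; exact: val_inj.
exists (size l), (fun k => cl0 (nth 0 l k)) => h; rewrite -[h]hrepK.
set x := cval (hrep h).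
have cx : is_cocycle x by exact: cvalP.
have -> : hcls (hrep h) = cl0 x.
  by rewrite (cl0E _ cx); congr hcls; exact: val_inj.
have := gen _ ((closedP x).1 cx); move: (x) (cx).
elim: l cl {gen} => [|y l IH] cl z cz /=.
  move=> bz; exists (fun=> 0); rewrite big_ord0 (cl0E _ cz); exact/hcls_eq0.
move=> [a /IH[]].
- by move=> u ul; apply: cl; rewrite in_cons ul orbT.
- apply/closedP; apply: closedB; first exact/closedP.
  by apply/closedP/c_act/cl; rewrite mem_head.
move=> c hc.
have cy : cocyc y by apply: cl; rewrite mem_head.
exists (fun k : 'I_(size l).+1 => if unlift ord0 k is Some k' then c k' else h0c a).
rewrite big_ord_recl unlift_none /=.
under eq_bigr do rewrite liftK.
have cd : is_cocycle (z - act0 a y).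
  by apply/closedP/closedB; [exact/closedP|apply/closedP; exact: c_act].
rewrite -hc (cl0E _ ((closedP _).2 cy)) (hZ a _ _ (c_act a _ cy)) (cl0E _ cz) (cl0E _ cd).
by rewrite -hclsD; congr hcls; apply: val_inj => /=; rewrite addrC subrK.
Qed.

(** The image of H(E) in H(X) is finitely generated by [noeth_sub]. Lifts of its generators together
    with the images of those of H(Y) generate H(E). *)
Lemma fgc_exact (nB : noetherian (H0 B)) (Y E X : dgModule B) j k l
    (phi : Y j -> E k) (psi : E k -> X l) :
  {morph phi : x y / x - y} -> {morph psi : x y / x - y} ->
  (forall a x, phi (act0 a x) = act0 a (phi x)) ->
  (forall a x, psi (act0 a x) = act0 a (psi x)) ->
  (forall x, cocyc x -> cocyc (phi x)) -> (forall x, bdry x -> bdry (phi x)) ->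
  (forall x, cocyc x -> cocyc (psi x)) ->
  (forall x, cocyc x -> bdry (psi x) -> exists2 y, cocyc y & bdry (x - phi y)) ->
  fgc Y j -> fgc X l -> fgc E k.
Proof.
move=> phiB psiB phiA psiA phic phib psic ex [ly cly sly] [lx clx slx].
pose S z := exists2 x, cocyc x & bdry (z - psi x).
have [||||l' Sl' sl'] := @noeth_sub B X l S lx nB _ _ _ clx.
- by move=> z bz; exists 0; [exact: closed0|rewrite (morphB0 psiB) subr0].
- move=> z z' [x cx bx] [x' cx' bx']; exists (x - x'); first exact: closedB.
  by rewrite psiB subrACA; exact: bdryB.
- move=> a z [x cx bx]; exists (act0 a x); first exact: act_closed.
  by rewrite psiA -act0Br; exact: act_bdry.
- move=> z [x cx bx]; apply: slx.
  by rewrite -(subrK (psi x) z); apply: closedD; [exact: bdry_closed|exact: psic].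
pose g z := if pselect (S z) is left p then s2val (cid2 p) else 0.
have gP z : S z -> cocyc (g z) /\ bdry (z - psi (g z)).
  by move=> Sz; rewrite /g; case: pselect => // p; case: cid2.
have lift r w : (forall z, z \in r -> S z) -> spanc r w ->
    exists x', [/\ cocyc x', spanc [seq g z | z <- r] x' & bdry (w - psi x')].
  elim: r w => [|z r IH] w Sr /=.
    by move=> bw; exists 0; split; [exact: closed0|exact: bdry0|rewrite (morphB0 psiB) subr0].
  move=> [a /IH[|x' [cx' sx' bx']]].
    by move=> u ur; apply: Sr; rewrite in_cons ur orbT.
  have [cg bg] := gP z (Sr z (mem_head _ _)).
  exists (x' + act0 a (g z)); split.
  - by apply: closedD => //; exact: act_closed.
  - by exists a; rewrite addrK.
  - rewrite (morphBD psiB) psiA opprD addrA.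
    have -> : w - psi x' - act0 a (psi (g z)) = (w - act0 a z - psi x') + act0 a (z - psi (g z)).
      by rewrite act0Br [w - _ - psi x']addrAC addrA subrK.
    by apply: bdryD => //; exact: act_bdry.
exists ([seq phi y | y <- ly] ++ [seq g z | z <- l']).
  move=> y; rewrite mem_cat => /orP[/mapP[u ul ->]|/mapP[u /Sl' /gP[? _] -> //]].
  by apply: phic; exact: cly.
move=> x cx.
have [x' [cx' sx' bx']] : exists x', [/\ cocyc x', spanc [seq g z | z <- l'] x' &
    bdry (psi x - psi x')].
  by apply: lift => //; apply: sl'; exists x => //; rewrite subrr; exact: bdry0.
have [y cy by_] : exists2 y, cocyc y & bdry (x - x' - phi y).
  by apply: ex; [exact: closedB|rewrite psiB].
apply: spanc_cat sx'.
rewrite -(subrK (phi y) (x - x')); apply: spancD; first exact: spanc_bdry.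
have := sly _ cy; elim: (ly) (y) => [|u r IH] v /=; first exact: phib.
by move=> [a ha]; exists a; rewrite -phiA -phiB; exact: IH.
Qed.

End FinGen.

(** * Injective dimension and devissage *)

Lemma con_sub (C : complex) (I : set int) : int_interval I ->
  (forall i, ~ I i -> van C i) -> (con C `<=` I)%classic.
Proof.
move=> iI vC i; apply; split => // j [h h0]; apply: contrapT => nI.
by apply: h0; apply/vanE: h; exact: vC.
Qed.

Lemma con_mem (C : complex) i : ~ van C i -> con C i.
Proof.
move=> nv I [_]; apply; apply: contrapT => nh; apply: nv; apply/vanE => h.
by apply: contrapT => h0; apply: nh; exists h.
Qed.

Section InjDim.
Variables (B : cdgRing) (R : dgModule B) (d0 d1 : int).
Hypothesis injR : forall M : dgModule B,
  exists P : kproj_resolution M, (con (RHom P R) `<=` con_bound (con M) d0 d1)%classic.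

(** An interval I that merely contains the cohomological degrees of T suffices, so that one-sided
    bounds can be used without computing [con T]. *)
Lemma inj_dim_van (T : dgModule B) (I : set int) j : K_projective T -> int_interval I ->
  (forall i, ~ I i -> van T i) -> (forall s, I s -> ~ (d0 - s <= j <= d1 - s)) -> hvan T R j.
Proof.
move=> KT iI vT nI; have [P cP] := injR T.
apply: (Kproj_unique (@kp_proj _ _ P) KT (@kp_qis _ _ P) (qis_id T)).
apply: contrapT => nv; have [s cs [d /= dd jE]] := cP _ (con_mem nv).
have Is := con_sub iI vT cs.
by apply: (nI s Is); rewrite -jE; lia.
Qed.

Lemma inj_dim_lt (T : dgModule B) m j : K_projective T -> (forall i, m < i -> van T i) ->
  j < d0 - m -> hvan T R j.
Proof.
move=> KT vT jm; apply: (@inj_dim_van T [set i | i <= m]%classic) => //.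
- by move=> x y z /= xm ym; lia.
- by move=> i /= /negP; rewrite -ltNge; exact: vT.
- by move=> s /=; lia.
Qed.

Lemma inj_dim_gt (T : dgModule B) e j : K_projective T -> (forall i, i < e -> van T i) ->
  d1 - e < j -> hvan T R j.
Proof.
move=> KT vT jm; apply: (@inj_dim_van T [set i | e <= i]%classic) => //.
- by move=> x y z /= xm ym; lia.
- by move=> i /= /negP; rewrite -ltNge; exact: vT.
- by move=> s /=; lia.
Qed.

End InjDim.

Section Cell.
Variables (B : cdgRing) (S : dgModule B) (m : int) (z : S m).
Hypothesis cz : cocyc z.

Lemma el_closed : hclosed (el z).
Proof.
rewrite /hclosed /cocyc /= el_d [cx_d _ z]cz; exact: (cm_0 (elm S)).
Qed.

Lemma cell_e : 1 - m + m = 0 + 1. Proof. by lia. Qed.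

(* [S] with a cell of degree [m - 1] attached along the cocycle [z]. *)
Definition cell : twist (dg_self B) S :=
  @Twist B (dg_self B) S m (1 - m) 0 (fun k => k + (1 - m)) id (fun k => erefl)
    (fun k => esym (addr0 k)) cell_e (el z) el_closed.

Lemma cell_proj : K_projective S -> K_projective (Tw cell).
Proof. by move=> KS; apply: Kproj_tw => //; exact: self_proj. Qed.

Lemma cell_van k : van (dg_self B) (k + (1 - m)) -> van S k -> van (Tw cell) k.
Proof. by move=> vB vS; exact: (ses_van_mid (tw_ses cell)). Qed.

Definition cell_inc k (s : S k) : Tw cell k := (0, s).

Lemma cell_fgc (nB : noetherian (H0 B)) k :
  fgc (dg_self B) (k + (1 - m)) -> fgc S k -> fgc (Tw cell) k.
Proof.
move=> fB fS; have ses := tw_ses cell.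
apply: (fgc_exact nB (phi := @cell_inc k) (psi := fun w : Tw cell k => w.1 : dg_self B _) _ _ _ _ _ _ _ _ fS fB).
- exact: (siB ses).
- exact: (spB ses).
- move=> a s; congr pair; first by rewrite -[RHS]/(sgnz _ (dm_act _ a 0)) dm_act0r sgnz0.
  by rewrite -[RHS]/(sgnz (0 * 0) (dm_act _ a s)) mul0r sgnz0l; congr dm_act; exact: eq_irrelevance.
- move=> a w; rewrite -[LHS]/(sgnz ((1 - m) * 0) (dm_act _ a w.1)) mulr0 sgnz0l.
  by congr dm_act; exact: eq_irrelevance.
- by move=> x /(si_closed ses).
- by move=> x /(si_bdry ses).
- by move=> x /(sp_closed ses).
- by move=> x cx /(ses_mid ses cx).
Qed.

Lemma cell_kills (a : B 0) : bdry (cell_inc (act0 a z)).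
Proof.
have e0 : 0 = m - 1 + (1 - m) by lia.
have e : m - 1 + 1 = m := subrK 1 m.
apply/(bdryE e).
exists ((- tr (C := dg_self B) e0 a, 0) : Tw cell (m - 1)); congr pair.
  rewrite -[LHS]/(sgnz _ (cx_d (c := dg_self B) _ _)) cx_dN d_tr.
  rewrite -[cx_d _ a]/(@cx_d B 0 _ _ a); set u := cx_d _ a.
  have -> : u = 0 by apply: (@cr_nonpos B); rewrite /=; lia.
  by rewrite oppr0 sgnz0.
rewrite -[LHS]/(sgnz 0 (cx_d _ 0 - hd_fun (el z) (t_sf_d cell e) (- tr (C := dg_self B) e0 a))).
rewrite cx_d0 sub0r hd_N opprK sgnz0l hd_tr.
by rewrite -[LHS]/(sgnz (m * 0) (dm_act _ a z)) mulr0 sgnz0l; congr dm_act; exact: eq_irrelevance.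
Qed.

End Cell.

Lemma self_van (B : cdgRing) k : 0 < k -> van (dg_self B) k.
Proof. by move=> k0 x _; rewrite [x](@cr_nonpos B) //; exact: bdry0. Qed.

(* Dimension shifting: attaching finitely many cells kills the top cohomology. *)
Lemma devissage (B : cdgRing) (nB : noetherian (H0 B)) (fB : forall i, fgc (dg_self B) i)
    (Phi : dgModule B -> Prop) (c : int) :
  (forall S, K_projective S -> (forall k, c < k -> van S k) -> Phi S) ->
  (forall (S : dgModule B) m (z : S m) (cz : cocyc z), K_projective S -> Phi (Tw (cell cz)) -> Phi S) ->
  forall S m, K_projective S -> (forall k, fgc S k) -> (forall k, m < k -> van S k) -> Phi S.
Proof.
move=> base step S m KS fS vS.
(* The outer induction counts the degrees above c, the inner one the generators of the top
   cohomology. *)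
have [n mn] : exists n : nat, m <= c + n%:Z by exists `|m - c|%N; lia.
elim: n => [|n IH] in S m KS fS vS mn *.
  by apply: base => // k ck; apply: vS; lia.
have [l cl sl] := fS m.
move sz: (size l) => N; elim: N => [|N IHN] in S KS fS vS l cl sl sz *.
  apply: (IH S (m - 1)) => //; last by lia.
  move=> k mk; have [->|km] := eqVneq k m; last by apply: vS; lia.
  by move=> x cx; have := sl x cx; rewrite (size0nil sz).
case: l cl sl sz => // z l cl sl [sz].
have cz : cocyc z by apply: cl; rewrite mem_head.
apply: (step S m z cz KS).
have vC k : m < k -> van (Tw (cell cz)) k.
  by move=> mk; apply: cell_van; [apply: self_van; lia|exact: vS].
have ses := tw_ses (cell cz).
apply: (IHN _ (@cell_proj _ _ _ _ cz KS) _ vC [seq @cell_inc _ _ _ _ cz m y | y <- l]).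
- by move=> k; exact: cell_fgc.
- move=> y /mapP[u ul ->]; apply/(si_closed ses); apply: cl.
  by rewrite in_cons ul orbT.
- move=> x cx.
  (* The cell contributes H^1(B) = 0 in degree m, so every class there comes from S. *)
  have [|y cy bxy] := ses_mid ses cx.
    by apply: (@self_van B (t_sa (cell cz) m)); [rewrite /=; lia|exact: (sp_closed ses)].
  have [a ha] := sl y cy.
  have sub r u : spanc r u -> spanc [seq @cell_inc _ _ _ _ cz m v | v <- r] (cell_inc cz u).
    elim: r u => [|v r IHr] u /=; first exact: (si_bdry ses).
    move=> [b /IHr hb]; exists b; move: hb; rewrite [cell_inc _ _](siB ses).
    congr (spanc _ (_ - _)); congr pair.
      by rewrite -[RHS]/(sgnz _ (dm_act _ b 0)) dm_act0r sgnz0.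
    by rewrite -[RHS]/(sgnz (0 * 0) (dm_act _ b v)) mul0r sgnz0l; congr dm_act; exact: eq_irrelevance.
  rewrite -(subrK (cell_inc cz y) x); apply: spancD; first exact: spanc_bdry.
  rewrite -(subrK (cell_inc cz (act0 a z)) (cell_inc cz y)); apply: spancD.
    by rewrite -(siB ses); exact: sub.
  by apply: spanc_bdry; exact: cell_kills.
- by rewrite size_map.
Qed.

Lemma hcomp_el (B : cdgRing) (N Q : dgModule B) i j k (e : i + j = k) (g : hom_deg N Q j)
    (y : N i) : hcomp e g (el y) = el (hd_fun g e y).
Proof.
apply: hom_deg_eq => p q e' b.
have e1 : p + i + j = q by lia.
rewrite (hcompE _ _ _ _ (erefl (p + i)) e1) /= hd_sgn.
rewrite (hd_act g (erefl (p + i)) e1 e e') sgnzD.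
by apply: sgnz_odd; rewrite -e; lia.
Qed.

Lemma tw_cosnd_d (A : cdgRing) (P N Q : dgModule A) (t : twist P N) j ja jb
    (ea : ja + t_a t = j) (eb : jb + t_b t = j) j' ja' jb' (ea' : ja' + t_a t = j')
    (eb' : jb' + t_b t = j') (e : j + 1 = j') (e2 : jb + 1 = jb') (F : hom_deg (Tw t) Q j) :
  tw_cosnd ea' eb' (hd_d e F) = hd_d e2 (tw_cosnd ea eb F).
Proof.
have e1 : ja + 1 = ja' by lia.
have e3 : t_i t + jb = ja' by have := t_iE t; lia.
rewrite -{1}[F](tw_copair_eta ea eb) (tw_copair_d ea eb ea' eb' e e1 e2 e3).
by rewrite tw_copair_snd.
Qed.

Section FinGenHom.
Variables (B : cdgRing) (R : dgModule B) (d0 d1 : int).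
Hypothesis nB : noetherian (H0 B).
Hypothesis fB : forall i, fgc (dg_self B) i.
Hypothesis fR : forall i, fgc R i.
Hypothesis injR : forall M : dgModule B,
  exists P : kproj_resolution M, (con (RHom P R) `<=` con_bound (con M) d0 d1)%classic.

(** Evaluation at the attaching cocycle z makes H^j Hom(Tw (cell cz), R) -> H^j Hom(S, R) -> H^(m +
    j)(R) exact, so finite generation passes from the larger module to S. *)
Lemma hom_fgc (S : dgModule B) m j : K_projective S -> (forall k, fgc S k) ->
  (forall k, m < k -> van S k) -> fgc (HomDG S R) j.
Proof.
(* For S in degrees <= d0 - j - 1, RHom(S, R) lives in degrees >= j + 1. *)
apply: (devissage nB fB (Phi := fun S => fgc (HomDG S R) j) (c := d0 - j - 1)).
  move=> {}S KS vS; exists [::] => // F cF.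
  by apply: (inj_dim_lt injR KS vS) => //; lia.
move=> {}S {}m z cz KS; set t := cell cz => fC.
have ea : j - t_a t + t_a t = j := subrK _ _.
have eb : j + t_b t = j := addr0 j.
have ea' : j - t_a t + 1 + t_a t = j + 1 by lia.
have eb' : j + 1 + t_b t = j + 1 := addr0 _.
have emj : m + j = j - t_a t + 1 by rewrite /t /=; lia.
apply: (fgc_exact nB (phi := fun F : HomDG (Tw t) R j => tw_cosnd ea eb F : HomDG S R j)
  (psi := fun G : HomDG S R j => hd_fun (G : hom_deg S R j) emj z)) fC (fR _).
- by move=> F G; exact: hom_deg_eq.
- by [].
- by move=> a F; apply: hom_deg_eq => p k e x; exact: act_hd_fun.
- by move=> a G; exact: hd_scaleE.
- move=> F cF; apply/(hclosedE (erefl (j + 1))).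
  rewrite -(tw_cosnd_d ea eb ea' eb' (erefl (j + 1)) (erefl (j + 1))) [hd_d _ F]cF.
  exact: hom_deg_eq.
- move=> F /(hbdryE (subrK 1 j))[H <-].
  have ea2 : j - t_a t - 1 + t_a t = j - 1 by lia.
  rewrite (tw_cosnd_d ea2 (addr0 (j - 1) : j - 1 + t_b t = j - 1) ea eb _ (subrK 1 j)).
  exact: (@bdry_d (HomDG S R)).
- by move=> G cG; exact: hd_closed.
- move=> G cG.
  move=> /(bdryE (erefl (j - t_a t + 1)))[r dr].
  exists (tw_copair ea eb (- sgnz (j + t_b t) (el r)) G).
    apply/(hclosedE (erefl (j + 1))).
    rewrite (tw_copair_d ea eb ea' eb' _ erefl erefl emj).
    rewrite -[t_f t]/(el z) hcomp_el -dr -el_d ((hclosedE erefl G).1 cG).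
    rewrite (morphN (@hd_dB _ _ _ _ _ _)) hd_d_sgn addNr.
    by apply: hom_deg_eq => p k e x; rewrite /= addr0.
  by rewrite tw_copair_snd subrr; exact: (@bdry0 (HomDG S R)).
Qed.
End FinGenHom.

(** * Biduality *)

(** The five lemma needs strictly commuting squares and equal sign data; rescaling the inclusion
    degree by degree adjusts both. *)
Lemma ses_resign (Y E X : complex) (sb sa : int -> int) (u u' v b a : int)
    (si : forall k, Y (sb k) -> E k) (sp : forall k, E k -> X (sa k)) (c : int -> int) :
  (forall k, odd `|(c (k + 1) + u')%R|%N = odd `|(u + c k)%R|%N) ->
  is_ses u v b a si sp -> is_ses u' v b a (fun k y => si k (sgnz (c k) y)) sp.
Proof.
move=> cE s; split; try by case: s.
- by move=> k x y; rewrite sgnzB (siB s).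
- move=> k l e e' y; rewrite (si_d s e e'); subst l; congr (si _ _).
  by rewrite cx_d_sgn !sgnzD; apply: sgnz_odd; rewrite cE.
- by move=> k y /(si_inj s)/sgnz_inj.
- by move=> k x /(ses_ex s)[y ->]; exists (sgnz (c k) y); rewrite sgnzK.
Qed.

Lemma elm_qis (B : cdgRing) (N : dgModule B) : is_qis (elm N).
Proof.
apply/is_qisE => i; split=> [x cx /(hbdryE (subrK 1 i))[G dG]|F cF].
  apply/(bdryE (subrK 1 i)); exists (hd_fun G (add0r _) (cr_one B)).
  by rewrite -[LHS](el_1 _ (add0r i)) -el_d elK dG el_1.
exists (hd_fun (F : hom_deg _ _ _) (add0r i) (cr_one B)); last first.
  by rewrite -[elm N i _]/(el _) elK subrr; exact: bdry0.
rewrite /cocyc -[LHS](el_1 _ (add0r (i + 1))) -el_d elK [hd_d _ F]cF; exact: erefl.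
Qed.

Lemma qis_comp (A : cdgRing) (M N P : dgModule A) (v : dgHom N P) (u : dgHom M N) :
  is_qis v -> is_qis u -> is_qis (dg_comp v u).
Proof.
move=> /is_qisE qv /is_qisE qu; apply/is_qisE => i; split=> [x cx bx|y cy].
  by apply: (qu i).1 => //; apply: (qv i).1 => //; exact: cm_closed.
have [y' cy' b'] := (qv i).2 y cy; have [x cx b] := (qu i).2 y' cy'.
exists x => //; have := bdryD b' (cm_bdry v b).
by rewrite cm_B addrA subrK.
Qed.

Lemma tw_cosnd_irr (A : cdgRing) (P N Q : dgModule A) (t : twist P N) j ja jb
    (ea : ja + t_a t = j) (eb : jb + t_b t = j) j' ja' jb' (ea' : ja' + t_a t = j')
    (eb' : jb' + t_b t = j') (e : j = j') (e2 : jb = jb') (F : HomDG (Tw t) Q j) :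
  tw_cosnd ea' eb' (tr e F : hom_deg _ _ _) = tr (C := HomDG N Q) e2 (tw_cosnd ea eb (F : hom_deg _ _ _)).
Proof.
have ej : ja = ja' by lia.
case: j' / e ea' eb' => ea' eb'; case: jb' / e2 eb' => eb'; case: ja' / ej ea' => ea'.
by rewrite !tr_id (eq_irrelevance ea' ea) (eq_irrelevance eb' eb).
Qed.

Lemma sgnz_sq (V : zmodType) i (x : V) : sgnz (i * i) x = sgnz i x.
Proof. by apply: sgnz_odd; rewrite abszM oddM andbb. Qed.

Section Bidual.
Variables (B : cdgRing) (R P0 : dgModule B) (p : dgHom P0 R).
Variables (S W : dgModule B) (sigma : dgHom S (HomDG W R)).
Variables (m : int) (z : S m) (cz : cocyc z).
Variables (omega : hom_deg W P0 m) (cw : hclosed omega) (h : hom_deg W R (m - 1)).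
Hypothesis dh : hd_d (subrK 1 m) h =
  (sigma m z : hom_deg W R m) - hcomp (addr0 m) (hm p) omega.

Let t := cell cz.
Notation a := (t_a t).

Lemma bd_e : - t_b t + m = - a + 1. Proof. by rewrite /=; lia. Qed.

(** The dual of attaching a cell: W stands for the dual of S and P0, the resolution of R, for the
    dual of B. The value of [sigma] at z is a map W -> R, and omega lifts it to P0 up to the
    homotopy h. *)
Definition btw : twist W P0 :=
  @Twist B W P0 m (- t_b t) (- a) (fun k => k - t_b t) (fun k => k - a)
    (fun k => erefl) (fun k => erefl) bd_e omega cw.

Lemma bd_ea k : k + t_a btw = k. Proof. by rewrite /=; lia. Qed.
Lemma bd_eb k : k + a + t_b btw = k. Proof. by rewrite /=; lia. Qed.

Definition binj : dgHom (HomDG W R) (HomDG (Tw btw) R).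
Proof.
unshelve refine (@DgHom B (HomDG W R) (HomDG (Tw btw) R) (@CxMap (HomDG W R) (HomDG (Tw btw) R)
  (fun k F => tw_copair (bd_ea k) (bd_eb k) F 0) _ _) _).
- by move=> k F G; rewrite -tw_copairB subr0.
- move=> k l e F.
  have e2 : k + a + 1 = l + a by lia.
  have e3 : t_i btw + (k + a) = l by rewrite /=; lia.
  rewrite [RHS](tw_copair_d _ _ (bd_ea l) (bd_eb l) e e e2 e3).
  by rewrite hcomp0l sgnz0 addr0 hd_d0.
- move=> q k l e b F; apply: hom_deg_eq => i n e' w.
  by rewrite /= addr0 [in RHS]addr0; exact: act_hd_fun.
Defined.

Lemma bdx_a : m - 1 + t_a btw = - a. Proof. by rewrite /=; lia. Qed.
Lemma bdx_b : 0 + t_b btw = - a. Proof. by rewrite /=; lia. Qed.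

(** The value on the new cell of the extension [bsig] of [sigma]. Its differential must match the
    attaching cocycle z, and h compensates for omega being only a lift up to homotopy. *)
Definition bdx : HomDG (Tw btw) R (- a) :=
  tw_copair bdx_a bdx_b (- h) (- hm p) : hom_deg (Tw btw) R (- a).

Lemma bdx_d (e : - a + 1 = m) : cx_d e bdx = - binj m (sigma m z).
Proof.
have e3 : t_i btw + 0 = m := addr0 _.
have e2 : 0 + 1 = m + a by rewrite /=; lia.
rewrite [LHS](tw_copair_d _ _ (bd_ea m) (bd_eb m) e (subrK 1 m) e2 e3).
have -> : hd_d e2 (- hm p) = 0.
  by rewrite (morphN (@hd_dB _ _ _ _ _ _)) ((hclosedE e2 _).1 (hm_closed p)) oppr0.
rewrite (morphN (@hd_dB _ _ _ _ _ _)) dh.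
rewrite (@sgnz_odd _ _ 0) ?sgnz0l; last by rewrite /=; lia.
rewrite -[t_f btw]/omega (morphN (fun x y => hcompBl e3 x y omega)).
rewrite (_ : e3 = addr0 m); last exact: eq_irrelevance.
rewrite opprB addrAC subrr add0r.
by apply: hom_deg_eq => i n e' w; rewrite -[LHS]/(- _ + 0) -[RHS]/(- (_ + 0)) !addr0.
Qed.

Lemma bds_a : - a + a = 0. Proof. by rewrite addNr. Qed.
Lemma bds_b : 0 + t_b t = 0. Proof. by []. Qed.

Lemma bsig_closed : hclosed (tw_copair (t := t) (Q := HomDG (Tw btw) R) bds_a bds_b (el bdx)
  (hm (dg_comp binj sigma))).
Proof.
apply/(hclosedE (erefl (0 + 1))).
have e1 : - a + 1 = m by rewrite /=; lia.
have ea : m + a = 0 + 1 by rewrite /=; lia.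
have eb : 1 + t_b t = 0 + 1 by [].
rewrite (tw_copair_d bds_a bds_b ea eb _ e1 (add0r 1) (addr0 m)).
rewrite -[t_f t]/(el z) hcomp_el el_d bdx_d ((hclosedE (add0r 1) _).1 (hm_closed _)).
rewrite hmE -[el (- _)]/(elm _ _ (- _)) cm_N addNr.
by apply: hom_deg_eq => i n e w; rewrite -[LHS]/(0 + 0) addr0.
Qed.

Definition bsig : dgHom (Tw t) (HomDG (Tw btw) R) := dgh bsig_closed.

Lemma bsigE j (c : Tw t j) i l (e : i + j = l) (w : Tw btw i) k
    (e1 : t_sa btw i + (m - 1) = k) (e2 : t_sb btw i = k) (e3 : t_sa t j + k = l)
    (e4 : t_sa btw i + j = l) :
  hd_fun (bsig j c : hom_deg (Tw btw) R j) e w =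
  sgnz (a * t_sa t j) (dm_act e3 (c.1 : B _) (- hd_fun h e1 w.1 - tr e2 (p _ w.2))) +
  hd_fun (sigma j c.2 : hom_deg W R j) e4 w.1.
Proof.
rewrite -[bsig j c]/((hd_fun (el bdx) (tw_copair_a bds_a (addr0 j)) c.1 +
  tr (C := HomDG (Tw btw) R) (hd_add0 (tw_copair_b bds_b (addr0 j))) (binj j (sigma j c.2)))
  : hom_deg (Tw btw) R j).
rewrite hd_funD tr_id; congr (_ + _); last first.
  rewrite -[LHS]/(hd_fun (sigma j c.2 : hom_deg W R j) _ w.1 + 0) addr0.
  by congr hd_fun; exact: eq_irrelevance.
rewrite -[hd_fun (el bdx) _ _]/(sgnz (- a * t_sa t j)
   (hd_scale (tw_copair_a bds_a (addr0 j)) (c.1 : B _) (bdx : hom_deg (Tw btw) R (- a)))).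
have e5 : i - a = k by rewrite -e2.
rewrite hd_fun_sgnz (hd_scaleE _ _ _ _ e5 e3).
rewrite (@sgnz_odd _ (- a * t_sa t j) (a * t_sa t j)); last by lia.
congr (sgnz _ (dm_act _ _ _)).
rewrite -[LHS]/(- hd_fun h _ w.1 + - tr _ (p _ w.2)).
by congr (- _ - _); [congr hd_fun|congr tr]; exact: eq_irrelevance.
Qed.

Lemma bsig_swap k (w : Tw btw k) j (c : Tw t j) l (e : j + k = l) i
    (e1 : t_sa btw k + (m - 1) = i) (e2 : t_sb btw k = i) (e3 : t_sa t j + i = l)
    (e4 : t_sa btw k + j = l) :
  hd_fun (dgh (swap_closed (hm_closed bsig)) k w : hom_deg (Tw t) R k) e c =
  sgnz (k * j) (sgnz (a * t_sa t j)
    (dm_act e3 (c.1 : B _) (- hd_fun h e1 w.1 - tr e2 (p _ w.2))) +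
    hd_fun (sigma j c.2 : hom_deg W R j) e4 w.1).
Proof.
have e5 : k + j = l by rewrite addrC.
rewrite -[dgh _ k w]/(hd_fun (swap (hm bsig)) (addr0 k) w).
rewrite (swapE _ _ _ _ _ (addr0 j) e5) mulrC hmE.
by congr sgnz; exact: bsigE.
Qed.

Definition wS : dgHom W (HomDG S R) := dgh (swap_closed (hm_closed sigma)).

Lemma wSE k (w : W k) j (s : S j) l (e : j + k = l) (e' : k + j = l) :
  hd_fun (wS k w : hom_deg S R k) e s = sgnz (k * j) (hd_fun (sigma j s : hom_deg W R j) e' w).
Proof.
rewrite -[wS k w]/(hd_fun (swap (hm sigma)) (addr0 k) w).
by rewrite (swapE _ _ _ _ _ (addr0 j) e') mulrC hmE.
Qed.

(** Five lemma: on the outer terms the map is p followed by the identification of R with Hom(B, R),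
    and [wS]. The rescaling by 1 - a k reconciles the signs of [tw_ses] and [hom_tw_ses]. *)
Lemma bsig_swap_qis : is_qis p -> is_qis wS -> is_qis (dgh (swap_closed (hm_closed bsig))).
Proof.
move=> qp qS.
have s : is_ses (- a) (- t_b t) (- a) (- t_b t)
   (fun k (F : HomDG (dg_self B) R (k - a)) =>
     tw_copair (subrK _ k) (subrK _ k) (sgnz (1 - a * k) F) 0 : HomDG (Tw t) R k)
   (fun k (F : HomDG (Tw t) R k) => tw_cosnd (subrK _ k) (subrK _ k) F : HomDG S R (k - t_b t)).
  have cE k : odd `|(1 - a * (k + 1) + - a)%R|%N = odd `|(0 + (1 - a * k))%R|%N by lia.
  exact: (ses_resign (c := fun k => 1 - a * k) cE (hom_tw_ses R t)).
apply: (ses_five (tw_ses btw) s (fy := dg_comp (elm R) p) (fx := wS)).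
- move=> k y; apply: hom_deg_eq => j l e c.
  have e1 : t_sa btw k + (m - 1) = k - a by rewrite /=; lia.
  have e3 : t_sa t j + (k - a) = l by rewrite /=; lia.
  have e4 : t_sa btw k + j = l by rewrite /=; lia.
  rewrite (bsig_swap _ _ _ e1 erefl e3 e4) hd_0 oppr0 sub0r dm_actN hd_0 addr0 tr_id.
  rewrite -[RHS]/(hd_fun (sgnz (1 - a * k) (el (p (k - a) y))) (tw_copair_a (subrK a k) e) c.1 + 0).
  rewrite addr0 hd_fun_sgnz.
  rewrite -[hd_fun (el _) _ _]/(sgnz ((k - a) * t_sa t j) (dm_act _ (c.1 : B _) (p (k - a) y))).
  rewrite (eq_irrelevance (tw_copair_a _ _) e3) !sgnzD -[- dm_act _ _ _](sgnzE 1) sgnzD.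
  by apply: sgnz_odd; rewrite /=; lia.
- move=> k x; apply: hom_deg_eq => j l e s'.
  have e0 : j + (k - 0) = l := e.
  have e1 : t_sa btw k + (m - 1) = k - a by rewrite /=; lia.
  have e3 : t_sa t (j - t_b t) + (k - a) = l by rewrite /=; lia.
  have e4 : t_sa btw k + (j - t_b t) = l by rewrite /=; lia.
  have e5 : t_sa btw k + j = l by rewrite /=; lia.
  rewrite -[LHS]/(hd_fun (dgh (swap_closed (hm_closed bsig)) k x : hom_deg (Tw t) R k)
    (tw_cosnd_subproof (subrK (t_b t) k) e) ((0, tr (tw_cosnd_tr t j) s') : Tw t _)).
  rewrite (bsig_swap _ _ _ e1 erefl e3 e4) dm_act0l sgnz0 add0r (wSE _ _ _ e5).
  have key j' (ej : j = j') (e6 : t_sa btw k + j' = l) :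
      hd_fun (sigma j' (tr ej s') : hom_deg W R j') e6 x.1 = hd_fun (sigma j s' : hom_deg W R j) e5 x.1.
    by subst j'; congr hd_fun; exact: eq_irrelevance.
  rewrite key; apply: sgnz_odd; rewrite /=; lia.
- by apply: qis_comp; [exact: elm_qis|].
- by [].
Qed.

(* The last argument relates [sigma] and [bsig] through the fibre of the
   homothety. *)
Definition bhom : hom_deg (dg_self B) (HomDG P0 R) 0 :=
  el (sgnz (a + 1) (hm p) : HomDG P0 R 0).

Lemma bhom_closed : hclosed bhom.
Proof.
have cp : cx_d (c := HomDG P0 R) (erefl (0 + 1)) (hm p) = 0 := hm_closed p.
rewrite /hclosed /cocyc /= el_d cx_d_sgn cp sgnz0.
exact: (cm_0 (elm _)).
Qed.

Definition bsi k (x : Tw (fib (hm_closed sigma)) k) : Tw (fib (hm_closed bsig)) k :=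
  ((0, x.1), binj _ x.2).

Lemma bsp_e k : k + (0 - 1) = t_sa t k + (0 - 1) + t_b btw. Proof. by rewrite /=; lia. Qed.

Definition bsp k (x : Tw (fib (hm_closed bsig)) k) : Tw (fib (hm_closed (dgh bhom_closed))) (t_sa t k) :=
  (x.1.1, sgnz (a * k) (tw_cosnd (bd_ea _) (esym (bsp_e k)) (x.2 : hom_deg (Tw btw) R _))).

Lemma bsig_inr k (s : S k) : bsig k ((0, s) : Tw t k) = binj k (sigma k s).
Proof.
apply: hom_deg_eq => i l e w.
have e1 : t_sa btw i + (m - 1) = i - a by rewrite /=; lia.
have e3 : t_sa t k + (i - a) = l by rewrite /=; lia.
have e4 : t_sa btw i + k = l by rewrite /=; lia.
rewrite (bsigE _ _ _ e1 erefl e3 e4) dm_act0l sgnz0 add0r.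
rewrite -[RHS]/(hd_fun (sigma k s : hom_deg W R k) _ w.1 + 0) addr0.
by congr hd_fun; exact: eq_irrelevance.
Qed.

Lemma bsig_cosnd k (c : Tw t k) :
  tw_cosnd (bd_ea k) (bd_eb k) (bsig k c : hom_deg (Tw btw) R k) =
  sgnz (a * k) (dgh bhom_closed (t_sa t k) c.1 : hom_deg P0 R (k + a)).
Proof.
apply: hom_deg_eq => i l e y; rewrite hd_fun_sgnz.
have e1 : t_sa btw (i - t_b btw) + (m - 1) = i by rewrite /=; lia.
have e2 : t_sb btw (i - t_b btw) = i by rewrite /=; lia.
have e0 : i + (k + (1 - m)) = l := e.
have e3 : t_sa t k + i = l by clear -e0; rewrite /=; lia.
have e4 : t_sa btw (i - t_b btw) + k = l by clear -e0; rewrite /=; lia.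
rewrite -[LHS]/(hd_fun (bsig k c : hom_deg (Tw btw) R k) (tw_cosnd_subproof (bd_eb k) e)
  ((0, tr (tw_cosnd_tr btw i) y) : Tw btw _)).
rewrite (bsigE _ _ _ e1 e2 e3 e4) hd_0 oppr0 sub0r dm_actN hd_0 addr0 -cm_tr tr_tr tr_id.
rewrite -[dgh bhom_closed _ _]/(sgnz (0 * t_sa t k) (hd_scale (addr0 (t_sa t k)) (c.1 : B _)
  (sgnz (a + 1) (hm p) : hom_deg P0 R 0))).
rewrite mul0r sgnz0l (hd_scaleE _ _ _ _ (addr0 i) e3) hd_fun_sgnz hmE dm_act_sgn !sgnzD.
rewrite -[- dm_act _ _ _](sgnzE 1) sgnzD.
have -> : a * t_sa t k + 1 = a * a + (a * k + 1) by rewrite /=; lia.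
by rewrite -(sgnzD (a * a)) (sgnz_sq a) sgnzD; apply: sgnz_odd; lia.
Qed.

Lemma b_ses : @is_ses (Tw (fib (hm_closed sigma))) (Tw (fib (hm_closed bsig)))
  (Tw (fib (hm_closed (dgh bhom_closed)))) id (t_sa t) 0 a 0 a bsi bsp.
Proof.
split.
- by move=> k; rewrite addr0.
- exact: t_saE.
- move=> k x y; congr pair; first by congr pair; rewrite subrr.
  by rewrite tw_B2 cm_B.
- move=> k x y; rewrite /bsp !tw_B1 !tw_B2; congr pair; apply: etrans (sgnzB _ _ _).
  by congr sgnz; exact: hom_deg_eq.
- move=> k l e e' x; rewrite sgnz0l.
  have e1 : k + (0 - 1) + 1 = l + (0 - 1) by lia.
  have e2 : k = l + (0 - 1) by lia.
  rewrite [LHS]surjective_pairing (fib_d1 (u := bsig)) (fib_d2 (u := bsig) e e1 e2).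
  rewrite /bsi (fib_d1 (u := sigma)) (fib_d2 (u := sigma) _ e1 e2).
  congr pair.
    congr pair; first by rewrite -[LHS]/(sgnz a (cx_d _ (0 : dg_self B _))) cx_d0 sgnz0.
    rewrite -[LHS]/(sgnz 0 (cx_d _ x.1 - hd_fun (el z) _ 0)) hd_0 subr0 sgnz0l.
    by congr cx_d; exact: eq_irrelevance.
  rewrite cm_N cm_B cm_d; congr (- (_ - _)).
  rewrite [LHS]/= (cm_tr binj); congr tr.
  exact: bsig_inr.
- move=> k l e e' x.
  have e1 : k + (0 - 1) + 1 = l + (0 - 1) by lia.
  have e2 : k = l + (0 - 1) by lia.
  have e3 : t_sa t k + (0 - 1) + 1 = t_sa t l + (0 - 1) by rewrite /=; lia.
  have e4 : t_sa t k = t_sa t l + (0 - 1) by rewrite /=; lia.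
  rewrite [LHS]surjective_pairing (fib_d1 (u := dgh bhom_closed)) (fib_d2 (u := dgh bhom_closed) _ e3 e4).
  rewrite /bsp sgnz_pair; congr pair.
    rewrite (fib_d1 (u := bsig)) -[(cx_d e x.1).1]/(sgnz a (cx_d _ x.1.1)) sgnzK.
    by congr cx_d; exact: eq_irrelevance.
  rewrite (fib_d2 (u := bsig) _ e1 e2).
  rewrite [(_, _).2]/= [(_, _).1]/=.
  pose cos k (F : hom_deg (Tw btw) R (k + (0 - 1))) : hom_deg P0 R (t_sa t k + (0 - 1)) :=
    tw_cosnd (bd_ea (k + (0 - 1))) (esym (bsp_e k)) F.
  have cosB : {morph cos l : F G / F - G} by move=> F G; exact: hom_deg_eq.
  have cosd : cos l (cx_d (c := HomDG (Tw btw) R) e1 x.2) = cx_d (c := HomDG P0 R) e3 (cos k x.2).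
    exact: tw_cosnd_d.
  have cosb : cos l (tr (C := HomDG (Tw btw) R) e2 (bsig k x.1)) =
      sgnz (a * k) (tr (C := HomDG P0 R) e4 (dgh bhom_closed (t_sa t k) x.1.1)).
    rewrite /cos (tw_cosnd_irr (bd_ea k) (bd_eb k) _ _ _ e4) bsig_cosnd.
    exact: (@tr_sgn (HomDG P0 R)).
  rewrite -[tw_cosnd (bd_ea (l + _)) _ _]/(cos l _) -[tw_cosnd (bd_ea (k + _)) _ _]/(cos k _).
  rewrite (morphN cosB) cosB cosd cosb sgnzD (@sgnz_odd _ (a + a * l) (a * k)); last first.
    by subst l; rewrite mulrDr; lia.
  by rewrite cx_d_sgn sgnzN sgnzB sgnzK.
- move=> k [s F] hs; congr pair; first by have := congr1 (fun x => x.1.2) hs.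
  have := congr1 (fun x : Tw (fib (hm_closed bsig)) k => tw_cofst (bd_ea _) (bd_eb _) (x.2 : hom_deg _ _ _)) hs.
  rewrite tw_copair_fst => h0; apply: etrans h0 _; exact: hom_deg_eq.
- move=> k [s F]; rewrite /bsp /bsi; congr pair; apply: etrans (sgnz0 _ (a * k)); congr sgnz.
  rewrite [(_, _).2]/= (_ : binj _ F = tw_copair (bd_ea _) (bd_eb _) F 0) //.
  apply: hom_deg_eq => i l e y.
  rewrite -[LHS]/(hd_fun F _ 0 + 0) hd_0 addr0; exact: erefl.
- move=> k [[b s] U] hs.
  have b0 : b = 0 := congr1 fst hs.
  have U0 : tw_cosnd (bd_ea _) (esym (bsp_e k)) U = 0.
    by have h0 := congr1 snd hs; apply: (@sgnz_inj _ (a * k)); exact: h0.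
  exists (s, tw_cofst (bd_ea (k + (0 - 1))) (esym (bsp_e k)) U).
  rewrite /bsi b0; congr pair.
  rewrite -[LHS](tw_copair_eta (bd_ea _) (esym (bsp_e k))) U0.
  by apply: hom_deg_eq => i l e y; rewrite -[LHS]/(_ + 0) -[RHS]/(_ + 0); congr (_ + _);
    congr hd_fun; exact: eq_irrelevance.
- move=> k [b V].
  exists (((b, 0) : Tw t k), tw_copair (bd_ea _) (esym (bsp_e k)) 0 (sgnz (a * k) (V : hom_deg _ _ _))).
  by rewrite /bsp; congr pair; rewrite tw_copair_snd sgnzK.
Qed.

End Bidual.

Lemma bhom_qis (B : cdgRing) (R P0 : dgModule B) (p : dgHom P0 R) (S : dgModule B) m (z : S m)
    (cz : cocyc z) : is_qis (homothety p) -> is_qis (dgh (bhom_closed p cz)).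
Proof.
have hE i b : dgh (bhom_closed p cz) i b = sgnz (1 - m + 1) (homothety p i b).
  apply: hom_deg_eq => j l e x; rewrite hd_fun_sgnz.
  rewrite -[LHS]/(sgnz (0 * i) (hd_fun (hd_scale (addr0 i) (b : B i)
    (sgnz (1 - m + 1) (hm p) : hom_deg P0 R 0)) e x)).
  have e3 : i + j = l by rewrite addrC.
  rewrite mul0r sgnz0l (hd_scaleE _ _ _ _ (addr0 j) e3) hd_fun_sgnz hmE dm_act_sgn.
  by rewrite hd_fun_sgnz; congr sgnz; rewrite -[RHS]/(dm_act _ b (p j x)); congr dm_act; exact: eq_irrelevance.
move=> /is_qisE q; apply/is_qisE => i; split=> [x cx|y cy].
  by rewrite hE => bx; apply: (q i).1 => //; apply/(bdry_sgn (1 - m + 1)).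
have [x cx bx] := (q i).2 _ (closed_sgn (1 - m + 1) cy).
exists x => //; rewrite hE; move/(bdry_sgn (1 - m + 1)): bx.
by rewrite sgnzB sgnzK.
Qed.

Section Biduality.
Variables (B : cdgRing) (R P0 : dgModule B) (p : dgHom P0 R) (d0 d1 : int).
Hypothesis nB : noetherian (H0 B).
Hypothesis fB : forall i, fgc (dg_self B) i.
Hypothesis injR : forall M : dgModule B,
  exists P : kproj_resolution M, (con (RHom P R) `<=` con_bound (con M) d0 d1)%classic.
Hypothesis KP0 : K_projective P0.
Hypothesis qp : is_qis p.
Hypothesis hp : is_qis (homothety p).

(** Devissage in one fixed degree j of the fibre of [sigma]. The property [Phi] quantifies over W
    and [sigma], since attaching a cell to S changes both. *)
Lemma bidual (S W : dgModule B) (sigma : dgHom S (HomDG W R)) m : K_projective S ->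
  (forall k, fgc S k) -> (forall k, m < k -> van S k) -> K_projective W ->
  is_qis (wS sigma) -> is_qis sigma.
Proof.
move=> KS fS vS KW qw; apply/hm_hqis; apply/(hqis_tw (fib (hm_closed sigma))).
apply/acyclicE => j.
pose Phi (S : dgModule B) := forall W (sigma : dgHom S (HomDG W R)), K_projective W ->
  is_qis (wS sigma) -> van (Tw (fib (hm_closed sigma))) j.
suff : Phi S by apply.
(* For S in degrees <= c, W lives in degrees >= d0 - c and Hom(W, R) in degrees <= c + d1 - d0 <= j
   - 2. So neither H^j(S) nor H^(j - 1) Hom(W, R) contributes to the fibre. *)
apply: (devissage nB fB (Phi := Phi) (c := j - 2 - `|d1 - d0|)) KS fS vS.
  move=> {}S KS vS {}W {}sigma {}KW {}qw.
  apply: (ses_van_mid (tw_ses (fib (hm_closed sigma)))); last by apply: vS => /=; lia.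
  apply: (inj_dim_gt injR KW (e := d0 - (j - 2 - `|d1 - d0|))); last by rewrite /=; lia.
  by move=> i ij; apply/(qis_van i qw); exact: (inj_dim_lt injR KS vS).
move=> {}S {}m z cz KS PhiC {}W {}sigma {}KW {}qw.
have csz : hclosed (sigma m z : hom_deg W R m) by exact: (cm_closed sigma cz).
have [omega cw /(hbdryE (subrK 1 m))[h dh]] :=
  Kproj_lift KW (hm_closed p) ((hm_hqis p).2 qp) (addr0 m) csz.
have vC : van (Tw (fib (hm_closed (bsig cz cw dh)))) j.
  by apply: PhiC; [exact: Kproj_tw|exact: (bsig_swap_qis cz cw dh qp qw)].
have vX : acyclic (Tw (fib (hm_closed (dgh (bhom_closed p cz))))).
  by apply/hqis_tw/hm_hqis; exact: (bhom_qis cz hp).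
(* The quotient in [b_ses] is, up to sign, the fibre of the homothety, hence acyclic, so vanishing
   passes from the fibre of [bsig] to that of [sigma]. *)
have := ses_van_sub (b_ses cz cw dh) (k := j - 1).
by rewrite subrK; apply => //; exact: (acyclicE _).1.
Qed.
End Biduality.

Lemma qis_fgc (B : cdgRing) (nB : noetherian (H0 B)) (M N : dgModule B) (u : dgHom M N) i :
  is_qis u -> fgc M i <-> fgc N i.
Proof.
move=> /is_qisE/(_ i)[inj surj].
have uA a x : u i (act0 a x) = act0 a (u i x) by exact: dh_act.
split=> fg.
  apply: (fgc_exact nB (phi := u i) (psi := fun=> 0 : M i) _ _ _ _ _ _ _ _ fg fg) => //.
  - exact: cm_B.
  - by move=> x y; rewrite subr0.
  - by move=> a x; rewrite /act0 dm_act0r.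
  - by move=> x; exact: cm_closed.
  - by move=> x; exact: cm_bdry.
  - by move=> x _; exact: closed0.
  - by move=> y /surj.
apply: (fgc_exact nB (phi := fun=> 0 : M i) (psi := u i) _ _ _ _ _ _ _ _ fg fg) => //.
- by move=> x y; rewrite subr0.
- exact: cm_B.
- by move=> a x; rewrite /act0 dm_act0r.
- by move=> x _; exact: closed0.
- by move=> x _; exact: bdry0.
- by move=> x; exact: cm_closed.
- by move=> x cx bx; exists 0; [exact: closed0|rewrite subr0; exact: inj].
Qed.

Lemma ctrunc_surj (A : cdgRing) (M : dgModule A) n k (w : ctrunc M n k) : n <= k ->
  cocyc w -> exists2 x, cocyc x & w = ctrunc_map M n k x.
Proof.
case: w => t x nk /ctrunc_closed[/= ct dx].
have [t0 _] := subP t.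
have {}t0 : t = 0 by apply: val_inj; apply: t0; change (n - 1 < k + 1); lia.
exists x; last by rewrite t0.
by apply/(closedE (t_sb_d (cone (sub_inc (trunc_le M (n - 1)))) (erefl (k + 1)))); rewrite dx t0.
Qed.

Lemma ctrunc_fgc (B : cdgRing) (nB : noetherian (H0 B)) (M : dgModule B) n k :
  fgc M k -> fgc (ctrunc M n) k.
Proof.
move=> fM; have [nk|kn] := leP n k; last first.
  by exists [::] => // x; exact: ctrunc_van.
apply: (fgc_exact nB (phi := ctrunc_map M n k) (psi := fun=> 0 : M k) _ _ _ _ _ _ _ _ fM fM) => //.
- exact: cm_B.
- by move=> x y; rewrite subr0.
- by move=> a x; exact: dh_act.
- by move=> a x; rewrite /act0 dm_act0r.
- by move=> x; exact: cm_closed.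
- by move=> x; exact: cm_bdry.
- by move=> x _; exact: closed0.
- move=> w /(ctrunc_surj nk)[x cx ->] _; exists x => //; rewrite subrr; exact: bdry0.
Qed.

Lemma ctrunc_van_gt (A : cdgRing) (M : dgModule A) n k : n <= k -> van M k -> van (ctrunc M n) k.
Proof.
by move=> nk vM w /(ctrunc_surj nk)[x cx ->]; apply: cm_bdry; exact: vM.
Qed.

Section Dual.
Variables (B : cdgRing) (R P0 : dgModule B) (p : dgHom P0 R) (d0 d1 : int).
Hypothesis nB : noetherian (H0 B).
Hypothesis fB : forall i, fgc (dg_self B) i.
Hypothesis injR : forall M : dgModule B,
  exists P : kproj_resolution M, (con (RHom P R) `<=` con_bound (con M) d0 d1)%classic.
Hypothesis KP0 : K_projective P0.
Hypothesis qp : is_qis p.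
Hypothesis hp : is_qis (homothety p).

Lemma dualizing_van i : i < d0 -> van R i.
Proof.
move=> id; apply/hvan_self; apply: (inj_dim_lt injR (@self_proj B) (m := 0)); last by lia.
exact: self_van.
Qed.

Definition D (S : dgModule B) : dgModule B := HomDG S R.
Definition RD (S : dgModule B) : dgModule B := resol (D S).
Definition rd (S : dgModule B) : dgHom (RD S) (D S) := resol_map (D S).

Definition bd (S : dgModule B) : dgHom S (HomDG (RD S) R) :=
  dgh (swap_closed (hm_closed (rd S))).

Lemma bd_qis S m : K_projective S -> (forall k, fgc S k) -> (forall k, m < k -> van S k) ->
  is_qis (bd S).
Proof.
move=> KS fS vS; apply: (bidual nB fB injR KP0 qp hp KS fS vS); first exact: resol_proj.
have -> : wS (bd S) = rd S; last exact: resol_qis.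
by apply: hm_inj; rewrite /wS /bd !hm_dgh swapK.
Qed.

(** Biduality for S and exchange of variables: Hom(T, S), Hom(T, Hom(D S, R)) and Hom(D S, Hom(T,
    R)) have the same cohomology. *)
Lemma dual_ext S T m j : K_projective S -> (forall k, fgc S k) ->
  (forall k, m < k -> van S k) -> K_projective T ->
  hvan T S j <-> hvan (RD S) (D T) j.
Proof.
move=> KS fS vS KT; rewrite (hvan_post _ KT (bd_qis KS fS vS)).
by split; exact: swap_van.
Qed.

End Dual.

(** * Cohen-Macaulay modules *)

Lemma deq_cancel (A : cdgRing) (M N P : dgModule A) (s : dgHom P M) (x y : dexpr M N) :
  is_qis s -> deq (dcomp x (dgen s)) (dcomp y (dgen s)) -> deq x y.
Proof.
move=> qs h.
have c (z : dexpr M N) : deq (dcomp (dcomp z (dgen s)) (dinv qs)) z.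
  apply: deq_trans (deq_sym (deq_assoc _ _ _)) _.
  apply: deq_trans (deq_comp (deq_refl z) (deq_invr qs)) _; exact: deq_idr.
apply: deq_trans (deq_sym (c x)) _; apply: deq_trans _ (c y).
by apply: deq_comp => //; exact: deq_refl.
Qed.

(** * Full faithfulness of restriction when negative Ext groups vanish *)

Section FullyFaithful.
Variables (A B : cdgRing) (f : cdgHom A B).
Hypothesis surj_f : forall b : H0 B, exists a : H0 A, H0map f a = b.
Variables (M N S : dgModule B) (s : dgHom S M) (q m : int).
Hypothesis vN : forall j, j < q -> van N j.
Hypothesis KS : K_projective S.
Hypothesis vS : forall j, m < j -> van S j.
Hypothesis qs : is_qis s.
Hypothesis ext_neg : forall j, j < 0 -> hvan S N j.

(** Degree 0 will give surjectivity of restriction on morphisms, and degree - 1 injectivity. *)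
Let vK j : j <= 0 -> hvan (ceps f S) N j.
Proof.
move=> j0; apply: (ceps_hvan surj_f vN KS vS (g := 0)) => //.
exact: (rest_of_hvan surj_f vN KS vS ext_neg).
Qed.

Lemma rest_hm_resA (u : dgHom S N) :
  hm (dg_comp (rest_hom f u) (pA f S)) = resA f (hm u).
Proof. by rewrite (hm_comp _ _ (addr0 0)) rest_hm /resA; congr hcomp; exact: eq_irrelevance. Qed.

(** Precomposition with the resolutions S of M and PA of S represents formal words by homotopy
    classes of DG homomorphisms; under this translation [restD] becomes [resA] in degree 0. *)
Lemma restD_bijective : bijective (@restD A B f M N : HomD M N -> HomD (rest f M) (rest f N)).
Proof.
have qrs : is_qis (rest_hom f s) by exact: qs.
have rcomp (x : dexpr M N) (v : dgHom S N) : deq (dcomp x (dgen s)) (dgen v) ->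
    deq (dcomp (dcomp (rest_expr f x) (dgen (rest_hom f s))) (dgen (pA f S)))
        (dgen (dg_comp (rest_hom f v) (pA f S))).
  move=> h; apply: deq_trans _ (deq_sym (deq_gen _ _)).
  apply: deq_comp; last exact: deq_refl.
  exact: (rest_expr_deq f h).
have inj : injective (@restD A B f M N).
  move=> c1 c2; have [x1 ->] := dclsP c1; have [x2 ->] := dclsP c2.
  rewrite !restDE => /dcls_eq h; apply/dcls_eq.
  have [v1 _ h1] := interp_exists KS x1 s; have [v2 _ h2] := interp_exists KS x2 s.
  apply: (deq_cancel qs); apply: deq_trans (h1) _; apply: deq_trans _ (deq_sym h2).
  apply: htp_deq; rewrite /htp.
  apply: (resA_inj (f := f)).
  - by apply: vK; lia.
  - by apply: hclosedB; exact: hm_closed.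
  rewrite /resA rest_hdB hcompBl -!/(resA f _) -!rest_hm_resA.
  apply/(deq_htp (@PA_proj _ _ f S)); apply: deq_trans (deq_sym (rcomp _ _ h1)) _.
  apply: deq_trans _ (rcomp _ _ h2).
  by do 2![apply: deq_comp; last exact: deq_refl].
have surj d : exists c, @restD A B f M N c = d.
  have [y ->] := dclsP d.
  have [v _ hv] := interp_exists (@PA_proj _ _ f S) y (dg_comp (rest_hom f s) (pA f S)).
  have [F cF bF] := resA_surj (vK (lexx 0)) (hm_closed v).
  pose x := dcomp (dgen (dgh cF)) (dinv qs) : dexpr M N.
  exists (dcls x); rewrite restDE; apply/dcls_eq.
  apply: (deq_cancel (s := dg_comp (rest_hom f s) (pA f S))).
    by apply: qis_comp => //; exact: pA_qis.
  apply: deq_trans _ (deq_sym hv).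
  apply: deq_trans (deq_comp (deq_refl _) (deq_gen _ _)) _.
  apply: deq_trans (deq_assoc _ _ _) _.
  have hx : deq (dcomp x (dgen s)) (dgen (dgh cF)).
    apply: deq_trans (deq_sym (deq_assoc _ _ _)) _.
    apply: deq_trans (deq_comp (deq_refl _) (deq_invl _)) _; exact: deq_idr.
  apply: deq_trans (rcomp _ _ hx) _.
  apply: htp_deq; apply: htp_sym; rewrite /htp rest_hm_resA hm_dgh.
  exact: bF.
exists (fun d => projT1 (cid (surj d))) => [c|d]; last by case: cid.
by case: cid => c' /= /inj.
Qed.

End FullyFaithful.

Lemma cohen_macaulay_van (B : cdgRing) (R M S : dgModule B) (s : dgHom S M) :
  K_projective S -> is_qis s -> cohen_macaulay R M -> forall i, i != 0 -> hvan S R i.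
Proof.
move=> KS qs [P [_ vP]] i /eqP i0.
by apply: (Kproj_unique (@kp_proj _ _ P) KS (@kp_qis _ _ P) qs); apply/vanE; exact: vP.
Qed.

Section Bounded.
Variables (B : cdgRing) (nB : noetherian (H0 B)) (M : dgModule B).
Hypothesis bM : Dbf M.

Lemma Dbf_bounds : exists q m : int, (forall j, j < q -> van M j) /\ (forall j, m < j -> van M j).
Proof.
have [_ [n0 [n1 h]]] := bM; exists n0, n1.
by split=> j jn; apply/vanE; apply: h => /andP[]; lia.
Qed.

Lemma Dbf_fgc i : fgc (resol M) i.
Proof. by apply/(qis_fgc nB _ (@resol_qis _ M)); apply/fin_gen_fgc; have [] := bM. Qed.

Lemma Dbf_resol_bounds : exists q m : int,
  (forall j, j < q -> van (resol M) j) /\ (forall j, m < j -> van (resol M) j).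
Proof.
have [q [m [h1 h2]]] := Dbf_bounds; exists q, m.
by split=> j h; apply/(qis_van j (@resol_qis _ M)); [exact: h1|exact: h2].
Qed.

End Bounded.

(** * Transfer of the Cohen-Macaulay property along isomorphisms over [A] *)

Section Main.
Variables (A B : cdgRing) (f : cdgHom A B).
Hypothesis surj_f : forall b : H0 B, exists a : H0 A, H0map f a = b.
Variables (R P0 : dgModule B) (p : dgHom P0 R) (d0 d1 : int).
Hypothesis nB : noetherian (H0 B).
Hypothesis fB : forall i, fgc (dg_self B) i.
Hypothesis fR : forall i, fgc R i.
Hypothesis injR : forall M : dgModule B,
  exists P : kproj_resolution M, (con (RHom P R) `<=` con_bound (con M) d0 d1)%classic.
Hypothesis KP0 : K_projective P0.
Hypothesis qp : is_qis p.
Hypothesis hp : is_qis (homothety p).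
Variables M N : dgModule B.
Hypotheses (bM : Dbf M) (bN : Dbf N).

Let S := resol M.
Let T := resol N.
Let KS : K_projective S. Proof. exact: resol_proj. Qed.
Let KT : K_projective T. Proof. exact: resol_proj. Qed.

Lemma cohen_macaulay_ff : cohen_macaulay R M -> cohen_macaulay R N ->
  bijective (@restD A B f M N : HomD M N -> HomD (rest f M) (rest f N)).
Proof.
move=> cM cN.
have [q [_ [vN _]]] := Dbf_bounds bN.
have [_ [m [_ vS]]] := Dbf_resol_bounds bM; have [_ [n [_ vT]]] := Dbf_resol_bounds bN.
apply: (restD_bijective surj_f vN KS vS (@resol_qis _ M)) => j j0.
apply/(hvan_post j KS (@resol_qis _ N)).
apply/(dual_ext nB fB injR KP0 qp hp j KT (Dbf_fgc nB bN) vT KS).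
apply: (hvan_trunc (m := 0) (g := 0)); last by rewrite add0r.
- exact: resol_proj.
- move=> i i0; apply/(qis_van i (@resol_qis _ (D R T))).
  by apply: (cohen_macaulay_van KT (@resol_qis _ N) cN); rewrite gt_eqF.
- by move=> i i0; apply: (cohen_macaulay_van KS (@resol_qis _ M) cM); rewrite lt_eqF.
Qed.

Hypothesis cM : cohen_macaulay R M.
Hypothesis MN : isoD (rest f M) (rest f N).

Let roof : exists2 u : dgHom (PA f S) (rest f M), is_qis u &
  exists v : dgHom (PA f S) (rest f N), is_qis v.
Proof.
have qu : is_qis (dg_comp (rest_hom f (resol_map M)) (pA f S)).
  by apply: qis_comp; [exact: (@resol_qis _ M)|exact: pA_qis].
exists (dg_comp (rest_hom f (resol_map M)) (pA f S)) => //.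
exact: (isoD_roof MN (@PA_proj _ _ f S) qu).
Qed.

Lemma iso_hvan_neg j : j < 0 -> hvan T R j.
Proof.
have [u qu [v qv]] := roof.
have [_ [m [_ vS]]] := Dbf_resol_bounds bM; have [_ [n [_ vT]]] := Dbf_resol_bounds bN.
have vR := dualizing_van injR.
apply: (hvan_of_rest surj_f vR KT vT) => i i0.
have qw : is_qis (dg_comp (rest_hom f (resol_map N)) (pA f T)).
  by apply: qis_comp; [exact: (@resol_qis _ N)|exact: pA_qis].
apply: (Kproj_unique (@PA_proj _ _ f S) (@PA_proj _ _ f T) qv qw).
apply: (rest_of_hvan surj_f vR KS vS _ i0) => k k0.
by apply: (cohen_macaulay_van KS (@resol_qis _ M) cM); rewrite lt_eqF.
Qed.

Lemma iso_hvan_pos s : 0 < s -> hvan T R s.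
Proof.
move=> s0; have [u qu [v qv]] := roof.
have [qM [_ [vM _]]] := Dbf_bounds bM; have [qN [_ [vN _]]] := Dbf_bounds bN.
have [_ [m [_ vS]]] := Dbf_resol_bounds bM; have [e [n [vT' vT]]] := Dbf_resol_bounds bN.
pose Z := ctrunc (D R T) s; pose V := resol Z.
have KV : K_projective V by exact: resol_proj.
have vV k : k < s -> van V k.
  by move=> ks; apply/(qis_van k (@resol_qis _ Z)); exact: ctrunc_van.
(* T lives in degrees >= e, hence D T in degrees <= d1 - e. This bound and the finite generation
   below are what biduality for V requires. *)
have vV' k : s + `|d1 - e| < k -> van V k.
  move=> sk; apply/(qis_van k (@resol_qis _ Z)); apply: ctrunc_van_gt; first by lia.
  by apply: (inj_dim_gt injR KT vT'); lia.
have fV k : fgc V k.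
  apply/(qis_fgc nB k (@resol_qis _ Z)); apply: ctrunc_fgc => //.
  exact: (hom_fgc nB fB fR injR k KT (Dbf_fgc nB bN) vT).
pose L := RD R V.
have KL : K_projective L by exact: resol_proj.
have vL k : d1 - s < k -> van L k.
  by move=> sk; apply/(qis_van k (@resol_qis _ (D R V))); exact: (inj_dim_gt injR KV vV).
have qV : is_qis (bd R V) := bd_qis nB fB injR KP0 qp hp KV fV vV'.
have KRD X : K_projective (RD R X) by exact: resol_proj.
(* Biduality is used twice: Ext(D V, X) = Ext(D X, D D V) by biduality for X, and D D V = V. *)
have ext X (KX : K_projective X) b (fX : forall k, fgc X k) (vX : forall k, b < k -> van X k) j :
    hvan L X j <-> hvan (RD R X) V j.
  rewrite (dual_ext nB fB injR KP0 qp hp j KX fX vX KL).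
  by rewrite (hvan_post j (KRD X) qV).
have LM j : j < s -> hvan L M j.
  move=> js; apply/(hvan_post j KL (@resol_qis _ M)).
  apply/(ext _ KS _ (Dbf_fgc nB bM) vS).
  apply: (hvan_trunc (m := 0) (g := s)) => //; last by rewrite add0r.
  move=> i i0; apply/(qis_van i (@resol_qis _ (D R S))).
  by apply: (cohen_macaulay_van KS (@resol_qis _ M) cM); rewrite gt_eqF.
(* The two targets are exchanged over [A], where the roof identifies M and N; the source L stays
   fixed. *)
have LN j : j < s -> hvan L N j.
  apply: (hvan_of_rest surj_f vN KL vL) => i is_.
  apply/(hvan_post i (@PA_proj _ _ f L) qv)/(hvan_post i (@PA_proj _ _ f L) qu).
  exact: (rest_of_hvan surj_f vM KL vL LM).
(* As 0 < s, degree 0 lies in the range of [LN]. *)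
have h0 : hvan (RD R T) Z 0.
  apply/(hvan_post 0 (KRD T) (@resol_qis _ Z)).
  apply/(ext _ KT _ (Dbf_fgc nB bN) vT).
  by apply/(hvan_post 0 KL (@resol_qis _ N)); exact: LN.
move=> y cy.
have [_ /(_ y cy)[x cx bxy]] := (is_qisE (rd R T)).1 (@resol_qis _ (D R T)) s.
have := hbdry_val (addr0 s) (h0 _ (hm_closed (dg_comp (ctrunc_map (D R T) s) (rd R T)))) cx.
rewrite hmE => b1; apply: (ctrunc_inj (M := D R T) (lexx s) cy).
have := bdryD (cm_bdry (ctrunc_map (D R T) s) bxy) b1.
by rewrite cm_B subrK.
Qed.

Lemma iso_cohen_macaulay : cohen_macaulay R N.
Proof.
have [_ [n [_ vT]]] := Dbf_resol_bounds bN.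
exists (resolution N); split=> i.
  by apply/fin_gen_fgc; exact: (hom_fgc nB fB fR injR i KT (Dbf_fgc nB bN) vT).
move=> /eqP; rewrite neq_lt => /orP[i0|i0]; apply/vanE.
  exact: iso_hvan_neg.
exact: iso_hvan_pos.
Qed.

End Main.

Unset Implicit Arguments.

Theorem theorem0p8 (A B : cdgRing) (f : cdgHom A B)
    (tractA : tractable A) (tractB : tractable B)
    (surj_f : forall b : H0 B, exists a : H0 A, H0map f a = b)
    (RB : dgModule B) (dualRB : dualizing RB)
    (M N : dgModule B) (bfM : Dbf M) (bfN : Dbf N) :
  (cohen_macaulay RB M -> isoD (rest f M) (rest f N) -> cohen_macaulay RB N) /\
  (cohen_macaulay RB M -> cohen_macaulay RB N ->
     bijective (@restD A B f M N : HomD M N -> HomD (rest f M) (rest f N))).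
Proof.
have [[nB fgB] _] := tractB; have [fgR [d0 [d1 [_ injR]]] [P /iso_qis hP]] := dualRB.
have fB i : fgc (dg_self B) i by apply/fin_gen_fgc; exact: fgB.
have fR i : fgc RB i by apply/fin_gen_fgc; exact: fgR.
split=> cM.
  exact: (iso_cohen_macaulay surj_f nB fB fR injR (@kp_proj _ _ P) (@kp_qis _ _ P) hP bfM bfN cM).
move=> cN.
exact: (cohen_macaulay_ff surj_f nB fB injR (@kp_proj _ _ P) (@kp_qis _ _ P) hP bfM bfN cM cN).
Qed.
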